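(* Let $S=p\,x\frac{\partial}{\partial x}+q\,y\frac{\partial}{\partial y}$, where $p,q\geq 1$ are integers with $\gcd(p,q)=1$, and let $X\in\mathcal{X}_2$ be $S$ quasi-homogeneous with $[S,X]=k\,X$, $k>0$. Assume that $X$ has an isolated singularity at $0\in\mathbb{C}^2$ and is non-dicritical. If $C(X)\neq\mathbb{C}\cdot X$, then $\mathcal{I}(X)=\mathbb{C}\{f\}$, where $f\neq 0$ is $S$ quasi-homogeneous, and $C(X)=\mathbb{C}\{f\}\cdot X$.
   Context: $\mathcal{O}_n$ is the ring of germs at $0\in\mathbb{C}^n$ of holomorphic functions and $\mathcal{X}_2$ the set of germs at $0\in\mathbb{C}^2$ of holomorphic vector fields. $C(X)=\{Y\in\mathcal{X}_2\mid[X,Y]=0\}$ and $\mathcal{I}(X)=\{g\in\mathcal{O}_2\mid X(g)=0\}$. A vector field $X$ is $S$ quasi-homogeneous if $[S,X]=kX$ for some $k\in\mathbb{Z}$; a function $f\in\mathcal{O}_2$ is $S$ quasi-homogeneous if $S(f)=mf$ for some integer $m$ (here $f$ is non-constant with $f(0)=0$). $\mathbb{C}\{f\}=\{\varphi\circ f\mid\varphi\in\mathcal{O}_1\}$ and $\mathbb{C}\{f\}\cdot X=\{g\,X\mid g\in\mathbb{C}\{f\}\}$. ''Isolated singularity at $0$'' means $X(0)=0$ and $0$ is an isolated zero of $X$. A separatrix of $X$ is a germ of irreducible analytic curve through $0$, regular outside $0$ and invariant by $X$; $X$ is non-dicritical if it has only finitely many separatrices. *)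

(* Defs.v *)
(* MathComp + MathComp-Analysis *)
From HB Require Import structures.
From mathcomp Require Import all_boot all_order all_algebra.
From mathcomp Require Import complex.
From mathcomp Require Import all_classical all_reals all_analysis.
Set Implicit Arguments.
Unset Strict Implicit.
Unset Printing Implicit Defensive.
Import Order.TTheory GRing.Theory Num.Theory.
Import numFieldNormedType.Exports.
Local Open Scope classical_set_scope.
Local Open Scope ring_scope.

(* C as a normed space over itself: derivatives below are complex ones. *)
Notation C1 R := (R[i]^o).
Notation C2 R := (R[i]^o * R[i]^o)%type.

(* Germs at 0 are handled through representatives, which are total functions
   (total sets, for T := Prop) considered up to [germ_eq]. A set of germs is the
   set of all representatives of its elements; the sets of germs defined below
   are closed under [germ_eq], so equality between them is equality of sets of
   germs. *)
Definition germ_eq (K : numFieldType) (V : normedModType K) (T : Type)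
    (f g : V -> T) : Prop :=
  \forall z \near (0 : V), f z = g z.

Definition holomorphic_at (K : numFieldType) (V W : normedModType K)
    (a : V) (f : V -> W) : Prop :=
  \forall z \near a, differentiable f z.

Definition holomorphic_germ (K : numFieldType) (V W : normedModType K)
    (f : V -> W) : Prop :=
  holomorphic_at 0 f.

Section VectorFields.
Variable R : realType.
Implicit Types (X Y S : C2 R -> C2 R) (f g h : C2 R -> C1 R) (A : set (C2 R)).

(* X(g) = X_1 dg/dx + X_2 dg/dy *)
Definition vf_apply X g : C2 R -> C1 R := fun z => 'D_(X z) g z.

(* The components are X(Y_j) - Y(X_j). *)
Definition lie_bracket X Y : C2 R -> C2 R :=
  fun z => 'D_(X z) Y z - 'D_(Y z) X z.

Definition centralizer X : set (C2 R -> C2 R) :=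
  [set Y | holomorphic_germ Y /\ germ_eq (lie_bracket X Y) (fun=> 0)].

Definition first_integrals X : set (C2 R -> C1 R) :=
  [set g | holomorphic_germ g /\ germ_eq (vf_apply X g) (fun=> 0)].

Definition scalar_multiples X : set (C2 R -> C2 R) :=
  [set Y | exists c : R[i], germ_eq Y (fun z => c *: X z)].

(* C{f}; only meaningful when f 0 = 0, as phi is a germ at 0. *)
Definition compositions f : set (C2 R -> C1 R) :=
  [set g | exists2 phi : C1 R -> C1 R,
             holomorphic_germ phi & germ_eq g (phi \o f)].

Definition composition_multiples f X : set (C2 R -> C2 R) :=
  [set Y | exists2 g, compositions f g & germ_eq Y (fun z => g z *: X z)].

Definition weighted_radial (p q : nat) : C2 R -> C2 R :=
  fun z => (p%:R * z.1, q%:R * z.2).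

Definition quasi_homogeneous_vf S (k : int) X : Prop :=
  germ_eq (lie_bracket S X) (fun z => k%:~R *: X z).

Definition quasi_homogeneous_fun S f : Prop :=
  [/\ f 0 = 0,
      ~ (exists c : C1 R, germ_eq f (fun=> c)) &
      exists m : int, germ_eq (vf_apply S f) (fun z => m%:~R * f z)].

Definition isolated_singularity X : Prop :=
  X 0 = 0 /\ \forall z \near (0 : C2 R)^', X z <> 0.

Definition analytic_germ A : Prop :=
  exists (n : nat) (g : 'I_n -> C2 R -> C1 R),
    (forall i, holomorphic_germ (g i)) /\
    germ_eq A [set z | forall i, g i z = 0].

Definition curve_germ A : Prop :=
  exists g, [/\ holomorphic_germ g, ~ germ_eq g (fun=> 0), g 0 = 0 &
                germ_eq A [set z | g z = 0]].

Definition irreducible_germ A : Prop :=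
  forall A1 A2, analytic_germ A1 -> analytic_germ A2 ->
    germ_eq A (A1 `|` A2) -> germ_eq A A1 \/ germ_eq A A2.

(* Near z, the set A is the smooth curve h = 0, with tangent line ker dh_z. *)
Definition local_equation A (z : C2 R) h : Prop :=
  [/\ holomorphic_at z h,
      \forall w \near z, A w <-> h w = 0 &
      exists v : C2 R, 'D_v h z <> 0].

Definition regular_outside_0 A : Prop :=
  \forall z \near (0 : C2 R)^', A z -> exists h, local_equation A z h.

Definition vf_invariant X A : Prop :=
  \forall z \near (0 : C2 R)^', A z ->
    forall h, local_equation A z h -> 'D_(X z) h z = 0.

Definition separatrix X A : Prop :=
  [/\ curve_germ A, irreducible_germ A, regular_outside_0 A & vf_invariant X A].

Definition non_dicritical X : Prop :=
  exists F : set (set (C2 R)), finite_set F /\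
    forall A, separatrix X A -> exists2 B, F B & germ_eq A B.

End VectorFields.

(* Main.v *)
(* X is a pair of weighted homogeneous polynomials, and the weighted homogeneous
   components Y_j of a field Y commuting with X commute with X. On the weighted blow-up,
   read in the charts x = 1 and y = 1, the equation [X, Y_j] = 0 becomes a pair of first
   order differential equations between polynomials in one variable. At a zero of
   h = S /\ X where S /\ Y_j does not vanish, j > 0, the blown-up field has a node, and
   the curves x = s^p, y = s^q T(c s^j), where T(w) is the zero of h - w (Y_j /\ X) near
   the node, are infinitely many separatrices: this is excluded. Hence h divides
   S /\ Y_j in both charts, and comparing orders of vanishing at the zeros of h forces
   Y_j to be parallel to X. So Y_j = g X with g a homogeneous first integral, and the
   homogeneous first integrals are the multiples of the powers of one of them, f, of
   minimal degree d. Along the curve t |-> (t^p x0, t^q y0) with f(x0, y0) = 1, the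
   quotient of Y by X is then invariant under the d-th roots of unity, hence a
   holomorphic function phi of t^d = f; as Y - phi(f) X commutes with X, it vanishes. *)
Require Import Defs.
From HB Require Import structures.
From mathcomp Require Import all_boot all_order all_algebra.
From mathcomp Require Import separable cyclotomic.
From mathcomp Require Import complex.
From mathcomp Require Import all_classical all_reals all_analysis.
From mathcomp Require Import ring lra zify.
Set Implicit Arguments.
Unset Strict Implicit.
Unset Printing Implicit Defensive.
Import Order.TTheory GRing.Theory Num.Theory.
Import numFieldNormedType.Exports.
Local Open Scope classical_set_scope.
Local Open Scope ring_scope.

(** * Complex integration *)

(** Write a commuting component as [Y_j = b X + c S]. That [h] divides [S /\ Y_j] means exactly that
    [b] and [c] are polynomial in each chart. Commutation reads [X(c) = 0] and [X(b) = k c]. Local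
    orders at the zeros of [c] then show that [c^(j-k)] divides [b^j]; both powers have weighted
    degree [j(j-k)], so the quotient has degree 0, is polynomial in both charts, and is constant. A
    logarithmic derivative now gives [c = 0]. Degrees [j <= 0] are outside the node argument: for
    [j = 0] a Wronskian replaces it, and for [j < 0] a count of weights leaves no field. The sum of
    the components is at first only a formal series in [f]; its convergence is read off from one
    orbit of the dilations. The hypothesis on [C(X)] provides a homogeneous first integral of
    positive degree: without one, every commuting field reduces to its component of degree [k]. On
    the analytic side, Cauchy's formula is taken over a square and normalised by the integral of
    [1/z], which is only bounded below. A germ is shown to vanish by being flat, that is [O(|z|^N)]
    for every [N]. *)

Notation cnorm := Normc.normc.
Notation cRe := complex.Re.
Notation cIm := complex.Im.
Section Complex.
Variable R : realType.
Local Notation C := R[i].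
Implicit Types (z w a b : C) (e r t : R).

Lemma cnorm_ge0 z : 0 <= cnorm z.
Proof. by case: z => x y; apply: sqrtr_ge0. Qed.

Lemma normcCE z : `|z| = (cnorm z)%:C%C.
Proof. by case: z => x y; rewrite normc_def. Qed.

Lemma cnormD z w : cnorm (z + w) <= cnorm z + cnorm w.
Proof. exact: le_normcD. Qed.

Lemma cnormN z : cnorm (- z) = cnorm z.
Proof. exact: normcN. Qed.

Lemma cnormM z w : cnorm (z * w) = cnorm z * cnorm w.
Proof. exact: Normc.normcM. Qed.
Lemma cnorm0 : cnorm (0 : C) = 0. Proof. exact: Normc.normc0. Qed.
Lemma cnorm1 : cnorm (1 : C) = 1. Proof. exact: Normc.normc1. Qed.

Lemma cnormX z n : cnorm (z ^+ n) = cnorm z ^+ n.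
Proof. by elim: n => [|n IH]; rewrite ?expr0 ?cnorm1 // !exprS cnormM IH. Qed.

Lemma cnormV z : cnorm z^-1 = (cnorm z)^-1.
Proof. exact: Normc.normcV. Qed.

Lemma cnorm_eq0 z : (cnorm z == 0) = (z == 0).
Proof. by apply/eqP/eqP => [/Normc.eq0_normc//|->]; rewrite cnorm0. Qed.

Lemma cnorm_gt0 z : (0 < cnorm z) = (z != 0).
Proof. by rewrite lt_def cnorm_ge0 andbT cnorm_eq0. Qed.

Lemma cnormB z w : cnorm (z - w) = cnorm (w - z).
Proof. by rewrite -cnormN opprB. Qed.

Lemma cnorm_real t : cnorm (t%:C%C : C) = `|t|.
Proof. by rewrite /= expr0n addr0 sqrtr_sqr. Qed.

Lemma cnorm_nat n : cnorm (n%:R : C) = n%:R.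
Proof. by rewrite -[n%:R](rmorph_nat (real_complex R)) cnorm_real ger0_norm. Qed.

Lemma cnormDl z w u : cnorm (z - u) <= cnorm (z - w) + cnorm (w - u).
Proof. by have := cnormD (z - w) (w - u); rewrite addrA subrK. Qed.

Lemma cnorm_le_D z w : cnorm z <= cnorm (z - w) + cnorm w.
Proof. by have := cnormD (z - w) w; rewrite subrK. Qed.

Lemma cnorm_Re z : `|cRe z| <= cnorm z.
Proof.
case: z => x y /=; rewrite -sqrtr_sqr ler_wsqrtr // lerDl; exact: sqr_ge0.
Qed.

Lemma cnorm_Im z : `|cIm z| <= cnorm z.
Proof.
case: z => x y /=; rewrite -sqrtr_sqr ler_wsqrtr // lerDr; exact: sqr_ge0.
Qed.

Lemma cnorm_ReIm z : cnorm z <= `|cRe z| + `|cIm z|.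
Proof.
rewrite {1}[z]complexE; apply: le_trans (cnormD _ _) _.
by rewrite cnormM !cnorm_real /= expr0n add0r expr1n sqrtr1 mul1r.
Qed.

Lemma cnorm_sum (I : Type) (s : seq I) (P : pred I) (F : I -> C) :
  cnorm (\sum_(i <- s | P i) F i) <= \sum_(i <- s | P i) cnorm (F i).
Proof.
elim/big_rec2: _ => [|i x y _ IH]; first by rewrite cnorm0.
by apply: le_trans (cnormD _ _) _; rewrite lerD2l.
Qed.

Lemma cauchy_Rlim (u : nat -> R) :
  (forall e, 0 < e -> exists N, forall n, (N <= n)%N -> `|u n - u N| <= e) ->
  exists l, forall e, 0 < e -> exists N, forall n, (N <= n)%N -> `|u n - l| <= e.
Proof.
move=> uC; have /cauchy_cvgP : cauchy (u @ \oo).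
  apply: cauchy_exP => e e0; have [N uN] := uC (e / 2) ltac:(lra).
  exists (u N); exists N => // n /= /uN; rewrite -ball_normE /= distrC => h.
  by apply: le_lt_trans h _; rewrite ltr_pdivrMr // ltr_pMr // ltr1n.
move=> /cvg_ex [l ul]; exists l => e e0.
move/cvgrPdist_le: ul => /(_ e e0) [N _ hN]; exists N => n nN.
by rewrite distrC; apply: hN.
Qed.

Definition ctendsto (u : nat -> C) z :=
  forall e, 0 < e -> exists N, forall n, (N <= n)%N -> cnorm (u n - z) <= e.

Lemma cauchy_Clim (u : nat -> C) :
  (forall e, 0 < e ->
     exists N, forall n, (N <= n)%N -> cnorm (u n - u N) <= e) ->
  exists z, ctendsto u z.
Proof.
move=> uC.
have [x ux] : exists l, forall e, 0 < e ->
    exists N, forall n, (N <= n)%N -> `|cRe (u n) - l| <= e.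
  apply: cauchy_Rlim => e /uC[N uN]; exists N => n /uN.
  by apply: le_trans; rewrite -raddfB; apply: cnorm_Re.
have [y uy] : exists l, forall e, 0 < e ->
    exists N, forall n, (N <= n)%N -> `|cIm (u n) - l| <= e.
  apply: cauchy_Rlim => e /uC[N uN]; exists N => n /uN.
  by apply: le_trans; rewrite -raddfB; apply: cnorm_Im.
exists (x +i* y)%C => e e0.
have [|N hN] := ux (e / 2); first lra.
have [|M hM] := uy (e / 2); first lra.
exists (maxn N M) => n; rewrite geq_max => /andP[/hN h1 /hM h2].
apply: le_trans (cnorm_ReIm _) _.
by move: (u n) h1 h2 => [a b] /= h1 h2; lra.
Qed.

Lemma pow2_lt e : 0 < e -> forall c, exists n, c / 2 ^+ n < e.
Proof.
move=> e0 c; have [n hn] : exists n, c / e < n%:R.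
  exists (Num.bound `|c / e|).
  by apply: le_lt_trans (ler_norm _) (archi_boundP _).
exists n; rewrite ltr_pdivrMr ?exprn_gt0 // mulrC -ltr_pdivrMr //.
apply: lt_trans hn _; rewrite -natrX ltr_nat; exact: ltn_expl.
Qed.

(** Abstract form of repeated subdivision. The step is iterated by choice; as the diameters halve,
    the displacement still to come after [y] is at most [diam y * (1 + 1/2 + ...) = 2 * diam y]. It
    is applied to sets of bad segments or triangles. *)
Lemma nested_limit (T : Type) (P : T -> Prop) (pos : T -> C) (diam : T -> R) :
  (forall x, P x -> exists y,
     [/\ P y, diam y = diam x / 2 & cnorm (pos y - pos x) <= diam x]) ->
  forall x, P x -> exists z, forall e, 0 < e -> exists y,
    [/\ P y, cnorm (pos y - z) <= 2 * diam y & diam y < e].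
Proof.
move=> step x Px.
have step' (s : {x | P x}) : exists s' : {x | P x},
    diam (sval s') = diam (sval s) / 2 /\
    cnorm (pos (sval s') - pos (sval s)) <= diam (sval s).
  by have [y [Py h1 h2]] := step _ (svalP s); exists (exist _ y Py).
have [nx nxP] := choice step'.
pose u n := sval (iter n nx (exist _ x Px)).
have Pu n : P (u n) by apply: svalP.
have du n : diam (u n) = diam x / 2 ^+ n.
  elim: n => [|n IH]; first by rewrite expr0 divr1.
  by rewrite /u iterS (nxP _).1 -/(u n) IH exprSr invfM mulrA.
have pu n : cnorm (pos (u n.+1) - pos (u n)) <= diam (u n).
  by rewrite {1}/u iterS; apply: (nxP _).2.
(* The factor [1 - (2 ^+ k)^-1] is the exact partial geometric sum, which lets the induction
   close. *)
have puk n k : cnorm (pos (u (n + k)%N) - pos (u n)) <=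
    2 * diam (u n) * (1 - (2 ^+ k)^-1).
  elim: k => [|k IH]; first by rewrite addn0 subrr cnorm0 expr0 invr1 subrr mulr0.
  apply: le_trans (cnormDl _ (pos (u (n + k)%N)) _) _; rewrite addnS.
  have := pu (n + k)%N; rewrite (du (n + k)%N) (du n) in IH *.
  rewrite exprD exprSr !invfM => h.
  set A := (2 ^+ k)^-1 in IH h *; set B := (2 ^+ n)^-1 in IH h *; lra.
have d0 : 0 <= diam x by apply: le_trans (pu 0%N); apply: cnorm_ge0.
have dun n : 0 <= diam (u n) by apply: le_trans (pu n); apply: cnorm_ge0.
have pukk n k : cnorm (pos (u (n + k)%N) - pos (u n)) <= 2 * diam (u n).
  apply: le_trans (puk n k) _; rewrite -[leRHS]mulr1; apply: ler_wpM2l.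
    by rewrite mulr_ge0.
  have : 0 <= (2 ^+ k : R)^-1 by rewrite invr_ge0 exprn_ge0.
  lra.
have [z zP] : exists z, ctendsto (pos \o u) z.
  apply: cauchy_Clim => e e0; have [n hn] := pow2_lt e0 (2 * diam x).
  exists n => m /subnKC <- /=; apply: le_trans (pukk n _) _.
  by rewrite du mulrA ltW.
exists z => e e0; have [n hn] := pow2_lt e0 (diam x).
exists (u n); split=> //; last by rewrite du.
apply/ler_addgt0Pl => d d0'; have [N hN] := zP _ d0'.
apply: le_trans (cnormDl _ (pos (u (n + N)%N)) _) _.
have := pukk n N; have := hN (n + N)%N (leq_addl _ _); rewrite cnormB /= => h1 h2.
by move: h1; rewrite cnormB => h1; rewrite cnormB; lra.
Qed.

(** Stability under midpoints stands for convexity, since only points obtained by repeated halving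
    are ever visited. *)
Definition cmidconvex (D : set C) := forall a b, D a -> D b -> D ((a + b) / 2).
Definition ccclosed (D : set C) :=
  forall z, (forall e, 0 < e -> exists2 w, D w & cnorm (w - z) <= e) -> D z.

Lemma cnorm_half z : cnorm (z / 2) = cnorm z / 2.
Proof. by rewrite cnormM cnormV cnorm_nat. Qed.

Lemma midBl a b : (a + b) / 2 - a = (b - a) / 2.
Proof. by field. Qed.
Lemma midBr a b : b - (a + b) / 2 = (b - a) / 2.
Proof. by field. Qed.

(** Cousin's principle: a counterexample could be halved forever, and the limit point, which lies in
    [D] by closedness, contradicts the local hypothesis. The local segments need not contain [z]:
    lying within twice their length of it is what [nested_limit] delivers. *)
Lemma segment_bisection D (P : C -> C -> Prop) : cmidconvex D -> ccclosed D ->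
  (forall a b, D a -> D b ->
     P a ((a + b) / 2) -> P ((a + b) / 2) b -> P a b) ->
  (forall z, D z -> exists2 d, 0 < d & forall a b, D a -> D b ->
     cnorm (a - z) <= 2 * cnorm (b - a) -> cnorm (b - a) < d -> P a b) ->
  forall a b, D a -> D b -> P a b.
Proof.
move=> Dm Dc glue loc a b Da Db; apply: contrapT => nP.
pose bad (s : C * C) := [/\ D s.1, D s.2 & ~ P s.1 s.2].
have [||z zP] := @nested_limit _ bad (fun s => s.1)
   (fun s => cnorm (s.2 - s.1)) _ (a, b); last 2 first.
- by [].
- have Dz : D z.
    apply: Dc => e e0; have [|[x y] [[/= Dx _ _] h1 h2]] := zP (e / 2); first lra.
    by exists x => //=; lra.
  have [d d0 hd] := loc z Dz; have [[x y] [[/= Dx Dy nPxy] h1 h2]] := zP d d0.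
  exact/nPxy/hd.
move=> [x y] [/= Dx Dy nPxy].
have [Pl|Pl] := pselect (P x ((x + y) / 2)).
- exists ((x + y) / 2, y); split=> /=.
  + by split => //=; [exact: Dm | move=> Pr; apply: nPxy; exact: glue].
  + by rewrite midBr cnorm_half.
  + by rewrite midBl cnorm_half; have := cnorm_ge0 (y - x); lra.
- exists (x, (x + y) / 2); split=> /=.
  + by split => //=; exact: Dm.
  + by rewrite midBl cnorm_half.
  + by rewrite subrr cnorm0 cnorm_ge0.
Qed.

(** The same principle for triangles cut into four by the midpoints of their sides, the perimeter
    being the size that halves. *)
Lemma triangle_bisection D (P : C -> C -> C -> Prop) :
  cmidconvex D -> ccclosed D ->
  (forall a b c, D a -> D b -> D c ->
     P a ((a + b) / 2) ((c + a) / 2) -> P ((a + b) / 2) b ((b + c) / 2) ->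
     P ((b + c) / 2) c ((c + a) / 2) ->
     P ((a + b) / 2) ((b + c) / 2) ((c + a) / 2) -> P a b c) ->
  (forall z, D z -> exists2 d, 0 < d & forall a b c, D a -> D b -> D c ->
     let l := cnorm (b - a) + cnorm (c - b) + cnorm (a - c) in
     cnorm (a - z) <= 2 * l -> l < d -> P a b c) ->
  forall a b c, D a -> D b -> D c -> P a b c.
Proof.
move=> Dm Dc glue loc a b c Da Db Dcc; apply: contrapT => nP.
pose bad (s : C * C * C) := [/\ D s.1.1, D s.1.2, D s.2 & ~ P s.1.1 s.1.2 s.2].
pose dm (s : C * C * C) :=
  cnorm (s.1.2 - s.1.1) + cnorm (s.2 - s.1.2) + cnorm (s.1.1 - s.2).
have [||z zP] := @nested_limit _ bad (fun s => s.1.1) dm _ (a, b, c); last 2 first.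
- by [].
- have Dz : D z.
    apply: Dc => e e0.
    have [|[[x y] t] [[/= Dx _ _ _] h1 h2]] := zP (e / 2); first lra.
    by exists x => //=; lra.
  have [d d0 hd] := loc z Dz.
  have [[[x y] t] [[/= Dx Dy Dt nPxy] h1 h2]] := zP d d0.
  exact/nPxy/hd.
move=> [[x y] t] [/= Dx Dy Dt nPxy]; rewrite /dm /=.
have Dxy := Dm _ _ Dx Dy; have Dyt := Dm _ _ Dy Dt; have Dtx := Dm _ _ Dt Dx.
have := cnorm_ge0 (y - x); have := cnorm_ge0 (t - y); have := cnorm_ge0 (x - t).
have [P1|nP1] := pselect (P x ((x + y) / 2) ((t + x) / 2)); last first.
  exists (x, (x + y) / 2, (t + x) / 2); split=> //=; last by rewrite subrr cnorm0; lra.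
  have -> : (x + y) / 2 - x = (y - x) / 2 by field.
  have -> : (t + x) / 2 - (x + y) / 2 = (t - y) / 2 by field.
  have -> : x - (t + x) / 2 = (x - t) / 2 by field.
  by rewrite !cnorm_half; field.
have [P2|nP2] := pselect (P ((x + y) / 2) y ((y + t) / 2)); last first.
  exists ((x + y) / 2, y, (y + t) / 2); split=> //=.
  - have -> : y - (x + y) / 2 = (y - x) / 2 by field.
    have -> : (y + t) / 2 - y = (t - y) / 2 by field.
    have -> : (x + y) / 2 - (y + t) / 2 = (x - t) / 2 by field.
    by rewrite !cnorm_half; field.
  - have -> : (x + y) / 2 - x = (y - x) / 2 by field.
    by rewrite cnorm_half; lra.
have [P3|nP3] := pselect (P ((y + t) / 2) t ((t + x) / 2)); last first.
  exists ((y + t) / 2, t, (t + x) / 2); split=> //=.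
  - have -> : t - (y + t) / 2 = (t - y) / 2 by field.
    have -> : (t + x) / 2 - t = (x - t) / 2 by field.
    have -> : (y + t) / 2 - (t + x) / 2 = (y - x) / 2 by field.
    by rewrite !cnorm_half; field.
  - have -> : (y + t) / 2 - x = (y - x) / 2 - (x - t) / 2 by field.
    by have := cnormD ((y - x) / 2) (- ((x - t) / 2)); rewrite cnormN !cnorm_half; lra.
exists ((x + y) / 2, (y + t) / 2, (t + x) / 2); split=> //=.
- by split=> //= P4; apply: nPxy; exact: glue.
- have -> : (y + t) / 2 - (x + y) / 2 = - ((x - t) / 2) by field.
  have -> : (t + x) / 2 - (y + t) / 2 = - ((y - x) / 2) by field.
  have -> : (x + y) / 2 - (t + x) / 2 = - ((t - y) / 2) by field.
  by rewrite !cnormN !cnorm_half; field.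
- have -> : (x + y) / 2 - x = (y - x) / 2 by field.
  by rewrite cnorm_half; lra.
Qed.
End Complex.

(** * Integrals along segments as limits of dyadic midpoint sums *)

Section Integral.
Variable R : realType.
Local Notation C := R[i].
Implicit Types (z w a b c : C) (e r t M : R) (D : set C) (f g : C -> C).

Definition ccont f z := forall e, 0 < e ->
  exists2 d, 0 < d & forall w, cnorm (w - z) < d -> cnorm (f w - f z) <= e.

Definition cderiv f z l := forall e, 0 < e -> exists2 d, 0 < d &
  forall w, cnorm (w - z) < d ->
    cnorm (f w - f z - l * (w - z)) <= e * cnorm (w - z).

(* The midpoint rule is exact on affine functions and antisymmetric. *)
Fixpoint msum f n a b : C :=
  if n is n'.+1 then msum f n' a ((a + b) / 2) + msum f n' ((a + b) / 2) b
  else (b - a) * f ((a + b) / 2).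

Lemma msum_bound D f M n a b : cmidconvex D ->
  (forall z, D z -> cnorm (f z) <= M) -> D a -> D b ->
  cnorm (msum f n a b) <= M * cnorm (b - a).
Proof.
move=> Dm fM; elim: n a b => [|n IH] a b Da Db /=.
  by rewrite cnormM mulrC ler_wpM2r ?cnorm_ge0 //; apply: fM; apply: Dm.
have Dab := Dm _ _ Da Db.
apply: le_trans (cnormD _ _) _.
have := IH _ _ Da Dab; have := IH _ _ Dab Db.
by rewrite midBl midBr cnorm_half; lra.
Qed.

Lemma eq_msum D f g n a b : cmidconvex D -> (forall z, D z -> f z = g z) ->
  D a -> D b -> msum f n a b = msum g n a b.
Proof.
move=> Dm fg; elim: n a b => [|n IH] a b Da Db /=; first by rewrite fg //; apply: Dm.
by have Dab := Dm _ _ Da Db; rewrite !IH.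
Qed.

Lemma msumD f g n a b :
  msum (fun z => f z + g z) n a b = msum f n a b + msum g n a b.
Proof. by elim: n a b => [|n IH] a b /=; rewrite ?mulrDr // !IH addrACA. Qed.

Lemma msumZ c f n a b : msum (fun z => c * f z) n a b = c * msum f n a b.
Proof. by elim: n a b => [|n IH] a b /=; [rewrite mulrCA | rewrite !IH mulrDr]. Qed.

Lemma msum_affine c d n a b :
  msum (fun z => c * z + d) n a b = c * (b ^+ 2 - a ^+ 2) / 2 + d * (b - a).
Proof.
by elim: n a b => [|n IH] a b /=; [field | rewrite !IH; field].
Qed.

Lemma msum_anti f n a b : msum f n b a = - msum f n a b.
Proof.
elim: n a b => [|n IH] a b /=; first by rewrite [b + a]addrC -mulNr opprB.
rewrite [b + a]addrC (IH _ b) (IH a) -opprD; congr (- _); exact: addrC.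
Qed.

Definition is_int f a b v := ctendsto (fun n => msum f n a b) v.

Lemma ctendsto_uniq (u : nat -> C) v w : ctendsto u v -> ctendsto u w -> v = w.
Proof.
move=> uv uw; apply/eqP; rewrite -subr_eq0 -cnorm_eq0 eq_le cnorm_ge0 andbT.
apply/ler_addgt0Pl => e e0; rewrite addr0.
have [|N hN] := uv (e / 2); first lra.
have [|K hK] := uw (e / 2); first lra.
have := cnormDl v (u (maxn N K)) w; rewrite (cnormB v (u _)).
have := hN _ (leq_maxl N K); have := hK _ (leq_maxr N K); lra.
Qed.

Lemma ctendstoD (u u' : nat -> C) v v' : ctendsto u v -> ctendsto u' v' ->
  ctendsto (fun n => u n + u' n) (v + v').
Proof.
move=> uv uv' e e0; have [|N hN] := uv (e / 2); first lra.
have [|K hK] := uv' (e / 2); first lra.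
exists (maxn N K) => n; rewrite geq_max => /andP[/hN h1 /hK h2].
have := cnormD (u n - v) (u' n - v'); rewrite addrACA -opprD; lra.
Qed.

Lemma ctendstoZ c (u : nat -> C) v : ctendsto u v ->
  ctendsto (fun n => c * u n) (c * v).
Proof.
move=> uv e e0; have c1 : 0 < cnorm c + 1 by have := cnorm_ge0 c; lra.
have [|N hN] := uv (e / (cnorm c + 1)); first exact: divr_gt0.
exists N => n /hN; rewrite -mulrBr cnormM ler_pdivlMr //.
have := cnorm_ge0 (u n - v); nra.
Qed.

Lemma ctendsto_bound (u : nat -> C) v M :
  ctendsto u v -> (forall n, cnorm (u n) <= M) -> cnorm v <= M.
Proof.
move=> uv uM; apply/ler_addgt0Pl => e /uv[N /(_ N (leqnn N))].
have := cnormD (u N) (v - u N); rewrite addrC subrK.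
by rewrite [cnorm (v - _)]cnormB; have := uM N; lra.
Qed.

Lemma ctendsto_cst v : ctendsto (fun=> v : C) v.
Proof. by move=> e e0; exists 0%N => n _; rewrite subrr cnorm0 ltW. Qed.

Definition cball z r : set C := fun w => cnorm (w - z) < r.

Lemma cmidconvex_cball z r : cmidconvex (cball z r).
Proof.
move=> a b; rewrite /cball => ha hb.
have -> : (a + b) / 2 - z = (a - z) / 2 + (b - z) / 2 by field.
by apply: le_lt_trans (cnormD _ _) _; rewrite !cnorm_half; lra.
Qed.

Lemma cmidconvexI D D' : cmidconvex D -> cmidconvex D' -> cmidconvex (D `&` D').
Proof. by move=> h h' a b [? ?] [? ?]; split; [apply: h | apply: h']. Qed.

Lemma ccclosedI D D' : ccclosed D -> ccclosed D' -> ccclosed (D `&` D').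
Proof.
by move=> h h' z hz; split; [apply: h|apply: h'] => e /hz[w []]; exists w.
Qed.

(** Subtracting the constant [f z] leaves a function bounded by [e] near [z]. Both ends of the
    segment are within three lengths of [z], hence the radius [d / 3]. *)
Lemma msum_local f z e : ccont f z -> 0 < e -> exists2 d, 0 < d &
  forall n a b, cnorm (a - z) <= 2 * cnorm (b - a) -> cnorm (b - a) < d ->
    cnorm (msum f n a b - f z * (b - a)) <= e * cnorm (b - a).
Proof.
move=> fz e0; have [d d0 hd] := fz e e0.
exists (d / 3) => [|n a b h1 h2]; first lra.
have -> : msum f n a b - f z * (b - a) = msum (fun w => f w + (0 * w - f z)) n a b.
  by rewrite msumD msum_affine !mul0r add0r mulNr.
have h3 := cnormDl b a z.
apply: (@msum_bound (cball z d)); first exact: cmidconvex_cball.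
- by move=> w /hd; rewrite mul0r add0r.
- by rewrite /cball; lra.
- by rewrite /cball; lra.
Qed.

(** The Cauchy property is proved by bisection with an error proportional to the length, because
    such bounds add up when two halves are glued. *)
Lemma is_int_exists D f a b : cmidconvex D -> ccclosed D ->
  (forall z, D z -> ccont f z) -> D a -> D b -> exists v, is_int f a b v.
Proof.
move=> Dm Dc fc Da Db; apply: cauchy_Clim => e e0.
have ba := cnorm_ge0 (b - a).
pose e' := e / (cnorm (b - a) + 1).
have e'0 : 0 < e' by apply: divr_gt0; lra.
suff [N hN] : exists N, forall n m, (N <= n)%N -> (N <= m)%N ->
    cnorm (msum f n a b - msum f m a b) <= e' * cnorm (b - a).
  exists N => n nN; apply: le_trans (hN _ _ nN (leqnn N)) _.
  rewrite /e' -mulrA ler_piMr ?(ltW e0) // mulrC ler_pdivrMr; lra.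
pose P x y := exists N, forall n m, (N <= n)%N -> (N <= m)%N ->
    cnorm (msum f n x y - msum f m x y) <= e' * cnorm (y - x).
clearbody e'; clear ba; apply: (@segment_bisection _ D P) => //.
(* One level is lost in gluing: the sum of depth [n.+1] on a segment consists of the sums of depth
   [n] on its halves. *)
- move=> {Da Db} {}a {}b _ _ [N hN] [K hK]; exists (maxn N K).+1 => [[|n]//] [|m] //.
  rewrite !ltnS !geq_max => /andP[n1 n2] /andP[m1 m2] /=.
  rewrite opprD addrACA; apply: le_trans (cnormD _ _) _.
  have := hN _ _ n1 m1; have := hK _ _ n2 m2.
  by rewrite midBl midBr cnorm_half; lra.
- move=> z /fc fz; have [|d d0 hd] := @msum_local f _ (e' / 2) fz; first lra.
  exists d => // x y _ _ h1 h2; exists 0%N => n m _ _.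
  have := hd n _ _ h1 h2; have := hd m _ _ h1 h2.
  set t := _ * (y - x); have := cnormDl (msum f n x y) t (msum f m x y).
  by rewrite (cnormB t); lra.
Qed.

Definition cint f a b : C := xget 0 (is_int f a b).

Lemma cint_eq f a b v : is_int f a b v -> cint f a b = v.
Proof.
move=> h; rewrite /cint; case: xgetP => [w _ hw|/(_ v)//].
exact: ctendsto_uniq hw h.
Qed.

Definition cintegrable f a b := exists v, is_int f a b v.

Lemma cintP f a b : cintegrable f a b -> is_int f a b (cint f a b).
Proof. by move=> [v h]; rewrite (cint_eq h). Qed.

Lemma cintD f g a b : cintegrable f a b -> cintegrable g a b ->
  cint (fun z => f z + g z) a b = cint f a b + cint g a b.
Proof.
move=> /cintP hf /cintP hg; apply: cint_eq; have := ctendstoD hf hg.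
by congr ctendsto; apply/funext => n; rewrite msumD.
Qed.

Lemma cintegrableD f g a b : cintegrable f a b -> cintegrable g a b ->
  cintegrable (fun z => f z + g z) a b.
Proof.
move=> [v hf] [w hg]; exists (v + w); have := ctendstoD hf hg.
by congr ctendsto; apply/funext => n; rewrite msumD.
Qed.

Lemma cintZ c f a b : cintegrable f a b ->
  cint (fun z => c * f z) a b = c * cint f a b.
Proof.
move=> /cintP hf; apply: cint_eq; have := ctendstoZ c hf.
by congr ctendsto; apply/funext => n; rewrite msumZ.
Qed.

Lemma is_int_affine c d a b :
  is_int (fun z => c * z + d) a b (c * (b ^+ 2 - a ^+ 2) / 2 + d * (b - a)).
Proof.
have := ctendsto_cst (c * (b ^+ 2 - a ^+ 2) / 2 + d * (b - a)).
by congr ctendsto; apply/funext => n; rewrite msum_affine.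
Qed.

Lemma cint_anti f a b : cintegrable f a b -> cint f b a = - cint f a b.
Proof.
move=> /cintP hf; apply: cint_eq; have := ctendstoZ (-1) hf; rewrite mulN1r.
by congr ctendsto; apply/funext => n; rewrite (msum_anti f n a b) mulN1r.
Qed.

(** Only the midpoint is available as splitting point: the dyadic sums of the segment are then
    literally those of its halves. *)
Lemma cint_split f a b : cintegrable f a ((a + b) / 2) ->
  cintegrable f ((a + b) / 2) b ->
  cint f a b = cint f a ((a + b) / 2) + cint f ((a + b) / 2) b.
Proof.
move=> /cintP h1 /cintP h2; apply: cint_eq => e /(ctendstoD h1 h2)[N hN].
by exists N.+1 => -[//|n]; rewrite ltnS => /hN.
Qed.

Lemma cint_bound D f M a b : cmidconvex D ->
  (forall z, D z -> cnorm (f z) <= M) -> D a -> D b -> cintegrable f a b ->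
  cnorm (cint f a b) <= M * cnorm (b - a).
Proof.
move=> Dm fM Da Db /cintP h; apply: ctendsto_bound h _ => n.
exact: msum_bound Dm fM Da Db.
Qed.

Lemma eq_cint D f g a b : cmidconvex D -> (forall z, D z -> f z = g z) ->
  D a -> D b -> cint f a b = cint g a b.
Proof.
move=> Dm fg Da Db; rewrite /cint /is_int; congr (xget 0 (ctendsto _)).
by apply/funext => n; apply: eq_msum Dm fg Da Db.
Qed.

Lemma cintegrable_sum (I : Type) (s : seq I) (F : I -> C -> C) a b :
  (forall i, cintegrable (F i) a b) ->
  cintegrable (fun z => \sum_(i <- s) F i z) a b /\
  cint (fun z => \sum_(i <- s) F i z) a b = \sum_(i <- s) cint (F i) a b.
Proof.
move=> h; elim: s => [|i s [IH1 IH2]].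
  have := is_int_affine 0 0 a b; rewrite !mul0r add0r => h0.
  have E : (fun z => 0 * z + 0) = (fun z => \sum_(i <- [::]) F i z).
    by apply/funext => z; rewrite big_nil mul0r addr0.
  by rewrite E in h0; split; [exists 0 | rewrite big_nil; exact: cint_eq].
have E : (fun z => \sum_(j <- i :: s) F j z) =
         (fun z => F i z + \sum_(j <- s) F j z).
  by apply/funext => z; rewrite big_cons.
rewrite E big_cons cintD // IH2; split=> //; exact: cintegrableD.
Qed.

End Integral.

(** * Complex derivatives in epsilon-delta form *)

Section ComplexDerivative.
Variable R : realType.
Local Notation C := R[i].
Implicit Types (z w : C) (f g : C -> C).

Lemma Cgt0P (e : C) : 0 < e -> exists2 r : R, 0 < r & e = r%:C%C.
Proof.
move=> e0; exists (cRe e); first by move: e0; rewrite ltcE => /andP[].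
by rewrite RRe_real ?gtr0_real.
Qed.

Lemma near_CP z (P : C -> Prop) : (\forall w \near (z : R[i]^o), P w) <->
  exists2 d : R, 0 < d & forall w, cnorm (w - z) < d -> P w.
Proof.
split=> [/nbhs_ballP[e /= e0 h]|[d d0 h]].
  have [r r0 re] := Cgt0P e0; exists r => // w wz; apply: h.
  by rewrite -ball_normE /= normcCE re ltcR cnormB.
apply/nbhs_ballP; exists d%:C%C => /=; first by rewrite ltcR.
by move=> w; rewrite -ball_normE /= normcCE ltcR cnormB => /h.
Qed.

(** [cderiv] measures with real norms, which suits estimates by linear arithmetic; this equivalence
    lets it inherit algebraic rules from [is_derive]. *)
Lemma cderiv_is_derive f z l :
  cderiv f z l <-> is_derive (z : R[i]^o) (1 : R[i]^o) (f : R[i]^o -> R[i]^o) l.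
Proof.
have E h : h != 0 -> cnorm (f (h + z) - f z - l * h) =
    cnorm h * cnorm (l - h^-1 * (f (h + z) - f z)).
  by move=> h0; rewrite -cnormM mulrBr mulVKf // cnormB [h * l]mulrC.
split=> [hf|[/derivable_nbhsP df dfl] e e0].
  suff cv : h^-1 *: ((f : R[i]^o -> R[i]^o) (h *: 1 + z) - f z) @[h --> (0 : R[i]^o)^'] --> (l : R[i]^o).
    by apply: DeriveDef; [apply/cvg_ex; exists l | exact/cvg_lim].
  apply/cvgrPdist_le => _ /Cgt0P[e e0 ->].
  have [d d0 hd] := hf e e0; rewrite near_withinE; apply/near_CP; exists d => // h hz h0.
  rewrite normcCE lecR.
  have := hd (h + z); rewrite addrK subr0 in hz *; move=> /(_ hz).
  by rewrite E // mulrC ler_pM2r ?cnorm_gt0 // [h *: 1]mulr1.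
have /eqaddoP/(_ _ _)/near_CP h := df.
have [|d d0 hd] := h e%:C%C; first by rewrite ltcR.
exists d => // w wz; have := hd (w - z); rewrite subr0 => /(_ wz).
rewrite !normcCE -rmorphM lecR /= dfl; apply: le_trans.
rewrite le_eqVlt; apply/orP; left; apply/eqP; congr cnorm.
transitivity (f ((w - z) * 1 + z) - (f z + (w - z) * l)); last by [].
by rewrite mulr1 subrK opprD addrA [_ * l]mulrC.
Qed.

Lemma cderiv_cst c z : cderiv (fun=> c) z 0.
Proof. by apply/cderiv_is_derive; apply: is_derive_cst. Qed.

Lemma cderiv_id z : cderiv id z 1.
Proof. by apply/cderiv_is_derive; apply: is_derive_id. Qed.

Lemma cderivD f g z l m : cderiv f z l -> cderiv g z m ->
  cderiv (fun w => f w + g w) z (l + m).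
Proof.
by move=> /cderiv_is_derive hf /cderiv_is_derive hg; apply/cderiv_is_derive; apply: is_deriveD.
Qed.

Lemma cderivN f z l : cderiv f z l -> cderiv (fun w => - f w) z (- l).
Proof. by move=> /cderiv_is_derive hf; apply/cderiv_is_derive; apply: is_deriveN. Qed.

Lemma cderivB f g z l m : cderiv f z l -> cderiv g z m ->
  cderiv (fun w => f w - g w) z (l - m).
Proof. by move=> hf /cderivN; apply: cderivD. Qed.

Lemma cderivM f g z l m : cderiv f z l -> cderiv g z m ->
  cderiv (fun w => f w * g w) z (l * g z + f z * m).
Proof.
move=> /cderiv_is_derive hf /cderiv_is_derive hg; have := is_deriveM hf hg.
have -> : f z *: m + g z *: l = l * g z + f z * m by rewrite addrC [g z *: l]mulrC.
by move/(cderiv_is_derive (fun w => f w * g w) z _).2.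
Qed.

Lemma cderivX f z l n : cderiv f z l ->
  cderiv (fun w => f w ^+ n) z (n%:R * f z ^+ n.-1 * l).
Proof.
move=> hf; elim: n => [|n IH]; first by rewrite !mul0r; apply: cderiv_cst.
have -> : (fun w => f w ^+ n.+1) = (fun w => f w * f w ^+ n).
  by apply/funext => w; rewrite exprS.
have -> : n.+1%:R * f z ^+ n.+1.-1 * l =
          l * f z ^+ n + f z * (n%:R * f z ^+ n.-1 * l).
  by case: n {IH} => [|n] /=; [rewrite expr0; ring | rewrite exprS -[n.+2]add1n natrD; ring].
exact: cderivM.
Qed.

Lemma cderiv_ext f g z l d : 0 < d -> (forall w, cnorm (w - z) < d -> f w = g w) ->
  cderiv f z l -> cderiv g z l.
Proof.
move=> d0 fg hf e /hf[d' d'0 hd]; exists (Num.min d d').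
  by rewrite lt_min d0.
by move=> w; rewrite lt_min => /andP[h1 h2]; rewrite -!fg ?subrr ?cnorm0 //; apply: hd.
Qed.

Lemma cderiv_lip f z l : cderiv f z l -> exists2 d, 0 < d &
  forall w, cnorm (w - z) < d -> cnorm (f w - f z) <= (cnorm l + 1) * cnorm (w - z).
Proof.
move=> /(_ 1 ltr01)[d d0 hd]; exists d => // w /hd; rewrite mul1r.
have := cnormD (f w - f z - l * (w - z)) (l * (w - z)); rewrite subrK cnormM; lra.
Qed.

Lemma cderiv_cont f z l : cderiv f z l -> ccont f z.
Proof.
move=> /cderiv_lip[d d0 hd] e e0; have l0 := cnorm_ge0 l.
exists (Num.min d (e / (cnorm l + 1))); first by rewrite lt_min d0 divr_gt0 //; lra.
move=> w; have l1 : 0 < cnorm l + 1 by lra.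
rewrite lt_min ltr_pdivlMr // => /andP[/hd h1 h2]; lra.
Qed.

Lemma cderiv_comp f g z l m : cderiv g z m -> cderiv f (g z) l ->
  cderiv (fun w => f (g w)) z (l * m).
Proof.
move=> hg hf e e0.
have [d1 d10 h1] := cderiv_lip hg.
have l0 := cnorm_ge0 l; have m0 := cnorm_ge0 m.
pose K := cnorm l + cnorm m + 1.
have K0 : 0 < K by rewrite /K; lra.
have e'0 : 0 < e / K by apply: divr_gt0.
have [d2 d20 h2] := hg _ e'0; have [d3 d30 h3] := hf _ e'0.
have d30' : 0 < d3 / 2 by lra.
have [d4 d40 h4] := cderiv_cont hg d30'.
exists (Num.min d1 (Num.min d2 d4)); first by rewrite !lt_min d10 d20.
move=> w; rewrite !lt_min => /andP[/h1 {}h1 /andP[/h2 {}h2 /h4 {}h4]].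
have {}h3 := h3 (g w) ltac:(lra).
have -> : f (g w) - f (g z) - l * m * (w - z) =
  f (g w) - f (g z) - l * (g w - g z) + l * (g w - g z - m * (w - z)) by ring.
apply: le_trans (cnormD _ _) _; rewrite cnormM.
have eK : e / K * K = e by rewrite divfK // gt_eqF.
rewrite -[in leRHS]eK; set e' := e / K in h2 h3 e'0 eK *.
have := ler_wpM2l (ltW e'0) h1; have := ler_wpM2l l0 h2.
by rewrite /K; lra.
Qed.
End ComplexDerivative.

(** * Goursat's theorem on triangles *)

Section Cauchy.
Variable R : realType.
Local Notation C := R[i].
Implicit Types (z w a b c v : C) (D : set C) (f g G : C -> C) (e r M : R).

Lemma cderiv_inv z : z != 0 -> cderiv GRing.inv z (- z ^- 2).
Proof.
move=> z0 e e0; have nz : 0 < cnorm z by rewrite cnorm_gt0.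
have n3 : 0 < cnorm z ^+ 3 by apply: exprn_gt0.
exists (Num.min (cnorm z / 2) (e * cnorm z ^+ 3 / 2)).
  rewrite lt_min; apply/andP; split; first lra.
  by rewrite !mulr_gt0 //; lra.
move=> w; rewrite lt_min => /andP[h1 h2].
have wn : cnorm z / 2 <= cnorm w.
  by have := cnormDl z w 0; rewrite !subr0 (cnormB z w); lra.
have w0 : w != 0 by rewrite -cnorm_gt0; lra.
have -> : w^-1 - z^-1 - - z ^- 2 * (w - z) = (w - z) * (w - z) / (z ^+ 2 * w).
  by field; apply/andP.
rewrite !cnormM cnormV cnormM cnormX mulrAC ler_wpM2r ?cnorm_ge0 //.
have : 0 < cnorm z ^+ 2 * cnorm w by rewrite mulr_gt0 ?exprn_gt0 //; lra.
move=> p; rewrite ler_pdivrMr //; apply: le_trans (ltW h2) _.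
rewrite -mulrA ler_pM2l // exprSr -mulrA ler_pM2l ?exprn_gt0 //.
Qed.

Lemma cmidconvex_disc z r : cmidconvex [set w : C | cnorm (w - z) <= r].
Proof.
move=> a b /= ha hb.
have -> : (a + b) / 2 - z = (a - z) / 2 + (b - z) / 2 by field.
by apply: le_trans (cnormD _ _) _; rewrite !cnorm_half; lra.
Qed.

Lemma ccclosed_disc z r : ccclosed [set w : C | cnorm (w - z) <= r].
Proof.
move=> w h /=; apply/ler_addgt0Pl => e /h[x /= hx xw].
by apply: le_trans (cnormDl w x z) _; rewrite (cnormB w); lra.
Qed.

Definition half_plane u w s : set C := [set z | s <= cRe (u * (z - w))].

Lemma cReD z w : cRe (z + w) = cRe z + cRe w.
Proof. by case: z w => [? ?] [? ?]. Qed.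
Lemma cRe_half z : cRe (z / 2) = cRe z / 2.
Proof.
have {2}-> : z = z / 2 + z / 2 by field.
by rewrite cReD; field.
Qed.

Lemma cmidconvex_half_plane u w s : cmidconvex (half_plane u w s).
Proof.
move=> a b; rewrite /half_plane /= => ha hb.
have -> : u * ((a + b) / 2 - w) = (u * (a - w)) / 2 + (u * (b - w)) / 2 by field.
by rewrite cReD !cRe_half; lra.
Qed.

Lemma ccclosed_half_plane u w s : ccclosed (half_plane u w s).
Proof.
move=> z hz; rewrite /half_plane /=; apply/ler_addgt0Pl => e e0.
have un : 0 < cnorm u + 1 by have := cnorm_ge0 u; lra.
have [x hx xz] := hz _ (divr_gt0 e0 un).
have -> : z - w = (z - x) + (x - w) by ring.
rewrite mulrDr cReD.
have := cnorm_Re (u * (z - x)); rewrite cnormM cnormB ler_norml => /andP[h1 _].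
have : cnorm u * cnorm (x - z) <= e.
  apply: le_trans (_ : (cnorm u + 1) * cnorm (x - z) <= _).
    by rewrite ler_wpM2r ?cnorm_ge0 // lerDl.
  by rewrite mulrC -ler_pdivlMr.
by move: hx; rewrite /half_plane /=; lra.
Qed.

Definition tri_int f a b c := cint f a b + cint f b c + cint f c a.

Lemma cnormD3 a b c : cnorm (a + b + c) <= cnorm a + cnorm b + cnorm c.
Proof. by apply: le_trans (cnormD _ _) _; rewrite lerD2r cnormD. Qed.

Lemma cnormD4 a b c z :
  cnorm (a + b + c + z) <= cnorm a + cnorm b + cnorm c + cnorm z.
Proof. by apply: le_trans (cnormD _ _) _; rewrite lerD2r cnormD3. Qed.

Section Convex.
Variable D : set C.
Hypotheses (Dm : cmidconvex D) (Dc : ccclosed D).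

Lemma cintegrable_cont f a b : (forall z, D z -> ccont f z) -> D a -> D b ->
  cintegrable f a b.
Proof. exact: is_int_exists. Qed.

Lemma tri_int_split f a b c : (forall z, D z -> ccont f z) ->
  D a -> D b -> D c ->
  tri_int f a b c = tri_int f a ((a + b) / 2) ((c + a) / 2) +
    tri_int f ((a + b) / 2) b ((b + c) / 2) +
    tri_int f ((b + c) / 2) c ((c + a) / 2) +
    tri_int f ((a + b) / 2) ((b + c) / 2) ((c + a) / 2).
Proof.
move=> fc Da Db Dc'; have H x y := @cintegrable_cont f x y fc.
have Dab := Dm Da Db; have Dbc := Dm Db Dc'; have Dca := Dm Dc' Da.
rewrite /tri_int (@cint_split _ f a b) ?(@cint_split _ f b c) ?(@cint_split _ f c a);
  try by apply: H.
rewrite (@cint_anti _ f ((c + a) / 2) ((a + b) / 2)); last exact: H.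
rewrite (@cint_anti _ f ((a + b) / 2) ((b + c) / 2)); last exact: H.
rewrite (@cint_anti _ f ((b + c) / 2) ((c + a) / 2)); last exact: H.
ring.
Qed.

(** The bound [e * L^2] in the perimeter [L] is stable under subdivision, since four triangles of
    perimeter [L/2] contribute [4 (L/2)^2]. Locally it holds because subtracting the affine
    approximation of [f] does not change the integral over a closed path. *)
Lemma goursat f a b c : (forall z, D z -> exists l, cderiv f z l) ->
  D a -> D b -> D c -> tri_int f a b c = 0.
Proof.
move=> fd Da Db Dc'.
have fc z : D z -> ccont f z by move=> /fd[l /cderiv_cont].
have H x y := @cintegrable_cont f x y fc.
pose L x y t := cnorm (y - x) + cnorm (t - y) + cnorm (x - t) : R.
suff hP e : 0 < e -> cnorm (tri_int f a b c) <= e * L a b c ^+ 2.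
  apply/eqP; rewrite -cnorm_eq0 eq_le cnorm_ge0 andbT.
  apply/ler_addgt0Pl => e e0; rewrite addr0.
  have L1 : 0 < L a b c ^+ 2 + 1 by have := sqr_ge0 (L a b c); lra.
  apply: le_trans (hP _ (divr_gt0 e0 L1)) _.
  rewrite mulrAC ler_pdivrMr // ler_wpM2l ?ltW //; lra.
move=> e0.
apply: (@triangle_bisection _ D
  (fun x y t => cnorm (tri_int f x y t) <= e * L x y t ^+ 2)) => //.
- move=> {Da Db Dc'} x y t Dx Dy Dt h1 h2 h3 h4.
  rewrite (tri_int_split fc) //.
  apply: le_trans (cnormD4 _ _ _ _) _.
  have E1 : L x ((x + y) / 2) ((t + x) / 2) = L x y t / 2.
    rewrite /L; have -> : (x + y) / 2 - x = (y - x) / 2 by field.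
    have -> : (t + x) / 2 - (x + y) / 2 = (t - y) / 2 by field.
    have -> : x - (t + x) / 2 = (x - t) / 2 by field.
    by rewrite !cnorm_half; field.
  have E2 : L ((x + y) / 2) y ((y + t) / 2) = L x y t / 2.
    rewrite /L; have -> : y - (x + y) / 2 = (y - x) / 2 by field.
    have -> : (y + t) / 2 - y = (t - y) / 2 by field.
    have -> : (x + y) / 2 - (y + t) / 2 = (x - t) / 2 by field.
    by rewrite !cnorm_half; field.
  have E3 : L ((y + t) / 2) t ((t + x) / 2) = L x y t / 2.
    rewrite /L; have -> : t - (y + t) / 2 = (t - y) / 2 by field.
    have -> : (t + x) / 2 - t = (x - t) / 2 by field.
    have -> : (y + t) / 2 - (t + x) / 2 = (y - x) / 2 by field.
    by rewrite !cnorm_half; field.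
  have E4 : L ((x + y) / 2) ((y + t) / 2) ((t + x) / 2) = L x y t / 2.
    rewrite /L; have -> : (y + t) / 2 - (x + y) / 2 = - ((x - t) / 2) by field.
    have -> : (t + x) / 2 - (y + t) / 2 = - ((y - x) / 2) by field.
    have -> : (x + y) / 2 - (t + x) / 2 = - ((t - y) / 2) by field.
    by rewrite !cnormN !cnorm_half; field.
  rewrite E1 in h1; rewrite E2 in h2; rewrite E3 in h3; rewrite E4 in h4.
  have -> : e * L x y t ^+ 2 = e * (L x y t / 2) ^+ 2 + e * (L x y t / 2) ^+ 2 +
    e * (L x y t / 2) ^+ 2 + e * (L x y t / 2) ^+ 2 by field.
  by rewrite !lerD.
- move=> z Dz; have [l hl] := fd z Dz.
  have e30 : 0 < e / 3 by lra.
  have [d d0 hd] := hl _ e30.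
  (* The vertices lie within [3 L] of [z]; on the disc [D'] of that radius the affine remainder is
     at most [(e/3) * 3 L]. *)
  exists (d / 3); first lra.
  move=> x y t Dx Dy Dt s; rewrite -/(L x y t) {}/s => h1 h2.
  have n1 := cnorm_ge0 (y - x); have n2 := cnorm_ge0 (t - y).
  have n3 := cnorm_ge0 (x - t).
  pose g w := f w + (- l * w + (l * z - f z)).
  have gE w : g w = f w - f z - l * (w - z) by rewrite /g; ring.
  pose D' := [set w | cnorm (w - z) <= 3 * L x y t].
  have D'm : cmidconvex D' by apply: cmidconvex_disc.
  have gM w : D' w -> cnorm (g w) <= e * L x y t.
    rewrite /D' /= /L => hw; rewrite gE.
    apply: le_trans (hd w _) _; first by lra.
    by rewrite mulrAC -mulrA ler_pM2l // ler_pdivrMr //; lra.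
  have D'x : D' x by rewrite /D' /=; rewrite /L in h1 *; lra.
  have D'y : D' y by have := cnormDl y x z; rewrite /D' /=; rewrite /L in h1 *; lra.
  have D't : D' t.
    by have := cnormDl t x z; rewrite (cnormB t x) /D' /=; rewrite /L in h1 *; lra.
  have aff x' y' : cintegrable (fun w => - l * w + (l * z - f z)) x' y'.
    by eexists; apply: is_int_affine.
  have fg x' y' : D x' -> D y' -> cintegrable g x' y' /\
      cint g x' y' = cint f x' y' + (- l * (y' ^+ 2 - x' ^+ 2) / 2 + (l * z - f z) * (y' - x')).
    move=> Dx' Dy'; split; first by apply: cintegrableD => //; apply: H.
    rewrite /g cintD //; last exact: H.
    by rewrite (cint_eq (is_int_affine _ _ _ _)).
  have [g1 E1] := fg _ _ Dx Dy; have [g2 E2] := fg _ _ Dy Dt.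
  have [g3 E3] := fg _ _ Dt Dx.
  have -> : tri_int f x y t = tri_int g x y t.
    by rewrite /tri_int E1 E2 E3; field.
  have := cint_bound D'm gM D'x D'y g1; have := cint_bound D'm gM D'y D't g2.
  have := cint_bound D'm gM D't D'x g3 => b3 b2 b1.
  apply: le_trans (cnormD3 _ _ _) _.
  have -> : e * L x y t ^+ 2 = e * L x y t * cnorm (y - x) +
    e * L x y t * cnorm (t - y) + e * L x y t * cnorm (x - t).
    by rewrite /L; ring.
  by rewrite !lerD.
Qed.

End Convex.

(* Shrinking the triangle towards w: the discarded triangles stay in a half
   plane avoiding w. *)
Lemma goursat_vertex D g w a b u : cmidconvex D -> ccclosed D -> ccont g w ->
  (forall z, D z -> z != w -> exists l, cderiv g z l) ->
  D w -> D a -> D b -> 0 < cRe (u * (a - w)) -> 0 < cRe (u * (b - w)) ->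
  tri_int g w a b = 0.
Proof.
move=> Dm Dc gw gd Dw.
have gc z : D z -> ccont g z.
  by move=> Dz; have [->//|/(gd _ Dz)[l /cderiv_cont]] := eqVneq z w.
have H x y := @cintegrable_cont D Dm Dc g x y gc.
have step x y : D x -> D y -> 0 < cRe (u * (x - w)) -> 0 < cRe (u * (y - w)) ->
    tri_int g w x y = tri_int g w ((w + x) / 2) ((w + y) / 2).
  move=> Dx Dy ux uy; rewrite (tri_int_split Dm Dc gc) //.
  have [s s0 [sx sy]] : exists2 s, 0 < s & s <= cRe (u * (x - w)) / 2 /\
      s <= cRe (u * (y - w)) / 2.
    exists (Num.min (cRe (u * (x - w)) / 2) (cRe (u * (y - w)) / 2)).
      by rewrite lt_min; apply/andP; split; lra.
    by rewrite !ge_min !lexx orbT.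
  pose D' := D `&` half_plane u w s.
  have D'm : cmidconvex D' by apply: cmidconvexI => //; apply: cmidconvex_half_plane.
  have D'c : ccclosed D' by apply: ccclosedI => //; apply: ccclosed_half_plane.
  have D'd z : D' z -> exists l, cderiv g z l.
    move=> [Dz hz]; apply: gd => //; apply: contraTneq hz => ->.
    by rewrite /half_plane /= subrr mulr0 /= -ltNge.
  have D'x : D' x by split=> //; rewrite /half_plane /=; lra.
  have D'y : D' y by split=> //; rewrite /half_plane /=; lra.
  have D'wx : D' ((w + x) / 2).
    split; first exact: Dm.
    rewrite /half_plane /=; have -> : u * ((w + x) / 2 - w) = u * (x - w) / 2 by field.
    by rewrite cRe_half.
  have D'wy : D' ((y + w) / 2).
    split; first exact: Dm.
    rewrite /half_plane /=; have -> : u * ((y + w) / 2 - w) = u * (y - w) / 2 by field.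
    by rewrite cRe_half.
  have D'xy : D' ((x + y) / 2) by apply: D'm.
  have Z p q o : D' p -> D' q -> D' o -> tri_int g p q o = 0.
    move=> hp hq ho.
    exact: (@goursat _ D'm D'c g p q o D'd).
  by rewrite [X in _ + X + _ + _]Z // [X in _ + X + _]Z // [X in _ + X]Z // !addr0 [y + w]addrC.
move=> Da Db ua ub.
have iter n : exists x y, [/\ D x, D y, 0 < cRe (u * (x - w)), 0 < cRe (u * (y - w)) &
   [/\ cnorm (x - w) = cnorm (a - w) / 2 ^+ n, cnorm (y - w) = cnorm (b - w) / 2 ^+ n &
       tri_int g w a b = tri_int g w x y]].
  elim: n => [|n [x [y [Dx Dy ux uy [nx ny ->]]]]].
    by exists a, b; split=> //; rewrite !expr0 !divr1.
  have E t : (w + t) / 2 - w = (t - w) / 2 by field.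
  have E' t : u * ((t - w) / 2) = u * (t - w) / 2 by rewrite mulrA.
  exists ((w + x) / 2), ((w + y) / 2); rewrite !E !E' !cRe_half !cnorm_half nx ny.
  split; [exact: Dm | exact: Dm | lra | lra | split]; last exact: step.
  - by rewrite exprSr invfM mulrA.
  - by rewrite exprSr invfM mulrA.
apply/eqP; rewrite -cnorm_eq0 eq_le cnorm_ge0 andbT.
apply/ler_addgt0Pl => e e0; rewrite addr0.
have [d d0 hd] := gw 1 ltr01.
have K0 : 0 < cnorm (g w) + 1 by have := cnorm_ge0 (g w); lra.
pose s := Num.min d (e / (4 * (cnorm (g w) + 1))).
have s0 : 0 < s by rewrite lt_min d0 divr_gt0 //; lra.
have na := cnorm_ge0 (a - w); have nb := cnorm_ge0 (b - w).
have [n hn] := pow2_lt s0 (cnorm (a - w) + cnorm (b - w)).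
have [x [y [Dx Dy _ _ [nx ny ->]]]] := iter n.
rewrite mulrDl -nx -ny in hn.
have mx := cnorm_ge0 (x - w); have my := cnorm_ge0 (y - w).
have [hn1 hn2] : cnorm (x - w) + cnorm (y - w) < d /\
    4 * (cnorm (g w) + 1) * (cnorm (x - w) + cnorm (y - w)) <= e.
  move: hn; rewrite lt_min => /andP[-> /ltW]; split=> //.
  by rewrite mulrC -ler_pdivlMr //; lra.
have hb p q : D p -> D q -> cnorm (p - w) < d -> cnorm (q - w) < d ->
    cnorm (cint g p q) <= (cnorm (g w) + 1) * cnorm (q - p).
  move=> Dp Dq pd qd; apply: (@cint_bound _ (cball w d)) => //.
  - exact: cmidconvex_cball.
  - by move=> z /hd; have := cnorm_le_D (g z) (g w); lra.
  - exact: H.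
have ww : cnorm (w - w) < d by rewrite subrr cnorm0.
have xd : cnorm (x - w) < d by lra.
have yd : cnorm (y - w) < d by lra.
apply: le_trans (cnormD3 _ _ _) _.
have := hb _ _ Dw Dx ww xd; have := hb _ _ Dx Dy xd yd; have := hb _ _ Dy Dw yd ww.
have := cnormDl y w x; rewrite (cnormB w x) (cnormB w y).
set K := cnorm (g w) + 1 in K0 hn2 *; set p := cnorm (x - w) in mx hn2 *.
set q := cnorm (y - w) in my hn2 *; set t := cnorm (y - x) => ht.
have := ler_wpM2l (ltW K0) ht; lra.
Qed.
End Cauchy.

(** * Primitives, and the integral of [1/z] along one side of a square *)

Section Taylor.
Variable R : realType.
Local Notation C := R[i].
Implicit Types (z w a b c v : C) (D : set C) (f g G : C -> C) (e r M : R).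

Lemma cint_local f z e : ccont f z -> 0 < e -> exists2 d, 0 < d &
  forall a b, cintegrable f a b -> cnorm (a - z) <= 2 * cnorm (b - a) ->
    cnorm (b - a) < d ->
    cnorm (cint f a b - f z * (b - a)) <= e * cnorm (b - a).
Proof.
move=> fz e0; have [d d0 hd] := msum_local fz e0; exists d => // a b /cintP fi h1 h2.
apply: (@ctendsto_bound _ (fun n => msum f n a b - f z * (b - a))) => [|n]; last exact: hd.
apply: ctendstoD => //; exact: ctendsto_cst.
Qed.

(** Bisection once more, with an error proportional to the length, so that it is additive under
    gluing. *)
Lemma cint_deriv D G g a b : cmidconvex D -> ccclosed D ->
  (forall z, D z -> cderiv G z (g z)) -> (forall z, D z -> ccont g z) ->
  D a -> D b -> cint g a b = G b - G a.
Proof.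
move=> Dm Dc Gg gc Da Db.
have H x y := @cintegrable_cont _ D Dm Dc g x y gc.
suff hP e : 0 < e -> cnorm (cint g a b - (G b - G a)) <= e * cnorm (b - a).
  apply/eqP; rewrite -subr_eq0 -cnorm_eq0 eq_le cnorm_ge0 andbT.
  apply/ler_addgt0Pl => e e0; rewrite addr0.
  have n1 : 0 < cnorm (b - a) + 1 by have := cnorm_ge0 (b - a); lra.
  apply: le_trans (hP _ (divr_gt0 e0 n1)) _.
  rewrite mulrAC ler_pdivrMr // ler_wpM2l ?ltW //; lra.
move=> e0; apply: (@segment_bisection _ D
  (fun x y => cnorm (cint g x y - (G y - G x)) <= e * cnorm (y - x))) => //.
- move=> {Da Db} {}a {}b Da Db h1 h2; have Dab := Dm _ _ Da Db.
  rewrite cint_split; [|exact: H|exact: H].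
  set m := (a + b) / 2 in h1 h2 Dab *.
  have -> : cint g a m + cint g m b - (G b - G a) =
    (cint g a m - (G m - G a)) + (cint g m b - (G b - G m)) by ring.
  apply: le_trans (cnormD _ _) _; move: h1 h2.
  by rewrite /m midBl midBr cnorm_half; lra.
- move=> z Dz; have e10 : 0 < e / 10 by lra.
  have [d1 d10 h1] := Gg z Dz _ e10; have [d2 d20 h2] := cint_local (gc z Dz) e10.
  exists (Num.min (d1 / 3) d2); first by rewrite lt_min d20 andbT; lra.
  move=> x y Dx Dy xz; rewrite lt_min => /andP[xy1 xy2].
  have yz := cnormDl y x z.
  have {}h2 := h2 x y (H _ _ Dx Dy) xz xy2.
  have hx := h1 x ltac:(lra); have hy := h1 y ltac:(lra).
  have -> : cint g x y - (G y - G x) = (cint g x y - g z * (y - x)) -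
    (G y - G z - g z * (y - z)) + (G x - G z - g z * (x - z)) by ring.
  apply: le_trans (cnormD3 _ _ _) _; rewrite (cnormN (G y - G z - g z * (y - z))).
  have := ler_wpM2l (ltW e0) xz; have := ler_wpM2l (ltW e0) yz.
  have := mulr_ge0 (ltW e0) (cnorm_ge0 (y - x)); lra.
Qed.

Lemma cnorm_sqr z : cnorm z ^+ 2 = cRe z ^+ 2 + cIm z ^+ 2.
Proof. by case: z => x y /=; rewrite sqr_sqrtr // addr_ge0 // sqr_ge0. Qed.

Lemma cnormi : cnorm ('i%C : C) = 1.
Proof. by rewrite /= expr0n expr1n add0r sqrtr1. Qed.

Lemma cnorm_1Bi : cnorm (1 - 'i%C : C) <= 2.
Proof. by apply: le_trans (cnormD _ _) _; rewrite cnormN cnormi cnorm1; lra. Qed.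

(* The integration path is the square with vertices the 'i ^+ k * v. *)
Definition edge v : set C :=
  [set z | cnorm (z - 0) <= cnorm v] `&` half_plane ((1 - 'i%C) / v) 0 1.

Lemma edge_midconvex v : cmidconvex (edge v).
Proof. by apply: cmidconvexI; [apply: cmidconvex_disc|apply: cmidconvex_half_plane]. Qed.

Lemma edge_closed v : ccclosed (edge v).
Proof. by apply: ccclosedI; [apply: ccclosed_disc|apply: ccclosed_half_plane]. Qed.

Lemma edgel v : v != 0 -> edge v v.
Proof.
by move=> v0; split; rewrite ?/half_plane /= subr0 // divfK //= oppr0 addr0.
Qed.

Lemma edger v : v != 0 -> edge v ('i%C * v).
Proof.
move=> v0; split; rewrite ?/half_plane /= subr0; first by rewrite cnormM cnormi mul1r.
rewrite mulrCA divfK //=; lra.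
Qed.

Lemma edge_ge v z : v != 0 -> edge v z -> cnorm v <= 2 * cnorm z.
Proof.
move=> v0 [_]; rewrite /half_plane /= subr0 => h.
have nv : 0 < cnorm v by rewrite cnorm_gt0.
have := le_trans h (le_trans (ler_norm _) (cnorm_Re _)).
rewrite !cnormM cnormV mulrAC ler_pdivlMr // mul1r => /le_trans; apply.
by rewrite ler_wpM2r ?cnorm_ge0 ?cnorm_1Bi.
Qed.

Lemma edge_neq0 v z : v != 0 -> edge v z -> z != 0.
Proof.
move=> v0 /(edge_ge v0); rewrite -!cnorm_gt0 in v0 *; lra.
Qed.

(** A crude estimate of [i pi / 2], sufficient for four edges to add up to something nonzero: [1/z]
    is compared with the constant [- c], its value at the midpoint of the edge, whose integral is
    [2 i]. *)
Lemma edge_inv v : v != 0 ->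
  cnorm (cint (fun z => z^-1) v ('i%C * v) - 2 * 'i%C) <= 3 / 2.
Proof.
move=> v0; have nv : 0 < cnorm v by rewrite cnorm_gt0.
have i10 : ('i%C - 1 : C) != 0.
  by rewrite eq_complex /= negb_and; apply/orP; left; apply/eqP; lra.
have ci : cintegrable (fun z => z^-1) v ('i%C * v).
  apply: (@cintegrable_cont _ (edge v)); rewrite //; try exact: edgel; try exact: edger.
  - exact: edge_midconvex.
  - exact: edge_closed.
  - by move=> z /(edge_neq0 v0) /cderiv_inv/cderiv_cont.
pose c : C := - (2 * 'i%C / (('i%C - 1) * v)).
have ca : is_int (fun z => 0 * z + c) v ('i%C * v) (- (2 * 'i%C)).
  have := is_int_affine 0 c v ('i%C * v); congr is_int.
  by rewrite /c; field; rewrite ?i10 ?v0.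
have -> : cint (fun z => z^-1) v ('i%C * v) - 2 * 'i%C =
    cint (fun z => z^-1 + (0 * z + c)) v ('i%C * v).
  by rewrite cintD ?(cint_eq ca) //; eexists; exact: ca.
have ndE : 'i%C * v - v = ('i%C - 1) * v by ring.
have nd : 0 < cnorm ('i%C * v - v).
  by rewrite ndE cnorm_gt0 mulf_neq0.
apply: le_trans (@cint_bound _ (edge v) _ (3 / 2 / cnorm ('i%C * v - v)) _ _ _ _ _ _ _) _.
- exact: edge_midconvex.
- move=> z zv; have z0 := edge_neq0 v0 zv.
  pose y := z / v.
  have zE : z = y * v by rewrite /y divfK.
  have y0 : y != 0 by rewrite /y mulf_neq0 ?invr_eq0.
  have -> : z^-1 + (0 * z + c) = (('i%C - 1) - 2 * 'i%C * y) / (y * (('i%C - 1) * v)).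
    by rewrite /c zE; field; rewrite ?y0 ?v0 ?i10.
  rewrite ndE [cnorm (_ / _)]cnormM cnormV (cnormM y) invfM mulrA.
  rewrite ler_pM2r ?invr_gt0; last by rewrite cnorm_gt0 mulf_neq0.
  rewrite ler_pdivrMr ?cnorm_gt0 //.
  have ge0 : 0 <= 3 / 2 * cnorm y by rewrite mulr_ge0 ?cnorm_ge0 //; lra.
  rewrite -(ler_pXn2r (_ : 0 < 2)%N) ?nnegrE ?cnorm_ge0 //.
  rewrite exprMn !cnorm_sqr.
  have := edge_ge v0 zv; move: zv => [/=]; rewrite subr0 /half_plane /= subr0.
  rewrite mulrAC -mulrA -/y zE cnormM -[leRHS]mul1r ler_pM2r // => y1 y2 _.
  have := cnorm_sqr y; have := cnorm_ge0 y; move: y1 y2 {zE y0 ge0}.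
  move: (cnorm y); case: y => s t n /= n1 h n0 hn.
  nra.
- exact: edgel.
- exact: edger.
- by apply: cintegrableD => //; eexists; exact: ca.
- by rewrite divfK // gt_eqF.
Qed.
End Taylor.

(** * Cauchy's formula and Taylor expansions *)

Section Taylor2.
Variable R : realType.
Local Notation C := R[i].
Implicit Types (z w a b c v : C) (D : set C) (f g G : C -> C) (e r M : R).

Lemma inv_le_div (V Z c : R) : 0 < V -> 0 < c -> V <= c * Z -> Z^-1 <= c / V.
Proof.
move=> V0 c0 h; have Z0 : 0 < Z by rewrite -(pmulr_rgt0 _ c0); apply: lt_le_trans h.
by rewrite ler_pdivlMr // mulrC ler_pdivrMr.
Qed.

Definition vertex v k : C := 'i%C ^+ k * v.
Definition contour v : set C := [set z | exists k, edge (vertex v k) z].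
Definition oint f v : C := \sum_(k < 4) cint f (vertex v k) (vertex v k.+1).

Lemma cnorm_vertex v k : cnorm (vertex v k) = cnorm v.
Proof. by rewrite /vertex cnormM cnormX cnormi expr1n mul1r. Qed.

Lemma vertex_neq0 v k : v != 0 -> vertex v k != 0.
Proof. by rewrite -!cnorm_gt0 cnorm_vertex. Qed.

Lemma vertexS v k : vertex v k.+1 = 'i%C * vertex v k.
Proof. by rewrite /vertex exprS mulrA. Qed.

Lemma vertex4 v : vertex v 4 = vertex v 0.
Proof.
rewrite /vertex; have -> : 'i%C ^+ 4 = 1 :> C by rewrite (exprM _ 2 2) sqr_i sqrrN expr1n.
by rewrite expr0.
Qed.

Lemma contour_le v z : contour v z -> cnorm z <= cnorm v.
Proof. by move=> [k [/=]]; rewrite subr0 cnorm_vertex. Qed.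

Lemma contour_ge v z : v != 0 -> contour v z -> cnorm v <= 2 * cnorm z.
Proof. by move=> v0 [k /(edge_ge (vertex_neq0 k v0))]; rewrite cnorm_vertex. Qed.

Lemma contour_neq0 v z : v != 0 -> contour v z -> z != 0.
Proof. by move=> v0 [k /(edge_neq0 (vertex_neq0 k v0))]. Qed.

Section Contour.
Variable v : C.
Hypothesis v0 : v != 0.

Definition pcont f := forall z, contour v z -> ccont f z.

Lemma edge_cintegrable f k : pcont f -> cintegrable f (vertex v k) (vertex v k.+1).
Proof.
move=> fc; have vk := vertex_neq0 k v0.
apply: (@cintegrable_cont _ (edge (vertex v k))).
- exact: edge_midconvex.
- exact: edge_closed.
- by move=> z hz; apply: fc; exists k.
- exact: edgel.
- by rewrite vertexS; apply: edger.
Qed.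

Lemma ointD f g : pcont f -> pcont g ->
  oint (fun z => f z + g z) v = oint f v + oint g v.
Proof.
move=> fc gc; rewrite -big_split /=; apply: eq_bigr => k _.
by rewrite cintD //; apply: edge_cintegrable.
Qed.

Lemma ointZ c f : pcont f -> oint (fun z => c * f z) v = c * oint f v.
Proof.
move=> fc; rewrite mulr_sumr; apply: eq_bigr => k _.
by rewrite cintZ //; apply: edge_cintegrable.
Qed.

Lemma oint_sum (I : Type) (s : seq I) (F : I -> C -> C) :
  (forall i, pcont (F i)) ->
  oint (fun z => \sum_(i <- s) F i z) v = \sum_(i <- s) oint (F i) v.
Proof.
move=> h; rewrite exchange_big; apply: eq_bigr => k _ /=.
by apply: (cintegrable_sum s (F := F) _).2 => i; apply: edge_cintegrable.
Qed.

Lemma eq_oint f g : (forall z, contour v z -> f z = g z) -> oint f v = oint g v.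
Proof.
move=> fg; apply: eq_bigr => k _; have vk := vertex_neq0 k v0.
apply: (@eq_cint _ (edge (vertex v k))); first exact: edge_midconvex.
- by move=> z hz; apply: fg; exists k.
- exact: edgel.
- by rewrite vertexS; apply: edger.
Qed.

Lemma oint_bound f M : pcont f -> (forall z, contour v z -> cnorm (f z) <= M) ->
  cnorm (oint f v) <= 8 * cnorm v * M.
Proof.
move=> fc fM; apply: le_trans (cnorm_sum _ _ _) _.
have M0 : 0 <= M.
  apply: le_trans (cnorm_ge0 _) (fM (vertex v 0) _).
  by exists 0%N; apply/edgel/vertex_neq0.
apply: (@le_trans _ _ (\sum_(k < 4) 2 * cnorm v * M)).
  apply: ler_sum => k _; have vk := vertex_neq0 k v0.
  apply: le_trans (@cint_bound _ (edge (vertex v k)) f M _ _ _ _ _ _ _) _.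
  - exact: edge_midconvex.
  - by move=> z hz; apply: fM; exists k.
  - exact: edgel.
  - by rewrite vertexS; apply: edger.
  - exact: edge_cintegrable.
  - rewrite mulrC ler_wpM2r //; apply: le_trans (cnormD _ _) _.
    by rewrite cnormN !cnorm_vertex; lra.
by rewrite sumr_const card_ord -mulr_natl; lra.
Qed.

Lemma pcontM f g : pcont f -> pcont g -> pcont (fun z => f z * g z).
Proof.
move=> fc gc z vz e e0.
have nf := cnorm_ge0 (f z); have ng := cnorm_ge0 (g z).
pose K := cnorm (f z) + cnorm (g z) + 1.
have K1 : 1 <= K by rewrite /K; lra.
pose s := Num.min 1 (e / K).
have s0 : 0 < s by rewrite lt_min ltr01 divr_gt0 //; lra.
have s1 : s <= 1 by rewrite /s ge_min lexx.
have sK : s * K <= e by rewrite -ler_pdivlMr ?ge_min ?lexx ?orbT //; lra.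
have [d1 d10 h1] := fc z vz s s0; have [d2 d20 h2] := gc z vz s s0.
exists (Num.min d1 d2); first by rewrite lt_min d10.
move=> w; rewrite lt_min => /andP[/h1 {}h1 /h2 {}h2].
have -> : f w * g w - f z * g z = (f w - f z) * (g w - g z) +
  f z * (g w - g z) + g z * (f w - f z) by ring.
apply: le_trans (cnormD3 _ _ _) _; rewrite !cnormM.
have f0 := cnorm_ge0 (f w - f z); have g0 := cnorm_ge0 (g w - g z).
have b1 := ler_pM f0 g0 h1 h2; have b2 := ler_wpM2l nf h2; have b3 := ler_wpM2l ng h1.
have b4 := ler_wpM2l (ltW s0) s1; rewrite /K in sK; lra.
Qed.

Lemma pcontD f g : pcont f -> pcont g -> pcont (fun z => f z + g z).
Proof.
move=> fc gc z vz e e0; have e20 : 0 < e / 2 by lra.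
have [d1 d10 h1] := fc z vz _ e20; have [d2 d20 h2] := gc z vz _ e20.
exists (Num.min d1 d2); first by rewrite lt_min d10.
move=> w; rewrite lt_min => /andP[/h1 {}h1 /h2 {}h2].
rewrite opprD addrACA; apply: le_trans (cnormD _ _) _; lra.
Qed.

Lemma pcont_deriv f : (forall z, contour v z -> exists l, cderiv f z l) -> pcont f.
Proof. by move=> h z /h[l /cderiv_cont]. Qed.

Lemma pcont_sum N (F : 'I_N -> C -> C) : (forall i, pcont (F i)) ->
  pcont (fun z => \sum_(i < N) F i z).
Proof.
elim: N F => [|N IH] F Fc z vz.
  have : ccont (fun=> 0 : C) z by apply: cderiv_cont (cderiv_cst 0 z).
  by congr ccont; apply/funext => x; rewrite big_ord0.
have := pcontD (IH (fun i => F (widen_ord (leqnSn N) i)) (fun i => Fc _)) (Fc ord_max) vz.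
by congr ccont; apply/funext => x; rewrite big_ord_recr.
Qed.

Lemma cderiv_invX n z : z != 0 -> cderiv (fun w => w ^- n) z (- n%:R * z ^- n.+1).
Proof.
move=> z0; have := cderivX n (cderiv_inv z0).
have -> : (fun w : C => w^-1 ^+ n) = (fun w => w ^- n).
  by apply/funext => w; rewrite exprVn.
case: n => [|n] /=; first by rewrite oppr0 !mul0r.
by congr cderiv; rewrite exprVn mulrN mulNr -mulrA -invfM -exprD addn2.
Qed.

Lemma pcont_invX n : pcont (fun z => z ^- n).
Proof.
apply: pcont_deriv => z /(contour_neq0 v0) z0.
by exists (- n%:R * z ^- n.+1); exact: cderiv_invX.
Qed.

(** The integrand has the primitive [- z ^- n.+1 / n.+1] and the contour is closed. *)
Lemma oint_invX n : oint (fun z => z ^- n.+2) v = 0.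
Proof.
have n1 : n.+1%:R != 0 :> C by rewrite pnatr_eq0.
pose G z : C := - n.+1%:R^-1 * z ^- n.+1.
rewrite /oint (eq_bigr (fun k : 'I_4 => G (vertex v k.+1) - G (vertex v k))); last first.
  move=> k _; have vk := vertex_neq0 k v0.
  apply: (@cint_deriv _ (edge (vertex v k))).
  - exact: edge_midconvex.
  - exact: edge_closed.
  - move=> z /(edge_neq0 vk) z0.
    have := cderivM (cderiv_cst (- n.+1%:R^-1) z) (cderiv_invX n.+1 z0).
    by congr cderiv; rewrite mul0r add0r mulrA mulrNN mulVf ?mul1r.
  - by move=> z hz; apply: (@pcont_invX n.+2); exists k.
  - exact: edgel.
  - by rewrite vertexS; apply: edger.
rewrite -(big_mkord xpredT (fun k => G (vertex v k.+1) - G (vertex v k))).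
by rewrite telescope_sumr // vertex4 subrr.
Qed.

(** Four edges, each within [3/2] of [2 i], give a value within 6 of [8 i]. This lower bound is all
    that is used about [2 pi i]. *)
Lemma oint_inv_ge : 2 <= cnorm (oint (fun z => z^-1) v).
Proof.
pose c : C := 2 * 'i%C.
have : cnorm (oint (fun z => z^-1) v - 4%:R * c) <= 6.
  have -> : oint (fun z => z^-1) v - 4%:R * c =
      \sum_(k < 4) (cint (fun z => z^-1) (vertex v k) (vertex v k.+1) - c).
    by rewrite sumrB sumr_const card_ord mulr_natl.
  apply: le_trans (cnorm_sum _ _ _) _.
  apply: (@le_trans _ _ (\sum_(k < 4) 3 / 2)).
    by apply: ler_sum => k _; rewrite vertexS; apply/edge_inv/vertex_neq0.
  by rewrite sumr_const card_ord -mulr_natl; lra.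
have := cnorm_le_D (4%:R * c) (oint (fun z => z^-1) v); rewrite cnormB.
by rewrite /c 2!cnormM !cnorm_nat cnormi; lra.
Qed.

Lemma contour_far w z : cnorm w <= cnorm v / 4 -> contour v z ->
  cnorm v / 4 <= cnorm (z - w).
Proof.
move=> wv /(contour_ge v0) h; have := cnorm_le_D z w; lra.
Qed.

Lemma contour_neq w z : cnorm w <= cnorm v / 4 -> contour v z -> z - w != 0.
Proof.
move=> wv /(contour_far wv); have : 0 < cnorm v by rewrite cnorm_gt0.
by rewrite -cnorm_gt0; lra.
Qed.

Lemma cderiv_invB w z : z - w != 0 ->
  cderiv (fun x => (x - w)^-1) z (- (z - w) ^- 2).
Proof.
move=> zw; have := cderiv_comp (cderivB (cderiv_id z) (cderiv_cst w z)) (cderiv_inv zw).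
by rewrite subr0 mulr1.
Qed.

Lemma pcont_invB w : cnorm w <= cnorm v / 4 -> pcont (fun z => (z - w)^-1).
Proof.
move=> wv; apply: pcont_deriv => z /(contour_neq wv) zw.
by exists (- (z - w) ^- 2); apply: cderiv_invB.
Qed.

Lemma geometric_inv w z N : z != 0 -> z - w != 0 ->
  (z - w)^-1 = \sum_(n < N) w ^+ n * z ^- n.+1 + w ^+ N * (z ^- N * (z - w)^-1).
Proof.
move=> z0 zw; elim: N => [|N IH]; first by rewrite big_ord0 add0r !expr0 invr1 !mul1r.
rewrite {1}IH big_ord_recr /= -addrA; congr (_ + _).
by rewrite !exprS; field; rewrite z0 zw expf_neq0.
Qed.

(** On the contour [|z| >= |v|/2] and [|z - w| >= |v|/4], so the remainder of the geometric series
    contributes at most [8 |v| * M * (2/|v|)^N * (4/|v|) * |w|^N]. *)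
Lemma oint_geometric f w N M : cnorm w <= cnorm v / 4 -> pcont f ->
  (forall z, contour v z -> cnorm (f z) <= M) ->
  cnorm (oint (fun z => f z * (z - w)^-1) v -
     \sum_(n < N) oint (fun z => f z * z ^- n.+1) v * w ^+ n) <=
  32 * M * (2 * cnorm w / cnorm v) ^+ N.
Proof.
move=> wv fc fM; have nv : 0 < cnorm v by rewrite cnorm_gt0.
pose r z := f z * (z ^- N * (z - w)^-1).
have rc : pcont r.
  by apply: pcontM => //; apply: pcontM; [exact: pcont_invX|exact: pcont_invB].
have fzc n : pcont (fun z => w ^+ n * (f z * z ^- n.+1)).
  apply: pcontM; first by apply: pcont_deriv => z _; exists 0; exact: cderiv_cst.
  by apply: pcontM => //; exact: pcont_invX.
have -> : oint (fun z => f z * (z - w)^-1) v =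
   \sum_(n < N) oint (fun z => f z * z ^- n.+1) v * w ^+ n + w ^+ N * oint r v.
  rewrite (_ : w ^+ N * oint r v = oint (fun z => w ^+ N * r z) v); last by rewrite ointZ.
  rewrite (eq_bigr (fun n : 'I_N => oint (fun z => w ^+ n * (f z * z ^- n.+1)) v)); last first.
    by move=> n _; rewrite mulrC ointZ //; apply: pcontM => //; exact: pcont_invX.
  rewrite -oint_sum; last by move=> n; exact: fzc.
  rewrite -ointD.
  - apply: eq_oint => z vz.
    rewrite (geometric_inv N (contour_neq0 v0 vz) (contour_neq wv vz)).
    rewrite mulrDr mulr_sumr; congr (_ + _); last by rewrite /r mulrCA.
    by apply: eq_bigr => n _; rewrite mulrCA.
  - exact: (@pcont_sum N (fun n => _)).
  - apply: pcontM => // z _; exact: cderiv_cont (cderiv_cst _ z).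
rewrite addrAC subrr add0r cnormM cnormX.
have rM z : contour v z -> cnorm (r z) <= M * ((2 / cnorm v) ^+ N * (4 / cnorm v)).
  move=> vz; have M0 := le_trans (cnorm_ge0 _) (fM z vz).
  rewrite !cnormM !cnormV cnormX -exprVn ler_pM ?cnorm_ge0 ?fM //.
    by rewrite mulr_ge0 ?exprn_ge0 ?invr_ge0 ?cnorm_ge0.
  have z0 := contour_ge v0 vz; have zw := contour_far wv vz.
  rewrite ler_pM ?exprn_ge0 ?invr_ge0 ?cnorm_ge0 //.
  - by apply: lerXn2r; rewrite ?nnegrE ?invr_ge0 ?divr_ge0 ?cnorm_ge0 ?inv_le_div.
  - by apply: inv_le_div => //; lra.
have -> : 32 * M * (2 * cnorm w / cnorm v) ^+ N =
  cnorm w ^+ N * (8 * cnorm v * (M * ((2 / cnorm v) ^+ N * (4 / cnorm v)))).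
  have -> : 2 * cnorm w / cnorm v = cnorm w * (2 / cnorm v) by ring.
  by rewrite exprMn; field; rewrite gt_eqF.
by rewrite ler_wpM2l ?exprn_ge0 ?cnorm_ge0 // oint_bound.
Qed.

Lemma expr_half_lt (c e : R) : 0 < e -> 0 <= c -> exists N : nat, c * (1 / 2) ^+ N < e.
Proof. by move=> e0 c0; have [n hn] := pow2_lt e0 c; exists n; rewrite expr_div_n expr1n mul1r. Qed.

Lemma ratio_le_half w : cnorm w <= cnorm v / 4 ->
  0 <= 2 * cnorm w / cnorm v <= 1 / 2.
Proof.
move=> wv; have nv : 0 < cnorm v by rewrite cnorm_gt0.
have nw := cnorm_ge0 w.
apply/andP; split; first by rewrite divr_ge0 ?mulr_ge0 ?cnorm_ge0.
by rewrite ler_pdivrMr //; lra.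
Qed.

(** In the geometric expansion of [1/(z - w)] every term but the first has a primitive, and the
    remainder tends to 0. *)
Lemma oint_invB w : cnorm w <= cnorm v / 4 ->
  oint (fun z => (z - w)^-1) v = oint (fun z => z^-1) v.
Proof.
move=> wv; apply/eqP; rewrite -subr_eq0 -cnorm_eq0 eq_le cnorm_ge0 andbT.
apply/ler_addgt0Pl => e e0; rewrite addr0.
have [N hN] := expr_half_lt e0 (ler0n _ 32).
have c1 : pcont (fun=> 1) by move=> z _; apply: cderiv_cont (cderiv_cst 1 z).
have b1 z : contour v z -> cnorm (1 : C) <= 1 by rewrite cnorm1.
have := oint_geometric N.+1 wv c1 b1.
rewrite (eq_oint (g := fun z => (z - w)^-1)); last by move=> z _; rewrite mul1r.
rewrite big_ord_recl big1 ?addr0 => [|i _]; last first.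
  rewrite (eq_oint (g := fun z => z ^- i.+2)); last by move=> z _; rewrite mul1r.
  by rewrite oint_invX mul0r.
have -> : oint (fun z => 1 * z ^- (@ord0 N).+1) v = oint (fun z => z^-1) v.
  by apply: eq_oint => z _; rewrite mul1r expr1.
rewrite expr0 mulr1.
move=> /le_trans; apply; apply: le_trans (ltW hN); rewrite mulr1 ler_wpM2l //.
have /andP[h1 h2] := ratio_le_half wv.
apply: le_trans (_ : (1 / 2) ^+ N.+1 <= _); first by apply: lerXn2r; rewrite ?nnegrE //; lra.
by rewrite exprS ler_piMl ?exprn_ge0 //; lra.
Qed.

Lemma cauchy_formula f w : (forall z, cnorm z <= cnorm v -> exists l, cderiv f z l) ->
  cnorm w <= cnorm v / 4 ->
  oint (fun z => f z * (z - w)^-1) v = f w * oint (fun z => z^-1) v.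
Proof.
move=> fd wv; have nv : 0 < cnorm v by rewrite cnorm_gt0.
have fc : pcont f by apply: pcont_deriv => z /contour_le; apply: fd.
have [l hl] : exists l, cderiv f w l by apply: fd; lra.
(* The difference quotient, completed by the derivative at [w], is continuous at [w] and holomorphic
   elsewhere: the situation of [goursat_vertex]. *)
pose g z := if z == w then l else (f z - f w) / (z - w).
have gw : ccont g w.
  move=> e e0; have [d d0 hd] := hl e e0; exists d => // z /hd; rewrite {2}/g eqxx /g.
  case: eqVneq => [->|zw]; first by move=> _; rewrite subrr cnorm0 ltW.
  have zw' : z - w != 0 by rewrite subr_eq0.
  rewrite -{1}[f z - f w](divfK zw') -mulrBl cnormM ler_pM2r //.
  by rewrite cnorm_gt0.
have gd z : z != w -> cnorm z <= cnorm v -> exists l', cderiv g z l'.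
  move=> zw zv; have zw' : z - w != 0 by rewrite subr_eq0.
  have [l' hl'] := fd z zv; eexists.
  apply: (@cderiv_ext _ (fun x => (f x - f w) * (x - w)^-1) _ _ _ (cnorm (z - w))).
  - by rewrite cnorm_gt0.
  - move=> x; rewrite /g; case: eqVneq => [->|//]; by rewrite cnormB ltxx.
  - exact: cderivM (cderivB hl' (cderiv_cst (f w) z)) (cderiv_invB zw').
have disc_m := @cmidconvex_disc R 0 (cnorm v).
have disc_c := @ccclosed_disc R 0 (cnorm v).
(* The square is the sum of four triangles with apex [w]. The bound [|w| <= |v|/4] puts the two
   other vertices strictly on the same side of [w] in the direction given by
   [(1 - i) / vertex v k]. *)
have tri k : tri_int g w (vertex v k) (vertex v k.+1) = 0.
  have vk := vertex_neq0 k v0.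
  have small (c : C) : cnorm c <= 2 -> -(1/2) <= cRe (c * (w / vertex v k)) <= 1/2.
    move=> c2; have := cnorm_Re (c * (w / vertex v k)).
    rewrite ler_norml cnormM cnormM cnormV cnorm_vertex => h.
    suff h' : cnorm c * (cnorm w / cnorm v) <= 1 / 2 by move: h; lra.
    apply: le_trans (_ : 2 * (cnorm w / cnorm v) <= _).
      by rewrite ler_wpM2r ?divr_ge0 ?cnorm_ge0.
    by have /andP[_] := ratio_le_half wv; rewrite mulrA.
  apply: (@goursat_vertex _ [set z | cnorm (z - 0) <= cnorm v] g w _ _
     ((1 - 'i%C) / vertex v k)) => //=; rewrite ?subr0 ?cnorm_vertex //; try lra.
  - by move=> z; rewrite subr0 => zv zw; apply: gd.
  - have -> : (1 - 'i%C) / vertex v k * (vertex v k - w) =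
      (1 - 'i%C) - (1 - 'i%C) * (w / vertex v k) by field.
    rewrite cReD raddfN /=; have /andP[_] := small _ (cnorm_1Bi R).
    by rewrite /=; lra.
  - rewrite vertexS; have -> : (1 - 'i%C) / vertex v k * ('i%C * vertex v k - w) =
      (1 - 'i%C) * 'i%C - (1 - 'i%C) * (w / vertex v k) by field.
    rewrite cReD raddfN /=; have /andP[_] := small _ (cnorm_1Bi R).
    by rewrite /=; lra.
have gc z : cnorm (z - 0) <= cnorm v -> ccont g z.
  rewrite subr0 => zv; have [->//|zw] := eqVneq z w.
  by have [l' /cderiv_cont] := gd z zw zv.
have gi x y : cnorm x <= cnorm v -> cnorm y <= cnorm v -> cintegrable g x y.
  move=> xv yv; apply: (@cintegrable_cont _ _ disc_m disc_c) => //=; by rewrite subr0.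
have wv' : cnorm w <= cnorm v by lra.
have g0 : oint g v = 0.
  rewrite /oint (eq_bigr (fun k : 'I_4 => cint g w (vertex v k.+1) - cint g w (vertex v k))).
    rewrite -(big_mkord xpredT (fun k => cint g w (vertex v k.+1) - cint g w (vertex v k))).
    by rewrite telescope_sumr // vertex4 subrr.
  move=> k _; have := tri k; rewrite /tri_int (@cint_anti _ g w (vertex v k.+1)).
    by move/eqP; rewrite subr_eq0 addrC eq_sym -subr_eq => /eqP.
  by apply: gi; rewrite ?cnorm_vertex.
have gE z : contour v z -> g z = f z * (z - w)^-1 + - f w * (z - w)^-1.
  move=> vz; have := contour_neq wv vz; rewrite subr_eq0 /g => /negPf ->.
  by rewrite mulrBl mulNr.
have ic := pcont_invB wv.
move: g0; rewrite (eq_oint gE) ointD ?ointZ ?oint_invB //; last 2 first.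
- exact: pcontM.
- by apply: pcontM => // z _; exact: cderiv_cont (cderiv_cst _ z).
by move/eqP; rewrite mulNr subr_eq0 => /eqP.
Qed.

(** Cauchy's integral for the [n]-th Taylor coefficient, normalised by the integral of [1/z] in
    place of [2 pi i]. *)
Definition tcoef n f : C := (oint (fun z => z^-1) v)^-1 * oint (fun z => f z * z ^- n.+1) v.

Lemma oint_inv_neq0 : oint (fun z => z^-1) v != 0.
Proof. by rewrite -cnorm_gt0; have := oint_inv_ge; lra. Qed.

(** [oint_geometric] inserted in Cauchy's formula; the constant 32 becomes 16 on dividing by the
    integral of [1/z], of norm at least 2. *)
Lemma taylor f M N w : (forall z, cnorm z <= cnorm v -> exists l, cderiv f z l) ->
  (forall z, cnorm z <= cnorm v -> cnorm (f z) <= M) -> cnorm w <= cnorm v / 4 ->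
  cnorm (f w - \sum_(n < N) tcoef n f * w ^+ n) <=
    16 * M * (2 * cnorm w / cnorm v) ^+ N.
Proof.
move=> fd fM wv.
have fc : pcont f by apply: pcont_deriv => z /contour_le; apply: fd.
have := oint_geometric N wv fc (fun z vz => fM z (contour_le vz)).
rewrite cauchy_formula // /tcoef.
have K0 := oint_inv_neq0; have K2 := oint_inv_ge.
move: (oint (fun z => z^-1) v) K0 K2 => K K0 K2 h.
have -> : f w - \sum_(n < N) K^-1 * oint (fun z => f z * z ^- n.+1) v * w ^+ n = K^-1 *
   (f w * K - \sum_(n < N) oint (fun z => f z * z ^- n.+1) v * w ^+ n).
  rewrite mulrBr mulr_sumr [K^-1 * (f w * K)]mulrC mulfK //; congr (_ - _).
  by apply: eq_bigr => n _; rewrite mulrA.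
rewrite cnormM cnormV ler_pdivrMl ?cnorm_gt0 //; apply: le_trans h _.
rewrite mulrA ler_wpM2r ?exprn_ge0 //; first by have /andP[] := ratio_le_half wv.
have M0 : 0 <= M by apply: le_trans (cnorm_ge0 _) (fM 0 _); rewrite cnorm0 cnorm_ge0.
by rewrite mulrA ler_wpM2r //; lra.
Qed.

Lemma tcoefD n f g : pcont f -> pcont g ->
  tcoef n (fun z => f z + g z) = tcoef n f + tcoef n g.
Proof.
move=> fc gc; rewrite /tcoef -mulrDr -ointD; last 2 first.
- by apply: pcontM => //; exact: pcont_invX.
- by apply: pcontM => //; exact: pcont_invX.
by congr (_ * _); apply: eq_oint => z _; rewrite mulrDl.
Qed.

Lemma tcoefZ n c f : pcont f -> tcoef n (fun z => c * f z) = c * tcoef n f.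
Proof.
move=> fc; have fzc : pcont (fun z => f z * z ^- n.+1).
  by apply: pcontM => //; exact: pcont_invX.
rewrite /tcoef mulrCA -(ointZ c fzc).
by congr (_ * _); apply: eq_oint => z _; rewrite mulrA.
Qed.

Lemma tcoef_sum n N (F : 'I_N -> C -> C) : (forall i, pcont (F i)) ->
  tcoef n (fun z => \sum_(i < N) F i z) = \sum_(i < N) tcoef n (F i).
Proof.
move=> Fc; rewrite /tcoef -mulr_sumr -oint_sum; last first.
  by move=> i; apply: pcontM => //; exact: pcont_invX.
by congr (_ * _); apply: eq_oint => z _; rewrite mulr_suml.
Qed.

Lemma tcoef_bound n f M : pcont f -> (forall z, contour v z -> cnorm (f z) <= M) ->
  cnorm (tcoef n f) <= 8 * M * (2 / cnorm v) ^+ n.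
Proof.
move=> fc fM; have nv : 0 < cnorm v by rewrite cnorm_gt0.
have vv : contour v (vertex v 0) by exists 0%N; apply/edgel/vertex_neq0.
have M0 : 0 <= M := le_trans (cnorm_ge0 _) (fM _ vv).
rewrite cnormM cnormV ler_pdivrMl ?cnorm_gt0 ?oint_inv_neq0 //.
apply: le_trans (@oint_bound _ (M * (2 / cnorm v) ^+ n.+1) _ _) _.
- by apply: pcontM => //; exact: pcont_invX.
- move=> z vz; rewrite cnormM cnormV cnormX -exprVn ler_pM ?cnorm_ge0 ?fM //.
    by rewrite exprn_ge0 ?invr_ge0 ?cnorm_ge0.
  have z0 := contour_ge v0 vz.
  by apply: lerXn2r; rewrite ?nnegrE ?invr_ge0 ?divr_ge0 ?cnorm_ge0 ?inv_le_div.
rewrite exprS.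
have -> : 8 * cnorm v * (M * (2 / cnorm v * (2 / cnorm v) ^+ n)) =
  2 * (8 * M * (2 / cnorm v) ^+ n) by field; rewrite gt_eqF.
by rewrite ler_wpM2r ?oint_inv_ge // !mulr_ge0 ?exprn_ge0 ?divr_ge0 ?cnorm_ge0.
Qed.
End Contour.
End Taylor2.

(** * Expansions of holomorphic germs in two variables *)

Section Osgood.
Variable R : realType.
Local Notation C := R[i].
Implicit Types (x y z w a b c v : C) (f g : C -> C) (e r M : R).

Lemma cderiv_shift f z c l : cderiv f (z + c) l -> cderiv (fun w => f (w + c)) z l.
Proof.
move=> h; have := cderiv_comp (cderivD (cderiv_id z) (cderiv_cst c z)) h.
by rewrite addr0 mulr1.
Qed.

(** The Taylor estimate with a single term, whose coefficient is the value at the centre. *)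
Lemma cderiv_lipschitz f M r z0 z : 0 < r ->
  (forall w, cnorm (w - z0) <= r -> exists l, cderiv f w l) ->
  (forall w, cnorm (w - z0) <= r -> cnorm (f w) <= M) ->
  cnorm (z - z0) <= r / 4 -> cnorm (f z - f z0) <= 32 * M / r * cnorm (z - z0).
Proof.
move=> r0 fd fM hz; pose v : C := r%:C%C.
have nv : cnorm v = r by rewrite cnorm_real gtr0_norm.
have v0 : v != 0 by rewrite -cnorm_gt0 nv.
pose g w := f (w + z0).
have gd w : cnorm w <= cnorm v -> exists l, cderiv g w l.
  by rewrite nv => wr; have [|l hl] := fd (w + z0); [rewrite addrK|exists l; exact: cderiv_shift].
have gM w : cnorm w <= cnorm v -> cnorm (g w) <= M.
  by rewrite nv => wr; apply: fM; rewrite addrK.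
have n0 : cnorm (0 : C) <= cnorm v / 4 by rewrite cnorm0 nv; lra.
have g0 : tcoef v 0 g = g 0.
  have := taylor v0 1 gd gM n0; rewrite big_ord1 expr0 mulr1 cnorm0 mulr0 mul0r expr1 mulr0.
  move=> h; apply/esym/eqP; rewrite -subr_eq0 -cnorm_eq0 eq_le h; exact: cnorm_ge0.
have := taylor v0 1 gd gM (_ : cnorm (z - z0) <= cnorm v / 4).
rewrite nv big_ord1 expr0 mulr1 g0 /g add0r subrK expr1 => /(_ hz) h.
by apply: le_trans h _; rewrite le_eqVlt; apply/orP; left; apply/eqP; ring.
Qed.

Lemma cderiv_norm_le f z l K r : 0 < r -> cderiv f z l ->
  (forall w, cnorm (w - z) < r -> cnorm (f w - f z) <= K * cnorm (w - z)) ->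
  cnorm l <= K.
Proof.
move=> r0 hl hK; apply/ler_addgt0Pl => e /hl[d d0 hd].
pose s := Num.min (d / 2) (r / 2).
have [s0 sd sr] : [/\ 0 < s, s < d & s < r].
  rewrite /s; split; rewrite ?lt_min ?gt_min.
  - by apply/andP; split; lra.
  - by apply/orP; left; lra.
  - by apply/orP; right; lra.
have ns : cnorm (z + s%:C%C - z) = s by rewrite addrAC subrr add0r cnorm_real gtr0_norm.
have := hd (z + s%:C%C); have := hK (z + s%:C%C); rewrite ns => /(_ sr) h1 /(_ sd) h2.
have := cnorm_le_D (l * (z + s%:C%C - z)) (f (z + s%:C%C) - f z).
rewrite cnormM ns cnormB => h3; rewrite -(ler_pM2r s0); lra.
Qed.

(** The coefficient of [x^i] in the expansion along [x] is an integral over a variable [t]. Under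
    this integral [f t y] is replaced by its expansion in [y], whose coefficients [b l t] are only
    required to be continuous in [t]. *)
Lemma osgood (f : C -> C -> C) r M : 0 < r ->
  (forall x y, cnorm x < 2 * r -> cnorm y < 2 * r ->
     [/\ exists l, cderiv (fun t => f t y) x l, exists l, cderiv (f x) y l &
         cnorm (f x y) <= M]) ->
  exists a : nat -> nat -> C, forall N, exists K : R, forall x y,
    cnorm x <= r / 4 -> cnorm y <= r / 4 ->
    cnorm (f x y - \sum_(i < N) \sum_(l < N) a i l * x ^+ i * y ^+ l) <=
    K * (cnorm x ^+ N + cnorm y ^+ N).
Proof.
move=> r0 hf; pose v : C := r%:C%C.
have nv : cnorm v = r by rewrite cnorm_real gtr0_norm.
have v0 : v != 0 by rewrite -cnorm_gt0 nv.
have M0 : 0 <= M.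
  have c0 : cnorm (0 : C) < 2 * r by rewrite cnorm0; lra.
  by have [_ _] := hf 0 0 c0 c0; apply: le_trans; exact: cnorm_ge0.
pose b l x := tcoef v l (f x).
have fxc x : cnorm x < 2 * r -> pcont v (f x).
  move=> xr; apply: pcont_deriv => y /contour_le; rewrite nv => yr.
  by have [|_ hl _] := hf x y xr; first lra.
(* Cauchy's estimate makes [f] Lipschitz in its first variable, uniformly in the second, and [tcoef]
   is bounded by the supremum on the contour. *)
have bc l : pcont v (b l).
  move=> x0 /contour_le; rewrite nv => x0r e e0.
  pose K := 8 * (32 * M / (r / 2)) * (2 / r) ^+ l + 1.
  have K0 : 0 < K.
    have A : 0 <= 32 * M / (r / 2) by rewrite divr_ge0 ?mulr_ge0 //; lra.
    have B : 0 <= (2 / r) ^+ l by rewrite exprn_ge0 // divr_ge0 // ltW.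
    have := mulr_ge0 (mulr_ge0 (ler0n R 8) A) B; rewrite /K; lra.
  pose d := Num.min (r / 8) (e / K).
  have d0 : 0 < d by rewrite lt_min divr_gt0 // divr_gt0.
  exists d => // x; rewrite /d lt_min => /andP[xd1 xd2].
  have xr : cnorm x < 2 * r by have := cnorm_le_D x x0; lra.
  have x0r' : cnorm x0 < 2 * r by lra.
  have Nc : pcont v (fun y => -1 * f x0 y).
    by apply: pcontM; [move=> z _; exact: cderiv_cont (cderiv_cst _ z)|exact: fxc].
  rewrite /b -mulN1r -tcoefZ -?tcoefD //; [|exact: fxc|exact: fxc].
  apply: le_trans (@tcoef_bound _ _ v0 l _ (32 * M / (r / 2) * cnorm (x - x0)) _ _) _.
  - by apply: pcontD => //; exact: fxc.
  - move=> y /contour_le; rewrite nv mulN1r => yr.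
    have yr' : cnorm y < 2 * r by lra.
    apply: (@cderiv_lipschitz (fun t => f t y)); [lra | | | lra].
    + move=> w wx; have wr : cnorm w < 2 * r by have := cnorm_le_D w x0; lra.
      by have [] := hf w y wr yr'.
    + move=> w wx; have wr : cnorm w < 2 * r by have := cnorm_le_D w x0; lra.
      by have [] := hf w y wr yr'.
  rewrite nv; apply: le_trans (_ : K * cnorm (x - x0) <= _); last first.
    by rewrite mulrC -ler_pdivlMr // ltW.
  by have nxx := cnorm_ge0 (x - x0); rewrite /K; lra.
exists (fun i l => tcoef v i (b l)) => N.
exists (16 * M * (2 / r) ^+ N + 128 * M * N%:R * (2 / r) ^+ N) => x y xr yr.
have nx := cnorm_ge0 x; have ny := cnorm_ge0 y.
have xr' : cnorm x < 2 * r by lra.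
have yr' : cnorm y < 2 * r by lra.
have h1 : cnorm (f x y - \sum_(i < N) tcoef v i (fun t => f t y) * x ^+ i) <=
    16 * M * (2 * cnorm x / r) ^+ N.
  rewrite -nv; apply: (@taylor _ v v0 (fun t => f t y)); last by rewrite nv.
  - move=> z; rewrite nv => zr; have zr' : cnorm z < 2 * r by lra.
    by have [] := hf z y zr' yr'.
  - move=> z; rewrite nv => zr; have zr' : cnorm z < 2 * r by lra.
    by have [] := hf z y zr' yr'.
pose rem t := f t y + - \sum_(l < N) y ^+ l * b l t.
have cc l : pcont v (fun t => y ^+ l * b l t).
  by apply: pcontM => // z _; exact: cderiv_cont (cderiv_cst _ z).
have sc : pcont v (fun t => \sum_(l < N) y ^+ l * b l t) by apply: pcont_sum => l.
have fyc : pcont v (fun t => f t y).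
  apply: pcont_deriv => z /contour_le; rewrite nv => zr.
  have zr' : cnorm z < 2 * r by lra.
  by have [] := hf z y zr' yr'.
have nsc : pcont v (fun t => -1 * \sum_(l < N) y ^+ l * b l t).
  by apply: pcontM => // z _; exact: cderiv_cont (cderiv_cst _ z).
have remc : pcont v rem.
  by have := pcontD fyc nsc; congr pcont; apply/funext => t; rewrite mulN1r.
have remM t : contour v t -> cnorm (rem t) <= 16 * M * (2 * cnorm y / r) ^+ N.
  move=> /contour_le; rewrite nv => tr; have tr' : cnorm t < 2 * r by lra.
  rewrite /rem (eq_bigr (fun l : 'I_N => tcoef v l (f t) * y ^+ l)); last first.
    by move=> l _; rewrite mulrC.
  rewrite -nv; apply: (@taylor _ v v0 (f t)); last by rewrite nv.
  - move=> z; rewrite nv => zr; have zr' : cnorm z < 2 * r by lra.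
    by have [] := hf t z tr' zr'.
  - move=> z; rewrite nv => zr; have zr' : cnorm z < 2 * r by lra.
    by have [] := hf t z tr' zr'.
have tE i : tcoef v i (fun t => f t y) =
    \sum_(l < N) tcoef v i (b l) * y ^+ l + tcoef v i rem.
  have -> : (fun t => f t y) = (fun t => (\sum_(l < N) y ^+ l * b l t) + rem t).
    by apply/funext => t; rewrite /rem addrC subrK.
  rewrite tcoefD //; congr (_ + _).
  rewrite (@tcoef_sum _ _ v0 i N (fun l t => y ^+ l * b l t)) //.
  by apply: eq_bigr => l _; rewrite tcoefZ // mulrC.
have h2 i : cnorm (tcoef v i rem * x ^+ i) <= 128 * M * (2 * cnorm y / r) ^+ N.
  rewrite cnormM cnormX; have := tcoef_bound v0 i remc remM; rewrite nv => h.
  apply: le_trans (ler_wpM2r _ h) _; first by rewrite exprn_ge0.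
  set Y := _ ^+ N.
  have -> : 8 * (16 * M * Y) * (2 / r) ^+ i * cnorm x ^+ i =
      128 * M * Y * (2 / r * cnorm x) ^+ i by rewrite [(2 / r * cnorm x) ^+ i]exprMn; ring.
  rewrite /Y; apply: ler_piMr.
    by rewrite !mulr_ge0 ?exprn_ge0 ?divr_ge0 ?mulr_ge0 //; lra.
  apply: exprn_ile1; first by rewrite mulr_ge0 ?divr_ge0 //; lra.
  by rewrite mulrAC ler_pdivrMr //; lra.
have -> : f x y - \sum_(i < N) \sum_(l < N) tcoef v i (b l) * x ^+ i * y ^+ l =
   (f x y - \sum_(i < N) tcoef v i (fun t => f t y) * x ^+ i) +
   \sum_(i < N) tcoef v i rem * x ^+ i.
  have -> : \sum_(i < N) tcoef v i (fun t => f t y) * x ^+ i =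
      \sum_(i < N) \sum_(l < N) tcoef v i (b l) * x ^+ i * y ^+ l +
      \sum_(i < N) tcoef v i rem * x ^+ i.
    rewrite -big_split /=; apply: eq_bigr => i _.
    rewrite tE mulrDl mulr_suml; congr (_ + _).
    by apply: eq_bigr => l _; rewrite mulrAC.
  by ring.
apply: le_trans (cnormD _ _) _.
have h3 : cnorm (\sum_(i < N) tcoef v i rem * x ^+ i) <=
    128 * M * N%:R * (2 / r) ^+ N * cnorm y ^+ N.
  apply: le_trans (cnorm_sum _ _ _) _.
  apply: (@le_trans _ _ (\sum_(i < N) (128 * M * (2 * cnorm y / r) ^+ N))).
    by apply: ler_sum => i _; exact: h2.
  rewrite sumr_const card_ord -mulr_natl.
  have -> : 2 * cnorm y / r = 2 / r * cnorm y by ring.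
  by rewrite exprMn le_eqVlt; apply/orP; left; apply/eqP; ring.
have E1 : (2 * cnorm x / r) ^+ N = (2 / r) ^+ N * cnorm x ^+ N.
  by rewrite -exprMn; congr (_ ^+ _); ring.
rewrite E1 in h1.
have rN : 0 <= (2 / r) ^+ N by rewrite exprn_ge0 // divr_ge0 // ltW.
have MN := mulr_ge0 M0 rN.
have p1 := mulr_ge0 MN (exprn_ge0 N ny).
have p2 := mulr_ge0 (ler0n R N) (mulr_ge0 MN (exprn_ge0 N nx)).
lra.
Qed.
End Osgood.

(** * Germs in two variables and their order at 0 *)

Section Bridge.
Variable R : realType.
Local Notation C := R[i].
Implicit Types (z w : C2 R) (e r M : R).

Lemma near_C2P z (P : C2 R -> Prop) : (\forall w \near z, P w) <->
  exists2 d : R, 0 < d & forall w, cnorm (w.1 - z.1) < d -> cnorm (w.2 - z.2) < d -> P w.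
Proof.
split=> [/nbhs_ballP[e /= e0 h]|[d d0 h]].
  have [r r0 re] := Cgt0P e0; exists r => // w w1 w2; apply: h.
  by rewrite re; split; rewrite -ball_normE /= normcCE ltcR cnormB.
apply/nbhs_ballP; exists d%:C%C => /=; first by rewrite ltcR.
move=> w [w1 w2]; apply: h.
- by move: w1; rewrite -ball_normE /= normcCE ltcR cnormB.
- by move: w2; rewrite -ball_normE /= normcCE ltcR cnormB.
Qed.

Lemma near_C20P (P : C2 R -> Prop) : (\forall w \near (0 : C2 R), P w) <->
  exists2 d : R, 0 < d & forall w, cnorm w.1 < d -> cnorm w.2 < d -> P w.
Proof.
split=> [/near_C2P[d d0 h]|[d d0 h]].
  by exists d => // w w1 w2; apply: h; rewrite subr0.
by apply/near_C2P; exists d => // w; rewrite !subr0; apply: h.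
Qed.

Lemma differentiable1P (f : C1 R -> C1 R) (z : C1 R) :
  differentiable f z <-> exists l, cderiv f z l.
Proof.
rewrite -derivable1_diffP; split=> [h|[l /cderiv_is_derive[]//]].
by exists ('D_1 f z); apply/cderiv_is_derive/derivableP.
Qed.

Lemma cderiv_diff (f : C1 R -> C1 R) (z l : C1 R) : cderiv f z l ->
  differentiable f z /\ 'd f z 1 = l.
Proof.
move=> h; have df : differentiable f z by apply/differentiable1P; exists l.
split=> //; move/cderiv_is_derive: h => hd.
by rewrite -deriveE //; apply: derive_val.
Qed.

Definition pt (x y : C) : C2 R := (x, y).

Lemma cderiv_curve (f : C2 R -> C1 R) (g1 g2 : C -> C) t m1 m2 :
  differentiable f (pt (g1 t) (g2 t)) -> cderiv g1 t m1 -> cderiv g2 t m2 ->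
  cderiv (fun u => f (pt (g1 u) (g2 u))) t ('d f (pt (g1 t) (g2 t)) (pt m1 m2)).
Proof.
move=> df /(@cderiv_diff g1)[dg1 <-] /(@cderiv_diff g2)[dg2 <-].
pose g : C1 R -> C2 R := fun u => pt (g1 u) (g2 u).
have dg : differentiable g (t : C1 R) by apply: differentiable_pair.
have dfg : differentiable (f \o g) (t : C1 R) by apply: differentiable_comp.
have : is_derive (t : C1 R) (1 : C1 R) (f \o g) ('d f (g t) ('d g (t : C1 R) (1 : C1 R))).
  apply: DeriveDef; first by apply/derivable1_diffP.
  by rewrite deriveE // diff_comp.
by rewrite diff_pair // => /cderiv_is_derive.
Qed.

Lemma differentiable_fst z : differentiable (fst : C2 R -> C1 R) z.
Proof. by apply: linear_differentiable => x; exact: cvg_fst. Qed.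

Lemma differentiable_snd z : differentiable (snd : C2 R -> C1 R) z.
Proof. by apply: linear_differentiable => x; exact: cvg_snd. Qed.

Lemma diff_fst z v : 'd (fst : C2 R -> C1 R) z v = v.1.
Proof. by rewrite diff_lin // => x; exact: cvg_fst. Qed.

Lemma diff_snd z v : 'd (snd : C2 R -> C1 R) z v = v.2.
Proof. by rewrite diff_lin // => x; exact: cvg_snd. Qed.

Lemma differentiable_components (X : C2 R -> C2 R) z : differentiable X z <->
  differentiable (fun w => (X w).1) z /\ differentiable (fun w => (X w).2) z.
Proof.
split=> [dX|[d1 d2]].
  by split; [apply: (differentiable_comp dX (differentiable_fst _))
            |apply: (differentiable_comp dX (differentiable_snd _))].
have -> : X = (fun w => ((X w).1, (X w).2)) by apply/funext => w; case: (X w).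
exact: differentiable_pair.
Qed.

Lemma diff_components (X : C2 R -> C2 R) z v : differentiable X z ->
  'd X z v = ('d (fun w => (X w).1) z v, 'd (fun w => (X w).2) z v).
Proof.
move=> /differentiable_components[d1 d2].
have E : X = (fun w => ((X w).1, (X w).2)) by apply/funext => w; case: (X w).
by rewrite {1}E diff_pair.
Qed.

Definition n2 z : R := cnorm z.1 + cnorm z.2.

Lemma n2_ge0 z : 0 <= n2 z. Proof. by rewrite addr_ge0 ?cnorm_ge0. Qed.

Lemma n2_gt0 z : (0 < n2 z) = (z != 0).
Proof.
rewrite lt_def n2_ge0 andbT paddr_eq0 ?cnorm_ge0 // !cnorm_eq0.
by case: z => x y.
Qed.

Lemma near_n2P z (P : C2 R -> Prop) : (\forall w \near z, P w) <->
  exists2 d : R, 0 < d & forall w, n2 (w - z) < d -> P w.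
Proof.
split=> [/near_C2P[d d0 h]|[d d0 h]].
  exists d => // w; rewrite /n2 /= => wz; apply: h.
    by have := cnorm_ge0 (w.2 - z.2); lra.
  by have := cnorm_ge0 (w.1 - z.1); lra.
apply/near_C2P; exists (d / 2); first lra.
by move=> w w1 w2; apply: h; rewrite /n2 /=; lra.
Qed.

Lemma near0_n2P (P : C2 R -> Prop) : (\forall w \near (0 : C2 R), P w) <->
  exists2 d : R, 0 < d & forall w, n2 w < d -> P w.
Proof.
rewrite near_n2P; split=> -[d d0 h]; exists d => // w; last by rewrite subr0; apply: h.
by have := h w; rewrite subr0.
Qed.

Lemma continuous_bounded (f : C2 R -> C1 R) z : {for z, continuous f} ->
  \forall w \near z, cnorm (f w) <= cnorm (f z) + 1.
Proof.
move=> /cvgrPdist_le /(_ 1 ltr01) h; near=> w.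
have : `|f z - f w| <= 1 by near: w.
rewrite normcCE -(rmorph1 (real_complex R)) lecR cnormB => h1.
by have := cnorm_le_D (f w) (f z); lra.
Unshelve. all: by end_near. Qed.

Lemma holomorphic_germ_bounded (f : C2 R -> C1 R) : holomorphic_germ f ->
  exists2 r, 0 < r & exists2 M, 0 <= M & forall z, n2 z < r ->
    differentiable f z /\ cnorm (f z) <= M.
Proof.
move=> hf; have f0 := nbhs_singleton hf.
have fb := continuous_bounded (differentiable_continuous f0).
have /near0_n2P[r r0 h] : \forall z \near (0 : C2 R),
    differentiable f z /\ cnorm (f z) <= cnorm (f 0) + 1.
  by near=> z; split; near: z.
by exists r => //; exists (cnorm (f 0) + 1) => //; rewrite addr_ge0 ?cnorm_ge0.
Unshelve. all: by end_near. Qed.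

(** The origin is left out, because identities between homogeneous functions will be known only away
    from it. *)
Definition bigO (N : nat) (f : C2 R -> C) := exists2 K : R, 0 <= K &
  exists2 d : R, 0 < d & forall z, 0 < n2 z -> n2 z < d -> cnorm (f z) <= K * n2 z ^+ N.

Lemma bigOD N f g : bigO N f -> bigO N g -> bigO N (fun z => f z + g z).
Proof.
move=> [K K0 [d d0 h]] [K' K'0 [d' d'0 h']]; exists (K + K'); first exact: addr_ge0.
exists (Num.min d d'); first by rewrite lt_min d0.
move=> z z0; rewrite lt_min => /andP[/h{}h /h'{}h'].
by apply: le_trans (cnormD _ _) _; rewrite mulrDl lerD ?h ?h'.
Qed.

Lemma bigON N f : bigO N f -> bigO N (fun z => - f z).
Proof.
by move=> [K K0 [d d0 h]]; exists K => //; exists d => // z; rewrite cnormN; apply: h.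
Qed.

Lemma bigOM N N' f g : bigO N f -> bigO N' g -> bigO (N + N') (fun z => f z * g z).
Proof.
move=> [K K0 [d d0 h]] [K' K'0 [d' d'0 h']]; exists (K * K'); first exact: mulr_ge0.
exists (Num.min d d'); first by rewrite lt_min d0.
move=> z z0; rewrite lt_min => /andP[/h{}h /h'{}h'].
by rewrite cnormM exprD mulrACA ler_pM ?cnorm_ge0 ?h ?h'.
Qed.

Lemma eq_bigO N f g : germ_eq f g -> bigO N f -> bigO N g.
Proof.
move=> /near0_n2P[e e0 fg] [K K0 [d d0 h]]; exists K => //.
exists (Num.min d e); first by rewrite lt_min d0.
by move=> z z0; rewrite lt_min => /andP[/h{}h /fg <-]; apply: h.
Qed.

Lemma bigO_sum N n (F : 'I_n -> C2 R -> C) (P : pred 'I_n) :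
  (forall i, P i -> bigO N (F i)) -> bigO N (fun z => \sum_(i < n | P i) F i z).
Proof.
move=> h.
suff : forall s : seq 'I_n, bigO N (fun z => \sum_(i <- s | P i) F i z).
  by move=> /(_ (index_enum _)).
elim=> [|i s IH].
  exists 0 => //; exists 1 => // z _ _; by rewrite big_nil cnorm0 mul0r.
have [Pi|nPi] := boolP (P i); last first.
  by move: IH; congr bigO; apply/funext => z; rewrite big_cons (negPf nPi).
by have := bigOD (h i Pi) IH; congr bigO; apply/funext => z; rewrite big_cons Pi.
Qed.

Lemma bigO_le N N' f : (N' <= N)%N -> bigO N f -> bigO N' f.
Proof.
move=> NN [K K0 [d d0 h]]; exists K => //; exists (Num.min d 1).
  by rewrite lt_min d0 /=.
move=> z z0; rewrite lt_min => /andP[/(h _ z0){}h z1]; apply: le_trans h _.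
by rewrite ler_wpM2l // ler_wiXn2l // ?n2_ge0 // ltW.
Qed.

Lemma bigO0 f : holomorphic_germ (f : C2 R -> C1 R) -> bigO 0 f.
Proof.
move=> /holomorphic_germ_bounded[r r0 [M M0 h]]; exists M => //; exists r => // z _ /h[_].
by rewrite expr0 mulr1.
Qed.

(** Cauchy's estimate on the disc of radius [|z|/2] around [z] in a coordinate line, chosen by [b];
    there [f] is at most [K (2 |z|)^(N+1)]. *)
Lemma bigO_diff N f (b : bool) : holomorphic_germ (f : C2 R -> C1 R) -> bigO N.+1 f ->
  bigO N (fun z => 'd (f : C2 R -> C1 R) z (if b then pt 1 0 else pt 0 1)).
Proof.
move=> /holomorphic_germ_bounded[r r0 [M M0 hf]] [K K0 [d d0 h]].
exists (64 * K * 2 ^+ N.+1); first by rewrite !mulr_ge0 ?exprn_ge0.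
exists (Num.min r d / 2); first by rewrite divr_gt0 // lt_min r0.
move=> z z0; set s := n2 z in z0 *; rewrite ltr_pdivlMr // lt_min => /andP[sr sd].
pose g1 t := if b then z.1 + t else z.1; pose g2 t := if b then z.2 else z.2 + t.
have n2g t : n2 (pt (g1 t) (g2 t)) <= s + cnorm t /\ s <= n2 (pt (g1 t) (g2 t)) + cnorm t.
  rewrite /s /n2 /g1 /g2 /=; case: (b) => /=.
    by have := cnormD z.1 t; have := cnormDl (z.1 + t) z.1 0;
       have := cnorm_le_D z.1 (z.1 + t); rewrite opprD addrA subrr add0r cnormN; lra.
  by have := cnormD z.2 t; have := cnorm_le_D z.2 (z.2 + t);
     rewrite opprD addrA subrr add0r cnormN; lra.
have dg1 t : cderiv g1 t (if b then 1 else 0).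
  rewrite /g1; case: (b); last exact: cderiv_cst.
  by have := cderivD (cderiv_cst z.1 t) (cderiv_id t); rewrite add0r.
have dg2 t : cderiv g2 t (if b then 0 else 1).
  rewrite /g2; case: (b); first exact: cderiv_cst.
  by have := cderivD (cderiv_cst z.2 t) (cderiv_id t); rewrite add0r.
have dgt t : cnorm (t - 0) <= s / 2 -> cderiv (fun u => f (pt (g1 u) (g2 u))) t
    ('d (f : C2 R -> C1 R) (pt (g1 t) (g2 t)) (pt (if b then 1 else 0) (if b then 0 else 1))).
  rewrite subr0 => ts; apply: cderiv_curve => //; apply: (hf _ _).1.
  by have [] := n2g t; lra.
have g0 : pt (g1 0) (g2 0) = z by rewrite /g1 /g2 /pt; case: (b); rewrite addr0; case: (z).
have s20 : 0 < s / 2 by lra.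
have z0' : cnorm (0 - 0 : C) <= s / 2 by rewrite subrr cnorm0; lra.
have := cderiv_norm_le (K := 64 * K * 2 ^+ N.+1 * s ^+ N) (_ : 0 < s / 8) (dgt 0 z0').
rewrite g0.
have -> : pt (if b then 1 else 0) (if b then 0 else 1) = (if b then pt 1 0 else pt 0 1).
  by case: (b).
apply; first lra.
move=> w ws; have := @cderiv_lipschitz _ _ (K * (2 * s) ^+ N.+1) _ 0 w s20
  (fun t ts => ex_intro _ _ (dgt t ts)); rewrite g0.
have -> : 32 * (K * (2 * s) ^+ N.+1) / (s / 2) = 64 * K * 2 ^+ N.+1 * s ^+ N.
  by rewrite exprMn [s ^+ N.+1]exprS; field; rewrite gt_eqF.
apply; last by rewrite subr0 in ws *; lra.
move=> t; rewrite subr0 => ts; have [n1 n2'] := n2g t.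
apply: le_trans (h _ _ _) _; [lra|lra|].
by rewrite ler_wpM2l //; apply: lerXn2r; rewrite ?nnegrE ?n2_ge0 //; lra.
Qed.

End Bridge.

#[global] Arguments Normc.normc : simpl never.

(** * Flat germs vanish *)

Section Homogeneous.
Variable R : realType.
Local Notation C := R[i].
Implicit Types (z w : C2 R) (e r M : R) (t : C).

Lemma poly_bounded (P : {poly C}) : exists2 B, 0 <= B &
  forall t, cnorm t <= 1 -> cnorm P.[t] <= B.
Proof.
elim/poly_ind: P => [|P c [B B0 hB]].
  by exists 0 => // t _; rewrite horner0 cnorm0.
exists (B + cnorm c); first by rewrite addr_ge0 ?cnorm_ge0.
move=> t t1; rewrite hornerMXaddC; apply: le_trans (cnormD _ _) _.
by rewrite lerD2r cnormM -[leRHS]mulr1 ler_pM ?cnorm_ge0 ?hB.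
Qed.

(** Letting [t] tend to 0 kills the constant term, and dividing by [t] lowers [D]. Since [t = 0] is
    excluded, this also identifies coefficients of expansions known only off 0. *)
Lemma poly_small (P : {poly C}) D (K r : R) : 0 < r ->
  (forall t, t != 0 -> cnorm t < r -> cnorm P.[t] <= K * cnorm t ^+ D) ->
  forall n, (n < D)%N -> P`_n = 0.
Proof.
move=> r0; elim: D P => [//|D IH] P h.
have [Q [c PE]] : exists Q c, P = Q * 'X + c%:P.
  elim/poly_ind: P {h} => [|Q c _]; last by exists Q, c.
  by exists 0, 0; rewrite mul0r addr0.
have PtE t : P.[t] = Q.[t] * t + c by rewrite PE hornerMXaddC.
have [B B0 hB] := poly_bounded Q.
have K0 : 0 <= K.
  pose t : C := (r / 2)%:C%C.
  have tE : cnorm t = r / 2 by rewrite cnorm_real gtr0_norm // divr_gt0.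
  have t0 : 0 < cnorm t by rewrite tE divr_gt0.
  have := h t; rewrite -cnorm_gt0 => /(_ t0); rewrite tE => /(_ ltac:(lra)).
  move=> /(le_trans (cnorm_ge0 _)); rewrite pmulr_lge0 // exprn_gt0 //; lra.
have c0 : c = 0.
  apply/eqP; rewrite -cnorm_eq0 eq_le cnorm_ge0 andbT; apply/ler_addgt0Pl => e e0.
  rewrite addr0; pose s := Num.min (Num.min (r / 2) 1) (e / (K + B + 1)).
  have KB : 0 < K + B + 1 by lra.
  have s0 : 0 < s by rewrite !lt_min divr_gt0 //= ltr01 divr_gt0.
  have sr : s < r by rewrite !gt_min; apply/orP; left; apply/orP; left; lra.
  have s1 : s <= 1 by rewrite !ge_min lexx orbT.
  have se : s * (K + B + 1) <= e by rewrite -ler_pdivlMr // ge_min lexx orbT.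
  have sE : cnorm (s%:C%C : C) = s by rewrite cnorm_real gtr0_norm.
  have h1 := h s%:C%C; have h2 := hB s%:C%C; rewrite sE in h1 h2.
  have {}h1 := h1 _ sr; rewrite -cnorm_gt0 sE in h1.
  have {}h1 := h1 s0; have {}h2 := h2 s1.
  have -> : c = P.[s%:C%C] - Q.[s%:C%C] * s%:C%C by rewrite PtE; ring.
  apply: le_trans (cnormD _ _) _; rewrite cnormN cnormM sE.
  have : K * s ^+ D.+1 <= K * s.
    by rewrite ler_wpM2l // exprS ler_piMr ?exprn_ile1 // ltW.
  by have := ler_wpM2r (ltW s0) h2; lra.
have Q0 : forall n, (n < D)%N -> Q`_n = 0.
  apply: IH => t t0 tr; have := h t t0 tr.
  by rewrite PtE c0 addr0 cnormM exprS mulrCA mulrC ler_pM2l // cnorm_gt0.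
by move=> [|n] nD; rewrite PE c0 addr0 coefMX //= Q0.
Qed.

(** On the complex line through 0 and [z] all Taylor coefficients vanish by [poly_small], and the
    remainder tends to 0. The point [z] is reached at [t = 1]; radius 4 is the least contour allowed
    by [|w| <= |v|/4], whence [r / 5]. At 0 itself [bigO] says nothing and continuity is used. *)
Lemma holomorphic_germ_zero (f : C2 R -> C1 R) : holomorphic_germ f ->
  (forall N, bigO N f) -> germ_eq f (fun=> 0).
Proof.
move=> /holomorphic_germ_bounded[r r0 [M M0 hf]] fO.
apply/near0_n2P; exists (r / 5); first lra.
move=> z zr; have [->|z0] := eqVneq z 0.
  apply/eqP; rewrite -cnorm_eq0 eq_le cnorm_ge0 andbT; apply/ler_addgt0Pl => e e0.
  rewrite addr0; have [K K0 [d d0 h]] := fO 1%N.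
  have df : differentiable f 0.
    by apply: (hf _ _).1; rewrite /n2 /= !cnorm0 addr0.
  have /cvgrPdist_le := differentiable_continuous df.
  have e20 : 0 < (e / 2)%:C%C :> C by rewrite ltcR; lra.
  move=> /(_ _ e20) /near0_n2P[d' d'0 h'].
  pose s := Num.min (Num.min (d / 2) (d' / 2)) (e / (2 * (K + 1))).
  have K1 : 0 < 2 * (K + 1) by lra.
  have s0 : 0 < s by rewrite !lt_min !divr_gt0.
  have sd : s < d by rewrite !gt_min; apply/orP; left; apply/orP; left; lra.
  have sd' : s < d' by rewrite !gt_min; apply/orP; left; apply/orP; right; lra.
  have se : s * (2 * (K + 1)) <= e by rewrite -ler_pdivlMr // ge_min lexx orbT.
  have sE : n2 (pt s%:C%C 0) = s by rewrite /n2 /= cnorm_real cnorm0 addr0 gtr0_norm.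
  have := h (pt s%:C%C 0); have := h' (pt s%:C%C 0); rewrite sE normcCE lecR.
  move=> /(_ sd') h1 /(_ s0 sd); rewrite expr1 => h2.
  by have := cnorm_le_D (f 0) (f (pt s%:C%C 0)); nra.
have nz : 0 < n2 z by rewrite n2_gt0.
have [z1 z2] : cnorm z.1 <= n2 z /\ cnorm z.2 <= n2 z.
  by rewrite /n2; have := cnorm_ge0 z.1; have := cnorm_ge0 z.2; lra.
pose g t := f (pt (t * z.1) (t * z.2)).
have ng t : n2 (pt (t * z.1) (t * z.2)) = cnorm t * n2 z by rewrite /n2 /= !cnormM mulrDr.
pose v : C := 4%:R; have nv : cnorm v = 4 by rewrite cnorm_nat.
have v0 : v != 0 by rewrite pnatr_eq0.
have nr t : cnorm t <= cnorm v -> n2 (pt (t * z.1) (t * z.2)) < r.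
  by rewrite ng nv => t4; have := ler_wpM2r (ltW nz) t4; lra.
have gd t : cnorm t <= cnorm v -> exists l, cderiv g t l.
  move=> /nr/hf[df _]; have lin (c : C) : cderiv (fun u => u * c) t c.
    by have := cderivM (cderiv_id t) (cderiv_cst c t); rewrite mul1r mulr0 addr0.
  eexists; exact: (@cderiv_curve _ f (fun u => u * z.1) (fun u => u * z.2) t _ _
    df (lin z.1) (lin z.2)).
have gM t : cnorm t <= cnorm v -> cnorm (g t) <= M by move=> /nr/hf[].
have n1 : cnorm (1 : C) <= cnorm v / 4 by rewrite nv cnorm1; lra.
have c0 n : tcoef v n g = 0.
  have [K K0 [d d0 h]] := fO n.+1.
  pose P := \poly_(i < n.+1) tcoef v i g.
  suff : P`_n = 0 by rewrite coef_poly ltnSn.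
  apply: (@poly_small P n.+1 (K * n2 z ^+ n.+1 + 16 * M * (2 / 4) ^+ n.+1)
     (Num.min 1 (d / n2 z))) => //; first by rewrite lt_min ltr01 divr_gt0.
  move=> t t0; rewrite lt_min ltr_pdivlMr // => /andP[t1 td].
  have tv : cnorm t <= cnorm v / 4 by rewrite nv; lra.
  have := taylor v0 n.+1 gd gM tv; rewrite nv horner_poly => h1.
  have := h (pt (t * z.1) (t * z.2)); rewrite ng => /(_ _ td).
  rewrite mulr_gt0 ?cnorm_gt0 // -/(g t) => /(_ isT) h2.
  have := cnorm_le_D (\sum_(i < n.+1) tcoef v i g * t ^+ i) (g t).
  rewrite cnormB => /le_trans; apply; apply: le_trans (lerD h1 h2) _.
  have -> : (2 * cnorm t / 4) ^+ n.+1 = (2 / 4) ^+ n.+1 * cnorm t ^+ n.+1.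
    by rewrite -exprMn; congr (_ ^+ _); ring.
  rewrite [(cnorm t * n2 z) ^+ _]exprMn le_eqVlt.
  by apply/orP; left; apply/eqP; ring.
have hh N := taylor v0 N gd gM n1.
have g1 : g 1 = f z by rewrite /g !mul1r; case: (z).
apply/eqP; rewrite -g1 -cnorm_eq0 eq_le cnorm_ge0 andbT; apply/ler_addgt0Pl => e e0.
rewrite addr0; have M16 : 0 <= 16 * M by rewrite mulr_ge0.
have [N hN] := expr_half_lt e0 M16.
apply: le_trans (ltW hN); have := hh N; rewrite big1 ?subr0 => [|i _]; last by rewrite c0 mul0r.
by rewrite nv cnorm1 => /le_trans; apply; rewrite le_eqVlt; apply/orP; left; apply/eqP; congr (_ * _ ^+ _); field.
Qed.
End Homogeneous.

(** * Weighted homogeneous components *)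

Section Weighted.
Variable R : realType.
Local Notation C := R[i].
Variables p q : nat.
Implicit Types (z w : C2 R) (e r : R) (M N : nat) (t : C) (f g F : C2 R -> C1 R) (a : nat -> nat -> C).

Lemma differentiable_mul f g z : differentiable f z -> differentiable g z ->
  differentiable (fun w => f w * g w : C1 R) z.
Proof. by move=> df dg; exact: (differentiableM df dg). Qed.

Lemma differentiable_add f g z : differentiable f z -> differentiable g z ->
  differentiable (fun w => f w + g w : C1 R) z.
Proof. by move=> df dg; exact: (differentiableD df dg). Qed.

Lemma differentiable_sub f g z : differentiable f z -> differentiable g z ->
  differentiable (fun w => f w - g w : C1 R) z.
Proof. by move=> df dg; exact: (differentiableB df dg). Qed.

Lemma differentiable_const (c : C1 R) z : differentiable (fun _ : C2 R => c) z.
Proof. exact: (differentiable_cst c z). Qed.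

Lemma differentiable_exp f n z : differentiable f z ->
  differentiable (fun w => f w ^+ n : C1 R) z.
Proof.
move=> df; elim: n => [|n IH]; first exact: differentiable_const.
have := differentiable_mul df IH; congr (differentiable _ z).
by apply/funext => w; rewrite exprS.
Qed.

Lemma differentiable_bigsum (I : Type) (s : seq I) (P : pred I) (h : I -> C2 R -> C1 R) z :
  (forall i, P i -> differentiable (h i) z) ->
  differentiable (fun w => \sum_(i <- s | P i) h i w : C1 R) z.
Proof.
move=> hd; elim: s => [|i s IH].
  have := differentiable_const 0 z; congr (differentiable _ z).
  by apply/funext => w; rewrite big_nil.
have [Pi|nPi] := boolP (P i); last first.
  move: IH; congr (differentiable _ z).
  by apply/funext => w; rewrite big_cons (negPf nPi).
have := differentiable_add (hd i Pi) IH; congr (differentiable _ z).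
by apply/funext => w; rewrite big_cons Pi.
Qed.

Definition monomial a i l z : C1 R := a i l * z.1 ^+ i * z.2 ^+ l.

Lemma differentiable_monomial a i l z : differentiable (monomial a i l) z.
Proof.
apply: differentiable_mul; last exact/differentiable_exp/differentiable_snd.
apply: differentiable_mul; last exact/differentiable_exp/differentiable_fst.
exact: differentiable_const.
Qed.

Lemma bigO_monomial a i l : bigO (i + l) (monomial a i l).
Proof.
exists (cnorm (a i l)); first exact: cnorm_ge0.
exists 1 => // z _ _; rewrite /monomial 2!cnormM !cnormX exprD mulrA.
have h1 : cnorm z.1 <= n2 z by rewrite lerDl cnorm_ge0.
have h2 : cnorm z.2 <= n2 z by rewrite lerDr cnorm_ge0.
have k1 : cnorm z.1 ^+ i <= n2 z ^+ i by apply: lerXn2r; rewrite ?nnegrE ?cnorm_ge0 ?n2_ge0.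
have k2 : cnorm z.2 ^+ l <= n2 z ^+ l by apply: lerXn2r; rewrite ?nnegrE ?cnorm_ge0 ?n2_ge0.
rewrite ler_pM ?mulr_ge0 ?exprn_ge0 ?cnorm_ge0 //.
by rewrite ler_wpM2l ?cnorm_ge0.
Qed.

(** With positive weights, the bounds on [i] and [l] lose no monomial of weight [m]. *)
Definition hpart a m z : C1 R :=
  \sum_(i < m.+1) \sum_(l < m.+1 | (p * i + q * l == m)%N) monomial a i l z.

Definition dil t z : C2 R := pt (t ^+ p * z.1) (t ^+ q * z.2).

(** Integer degrees and [t != 0] make room for the negative degrees that arise from shifting weights
    and from differentiation. *)
Definition hom (m : int) F := forall t z, t != 0 -> F (dil t z) = t ^ m * F z.

Lemma hom_hpart a (m : nat) : hom m%:Z (hpart a m).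
Proof.
move=> t z t0; rewrite /hpart mulr_sumr; apply: eq_bigr => i _.
rewrite mulr_sumr; apply: eq_bigr => l /eqP ml.
have -> : t ^ m%:Z = t ^+ (p * i + q * l) by rewrite ml.
by rewrite /monomial /= !exprMn exprD -!exprM; ring.
Qed.

Lemma differentiable_hpart a m z : differentiable (hpart a m) z.
Proof.
apply: differentiable_bigsum => i _; apply: differentiable_bigsum => l _.
exact: differentiable_monomial.
Qed.

Lemma hpart_chart1 a m : exists P : {poly C}, forall t, hpart a m (pt 1 t) = P.[t].
Proof.
exists (\sum_(i < m.+1) \sum_(l < m.+1 | (p * i + q * l == m)%N) (a i l)%:P * 'X^l).
move=> t; rewrite horner_sum; apply: eq_bigr => i _.
rewrite horner_sum; apply: eq_bigr => l _.
by rewrite /monomial /= expr1n mulr1 hornerM hornerC hornerXn.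
Qed.

Lemma hpart_chart2 a m : exists P : {poly C}, forall t, hpart a m (pt t 1) = P.[t].
Proof.
exists (\sum_(i < m.+1) \sum_(l < m.+1 | (p * i + q * l == m)%N) (a i l)%:P * 'X^i).
move=> t; rewrite horner_sum; apply: eq_bigr => i _.
rewrite horner_sum; apply: eq_bigr => l _.
by rewrite /monomial /= expr1n mulr1 hornerM hornerC hornerXn.
Qed.

Hypotheses (p0 : (0 < p)%N) (q0 : (0 < q)%N).

Lemma hpart_widen a m M z : (m < M)%N ->
  hpart a m z = \sum_(i < M) \sum_(l < M | (p * i + q * l == m)%N) monomial a i l z.
Proof.
move=> mM; rewrite /hpart.
rewrite (big_ord_widen M (fun i => \sum_(l < m.+1 | (p * i + q * l == m)%N)
   monomial a i l z)) // big_mkcond; apply: eq_bigr => i _.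
rewrite (big_ord_widen_cond M (fun l => (p * i + q * l == m)%N) (fun l => monomial a i l z)) //.
case: ltnP => im.
  apply: eq_bigl => l; rewrite andb_idr // => /eqP <-; rewrite ltnS.
  by apply: leq_trans (leq_addl _ _); apply: leq_pmull.
rewrite big1 // => l /eqP ml.
have : (i <= m)%N by rewrite -ml; apply: leq_trans (leq_addr _ _); apply: leq_pmull.
by rewrite leqNgt im.
Qed.

Lemma sum_hpart a M z : \sum_(m < M) hpart a m z =
  \sum_(i < M) \sum_(l < M) (if (p * i + q * l < M)%N then monomial a i l z else 0).
Proof.
rewrite (eq_bigr (fun m : 'I_M => \sum_(i < M) \sum_(l < M)
    if (p * i + q * l == m)%N then monomial a i l z else 0)); last first.
  move=> m _; rewrite (hpart_widen a z (ltn_ord m)); apply: eq_bigr => i _.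
  by rewrite big_mkcond.
rewrite exchange_big; apply: eq_bigr => i _; rewrite exchange_big; apply: eq_bigr => l _ /=.
case: ltnP => h.
  rewrite (bigD1 (Ordinal h)) //= eqxx big1 ?addr0 // => m /negPf.
  by rewrite -val_eqE /= eq_sym => ->.
rewrite big1 // => m _; case: eqP => // E.
by have := ltn_ord m; rewrite -E ltnNge h.
Qed.

Lemma sum_square a N M z : (N <= M)%N ->
  \sum_(i < N) \sum_(l < N) monomial a i l z =
  \sum_(i < M) \sum_(l < M) (if ((i < N) && (l < N))%N then monomial a i l z else 0).
Proof.
move=> NM; rewrite (big_ord_widen M (fun i => \sum_(l < N) monomial a i l z)) //.
rewrite big_mkcond; apply: eq_bigr => i _.
case: ltnP => iN /=; last by rewrite big1.
rewrite (big_ord_widen M (fun l => monomial a i l z)) // big_mkcond.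
by apply: eq_bigr => l _.
Qed.

(** A monomial with both exponents below [N] has weight below [N (p + q)]. The truncation by weight
    at [M] and the square truncation at [N] therefore differ only by monomials of order at least
    [N]. *)
Lemma weighted_expansion f : holomorphic_germ f -> exists a, forall N M,
  (N * (p + q) <= M)%N -> bigO N (fun z => f z - \sum_(m < M) hpart a m z).
Proof.
move=> /holomorphic_germ_bounded[r r0 [B B0 hf]].
have r40 : 0 < r / 4 by lra.
have [x y xr yr|a ha] := @osgood R (fun x y => f (pt x y)) (r / 4) B r40.
  have nr : n2 (pt x y) < r by rewrite /n2 /=; lra.
  have [df fB] := hf _ nr.
  split=> //.
  - eexists; exact: (@cderiv_curve _ f id (fun=> y) x _ _ df (cderiv_id x) (cderiv_cst y x)).
  - eexists; exact: (@cderiv_curve _ f (fun=> x) id y _ _ df (cderiv_cst x y) (cderiv_id y)).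
exists a => N M NM.
have NM' : (N <= M)%N by apply: leq_trans NM; rewrite leq_pmulr // addn_gt0 p0.
have O1 : bigO N (fun z => f z - \sum_(i < N) \sum_(l < N) monomial a i l z).
  have [K hK] := ha N; exists (2 * `|K|); first by rewrite mulr_ge0.
  exists (r / 16); first lra.
  move=> z z0 zr; have c1 := cnorm_ge0 z.1; have c2 := cnorm_ge0 z.2.
  have h := hK z.1 z.2; rewrite /n2 in zr.
  have {}h := h ltac:(lra) ltac:(lra).
  move: h; rewrite (_ : pt z.1 z.2 = z); last by case: (z).
  move=> /le_trans; apply.
  have k1 : cnorm z.1 ^+ N <= n2 z ^+ N by apply: lerXn2r; rewrite ?nnegrE ?n2_ge0 // lerDl.
  have k2 : cnorm z.2 ^+ N <= n2 z ^+ N by apply: lerXn2r; rewrite ?nnegrE ?n2_ge0 // lerDr.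
  apply: le_trans (_ : `|K| * (cnorm z.1 ^+ N + cnorm z.2 ^+ N) <= _).
    by rewrite ler_wpM2r ?ler_norm // addr_ge0 ?exprn_ge0.
  by have := normr_ge0 K => K0; have := ler_wpM2l K0 k1; have := ler_wpM2l K0 k2; lra.
have O2 : bigO N (fun z => \sum_(i < M) \sum_(l < M)
  ((if ((i < N) && (l < N))%N then monomial a i l z else 0) -
   (if (p * i + q * l < M)%N then monomial a i l z else 0))).
  apply: bigO_sum => i _; apply: bigO_sum => l _.
  have Z : bigO N (fun=> 0 : C).
    by exists 0 => //; exists 1 => // z _ _; rewrite cnorm0 mul0r.
  case: (boolP ((i < N) && (l < N))%N) => [/andP[iN lN]|].
    have -> : (p * i + q * l < M)%N.
      apply: leq_trans NM; rewrite mulnDr -addSn leq_add //.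
        by rewrite [leqRHS]mulnC ltn_pmul2l.
      by rewrite mulnC leq_mul2r ltnW ?orbT.
    by move: Z; congr bigO; apply/funext => z; rewrite subrr.
  rewrite negb_and -!leqNgt => Nil; case: (_ < M)%N; last first.
    by move: Z; congr bigO; apply/funext => z; rewrite subrr.
  have : bigO N (fun z => - monomial a i l z).
    apply/bigON/(bigO_le _ (bigO_monomial a i l)).
    case/orP: Nil => h; first exact: leq_trans h (leq_addr _ _).
    exact: leq_trans h (leq_addl _ _).
  by congr bigO; apply/funext => z; rewrite sub0r.
have := bigOD O1 O2; congr bigO; apply/funext => z.
rewrite (sum_square a z NM') sum_hpart.
under [X in _ + X]eq_bigr => i _ do rewrite sumrB.
by rewrite sumrB addrA subrK.
Qed.

Lemma n2_dil t z : cnorm t <= 1 -> n2 (dil t z) <= cnorm t * n2 z.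
Proof.
move=> t1; rewrite /n2 /= !cnormM !cnormX mulrDr.
have h n : (0 < n)%N -> cnorm t ^+ n <= cnorm t.
  by case: n => // n _; rewrite exprS ler_piMr ?exprn_ile1 ?cnorm_ge0.
by rewrite lerD // ler_wpM2r ?cnorm_ge0 ?h.
Qed.

Lemma dil_neq0 t z : t != 0 -> z != 0 -> dil t z != 0.
Proof.
move=> t0; case: z => x y; rewrite /dil /pt /= => z0.
apply: contraNneq z0 => -[/eqP + /eqP]; rewrite !mulf_eq0 !expf_eq0 (negPf t0) !andbF /=.
by move=> /eqP -> /eqP ->.
Qed.

Lemma cnormXz t (m : int) : cnorm (t ^ m) = cnorm t ^ m.
Proof. by case: m => n; rewrite ?NegzE -?exprnN ?cnormV -?exprnP ?cnormX. Qed.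

(** Along a dilation orbit the sum is [t^c] times a polynomial in [t] with coefficients [F n z], and
    it is [O(t^N)] since positive weights give [|dil t z| <= |t| |z|] for [|t| <= 1]. *)
Lemma hom_sum_bigO (F : nat -> C2 R -> C1 R) (c : int) M N :
  (forall n, hom (c + n%:Z) (F n)) -> bigO N (fun z => \sum_(n < M) F n z) ->
  forall n z, (n < M)%N -> (c + n%:Z < N%:Z) -> z != 0 -> F n z = 0.
Proof.
move=> hF [K K0 [d d0 h]] n z nM cn z0.
have nz : 0 < n2 z by rewrite n2_gt0.
pose P := \poly_(i < M) F i z.
suff : P`_n = 0 by rewrite coef_poly nM.
have [e eE] : exists e : nat, N%:Z - c = (n.+1 + e)%N%:Z.
  by exists (absz (N%:Z - c - n.+1%:Z)%R); lia.
apply: (@poly_small _ P n.+1 (K * n2 z ^+ N) (Num.min 1 (d / n2 z))) => //.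
  by rewrite lt_min ltr01 divr_gt0.
move=> t t0; rewrite lt_min ltr_pdivlMr // => /andP[t1 td].
have nt : 0 < cnorm t by rewrite cnorm_gt0.
have PE : P.[t] = t ^ (- c) * \sum_(i < M) F i (dil t z).
  rewrite horner_poly mulr_sumr; apply: eq_bigr => i _.
  by rewrite (hF i) // mulrA -expfzDr // addrA addNr add0r mulrC.
have dz := n2_dil z (ltW t1).
have := h (dil t z); rewrite n2_gt0 => /(_ (dil_neq0 t0 z0) (le_lt_trans dz td)) hh.
rewrite PE cnormM cnormXz.
apply: le_trans (ler_wpM2l _ hh) _; first by rewrite exprz_ge0 // ltW.
apply: (@le_trans _ _ (cnorm t ^ (- c) * (K * (cnorm t * n2 z) ^+ N))).
  rewrite ler_wpM2l ?exprz_ge0 ?(ltW nt) // ler_wpM2l //.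
  by apply: lerXn2r; rewrite ?nnegrE ?n2_ge0 ?mulr_ge0 ?n2_ge0 ?(ltW nt).
have -> : cnorm t ^ (- c) * (K * (cnorm t * n2 z) ^+ N) =
    K * n2 z ^+ N * (cnorm t ^ (N%:Z - c)).
  rewrite exprMn addrC expfzDr ?gt_eqF // -exprnP; ring.
rewrite eE -exprnP ler_wpM2l ?mulr_ge0 ?exprn_ge0 ?n2_ge0 //.
by rewrite exprD ler_piMr ?exprn_ge0 ?exprn_ile1 // ltW.
Qed.
End Weighted.

(** * Partial derivatives and Euler's identity *)

Section Partial.
Variable R : realType.
Local Notation C := R[i].
Implicit Types (z w v : C2 R) (e r : R) (M N : nat) (t : C) (f g F A B P Q : C2 R -> C1 R).

Definition dx F z : C1 R := 'd F z (pt 1 0).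
Definition dy F z : C1 R := 'd F z (pt 0 1).
Definition vder A B F z : C1 R := A z * dx F z + B z * dy F z.

Lemma diff_split F z v : differentiable F z -> 'd F z v = v.1 * dx F z + v.2 * dy F z.
Proof.
move=> dF; have -> : v = v.1 *: pt 1 0 + v.2 *: pt 0 1.
  case: v => x y; congr (_, _); rewrite /= /GRing.scale /=.
    by rewrite mulr1 mulr0 addr0.
  by rewrite mulr1 mulr0 add0r.
by rewrite linearD !linearZ /= /GRing.scale /= !mulr0 !mulr1 addr0 add0r.
Qed.

Lemma cderiv_partial f (g1 g2 : C -> C) t m1 m2 : differentiable f (pt (g1 t) (g2 t)) ->
  cderiv g1 t m1 -> cderiv g2 t m2 ->
  cderiv (fun u => f (pt (g1 u) (g2 u))) t
    (m1 * dx f (pt (g1 t) (g2 t)) + m2 * dy f (pt (g1 t) (g2 t))).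
Proof.
move=> df h1 h2; have := cderiv_curve df h1 h2.
by have -> := diff_split (pt m1 m2) df.
Qed.

Lemma cderiv_partial_x f (g1 : C -> C) c t m1 : differentiable f (pt (g1 t) c) ->
  cderiv g1 t m1 -> cderiv (fun u => f (pt (g1 u) c)) t (m1 * dx f (pt (g1 t) c)).
Proof.
move=> df h1; have := @cderiv_partial f g1 (fun=> c) t _ _ df h1 (cderiv_cst c t).
by move: (dx f _) (dy f _) => a b; rewrite mul0r addr0.
Qed.

Lemma cderiv_partial_y f (g2 : C -> C) c t m2 : differentiable f (pt c (g2 t)) ->
  cderiv g2 t m2 -> cderiv (fun u => f (pt c (g2 u))) t (m2 * dy f (pt c (g2 t))).
Proof.
move=> df h2; have := @cderiv_partial f (fun=> c) g2 t _ _ df (cderiv_cst c t) h2.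
by move: (dx f _) (dy f _) => a b; rewrite mul0r add0r.
Qed.

Lemma cderivZ (f : C -> C) c t l : cderiv f t l -> cderiv (fun u => c * f u) t (c * l).
Proof. by move=> /(cderivM (cderiv_cst c t)); rewrite mul0r add0r. Qed.

Lemma cderiv_uniq (f : C -> C) t l l' : cderiv f t l -> cderiv f t l' -> l = l'.
Proof.
by move=> /cderiv_is_derive[_ <-] /cderiv_is_derive[_ <-].
Qed.

Lemma cderiv_line (c d t : C) : cderiv (fun u => c * (d + u)) t c.
Proof.
have := cderivM (cderiv_cst c t) (cderivD (cderiv_cst d t) (cderiv_id t)).
by rewrite mul0r !add0r mulr1.
Qed.

Lemma cderiv_horner (P : {poly C}) t : cderiv (fun u => P.[u]) t P^`().[t].
Proof.
elim/poly_ind: P => [|P c IH].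
  rewrite deriv0 horner0; have := cderiv_cst 0 t.
  by congr cderiv; apply/funext => u; rewrite horner0.
have := cderivD (cderivM IH (cderiv_id t)) (cderiv_cst c t).
rewrite derivD derivC addr0 derivM derivX mulr1 !hornerE.
have -> : (fun u => (P * 'X + c%:P).[u]) = (fun u => P.[u] * u + c).
  by apply/funext => u; rewrite hornerMXaddC.
by congr cderiv; rewrite /=; ring.
Qed.

Lemma poly_ext (P Q : {poly C}) : (forall t, P.[t] = Q.[t]) -> P = Q.
Proof.
move=> PQ; apply/eqP; rewrite -subr_eq0; apply/eqP/polyP => n; rewrite coef0.
apply: (@poly_small _ _ n.+1 0 1) => // t _ _.
by rewrite hornerD hornerN PQ subrr cnorm0 mul0r.
Qed.

Lemma near_eq_diff (K : numFieldType) (V W : normedModType K) (f g : V -> W) (z : V) :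
  (\forall w \near z, f w = g w) -> differentiable f z ->
  differentiable g z /\ 'd g z = 'd f z :> (V -> W).
Proof.
move=> fg df; have [dc df'] := (diff_locallyP _ _).1 df.
have gz : g z = f z by rewrite (nbhs_singleton fg).
have dg' : g \o shift z = cst (g z) + 'd f z +o_ (0 : V) id.
  apply/eqaddoP => e e0; move: df' => /eqaddoP/(_ e e0) h.
  have fgs : \forall h \near (0 : V), f (h + z) = g (h + z).
    by move: fg; rewrite (near_shift (0 : V)) /= subr0.
  near=> x; have E : f (x + z) = g (x + z) by near: x.
  have hx : `|f (x + z) - (f z + 'd f z x)| <= e * `|x| by near: x; exact: h.
  have : `|g (x + z) - (g z + 'd f z x)| <= e * `|x| by rewrite gz -E.
  by [].
have E := diff_unique dc dg'.
split; last exact: E.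
by apply/diff_locallyP; rewrite E; split.
Unshelve. all: by end_near. Qed.

Section Weight.
Variables p q : nat.

(** Polynomiality is recorded through the two charts, where the algebra takes place. The zero
    function qualifies in every degree, negative ones included. *)
Definition wpoly (m : int) F := [/\ forall z, differentiable F z, hom p q m F,
  exists P : {poly C}, forall t, F (pt 1 t) = P.[t] &
  exists P : {poly C}, forall t, F (pt t 1) = P.[t]].

Lemma hom_dx m F : (forall z, differentiable F z) -> hom p q m F ->
  hom p q (m - p%:Z) (dx F).
Proof.
move=> dF hF t z t0.
have tp0 : t ^+ p != 0 by rewrite expf_neq0.
have l1 := @cderiv_partial_x F (fun u => t ^+ p * (z.1 + u)) (t ^+ q * z.2) 0 _
  (dF _) (cderiv_line _ _ _).
have l2 := cderivZ (t ^ m) (@cderiv_partial_x F (fun u => 1 * (z.1 + u))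
  z.2 0 _ (dF _) (cderiv_line _ _ _)).
have E : (fun u => F (pt (t ^+ p * (z.1 + u)) (t ^+ q * z.2))) =
  (fun u => t ^ m * F (pt (1 * (z.1 + u)) z.2)).
  by apply/funext => u; rewrite mul1r; exact: (hF t (pt (z.1 + u) z.2) t0).
rewrite E in l1; have := cderiv_uniq l1 l2.
have -> : pt (t ^+ p * (z.1 + 0)) (t ^+ q * z.2) = dil p q t z by rewrite addr0.
have -> : pt (1 * (z.1 + 0)) z.2 = z by rewrite mul1r addr0; case: (z).
move: (dx F _) (dx F _) => a b h; apply: (mulfI tp0).
rewrite h mul1r mulrA exprnP -expfzDr //.
by rewrite addrC subrK.
Qed.

Lemma hom_dy m F : (forall z, differentiable F z) -> hom p q m F ->
  hom p q (m - q%:Z) (dy F).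
Proof.
move=> dF hF t z t0.
have tq0 : t ^+ q != 0 by rewrite expf_neq0.
have l1 := @cderiv_partial_y F (fun u => t ^+ q * (z.2 + u)) (t ^+ p * z.1) 0 _
  (dF _) (cderiv_line _ _ _).
have l2 := cderivZ (t ^ m) (@cderiv_partial_y F (fun u => 1 * (z.2 + u))
  z.1 0 _ (dF _) (cderiv_line _ _ _)).
have E : (fun u => F (pt (t ^+ p * z.1) (t ^+ q * (z.2 + u)))) =
  (fun u => t ^ m * F (pt z.1 (1 * (z.2 + u)))).
  by apply/funext => u; rewrite mul1r; exact: (hF t (pt z.1 (z.2 + u)) t0).
rewrite E in l1; have := cderiv_uniq l1 l2.
have -> : pt (t ^+ p * z.1) (t ^+ q * (z.2 + 0)) = dil p q t z by rewrite addr0.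
have -> : pt z.1 (1 * (z.2 + 0)) = z by rewrite mul1r addr0; case: (z).
move: (dy F _) (dy F _) => a b h; apply: (mulfI tq0).
rewrite h mul1r mulrA exprnP -expfzDr //.
by rewrite addrC subrK.
Qed.

Lemma cderivXz (m : int) : cderiv (fun u : C => u ^ m) 1 m%:~R.
Proof.
case: m => n.
  have := cderivX n (cderiv_id (1 : C)); rewrite /= expr1n !mulr1.
  by congr cderiv.
have := @cderiv_invX R n.+1 1 (oner_neq0 _).
by rewrite expr1n invr1 mulr1; congr cderiv.
Qed.

Lemma euler m F z : (forall w, differentiable F w) -> hom p q m F ->
  p%:R * z.1 * dx F z + q%:R * z.2 * dy F z = m%:~R * F z.
Proof.
move=> dF hF.
have mon n (c : C) : cderiv (fun u => u ^+ n * c) 1 (n%:R * c).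
  have := cderivM (cderivX n (cderiv_id (1 : C))) (cderiv_cst c 1).
  by rewrite /= expr1n !mulr1 mulr0 addr0.
have l1 := @cderiv_partial F (fun u => u ^+ p * z.1) (fun u => u ^+ q * z.2) 1 _ _
  (dF _) (mon _ _) (mon _ _).
have l2 := cderivM (cderivXz m) (cderiv_cst (F z) 1).
have l3 : cderiv (fun u => F (pt (u ^+ p * z.1) (u ^+ q * z.2))) 1
    (m%:~R * F z + 1 ^ m * 0).
  apply: (cderiv_ext (ltr01) _ l2) => u u1; rewrite -/(dil p q u z) hF //.
  by apply: contraTneq u1 => ->; rewrite sub0r cnormN cnorm1 ltxx.
have := cderiv_uniq l1 l3.
have -> : pt (1 ^+ p * z.1) (1 ^+ q * z.2) = z by rewrite !expr1n !mul1r; case: (z).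
by move: (dx F z) (dy F z) => a b; rewrite mulr0 addr0.
Qed.

Lemma chart_dy F (P : {poly C}) t : (forall z, differentiable F z) ->
  (forall u, F (pt 1 u) = P.[u]) -> dy F (pt 1 t) = P^`().[t].
Proof.
move=> dF FP; apply: (@cderiv_uniq (fun u => P.[u]) t); last exact: cderiv_horner.
have := @cderiv_partial_y F id 1 t _ (dF _) (cderiv_id t).
move: (dy F _) => a; rewrite mul1r.
by congr cderiv; apply/funext.
Qed.

Lemma chart_vder m F (P a b : {poly C}) A B t : (forall z, differentiable F z) ->
  hom p q m F -> (forall u, F (pt 1 u) = P.[u]) ->
  A (pt 1 t) = a.[t] -> B (pt 1 t) = b.[t] ->
  p%:R * vder A B F (pt 1 t) =
    m%:~R * a.[t] * P.[t] + (p%:R * b.[t] - q%:R * t * a.[t]) * P^`().[t].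
Proof.
move=> dF hF FP Aa Bb; have := euler (pt 1 t) dF hF.
rewrite /vder Aa Bb (chart_dy t dF FP) FP.
move: (dx F _) => a' h; rewrite [m%:~R * _ * _]mulrAC -h /=; ring.
Qed.
End Weight.
End Partial.

(** * Brackets in coordinates *)

Section Components.
Variable R : realType.
Local Notation C := R[i].
Implicit Types (z w v : C2 R) (e r : R) (M N : nat) (t : C) (f g F A B P Q : C2 R -> C1 R).

Lemma lie_bracketE (X Y : C2 R -> C2 R) z : differentiable X z -> differentiable Y z ->
  let X1 w := (X w).1 in let X2 w := (X w).2 in
  let Y1 w := (Y w).1 in let Y2 w := (Y w).2 in
  lie_bracket X Y z = (vder X1 X2 Y1 z - vder Y1 Y2 X1 z,
                       vder X1 X2 Y2 z - vder Y1 Y2 X2 z).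
Proof.
move=> dX dY /=; rewrite /lie_bracket !deriveE //.
have [dX1 dX2] := (differentiable_components X z).1 dX.
have [dY1 dY2] := (differentiable_components Y z).1 dY.
pose sub (V : zmodType) (u v : V) := u - v.
apply: (etrans (congr2 (@sub (C2 R)) (diff_components (X z) dY)
                                     (diff_components (Y z) dX))).
exact: (congr2 pair
  (congr2 (@sub (C1 R)) (diff_split (X z) dY1) (diff_split (Y z) dX1))
  (congr2 (@sub (C1 R)) (diff_split (X z) dY2) (diff_split (Y z) dX2))).
Qed.

Lemma dxD f g z : differentiable f z -> differentiable g z ->
  dx (fun w => f w + g w : C1 R) z = dx f z + dx g z.
Proof.
by move=> df dg; rewrite /dx; have := diffD df dg => /(congr1 (fun h => h (pt 1 0))).
Qed.

Lemma dyD f g z : differentiable f z -> differentiable g z ->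
  dy (fun w => f w + g w : C1 R) z = dy f z + dy g z.
Proof.
by move=> df dg; rewrite /dy; have := diffD df dg => /(congr1 (fun h => h (pt 0 1))).
Qed.

Lemma dxB f g z : differentiable f z -> differentiable g z ->
  dx (fun w => f w - g w : C1 R) z = dx f z - dx g z.
Proof.
by move=> df dg; rewrite /dx; have := diffB df dg => /(congr1 (fun h => h (pt 1 0))).
Qed.

Lemma dyB f g z : differentiable f z -> differentiable g z ->
  dy (fun w => f w - g w : C1 R) z = dy f z - dy g z.
Proof.
by move=> df dg; rewrite /dy; have := diffB df dg => /(congr1 (fun h => h (pt 0 1))).
Qed.

Lemma dx_cst (c : C1 R) z : dx (fun=> c) z = 0.
Proof. by rewrite /dx; have := diff_cst (V := C2 R) c z => /(congr1 (fun h => h (pt 1 0))). Qed.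

Lemma dy_cst (c : C1 R) z : dy (fun=> c) z = 0.
Proof. by rewrite /dy; have := diff_cst (V := C2 R) c z => /(congr1 (fun h => h (pt 0 1))). Qed.

Lemma dx_sum M (F : nat -> C2 R -> C1 R) z : (forall n, differentiable (F n) z) ->
  dx (fun w => \sum_(n < M) F n w : C1 R) z = \sum_(n < M) dx (F n) z.
Proof.
move=> dF; elim: M => [|M IH].
  have -> : (fun w => \sum_(n < 0) F n w : C1 R) = (fun=> 0).
    by apply/funext => w; rewrite big_ord0.
  by rewrite dx_cst big_ord0.
have -> : (fun w => \sum_(n < M.+1) F n w : C1 R) =
    (fun w => (\sum_(n < M) F n w : C1 R) + F M w).
  by apply/funext => w; rewrite big_ord_recr.
have dS : differentiable (fun w => \sum_(n < M) F n w : C1 R) z.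
  by apply: differentiable_bigsum => n _; exact: dF.
by apply: (etrans (dxD dS (dF M))); rewrite big_ord_recr IH.
Qed.

Lemma dy_sum M (F : nat -> C2 R -> C1 R) z : (forall n, differentiable (F n) z) ->
  dy (fun w => \sum_(n < M) F n w : C1 R) z = \sum_(n < M) dy (F n) z.
Proof.
move=> dF; elim: M => [|M IH].
  have -> : (fun w => \sum_(n < 0) F n w : C1 R) = (fun=> 0).
    by apply/funext => w; rewrite big_ord0.
  by rewrite dy_cst big_ord0.
have -> : (fun w => \sum_(n < M.+1) F n w : C1 R) =
    (fun w => (\sum_(n < M) F n w : C1 R) + F M w).
  by apply/funext => w; rewrite big_ord_recr.
have dS : differentiable (fun w => \sum_(n < M) F n w : C1 R) z.
  by apply: differentiable_bigsum => n _; exact: dF.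
by apply: (etrans (dyD dS (dF M))); rewrite big_ord_recr IH.
Qed.

Lemma bigO1 f : holomorphic_germ f -> bigO 1 (fun z => f z - f 0).
Proof.
move=> /holomorphic_germ_bounded[r r0 [M M0 hf]]; exists (64 * M / r).
  by rewrite divr_ge0 ?mulr_ge0 // ltW.
exists (r / 16); first lra.
move=> z z0 zr; rewrite expr1.
pose s := r / (2 * n2 z).
have s0 : 0 < s by rewrite divr_gt0 // mulr_gt0.
pose g t := f (pt (t * z.1) (t * z.2)).
have ng t : n2 (pt (t * z.1) (t * z.2)) = cnorm t * n2 z by rewrite /n2 /= !cnormM mulrDr.
have nr t : cnorm (t - 0) <= s -> n2 (pt (t * z.1) (t * z.2)) < r.
  rewrite ng subr0 => ts; have := ler_wpM2r (ltW z0) ts.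
  have -> : s * n2 z = r / 2 by rewrite /s; field; rewrite gt_eqF.
  lra.
have gd t : cnorm (t - 0) <= s -> exists l, cderiv g t l.
  move=> /nr/hf[df _]; have lin (c : C) : cderiv (fun u => u * c) t c.
    by have := cderivM (cderiv_id t) (cderiv_cst c t); rewrite mul1r mulr0 addr0.
  eexists; exact: (@cderiv_curve _ f (fun u => u * z.1) (fun u => u * z.2) t _ _
    df (lin z.1) (lin z.2)).
have gM t : cnorm (t - 0) <= s -> cnorm (g t) <= M by move=> /nr/hf[].
have := @cderiv_lipschitz _ g M s 0 1 s0 gd gM; rewrite subr0 cnorm1 mulr1.
have g1 : g 1 = f z by rewrite /g !mul1r; case: (z).
have g0 : g 0 = f 0 by rewrite /g !mul0r.
rewrite g1 g0; have -> : 32 * M / s = 64 * M / r * n2 z.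
  by rewrite /s; field; rewrite !gt_eqF.
apply; rewrite /s ler_pdivlMr // ler_pdivlMr ?mulr_gt0 //; lra.
Qed.

Lemma holomorphic_germB f g : holomorphic_germ f -> holomorphic_germ g ->
  holomorphic_germ (fun z => f z - g z : C1 R).
Proof. by move=> hf hg; near=> z; apply: differentiable_sub; near: z. Unshelve. all: by end_near. Qed.

Lemma holomorphic_germ_all f : (forall z, differentiable f z) -> holomorphic_germ f.
Proof. by move=> hf; near=> z; exact: hf. Unshelve. all: by end_near. Qed.

Lemma bigO_dx N f : holomorphic_germ f -> bigO N.+1 f -> bigO N (dx f).
Proof. exact: bigO_diff true. Qed.
Lemma bigO_dy N f : holomorphic_germ f -> bigO N.+1 f -> bigO N (dy f).
Proof. exact: bigO_diff false. Qed.

Lemma bigO0_dxdy f : holomorphic_germ f -> bigO 0 (dx f) /\ bigO 0 (dy f).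
Proof.
move=> hf; have hc : holomorphic_germ (fun z => f z - f 0 : C1 R).
  apply: holomorphic_germB => //; apply: holomorphic_germ_all => z.
  exact: differentiable_const.
have E : \forall z \near (0 : C2 R), dx (fun z => f z - f 0 : C1 R) z = dx f z /\
    dy (fun z => f z - f 0 : C1 R) z = dy f z.
  near=> z; have df : differentiable f z by near: z.
  rewrite dxB ?dyB //; try exact: differentiable_const.
  by rewrite dx_cst dy_cst; move: (dx f z) (dy f z) => a b; rewrite !subr0.
have bd := bigO_dx hc (bigO1 hf); have bd' := bigO_dy hc (bigO1 hf).
split; first by apply: eq_bigO bd; near=> z; have [] := near E z.
by apply: eq_bigO bd'; near=> z; have [] := near E z.
Unshelve. all: by end_near. Qed.

Lemma eq_bigO_neq0 N (f g : C2 R -> C) : (forall z, z != 0 -> f z = g z) ->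
  bigO N f -> bigO N g.
Proof.
move=> fg [K K0 [d d0 h]]; exists K => //; exists d => // z z0.
by rewrite -fg -?n2_gt0 //; apply: h.
Qed.

Lemma bigO_fst : bigO 0 (fun z : C2 R => z.1).
Proof.
exists 1 => //; exists 1 => // z _ z1; rewrite expr0.
by have := cnorm_ge0 z.2; move: z1; rewrite /n2; lra.
Qed.
Lemma bigO_snd : bigO 0 (fun z : C2 R => z.2).
Proof.
exists 1 => //; exists 1 => // z _ z1; rewrite expr0.
by have := cnorm_ge0 z.1; move: z1; rewrite /n2; lra.
Qed.
Lemma bigO_cst (c : C) : bigO 0 (fun _ : C2 R => c).
Proof. by exists (cnorm c); rewrite ?cnorm_ge0 //; exists 1 => // z _ _; rewrite expr0 mulr1. Qed.

Section Weight.
Variables p q : nat.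
Hypotheses (p0 : (0 < p)%N) (q0 : (0 < q)%N).

(** The operator on the left multiplies the component of weight [n] by [n], so [(n - k) f_n = 0] and
    only the weight [k] survives; the difference of [f] and this component is flat. *)
Lemma qh_component f (k : nat) : holomorphic_germ f ->
  (\forall z \near (0 : C2 R),
     p%:R * z.1 * dx f z + q%:R * z.2 * dy f z = k%:R * f z) ->
  exists a, germ_eq f (hpart p q a k).
Proof.
move=> hf fk; have [a ha] := weighted_expansion p0 q0 hf; exists a.
have dh n z : differentiable (hpart p q a n) z := differentiable_hpart p q a n z.
pose S M : C2 R -> C1 R := fun z => \sum_(m < M) hpart p q a m z.
have dS M z : differentiable (S M) z by apply: differentiable_bigsum.
pose F (n : nat) : C2 R -> C1 R := fun z => (n%:R - k%:R) * hpart p q a n z.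
have F0 n z : z != 0 -> F n z = 0.
  pose N := n.+1; pose M := (N.+1 * (p + q))%N; pose Rm z : C1 R := f z - S M z.
  have NM : (N < M)%N by rewrite leq_pmulr // addn_gt0 p0.
  have hRm : holomorphic_germ Rm.
    by apply: holomorphic_germB => //; apply: holomorphic_germ_all.
  have ORm : bigO N.+1 Rm by apply: ha.
  have OE : bigO N (fun z => p%:R * z.1 * dx Rm z + q%:R * z.2 * dy Rm z - k%:R * Rm z).
    apply: bigOD; first apply: bigOD.
    - apply: (@bigOM R 0 N); last exact: bigO_dx.
      exact: (bigOM (bigO_cst _) bigO_fst).
    - apply: (@bigOM R 0 N); last exact: bigO_dy.
      exact: (bigOM (bigO_cst _) bigO_snd).
    - by apply/bigON/(bigOM (bigO_cst _) (bigO_le (leqnSn N) ORm)).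
  have OF : bigO N (fun z => \sum_(n < M) F n z).
    apply: eq_bigO (bigON OE); near=> x.
    have fx : p%:R * x.1 * dx f x + q%:R * x.2 * dy f x = k%:R * f x by near: x.
    have df : differentiable f x by near: x.
    rewrite /Rm (dxB df (dS M x)) (dyB df (dS M x)) (dx_sum M (fun n => dh n x)).
    rewrite (dy_sum M (fun n => dh n x)).
    have -> : \sum_(n < M) F n x = \sum_(n < M) (p%:R * x.1 * dx (hpart p q a n) x) +
       \sum_(n < M) (q%:R * x.2 * dy (hpart p q a n) x) - k%:R * S M x.
      rewrite /S mulr_sumr -big_split -sumrB; apply: eq_bigr => i _ /=.
      by rewrite (euler x (dh i) (hom_hpart p q a i)) /F mulrBl.
    rewrite -!mulr_sumr; move: fx; move: (dx f x) (dy f x) => u v.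
    move: (\sum_(i < M) dx _ x) (\sum_(i < M) dy _ x) => u' v' fx.
    by rewrite [in LHS]mulrBr [k%:R * (_ - _)]mulrBr -fx; ring.
  have hF m : hom p q (0 + m%:Z) (F m).
    move=> t w t0; rewrite add0r /F (hom_hpart p q a m _ t0); ring.
  move=> z0; apply: (hom_sum_bigO p0 q0 hF OF) => //.
    by apply: leq_trans NM; rewrite ltnS.
  by rewrite add0r ltz_nat.
have h0 n z : n != k -> z != 0 -> hpart p q a n z = 0.
  move=> nk /(F0 n)/eqP; rewrite mulf_eq0 subr_eq0 eqr_nat (negPf nk) /=.
  by move/eqP.
have hk : holomorphic_germ (hpart p q a k) by exact: holomorphic_germ_all.
have := holomorphic_germ_zero (holomorphic_germB hf hk).
move=> h; have {}h : germ_eq (fun z => f z - hpart p q a k z : C1 R) (fun=> 0).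
  apply: h => N; pose M := (N * (p + q) + k.+1)%N.
  have kM : (k < M)%N by rewrite /M addnS ltnS leq_addl.
  apply: (eq_bigO_neq0 _ (ha N M (leq_addr _ _))) => z z0.
  rewrite (bigD1 (Ordinal kM)) //= big1 ?addr0 // => i.
  by rewrite -val_eqE /= => ik; apply: h0.
by apply: filterS h => z /eqP; rewrite subr_eq0 => /eqP.
Unshelve. all: by end_near. Qed.
End Weight.
End Components.

(** * Homogeneous components of a commuting field *)

Section BracketComponents.
Variable R : realType.
Local Notation C := R[i].
Implicit Types (z w v : C2 R) (e r : R) (M N : nat) (t : C) (f g F A B P Q : C2 R -> C1 R).
Variables p q : nat.
Hypotheses (p0 : (0 < p)%N) (q0 : (0 < q)%N).

Lemma wpoly_hpart a (m : nat) : wpoly p q m%:Z (hpart p q a m : C2 R -> C1 R).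
Proof.
split; [exact: differentiable_hpart | exact: hom_hpart | exact: hpart_chart1 |
        exact: hpart_chart2].
Qed.

Lemma wpoly0 (m : int) : wpoly p q m (fun _ : C2 R => 0 : C1 R).
Proof.
split=> [z|t z _||]; first exact: differentiable_const.
- by rewrite mulr0.
- by exists 0 => t; rewrite horner0.
- by exists 0 => t; rewrite horner0.
Qed.

(* Weights are shifted so that the components of a field start at index 0. *)
Definition spart a (s n : nat) : C2 R -> C1 R :=
  if (s <= n)%N then hpart p q a (n - s) else fun=> 0.

Lemma wpoly_spart a s n : wpoly p q (n%:Z - s%:Z) (spart a s n).
Proof.
rewrite /spart; case: leqP => sn; last exact: wpoly0.
by rewrite subzn //; exact: wpoly_hpart.
Qed.

Lemma sum_spart a s M z : \sum_(n < M) spart a s n z = \sum_(m < M - s) hpart p q a m z.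
Proof.
elim: M => [|M IH]; first by rewrite !big_ord0.
rewrite big_ord_recr /= IH /spart; case: leqP => sM.
  by rewrite subSn // big_ord_recr.
by rewrite addr0 (eqP (ltnW sM : M - s == 0)%N) (eqP (sM : M.+1 - s == 0)%N).
Qed.

Lemma hom_sub (m : int) F F' : hom p q m F -> hom p q m F' ->
  hom p q m (fun z => F z - F' z : C1 R).
Proof. by move=> h h' t z t0; rewrite h // h' // mulrBr. Qed.

Lemma hom_add (m : int) F F' : hom p q m F -> hom p q m F' ->
  hom p q m (fun z => F z + F' z : C1 R).
Proof. by move=> h h' t z t0; rewrite h // h' // mulrDr. Qed.

Lemma hom_mul (m m' : int) F F' : hom p q m F -> hom p q m' F' ->
  hom p q (m + m') (fun z => F z * F' z : C1 R).
Proof. by move=> h h' t z t0; rewrite h // h' // expfzDr //; ring. Qed.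

Lemma hom_vder (k n : int) A B F : hom p q (k + p%:Z) A -> hom p q (k + q%:Z) B ->
  (forall z, differentiable F z) -> hom p q n F -> hom p q (k + n) (vder A B F).
Proof.
move=> hA hB dF hF; apply: hom_add.
  by have := hom_mul hA (hom_dx dF hF); congr hom; ring.
by have := hom_mul hB (hom_dy dF hF); congr hom; ring.
Qed.

Lemma vder_sumr M A B (F : nat -> C2 R -> C1 R) z : (forall n, differentiable (F n) z) ->
  vder A B (fun w => \sum_(n < M) F n w : C1 R) z = \sum_(n < M) vder A B (F n) z.
Proof.
move=> dF; rewrite /vder.
have -> := dx_sum M dF; have -> := dy_sum M dF.
by rewrite !mulr_sumr -big_split.
Qed.

Lemma vder_suml M (F G : nat -> C2 R -> C1 R) A z :
  vder (fun w => \sum_(n < M) F n w : C1 R) (fun w => \sum_(n < M) G n w : C1 R) A z =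
  \sum_(n < M) vder (F n) (G n) A z.
Proof. by rewrite /vder !mulr_suml -big_split. Qed.

(** The pair [(P n, Q n)] has degree [n - p - q] as a field, and its bracket with a field of degree
    [k] has degree [n - p - q + k]. The brackets thus lie in distinct degrees and [hom_sum_bigO]
    separates them. *)
Lemma bracket_components (k : int) A B (Y1 Y2 : C2 R -> C1 R) :
  (forall z, differentiable A z) -> (forall z, differentiable B z) ->
  hom p q (k + p%:Z) A -> hom p q (k + q%:Z) B ->
  holomorphic_germ Y1 -> holomorphic_germ Y2 ->
  (\forall z \near (0 : C2 R), vder A B Y1 z = vder Y1 Y2 A z /\
                               vder A B Y2 z = vder Y1 Y2 B z) ->
  exists P Q : nat -> C2 R -> C1 R,
    [/\ forall n, wpoly p q (n%:Z - q%:Z) (P n),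
        forall n, wpoly p q (n%:Z - p%:Z) (Q n),
        forall n z, z != 0 -> vder A B (P n) z = vder (P n) (Q n) A z /\
                              vder A B (Q n) z = vder (P n) (Q n) B z &
        forall N, exists M0, forall M, (M0 <= M)%N ->
          bigO N (fun z => Y1 z - \sum_(n < M) P n z) /\
          bigO N (fun z => Y2 z - \sum_(n < M) Q n z)].
Proof.
move=> dA dB hA hB hY1 hY2 hY.
have [a ha] := weighted_expansion p0 q0 hY1; have [b hb] := weighted_expansion p0 q0 hY2.
pose P := spart a q; pose Q := spart b p; exists P, Q.
have wP n : wpoly p q (n%:Z - q%:Z) (P n) := wpoly_spart a q n.
have wQ n : wpoly p q (n%:Z - p%:Z) (Q n) := wpoly_spart b p n.
have exps N M : (N * (p + q) + (p + q) <= M)%N ->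
    bigO N (fun z => Y1 z - \sum_(n < M) P n z) /\
    bigO N (fun z => Y2 z - \sum_(n < M) Q n z).
  move=> NM; split.
    have NM1 : (N * (p + q) <= M - q)%N by lia.
    by have := ha _ _ NM1; congr bigO; apply/funext => z; rewrite sum_spart.
  have NM1 : (N * (p + q) <= M - p)%N by lia.
  by have := hb _ _ NM1; congr bigO; apply/funext => z; rewrite sum_spart.
split; [exact: wP | exact: wQ | |
  by move=> N; exists (N * (p + q) + (p + q))%N => M; exact: exps].
have dP n z : differentiable (P n) z by have [] := wP n.
have dQ n z : differentiable (Q n) z by have [] := wQ n.
have hP n : hom p q (n%:Z - q%:Z) (P n) by have [] := wP n.
have hQ n : hom p q (n%:Z - p%:Z) (Q n) by have [] := wQ n.
have OA := bigO0 (holomorphic_germ_all dA); have OB := bigO0 (holomorphic_germ_all dB).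
(* One coordinate of the bracket: [D] and [T] are the components of the two fields in this
   coordinate, whose weight [s] is [p] or [q]. *)
have key (D : C2 R -> C1 R) (Y3 : C2 R -> C1 R) (T : nat -> C2 R -> C1 R) (s : int) :
    (forall z, differentiable D z) -> hom p q (k + s) D -> holomorphic_germ Y3 ->
    (forall n z, differentiable (T n) z) ->
    (forall n, hom p q (n%:Z + s - p%:Z - q%:Z) (T n)) ->
    (forall N M, (N * (p + q) + (p + q) <= M)%N ->
       bigO N (fun z => Y3 z - \sum_(n < M) T n z)) ->
    (\forall z \near (0 : C2 R), vder A B Y3 z = vder Y1 Y2 D z) ->
    forall n z, z != 0 -> vder A B (T n) z - vder (P n) (Q n) D z = 0.
  move=> dD hD hY3 dT hT eT nY n.
  pose F m : C2 R -> C1 R := fun z => vder A B (T m) z - vder (P m) (Q m) D z.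
  have hF m : hom p q ((k + s - p%:Z - q%:Z) + m%:Z) (F m).
    apply: hom_sub.
      by have := hom_vder hA hB (dT m) (hT m); congr hom; ring.
    apply: hom_add.
      by have := hom_mul (hP m) (hom_dx dD hD); congr hom; ring.
    by have := hom_mul (hQ m) (hom_dy dD hD); congr hom; ring.
  pose N := (n.+1 + absz (k + s)%R)%N; pose M := (N.+1 * (p + q) + (p + q))%N.
  pose R1 z : C1 R := Y1 z - \sum_(m < M) P m z.
  pose R2 z : C1 R := Y2 z - \sum_(m < M) Q m z.
  pose R3 z : C1 R := Y3 z - \sum_(m < M) T m z.
  have [bR1 bR2] : bigO N.+1 R1 /\ bigO N.+1 R2 by apply: exps.
  have bR3 : bigO N.+1 R3 by apply: eT.
  have hR3 : holomorphic_germ R3.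
    apply: holomorphic_germB => //; apply: holomorphic_germ_all => z.
    by apply: differentiable_bigsum.
  have [bDx bDy] := bigO0_dxdy (holomorphic_germ_all dD).
  have OR : bigO N (fun z => vder R1 R2 D z - vder A B R3 z).
    apply: bigOD; last apply/bigON; apply: bigOD.
    - by rewrite -[N]addn0; apply: bigOM bDx; apply: bigO_le bR1.
    - by rewrite -[N]addn0; apply: bigOM bDy; apply: bigO_le bR2.
    - by apply: (bigOM OA); apply: bigO_dx.
    - by apply: (bigOM OB); apply: bigO_dy.
  have aux (u v w : C) : u - w - (u - v) = v - w by ring.
  have OF : bigO N (fun z => \sum_(m < M) F m z).
    apply: eq_bigO OR; near=> z.
    have e3 : vder A B Y3 z = vder Y1 Y2 D z by near: z.
    have d3 : differentiable Y3 z by near: z.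
    have dTs : differentiable (fun w => \sum_(m < M) T m w : C1 R) z.
      by apply: differentiable_bigsum.
    have E3 : vder A B R3 z = vder A B Y3 z - \sum_(m < M) vder A B (T m) z.
      rewrite -(vder_sumr M A B (fun m => dT m z)).
      rewrite /vder; have -> := dxB d3 dTs; have -> := dyB d3 dTs.
      by move: (dx Y3 z) (dy Y3 z) (dx _ z) (dy _ z) => *; ring.
    have E12 : vder R1 R2 D z = vder Y1 Y2 D z - \sum_(m < M) vder (P m) (Q m) D z.
      rewrite -vder_suml /vder /R1 /R2.
      by move: (dx D z) (dy D z) => u v; ring.
    have -> : \sum_(m < M) F m z =
        \sum_(m < M) vder A B (T m) z - \sum_(m < M) vder (P m) (Q m) D z by exact: sumrB.
    by rewrite E12 E3 e3; exact: aux.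
  move=> z z0; apply: (hom_sum_bigO p0 q0 hF OF _ _ z0).
    by rewrite /M /N; nia.
  by rewrite /N; lia.
have hY' : (\forall z \near (0 : C2 R), vder A B Y1 z = vder Y1 Y2 A z) /\
           (\forall z \near (0 : C2 R), vder A B Y2 z = vder Y1 Y2 B z).
  by split; apply: filterS hY => z [].
move=> n z z0; split; apply/eqP; rewrite -subr_eq0; apply/eqP.
  apply: (key A Y1 P p%:Z dA hA hY1 dP _ _ hY'.1).
  - by move=> m; have := hP m; congr hom; ring.
  - by move=> N M /exps[].
  - exact: z0.
apply: (key B Y2 Q q%:Z dB hB hY2 dQ _ _ hY'.2).
- by move=> m; have := hQ m; congr hom; ring.
- by move=> N M /exps[].
- exact: z0.
Unshelve. all: by end_near. Qed.
End BracketComponents.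

(** * Commuting fields in the charts of the weighted blow-up *)

Section Compat.
Variable R : realType.
Local Notation C := R[i].
Implicit Types (P Q A B : {poly C}) (s t : C) (m : int).

Lemma poly_ext_neq0 P Q : (forall t, t != 0 -> P.[t] = Q.[t]) -> P = Q.
Proof.
move=> h; apply: (mulIf (negbT (polyX_eq0 C))); apply: poly_ext => t.
rewrite !hornerM hornerX; have [->|t0] := eqVneq t 0; first by rewrite !mulr0.
by rewrite h.
Qed.

(* The restrictions to x = 1 and to y = 1 of a weighted homogeneous function. *)
Definition compat (p q : nat) m P1 P2 :=
  forall s, s != 0 -> P1.[s ^+ q] = s ^ m * P2.[s ^- p].

Lemma compat_sym p q m P1 P2 : compat p q m P1 P2 -> compat q p m P2 P1.
Proof.
move=> h s s0; have := h s^-1; rewrite invr_eq0 => /(_ s0).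
rewrite !exprVn invrK => ->; by rewrite mulrA -expfzMl divff // exp1rz mul1r.
Qed.

(** A term [y^l] on [x = 1] can only come from a monomial [x^i y^l] with [p i + q l = m]: once
    denominators are cleared, both sides are polynomials in [s] whose exponents determine [l] and
    [i]. *)
Lemma compat_coef p q m P1 P2 l : (0 < p)%N -> (0 < q)%N -> compat p q m P1 P2 -> P1`_l != 0 ->
  exists2 i : nat, (p * i + q * l)%N%:Z = m & P2`_i = P1`_l.
Proof.
move=> p0 q0 h Pl; pose M := size P2.
have [a [b mE]] : exists a b : nat, m = b%:Z - a%:Z.
  by case: m {h} => n; [exists 0%N, n | exists n.+1, 0%N; rewrite sub0r NegzE]; rewrite ?subr0.
(* The shift [p * M] clears the negative powers in [P2.[s ^- p]], and [a] those of [s ^ m]. *)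
pose U : {poly C} := \sum_(i < size P1) P1`_i *: 'X^(p * M + q * i + a).
pose V : {poly C} := \sum_(i < M) P2`_i *: 'X^(p * (M - i) + b).
have UV : U = V.
  apply: poly_ext_neq0 => s s0.
  have -> : U.[s] = s ^+ (p * M) * s ^+ a * P1.[s ^+ q].
    rewrite horner_sum horner_coef mulr_sumr; apply: eq_bigr => i _.
    by rewrite hornerZ hornerXn !exprD -exprM; ring.
  rewrite h // mE expfzDr // -exprnN -exprnP horner_coef horner_sum.
  have cancel (x y z w : C) : y != 0 -> x * y * (z / y * w) = x * z * w.
    by move=> y0; field.
  rewrite cancel ?expf_neq0 // mulr_sumr.
  apply: eq_bigr => i _; rewrite hornerZ hornerXn exprD exprVn -exprM.
  have -> : s ^+ (p * M) = s ^+ (p * (M - i)) * s ^+ (p * i).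
    by rewrite -exprD -mulnDr subnK // ltnW.
  by field; rewrite expf_neq0.
have lP : (l < size P1)%N.
  by rewrite ltnNge; apply: contra Pl => h1; rewrite nth_default.
have Ul : U`_(p * M + q * l + a) = P1`_l.
  rewrite /U coef_sum (bigD1 (Ordinal lP)) //= coefZ coefXn eqxx mulr1.
  rewrite big1 ?addr0 // => i; rewrite -val_eqE /= => il.
  rewrite coefZ coefXn eqn_add2r eqn_add2l eqn_pmul2l // eq_sym (negPf il).
  by rewrite mulr0.
have : V`_(p * M + q * l + a) != 0 by rewrite -UV Ul.
rewrite /V coef_sum => hV.
have [i [iM ni]] : exists i : 'I_M, True /\ (p * M + q * l + a == p * (M - i) + b)%N.
  apply/not_existsP => nE; move: hV; rewrite big1 ?eqxx // => i _.
  rewrite coefZ coefXn; case: eqP => [e|_]; last by rewrite mulr0.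
  by case: (nE i); split=> //; apply/eqP.
have iM' := ltn_ord i.
have E : (p * i + q * l)%N%:Z = m.
  move: ni => /eqP; rewrite mulnBr mE.
  have : (p * i <= p * M)%N by rewrite leq_mul2l ltnW ?orbT.
  by lia.
exists i => //; rewrite -Ul UV /V coef_sum (bigD1 i) //= coefZ coefXn ni mulr1.
rewrite big1 ?addr0 // => i'; rewrite -val_eqE /= => ii.
rewrite coefZ coefXn (eqP ni) eqn_add2r eqn_pmul2l //.
suff /negPf -> : (M - i != M - i')%N by rewrite mulr0.
by apply: contra ii => /eqP; have := ltn_ord i'; lia.
Qed.
End Compat.

(** * The commutation equations in a chart *)

Section Algebra.
Variable R : realType.
Local Notation C := R[i].
Implicit Types (P Q A B Y Z h e a b g : {poly C}) (s t x : C) (j k m : int).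

Lemma coprime_factors P Q : P != 0 -> exists g P1 Q1,
  [/\ P = g * P1, Q = g * Q1, g != 0 & forall x, P1.[x] = 0 -> Q1.[x] != 0].
Proof.
move=> P0; exists (gcdp P Q), (P %/ gcdp P Q), (Q %/ gcdp P Q).
rewrite [_ * (P %/ _)]mulrC [_ * (Q %/ _)]mulrC !divpK ?dvdp_gcdl ?dvdp_gcdr //.
split=> //; first by rewrite gcdp_eq0 negb_and P0.
move=> x /eqP Px; apply: coprimep_root Px.
by apply: coprimep_div_gcd; rewrite P0.
Qed.

Lemma size1_dvdp P Q g P1 Q1 : P = g * P1 -> Q = g * Q1 -> P != 0 ->
  (forall x, P1.[x] != 0) -> P %| Q.
Proof.
move=> PE QE P0 h; have P1n : size P1 == 1.
  by apply/negPn/negP => /closed_rootP[x /eqP]; apply/eqP.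
have P10 : P1 != 0 by rewrite -size_poly_eq0 (eqP P1n).
have /eqP := size1_polyC (eq_leq (eqP P1n)).
rewrite PE QE dvdp_mul2l; last by apply: contraNneq P0; rewrite PE => ->; rewrite mul0r.
by move=> _; apply: dvdp_trans (dvd1p _); rewrite dvdp1.
Qed.

Lemma mup_dvdp P Q : P != 0 -> Q != 0 ->
  (forall x, root P x -> (mup x P <= mup x Q)%N) -> P %| Q.
Proof.
move=> P0 Q0 h; have [g [P1 [Q1 [PE QE g0 co]]]] := coprime_factors Q P0.
have P10 : P1 != 0 by apply: contraNneq P0; rewrite PE => ->; rewrite mulr0.
have Q10 : Q1 != 0 by apply: contraNneq Q0; rewrite QE => ->; rewrite mulr0.
apply: (size1_dvdp PE QE P0) => x; apply/negP => /eqP P1x.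
have rP1 : root P1 x by apply/eqP.
have := h x; rewrite PE rootM rP1 orbT => /(_ isT).
rewrite QE !mupM // leq_add2l (mupNroot (co x P1x)) leqn0.
by rewrite eqn0Ngt -XsubC_dvd // dvdp_XsubCl rP1.
Qed.

Lemma poly_eq_mulXsubC P x : P.[x] = 0 -> exists Q, P = ('X - x%:P) * Q.
Proof. by move/eqP/factor_theorem => [Q ->]; exists Q; rewrite mulrC. Qed.

(** The restriction of [S /\ X] to [x = 1]; on [y = 1] it is [wedge q p B A], up to sign. *)
Definition wedge (p q : nat) A B : {poly C} := p%:R * B - q%:R * 'X * A.

Definition no_common_root A B := forall t, A.[t] = 0 -> B.[t] <> 0.

Lemma wedge_root p q A B t : (0 < p)%N -> no_common_root A B ->
  (wedge p q A B).[t] = 0 -> A.[t] <> 0.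
Proof.
move=> p0 AB ht At; apply: (AB t At); move: ht; rewrite /wedge hornerD hornerN !hornerM At mulr0 subr0.
rewrite -polyC_natr hornerC => /eqP.
by rewrite mulf_eq0 pnatr_eq0 -leqn0 leqNgt p0 => /eqP.
Qed.

(** Here [A], [Y] are the first components of [X] and [Y_j] on [x = 1], and [h], [e] the wedges of
    [S] with the two fields. The second equation combines both coordinates of the bracket so that
    the second components enter only through [h] and [e]. *)
Definition comm_eqs j k A Y h e :=
  (j - k)%:~R * A * Y + h * Y^`() = e * A^`() /\
  j%:~R * A * e + h * e^`() = k%:~R * Y * h + e * h^`().

Lemma deriv_wedge p q A B : (wedge p q A B)^`() =
  p%:R * B^`() - q%:R * A - q%:R * 'X * A^`().
Proof.
have d0 (n : nat) : (n%:R : {poly C})^`() = 0 by rewrite -polyC_natr derivC.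
by rewrite /wedge derivB !derivM derivX !d0; ring.
Qed.

Lemma comm_eqs_wedge (p q : nat) j k A B Y Z :
  let h := wedge p q A B in let e := wedge p q Y Z in
  (j + p%:Z)%:~R * A * Y + h * Y^`() = (k + p%:Z)%:~R * Y * A + e * A^`() ->
  (j + q%:Z)%:~R * A * Z + h * Z^`() = (k + q%:Z)%:~R * Y * B + e * B^`() ->
  comm_eqs j k A Y h e.
Proof.
move=> h e; rewrite /comm_eqs !intrD -!pmulrn => e1 e2; split.
  rewrite intrN; apply/eqP; rewrite -subr_eq0; apply/eqP.
  transitivity ((j%:~R + p%:R) * A * Y + h * Y^`() - ((k%:~R + p%:R) * Y * A + e * A^`())).
    by ring.
  by rewrite e1 subrr.
rewrite /h /e !deriv_wedge -/h -/e; apply/eqP; rewrite -subr_eq0; apply/eqP.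
transitivity (p%:R * (((j%:~R + q%:R) * A * Z + h * Z^`()) - ((k%:~R + q%:R) * Y * B + e * B^`())) -
  q%:R * 'X * ((j%:~R + p%:R) * A * Y + h * Y^`() - ((k%:~R + p%:R) * Y * A + e * A^`()))).
  by rewrite /e /h /wedge; ring.
by rewrite e1 e2 !subrr !mulr0 subrr.
Qed.

Section Chart.
Variables (j k : int) (A Y h e : {poly C}).
Hypotheses (hA : forall t, h.[t] = 0 -> A.[t] <> 0) (ce : comm_eqs j k A Y h e).

Lemma horner_int (m : int) t : (m%:~R : {poly C}).[t] = m%:~R.
Proof. by rewrite -(rmorph_int polyC) hornerC. Qed.

(* At such a point the blown-up field has a node. *)
Lemma node_root t : h.[t] = 0 -> e.[t] != 0 -> h^`().[t] = j%:~R * A.[t].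
Proof.
move=> ht et; have := congr1 (fun P => P.[t]) ce.2.
rewrite !hornerD !hornerM !horner_int ht !mul0r !mulr0 addr0 add0r mulrC.
by move/(mulfI et).
Qed.

(** Suppose the cofactor of the gcd in [h] has a root [x]. The gcd vanishes there too, because [e]
    does and its cofactor does not. Dividing the second equation by the gcd and evaluating at [x]
    leaves [j A e1 = 0], where no factor vanishes. *)
Lemma wedge_dvd : j != 0 -> h != 0 -> (forall t, h.[t] = 0 -> e.[t] = 0) -> h %| e.
Proof.
move=> j0 h0 he; have [g [h1 [e1 [hE eE g0 co]]]] := coprime_factors e h0.
apply: (size1_dvdp hE eE h0) => x; apply/negP => /eqP h1x.
have ht : h.[x] = 0 by rewrite hE hornerM h1x mulr0.
have gx : g.[x] = 0.
  by have /eqP := he x ht; rewrite eE hornerM mulf_eq0 (negPf (co x h1x)) orbF => /eqP.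
have : j%:~R * A * e1 + g * (h1 * e1^`() - e1 * h1^`()) = k%:~R * Y * h1.
  apply: (mulfI g0); move: ce.2; rewrite hE eE !derivM => E.
  apply/eqP; rewrite -subr_eq0; apply/eqP.
  set lhs := (X in X = _) in E; set rhs := (X in _ = X) in E.
  transitivity (lhs - rhs); first by rewrite /lhs /rhs; ring.
  by rewrite E subrr.
move/(congr1 (fun P => P.[x])); rewrite !hornerD !hornerM !horner_int h1x gx !mul0r !mulr0 !addr0.
move/eqP; rewrite !mulf_eq0 intr_eq0 (negPf j0) (negPf (co x h1x)) orbF /=.
by move/eqP/(hA ht).
Qed.

(** In the chart [Y_j = b X + c S] with [a = p c]. The conclusions are [X(c) = 0] and [X(b) = k c],
    up to powers of [p]. *)
Lemma quotient_eqs b : h != 0 -> e = b * h -> let a := Y - A * b in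
  j%:~R * A * a + h * a^`() = 0 /\ (j - k)%:~R * A * b + h * b^`() = k%:~R * a.
Proof.
move=> h0 eE a; have Eb : j%:~R * A * b + h * b^`() = k%:~R * Y.
  apply: (mulIf h0); move: ce.2; rewrite eE derivM => E.
  apply/eqP; rewrite -subr_eq0; apply/eqP.
  set lhs := (X in X = _) in E; set rhs := (X in _ = X) in E.
  transitivity (lhs - rhs); first by rewrite /lhs /rhs; ring.
  by rewrite E subrr.
have E2 : (j - k)%:~R * A * b + h * b^`() = k%:~R * a.
  rewrite /a intrD intrN; transitivity (j%:~R * A * b + h * b^`() - k%:~R * A * b); first by ring.
  by rewrite Eb; ring.
split=> //; have YE : Y = a + A * b by rewrite /a subrK.
move: ce.1; rewrite eE YE derivD derivM => E.
transitivity ((j - k)%:~R * A * (a + A * b) + h * (a^`() + (A^`() * b + A * b^`())) -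
   b * h * A^`() - A * ((j - k)%:~R * A * b + h * b^`()) + A * (k%:~R * a)).
  by rewrite intrD intrN; ring.
by rewrite E E2; ring.
Qed.
End Chart.
End Algebra.

(** * Orders of vanishing of the coefficients of [X] and [S] *)

Section Algebra2.
Variable R : realType.
Local Notation C := R[i].
Implicit Types (P Q A B Y Z h e a b g : {poly C}) (s t x : C) (j k m : int).

Lemma mup_factor P x : P != 0 -> exists P1,
  P1.[x] != 0 /\ P = ('X - x%:P) ^+ mup x P * P1.
Proof.
move=> P0; have [m [Q]] := multiplicity_XsubC P x; rewrite P0 /= => Qx PE.
exists Q; split=> //; rewrite {2}PE mupMr // mup_XsubCX eqxx mulrC; exact: PE.
Qed.

Lemma deriv_expXsubC x n Q : ('X - x%:P) * (('X - x%:P) ^+ n * Q)^`() =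
  ('X - x%:P) ^+ n * (n%:R * Q + ('X - x%:P) * Q^`()).
Proof.
rewrite derivM deriv_exp derivXsubC mul1r.
case: n => [|n] /=; first by rewrite expr0 mulr0n; ring.
by rewrite -mulr_natl exprS; ring.
Qed.

Lemma XsubC_root x : ('X - x%:P).[x] = 0 :> C.
Proof. by rewrite hornerXsubC subrr. Qed.

Lemma horner_nat (n : nat) x : (n%:R : {poly C}).[x] = n%:R.
Proof. by rewrite -polyC_natr hornerC. Qed.

(** Subtract from [Q] the multiple of [P] that agrees with it at a point where [P] is nonzero. A
    nonzero difference would satisfy the same equation, although at this point its order drops by
    one on the left side only. *)
Lemma wronskian0 P Q : P != 0 -> P * Q^`() = Q * P^`() -> exists c, Q = c%:P * P.
Proof.
move=> P0 E; have /closed_nonrootP[x Px] := P0.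
pose c := Q.[x] / P.[x]; exists c; apply/eqP; rewrite -subr_eq0; apply/negPn/negP => G0.
set G := Q - _ in G0; have GE : P * G^`() = G * P^`().
  by rewrite /G derivB derivM derivC mul0r add0r mulrBr mulrBl E; ring.
have Gx : G.[x] = 0 by rewrite /G hornerD hornerN hornerM hornerC /c divfK ?subrr.
have [G1 [G1x GG]] := mup_factor x G0.
have n0 : (0 < mup x G)%N by rewrite -XsubC_dvd // dvdp_XsubCl; apply/eqP.
move: n0 GG; set n := mup x G; clearbody G n => n0 GG.
have y0 : ('X - x%:P) ^+ n != 0 by rewrite expf_neq0 // polyXsubC_eq0.
have : P * (n%:R * G1 + ('X - x%:P) * G1^`()) = ('X - x%:P) * G1 * P^`().
  apply: (mulfI y0); rewrite mulrCA -deriv_expXsubC -GG mulrCA GE GG; ring.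
move/(congr1 (fun p => p.[x])); rewrite !(hornerXsubC, hornerM, hornerD) subrr horner_nat.
rewrite !mul0r addr0 => /eqP; rewrite !mulf_eq0 pnatr_eq0 (negPf G1x) orbF -leqn0 leqNgt n0 orbF.
by apply/negP.
Qed.

Section Quotients.
Variables (j k : int) (A h a b : {poly C}).
Hypotheses (j0 : 0 < j) (k0 : 0 < k) (hA : forall t, h.[t] = 0 -> A.[t] <> 0).
Hypotheses (Ea : j%:~R * A * a + h * a^`() = 0)
  (Eb : (j - k)%:~R * A * b + h * b^`() = k%:~R * a).

(** Let [n], [m] be the orders of [a], [b] at [x]. The leading term of [Ea] gives [j A + n h1 = 0]
    at [x], where [h = (X - x) h1]. If [m < n], the right side of [Eb] is of higher order and
    [(j - k) A + m h1 = 0]. Eliminating [A] and [h1] yields the second alternative. *)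
Lemma quotient_mup x : a != 0 -> b != 0 -> root a x ->
  (mup x a <= mup x b)%N \/ (j - k) * (mup x a)%:Z = j * (mup x b)%:Z.
Proof.
move=> a0 b0 ax; have [a1 [a1x aE]] := mup_factor x a0.
have [b1 [b1x bE]] := mup_factor x b0.
have n0 : (0 < mup x a)%N by rewrite -XsubC_dvd // dvdp_XsubCl.
move: n0 aE bE; move: (mup x a) (mup x b) => n m n0 aE bE.
case: (leqP n m) => [|mn]; [by left | right].
have dE l Q : ('X - x%:P) * (('X - x%:P) ^+ l * Q)^`() = _ := deriv_expXsubC x l Q.
have rE Q : Q.[x] = 0 -> exists Q', Q = ('X - x%:P) * Q' := @poly_eq_mulXsubC _ Q x.
set y : {poly C} := 'X - x%:P in aE bE dE rE.
have y0 : y != 0 by rewrite polyXsubC_eq0.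
have yx : y.[x] = 0 := XsubC_root x.
clearbody y; have E1 : j%:~R * A * y * a1 + h * (n%:R * a1 + y * a1^`()) = 0.
  apply: (mulfI (expf_neq0 n y0)); rewrite mulr0 mulrDr [y ^+ n * (h * _)]mulrCA.
  rewrite -dE -aE; transitivity (y * (j%:~R * A * a + h * a^`())).
    have -> : y ^+ n * (j%:~R * A * y * a1) = y * (j%:~R * A * (y ^+ n * a1)) by ring.
    by rewrite -aE; ring.
  by rewrite Ea mulr0.
have hx : h.[x] = 0.
  move/(congr1 (fun p => p.[x])): E1.
  rewrite !(hornerD, hornerM) yx horner_nat !(mulr0, mul0r) horner0 addr0 add0r.
  by move/eqP; rewrite !mulf_eq0 pnatr_eq0 (negPf a1x) orbF -[n == _]leqn0 leqNgt n0 orbF => /eqP.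
have [h1 hE] := rE _ hx.
have E2 : j%:~R * A.[x] + n%:R * h1.[x] = 0.
  have : j%:~R * A * a1 + h1 * (n%:R * a1 + y * a1^`()) = 0.
    by apply: (mulfI y0); rewrite mulr0 -[RHS]E1 hE; ring.
  move/(congr1 (fun p => p.[x])).
  rewrite !(hornerD, hornerM) yx horner_nat horner_int.
  rewrite !(mulr0, mul0r) horner0 addr0 => E; apply: (mulIf a1x).
  by rewrite mul0r -[RHS]E; ring.
have E3 : (j - k)%:~R * A.[x] + m%:R * h1.[x] = 0.
  have : (j - k)%:~R * A * b1 + h1 * (m%:R * b1 + y * b1^`()) = k%:~R * y ^+ (n - m) * a1.
    apply: (mulfI (expf_neq0 m y0)); rewrite mulrDr [y ^+ m * (h1 * _)]mulrCA.
    rewrite -dE -bE.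
    transitivity (k%:~R * a); last by rewrite aE -{1}(subnKC (ltnW mn)) exprD; ring.
    rewrite -Eb hE.
    have -> : y ^+ m * ((j - k)%:~R * A * b1) = (j - k)%:~R * A * (y ^+ m * b1) by ring.
    by rewrite -bE; ring.
  move/(congr1 (fun p => p.[x])).
  rewrite !(hornerD, hornerM) horner_exp yx horner_nat !horner_int.
  rewrite expr0n subn_eq0 leqNgt mn /= !(mulr0, mul0r) addr0 => E; apply: (mulIf b1x).
  by rewrite mul0r -[RHS]E; ring.
have h1x : h1.[x] != 0.
  apply: contra_notN (hA hx) => /eqP h1x; move/eqP: E2.
  by rewrite h1x mulr0 addr0 mulf_eq0 intr_eq0 gt_eqF //= => /eqP.
apply/eqP; rewrite -(eqr_int C) !intrM -!pmulrn; apply/eqP/(mulIf h1x).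
apply/eqP; rewrite -subr_eq0; apply/eqP.
transitivity ((j - k)%:~R * (j%:~R * A.[x] + n%:R * h1.[x]) -
  j%:~R * ((j - k)%:~R * A.[x] + m%:R * h1.[x])); first by ring.
by rewrite E2 E3 !mulr0 subrr.
Qed.

(** Both alternatives of [quotient_mup] give [m * ord a <= n * ord b] at each root of [a], the first
    because [k > 0] makes [m <= n]. *)
Lemma quotient_dvd (m n : nat) : j = n%:Z -> j - k = m%:Z -> a != 0 -> b != 0 ->
  a ^+ m %| b ^+ n.
Proof.
move=> jn jk a0 b0; apply: mup_dvdp; rewrite ?expf_neq0 // => x.
have mupX P l : P != 0 -> mup x (P ^+ l) = (l * mup x P)%N.
  move=> P0; elim: l => [|l IH]; first by rewrite expr0 mupNroot ?root1.
  by rewrite exprS mupM ?expf_neq0 // IH mulSn.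
case: m jk => [|m] jk; first by rewrite expr0 (negPf (root1 x)).
rewrite rootE horner_exp expf_eq0 /= => ax; rewrite !mupX //.
case: (quotient_mup a0 b0 ax) => [h1|]; last by rewrite jk jn; lia.
apply: leq_mul => //; lia.
Qed.

(** The logarithmic derivative of [b^n = c a^m], combined with [Ea], gives [h b' = - m A b]. The
    left side of [Eb] is then 0, hence [k a = 0]. *)
Lemma quotient_const (m n : nat) (c : C) : j = n%:Z -> j - k = m%:Z ->
  b ^+ n = c%:P * a ^+ m -> a = 0.
Proof.
move=> jn jk E; apply/eqP; apply: contraT => a0.
have [b0|b0] := eqVneq b 0.
  move: Eb; rewrite b0 deriv0 !mulr0 addr0 => /esym/eqP.
  by rewrite mulf_eq0 (negPf a0) orbF -(rmorph_int polyC) polyC_eq0 intr_eq0 gt_eqF.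
have bd P l : P * (P ^+ l)^`() = l%:R * P ^+ l * P^`().
  rewrite deriv_exp; case: l => [|l] /=; first by rewrite mulr0n mulr0 !mul0r.
  by rewrite -mulr_natl exprS; ring.
have E1 : n%:R * a * b^`() = m%:R * b * a^`().
  apply: (mulfI (expf_neq0 n b0)).
  transitivity (a * (b * (b ^+ n)^`())); first by rewrite bd; ring.
  rewrite {1}E derivM derivC mul0r add0r.
  transitivity (b * c%:P * (a * (a ^+ m)^`())); first by ring.
  by rewrite bd E; ring.
have hb : h * b^`() = - (m%:R * A * b).
  have n0 : n%:R * a != 0.
    rewrite mulf_neq0 // -polyC_natr polyC_eq0 pnatr_eq0.
    by apply: contraTneq j0 => n0; rewrite jn n0.
  apply: (mulfI n0); transitivity (h * (n%:R * a * b^`())); first by ring.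
  rewrite E1; transitivity (m%:R * b * (j%:~R * A * a + h * a^`()) - m%:R * b * (j%:~R * A * a)).
    by ring.
  by rewrite Ea jn -pmulrn; ring.
move: Eb; rewrite jk hb -pmulrn subrr => /esym/eqP.
by rewrite mulf_eq0 (negPf a0) orbF -(rmorph_int polyC) polyC_eq0 intr_eq0 gt_eqF.
Qed.
End Quotients.

(** For the wedges of two fields with [S], [D] is [p (Y_j /\ X)]. Its equation is [h] times the
    first commutation equation minus [A] times the second. *)
Lemma comm_eqs_wedge2 j k A Y h e : comm_eqs j k A Y h e ->
  let D := Y * h - A * e in j%:~R * A * D + h * D^`() = D * h^`().
Proof.
move=> [E1 E2] D; rewrite /D derivB !derivM; apply/eqP; rewrite -subr_eq0; apply/eqP.
rewrite !intrD !intrN in E1.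
set l1 := (X in X = _) in E1; set r1 := (X in _ = X) in E1.
set l2 := (X in X = _) in E2; set r2 := (X in _ = X) in E2.
transitivity (h * (l1 - r1) - A * (l2 - r2)); first by rewrite /l1 /r1 /l2 /r2; ring.
by rewrite E1 E2 !subrr !mulr0 subrr.
Qed.

(** In degree 0 the Wronskian of [h] and [D = Y h - A e] vanishes, so [D] is a multiple of [h] and
    [h] divides [A e]; it is prime to [A]. *)
Lemma wedge_dvd0 k A Y h e : h != 0 -> (forall t, h.[t] = 0 -> A.[t] <> 0) ->
  comm_eqs 0 k A Y h e -> h %| e.
Proof.
move=> h0 hA /comm_eqs_wedge2 /=; rewrite mul0r mul0r add0r => /(wronskian0 h0)[c hc].
have : h %| A * e.
  have -> : A * e = (Y - c%:P) * h by rewrite mulrBl -hc; ring.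
  exact: dvdp_mulIr.
rewrite Gauss_dvdpr //.
rewrite /coprimep; apply/negPn/negP => /closed_rootP[x].
by rewrite root_gcd => /andP[/eqP /hA Ax /eqP].
Qed.
End Algebra2.

(** * Gluing the charts: commuting homogeneous fields are parallel to [X] *)

Section Algebra3.
Variable R : realType.
Local Notation C := R[i].
Implicit Types (P Q A B Y Z h e a b g : {poly C}) (s t x c : C) (j k m : int).

Section CompatTheory.
Variables (p q : nat).
Hypotheses (p0 : (0 < p)%N) (q0 : (0 < q)%N).

Lemma compat_neg m P1 P2 : m < 0 -> compat p q m P1 P2 -> P1 = 0.
Proof.
move=> m0 h; apply/polyP => l; rewrite coef0; apply/eqP; apply: contraTT m0 => Pl.
by have [i <- _] := compat_coef p0 q0 h Pl.
Qed.

Lemma compat_zero P1 P2 : compat p q 0 P1 P2 -> P1 = (P1`_0)%:P.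
Proof.
move=> h; apply/polyP => -[|l]; rewrite coefC //=.
apply/eqP/negPn/negP => Pl; have [i + _] := compat_coef p0 q0 h Pl.
by move/eqP; rewrite eqz_nat addn_eq0 !muln_eq0 /= orbF andbC -leqn0 leqNgt q0.
Qed.

Lemma compat_eq0 m P1 P2 : compat p q m P1 P2 -> P2 = 0 -> P1 = 0.
Proof.
move=> h P20; apply/polyP => l; rewrite coef0; apply/eqP/negPn/negP => Pl.
by have [i _ E] := compat_coef p0 q0 h Pl; move: Pl; rewrite -E P20 coef0 eqxx.
Qed.

Lemma compatM m m' P1 P2 Q1 Q2 : compat p q m P1 P2 -> compat p q m' Q1 Q2 ->
  compat p q (m + m') (P1 * Q1) (P2 * Q2).
Proof.
by move=> h h' s s0; rewrite !hornerM h // h' // expfzDr //; ring.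
Qed.

Lemma compatC c : compat p q 0 c%:P c%:P.
Proof. by move=> s s0; rewrite !hornerC mul1r. Qed.

Lemma compatX m P1 P2 n : compat p q m P1 P2 -> compat p q (m * n%:Z) (P1 ^+ n) (P2 ^+ n).
Proof.
move=> h; elim: n => [|n IH]; first by rewrite mulr0 !expr0 -polyC1; apply: compatC.
by rewrite !exprS (_ : m * n.+1%:Z = m + m * n%:Z); [exact: compatM | rewrite intS mulrDr mulr1].
Qed.

(** Clears the negative powers of [s] on the right side of [compat]. *)
Lemma laurent m P : exists (N : nat) Q, forall s, s != 0 ->
  Q.[s] = s ^+ N * (s ^ m * P.[s ^- p]).
Proof.
elim/poly_ind: P => [|P c [N [Q hQ]]].
  by exists 0%N, 0 => s _; rewrite !horner0 !mulr0.
have [n [mE]] : exists n : nat, True /\ m + n%:Z >= 0 by exists (absz m); split=> //; lia.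
exists (N + n + p)%N, (Q * 'X^n + c%:P * 'X^(N + p + absz (m + n%:Z))) => s s0.
rewrite hornerMXaddC hornerD !hornerM hornerC !hornerXn hQ //.
have -> : s ^+ (N + p + absz (m + n%:Z)) = s ^+ N * s ^+ p * (s ^ m * s ^+ n).
  rewrite 2!exprD; congr (_ * _).
  by rewrite [s ^+ absz _]exprnP gez0_abs // expfzDr.
rewrite 2!exprD.
have sp : s ^+ p * s ^- p = 1 by rewrite divff // expf_neq0.
transitivity (s ^+ N * s ^+ n * s ^ m * (P.[s ^- p] * (s ^+ p * s ^- p) + c * s ^+ p)).
  by rewrite sp; ring.
by ring.
Qed.

Lemma poly_expX_neq0 P : P != 0 -> P \Po 'X^q != 0.
Proof.
apply: contraNneq => h; apply/eqP; apply: poly_ext => t.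
have := congr1 (fun Q => Q.[q.-root t]) h.
by rewrite horner_comp hornerXn rootCK // !horner0.
Qed.

(** Read as an identity of polynomials in [s], the relation for the products can be divided by the
    nonzero polynomial [Q1(s^q)]. *)
Lemma compat_cancel m m' P1 P2 Q1 Q2 : compat p q (m + m') (P1 * Q1) (P2 * Q2) ->
  compat p q m' Q1 Q2 -> Q1 != 0 -> compat p q m P1 P2.
Proof.
move=> hPQ hQ Q0.
have [N [V hV]] := laurent m P2.
suff E : 'X^N * (P1 \Po 'X^q) = V.
  move=> s s0; apply: (mulfI (expf_neq0 N s0)).
  have := congr1 (fun Q => Q.[s]) E.
  by rewrite hornerM hornerXn horner_comp hornerXn hV.
apply: (mulIf (poly_expX_neq0 Q0)); apply: poly_ext_neq0 => s s0.
rewrite !hornerM !horner_comp !hornerXn hV // -!mulrA -hornerM hPQ // hornerM.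
by rewrite hQ // expfzDr //; ring.
Qed.

(** The minus sign appears because [S /\ X] changes sign when the coordinates are exchanged. *)
Lemma compat_wedge m A1 A2 B1 B2 : compat p q (m + p%:Z) A1 A2 ->
  compat p q (m + q%:Z) B1 B2 ->
  compat p q (m + p%:Z + q%:Z) (wedge p q A1 B1) (- wedge q p B2 A2).
Proof.
move=> hA hB s s0; rewrite /wedge hornerN !hornerD !hornerN !hornerM !horner_nat !hornerX.
rewrite hA // hB //.
have -> : s ^ (m + p%:Z + q%:Z) = s ^ (m + p%:Z) * s ^+ q by rewrite expfzDr.
have sp : s ^ (m + p%:Z) = s ^ m * s ^+ p by rewrite expfzDr.
have sq : s ^ (m + q%:Z) = s ^ m * s ^+ q by rewrite expfzDr.
have s1 : s ^+ p * s ^- p = 1 by rewrite divff // expf_neq0.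
rewrite sp sq.
transitivity (s ^ m * s ^+ q * (p%:R * B2.[s ^- p] * (s ^+ p * s ^- p) - q%:R * s ^+ p * A2.[s ^- p])).
  by rewrite s1; ring.
by ring.
Qed.

Lemma compat_coef0 m P1 P2 : compat p q m P1 P2 -> P2.[0] != 0 ->
  exists2 l, (q * l)%N%:Z = m & P1`_l != 0.
Proof.
move=> /compat_sym h; rewrite horner_coef0 => P20.
have [l hl E] := compat_coef q0 p0 h P20; exists l; last by rewrite E.
by rewrite -hl muln0 addn0.
Qed.
End CompatTheory.

Section MainAlgebra.
Variables (p q : nat) (k : int).
Hypotheses (p0 : (0 < p)%N) (q0 : (0 < q)%N) (k0 : 0 < k).

(* A quasi-homogeneous field without zero outside the origin, in both charts. *)
Definition charts (p q : nat) A1 B1 A2 B2 :=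
  [/\ compat p q (k + p%:Z) A1 A2, compat p q (k + q%:Z) B1 B2,
      no_common_root A1 B1 & no_common_root B2 A2].

Lemma charts_sym A1 B1 A2 B2 : charts p q A1 B1 A2 B2 -> charts q p B2 A2 B1 A1.
Proof. by move=> [hA hB n1 n2]; split=> //; apply: compat_sym. Qed.

(** If [A2(0) != 0], then [A1] has a term [y^l] with [q l = k + p], so [l >= 1]; if [B2(0) != 0],
    then [B1] has one with [q l = k + q], so [l >= 2]. The size bounds exclude both, and 0 would be
    a common root. *)
Lemma charts_const A1 B1 A2 B2 : charts p q A1 B1 A2 B2 ->
  (size A1 <= 1)%N -> (size B1 <= 2)%N -> False.
Proof.
move=> [hA hB _ n2] sA sB.
have A20 : A2.[0] = 0.
  apply/eqP/negPn/negP => /(compat_coef0 p0 q0 hA)[l hl].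
  have l1 : (1 <= l)%N by case: l hl => // hl; lia.
  by rewrite nth_default ?eqxx // (leq_trans sA).
apply: (n2 0) A20; apply/eqP/negPn/negP => /(compat_coef0 p0 q0 hB)[l hl].
have l1 : (2 <= l)%N by case: l hl => [|[|l]] // hl; lia.
by rewrite nth_default ?eqxx // (leq_trans sB).
Qed.

(** Otherwise [X] is parallel to [S]: by [wedge_root] the polynomial [A1] has no root, so it is
    constant, and [p B1 = q t A1] has degree at most 1, against [charts_const]. *)
Lemma charts_wedge_neq0 A1 B1 A2 B2 : charts p q A1 B1 A2 B2 -> wedge p q A1 B1 != 0.
Proof.
move=> ch; have [hA hB n1 n2] := ch; apply/eqP => h0.
have h00 t : (wedge p q A1 B1).[t] = 0 by rewrite h0 horner0.
have sA : (size A1 <= 1)%N.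
  suff : size A1 == 1 by move/eqP ->.
  by apply/negPn/negP => /closed_rootP[x /eqP]; apply: wedge_root (h00 x).
apply: (charts_const ch sA).
have pC : (p%:R : C) != 0 by rewrite pnatr_eq0 -lt0n.
move/eqP: h0; rewrite /wedge subr_eq0 -polyC_natr mul_polyC => /eqP h0.
rewrite -(size_scale B1 pC) h0.
apply: leq_trans (size_polyMleq _ _) _.
have : (size ((q%:R : {poly C}) * 'X)%R <= 2)%N.
  rewrite -polyC_natr mul_polyC; apply: leq_trans (size_scale_leq _ _) _.
  by rewrite size_polyX.
by move=> s2; rewrite -subn1 leq_subLR; apply: leq_trans (leq_add s2 sA) _.
Qed.

(** A negative degree makes [Z1] constant. If it were nonzero, the equations would make [A1]
    constant and [B1] affine, against [charts_const]. *)
Lemma half_zero j A1 B1 A2 B2 Z1 Z2 : charts p q A1 B1 A2 B2 -> j < 0 ->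
  compat p q (j + q%:Z) Z1 Z2 -> comm_eqs j k A1 0 (wedge p q A1 B1) (wedge p q 0 Z1) ->
  Z1 = 0.
Proof.
move=> ch j0 hZ [E1 E2]; apply/eqP; apply: contraT => Z0.
have Zc : Z1 = (Z1`_0)%:P.
  apply/polyP => -[|l]; rewrite coefC //=; apply/eqP/negPn/negP => Zl.
  have [i + _] := compat_coef p0 q0 hZ Zl; lia.
have pC : (p%:R : {poly C}) != 0 by rewrite -polyC_natr polyC_eq0 pnatr_eq0 -lt0n.
have eE : wedge p q 0 Z1 = p%:R * Z1 by rewrite /wedge mulr0 subr0.
have e0 : wedge p q 0 Z1 != 0 by rewrite eE mulf_neq0.
have dA : A1^`() = 0.
  apply: (mulfI e0); rewrite mulr0 -E1 deriv0; ring.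
have de : (wedge p q 0 Z1)^`() = 0.
  by rewrite eE Zc -polyC_natr -polyCM derivC.
have dh : (wedge p q A1 B1)^`() = j%:~R * A1.
  apply: (mulfI e0); move: E2; rewrite de mulr0 addr0 !(mulr0, mul0r) add0r => <-; ring.
have coef_deriv0 (P : {poly C}) n : (P^`())`_n = 0 -> P`_n.+1 = 0.
  by rewrite coef_deriv => /eqP; rewrite mulrn_eq0 /= => /eqP.
have sA : (size A1 <= 1)%N.
  by apply/leq_sizeP => -[//|l] _; apply: coef_deriv0; rewrite dA coef0.
case: (charts_const ch sA); apply/leq_sizeP => -[|[|l]] // _.
apply: coef_deriv0; have : p%:R * B1^`() = (j%:~R + q%:R) * A1.
  move: dh; rewrite deriv_wedge dA mulr0 subr0 => dh.
  rewrite mulrDl -dh; ring.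
rewrite (_ : (j%:~R + q%:R : {poly C}) = (j%:~R + q%:R : C)%:P); last first.
  by rewrite polyCD polyC_natr (rmorph_int polyC).
rewrite -polyC_natr => /(congr1 (fun P => P`_l.+1)); rewrite !coefCM.
rewrite (nth_default 0 (leq_trans sA _)) // mulr0 => /eqP.
by rewrite mulf_eq0 pnatr_eq0 -leqn0 leqNgt p0 => /eqP.
Qed.

(** If [Y1] is a nonzero constant, its wedge with [S] is affine with a root [x]. The first equation
    gives [A1(x) = 0] and the second makes the wedge of [X] vanish at [x], which [wedge_root]
    forbids. *)
Lemma half_const j A1 B1 A2 B2 Y1 Z1 : charts p q A1 B1 A2 B2 -> j < 0 ->
  comm_eqs j k A1 Y1 (wedge p q A1 B1) (wedge p q Y1 Z1) ->
  (size Y1 <= 1)%N -> (size Z1 <= 1)%N -> Y1 = 0.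
Proof.
move=> [hA hB n1 n2] j0 [E1 E2] /size1_polyC Yc /size1_polyC Zc.
apply/eqP; apply: contraT; rewrite Yc polyC_eq0; set c := Y1`_0 in Yc *.
set z := Z1`_0 in Zc; rewrite Yc Zc in E1 E2 => c0.
have qC : (q%:R : C) != 0 by rewrite pnatr_eq0 -lt0n.
pose x := p%:R * z / (q%:R * c).
have ex : (wedge p q c%:P z%:P).[x] = 0.
  rewrite /wedge hornerD hornerN !hornerM !horner_nat hornerX !hornerC /x.
  by field; rewrite qC c0.
have de : (wedge p q c%:P z%:P)^`() = (- (q%:R * c))%:P.
  by rewrite deriv_wedge !derivC polyCN polyCM polyC_natr; ring.
have Ax : A1.[x] = 0.
  move/(congr1 (fun P => P.[x])): E1; rewrite derivC mulr0 addr0 !hornerM ex mul0r.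
  rewrite horner_int hornerC => /eqP; rewrite !mulf_eq0 (negPf c0) orbF intr_eq0.
  by case/orP => /eqP //; lia.
have hx : (wedge p q A1 B1).[x] = 0.
  have := congr1 (fun P => P.[x]) E2; move: ex Ax.
  move: (wedge p q A1 B1) (wedge p q c%:P z%:P) de => h e de ex Ax.
  rewrite de !hornerD !hornerM Ax ex !hornerC !horner_int.
  rewrite !(mulr0, mul0r, add0r, addr0) => /eqP; rewrite -subr_eq0.
  rewrite (_ : _ - _ = - ((q%:R + k%:~R) * c * h.[x])); last by ring.
  rewrite oppr_eq0 !mulf_eq0 (negPf c0) orbF => /orP[|/eqP//].
  by rewrite pmulrn -intrD intr_eq0; lia.
by case: (wedge_root p0 n1 hx).
Qed.
End MainAlgebra.

Section Final.
Variables (p q : nat) (k j : int) (A1 B1 A2 B2 Y1 Y2 Z1 Z2 : {poly C}).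
Hypotheses (p0 : (0 < p)%N) (q0 : (0 < q)%N) (k0 : 0 < k).
Hypotheses (ch : charts k p q A1 B1 A2 B2).
Hypotheses (hY : compat p q (j + p%:Z) Y1 Y2) (hZ : compat p q (j + q%:Z) Z1 Z2).
Let h1 := wedge p q A1 B1.
Let h2 := wedge q p B2 A2.
Let e1 := wedge p q Y1 Z1.
Let e2 := wedge q p Z2 Y2.
Hypotheses (ce1 : comm_eqs j k A1 Y1 h1 e1) (ce2 : comm_eqs j k B2 Z2 h2 e2).

(** When [Y1] and [Z2] are nonzero, the weights leave only [Y_j = (c y^l, c' x^i)] with
    [q l = j + p] and [p i = j + q]. Both exponents positive would mean [q < p] and [p < q]; so one
    is 0, and [half_const] applies in the corresponding chart. *)
Lemma commuting_neg : j < 0 -> Y1 = 0 /\ Z1 = 0.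
Proof.
move=> j0; have ch' := charts_sym ch.
have ZY : Y1 = 0 -> Z1 = 0.
  by move=> Y0; move: ce1; rewrite /e1 Y0; exact: (half_zero p0 q0 k0 ch j0 hZ).
have YZ : Z2 = 0 -> Y2 = 0.
  move=> Z0; move: ce2; rewrite /e2 Z0.
  exact: (half_zero q0 p0 k0 ch' j0 (compat_sym hY)).
have [Y0|Y0] := eqVneq Y1 0; first by split=> //; exact: ZY.
have [Z20|Z20] := eqVneq Z2 0.
  by case/eqP: Y0; apply: (compat_eq0 p0 q0 hY); apply: YZ.
have Yl l : Y1`_l != 0 -> (q * l)%N%:Z = j + p%:Z.
  move=> Yl; have [i hi _] := compat_coef p0 q0 hY Yl.
  have i0 : i = 0%N by case: i hi => // i; nia.
  by rewrite -hi i0 muln0.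
have Zi i : Z2`_i != 0 -> (p * i)%N%:Z = j + q%:Z.
  move=> Zi; have [l hl _] := compat_coef q0 p0 (compat_sym hZ) Zi.
  have l0 : l = 0%N by case: l hl => // l; nia.
  by rewrite -hl l0 muln0.
have Y2c : (size Y2 <= 1)%N.
  apply/leq_sizeP => -[//|i] _; apply/eqP/negPn/negP => Y2i.
  have [l + _] := compat_coef q0 p0 (compat_sym hY) Y2i; nia.
have Z1c : (size Z1 <= 1)%N.
  apply/leq_sizeP => -[//|l] _; apply/eqP/negPn/negP => Z1l.
  have [i + _] := compat_coef p0 q0 hZ Z1l; nia.
have lcY : Y1`_(size Y1).-1 != 0 by rewrite -lead_coefE lead_coef_eq0.
have lcZ : Z2`_(size Z2).-1 != 0 by rewrite -lead_coefE lead_coef_eq0.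
have := Yl _ lcY; have := Zi _ lcZ.
have sY : (0 < size Y1)%N by rewrite size_poly_gt0.
have sZ : (0 < size Z2)%N by rewrite size_poly_gt0.
move=> e2' e1'.
have [Y1c|Y1c] := leqP (size Y1) 1.
  by case/eqP: Y0; exact: (half_const p0 q0 k0 ch j0 ce1 Y1c Z1c).
have [Z2c|Z2c] := leqP (size Z2) 1.
  by case/eqP: Z20; exact: (half_const q0 p0 k0 ch' j0 ce2 Z2c Y2c).
exfalso; nia.
Qed.

Hypothesis node1 : 0 < j -> forall t, h1.[t] = 0 -> e1.[t] = 0.
Hypothesis node2 : 0 < j -> forall t, h2.[t] = 0 -> e2.[t] = 0.

Theorem commuting_parallel : Y1 * B1 = Z1 * A1.
Proof.
have pC : (p%:R : {poly C}) != 0 by rewrite -polyC_natr polyC_eq0 pnatr_eq0 -lt0n.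
have [j0|j0] := ltP j 0.
  by have [-> ->] := commuting_neg j0; rewrite !mul0r.
have ch' := charts_sym ch.
have h10 : h1 != 0 := charts_wedge_neq0 p0 q0 k0 ch.
have h20 : h2 != 0 := charts_wedge_neq0 q0 p0 k0 ch'.
have [hA hB n1 n2] := ch.
have hA1 t : h1.[t] = 0 -> A1.[t] <> 0 := wedge_root p0 n1 (t := t).
have hB2 t : h2.[t] = 0 -> B2.[t] <> 0 := wedge_root q0 n2 (t := t).
have [hd1 hd2] : h1 %| e1 /\ h2 %| e2.
  move: j0; rewrite le_eqVlt => /orP[/eqP jz|jpos].
    by split; [apply: (@wedge_dvd0 R k A1 Y1) | apply: (@wedge_dvd0 R k B2 Z2)] => //; rewrite jz.
  by split; [apply: (wedge_dvd hA1 ce1) | apply: (wedge_dvd hB2 ce2)] => //;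
    [rewrite gt_eqF | exact: node1 | rewrite gt_eqF | exact: node2].
have /dvdpP[b1 e1E] := hd1; have /dvdpP[b2 e2E] := hd2.
have [Ea1 Eb1] := quotient_eqs ce1 h10 e1E; have [Ea2 Eb2] := quotient_eqs ce2 h20 e2E.
set a1 := Y1 - A1 * b1 in Ea1 Eb1; set a2 := Z2 - B2 * b2 in Ea2 Eb2.
suff a10 : a1 = 0.
  apply: (mulfI pC); have Yb : Y1 = A1 * b1 by apply/eqP; rewrite -subr_eq0 -/a1 a10.
  have : p%:R * (Y1 * B1 - Z1 * A1) = Y1 * h1 - A1 * e1 by rewrite /h1 /e1 /wedge; ring.
  rewrite e1E {2}Yb => E; apply/eqP; rewrite -subr_eq0 -mulrBr E; apply/eqP; ring.
(* [b] is the quotient of two wedges, of weights [j + p + q] and [k + p + q]. *)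
have cb : compat p q (j - k) b1 b2.
  apply: (compat_cancel p0 q0 (m' := k + p%:Z + q%:Z) (Q1 := h1) (Q2 := - h2)) => //.
    rewrite (_ : j - k + _ = j + p%:Z + q%:Z); last by ring.
    by rewrite mulrN -e1E -e2E; exact: compat_wedge.
  exact: compat_wedge.
(* [a1] and [a2] are [p] and [q] times the coefficient [c] of [S], so the factors [q] and [p] turn
   them into restrictions of [p q c]. The weight is read on [q c y], the second component of
   [c S]. *)
have ca : compat p q j (q%:R%:P * a1) (p%:R%:P * a2).
  have cX : compat p q q%:Z 'X 1 by move=> s s0; rewrite hornerX hornerC mulr1.
  have cZb : compat p q (j + q%:Z) (Z1 - b1 * B1) (Z2 - b2 * B2).
    move=> s s0; have := compatM cb hB s0; rewrite (_ : j - k + (k + q%:Z) = j + q%:Z); last by ring.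
    by rewrite !hornerD !hornerN => ->; rewrite hZ // mulrBr.
  apply: (compat_cancel p0 q0 (m' := q%:Z) (Q1 := 'X) (Q2 := 1)) => //; last by rewrite polyX_eq0.
  have -> : q%:R%:P * a1 * 'X = p%:R%:P * (Z1 - b1 * B1).
    rewrite !polyC_natr /a1; move: e1E; rewrite /e1 /h1 /wedge => E.
    apply/eqP; rewrite -subr_eq0; apply/eqP.
    transitivity (b1 * (p%:R * B1 - q%:R * 'X * A1) - (p%:R * Z1 - q%:R * 'X * Y1)); first by ring.
    by rewrite E subrr.
  rewrite mulr1 (_ : a2 = Z2 - b2 * B2); last by rewrite /a2 mulrC.
  by have := compatM (compatC p q p%:R) cZb; rewrite add0r.
have [b10|b10] := eqVneq b1 0.
  move: Eb1; rewrite b10 deriv0 !mulr0 addr0 => /esym/eqP.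
  by rewrite mulf_eq0 -(rmorph_int polyC) polyC_eq0 intr_eq0 gt_eqF //= => /eqP.
have [jk|jk] := ltP (j - k) 0; first by rewrite (compat_neg p0 q0 jk cb) eqxx in b10.
have jpos : 0 < j by lia.
apply/eqP; apply: contraT => a10.
have pC' : (p%:R : C) != 0 by rewrite pnatr_eq0 -lt0n.
have qC' : (q%:R : C) != 0 by rewrite pnatr_eq0 -lt0n.
have b20 : b2 != 0 by apply: contraNneq b10 => b20; exact/eqP/(compat_eq0 p0 q0 cb).
have a20 : a2 != 0.
  apply: contraNneq a10 => a20; have := compat_eq0 p0 q0 ca; rewrite a20 mulr0 => /(_ erefl).
  by move/eqP; rewrite mulf_eq0 polyC_eq0 (negPf qC').
pose n := absz j; pose m := absz (j - k).
have jn : j = n%:Z by rewrite /n gez0_abs // ltW.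
have jm : j - k = m%:Z by rewrite /m gez0_abs.
have /dvdpP[w1 w1E] := quotient_dvd jpos k0 hA1 Ea1 Eb1 jn jm a10 b10.
have /dvdpP[w2 w2E] := quotient_dvd jpos k0 hB2 Ea2 Eb2 jn jm a20 b20.
pose c : C := p%:R ^+ m * q%:R ^+ m.
(* The quotient of [b^n] by [a^m] has weight [(j - k) n - j m = 0]; the powers of [p] and [q]
   compensate the normalisation of [a1] and [a2]. *)
have cw : compat p q 0 ((p%:R ^+ m)%:P * w1) ((q%:R ^+ m)%:P * w2).
  apply: (compat_cancel p0 q0 (m' := j * m%:Z) (Q1 := (q%:R%:P * a1) ^+ m)
    (Q2 := (p%:R%:P * a2) ^+ m)).
  - have -> : (p%:R ^+ m)%:P * w1 * (q%:R%:P * a1) ^+ m = c%:P * b1 ^+ n.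
      by rewrite w1E exprMn /c polyCM -polyC_exp mulrACA.
    have -> : (q%:R ^+ m)%:P * w2 * (p%:R%:P * a2) ^+ m = c%:P * b2 ^+ n.
      by rewrite w2E exprMn /c polyCM -polyC_exp [in RHS](mulrC (_ %:P)) mulrACA.
    have := compatM (compatC p q c) (compatX n cb).
    by congr compat; rewrite !add0r jm -jn mulrC.
  - exact: compatX.
  - by rewrite expf_neq0 // mulf_neq0 // polyC_eq0.
have wc := compat_zero p0 q0 cw.
have pm : (p%:R ^+ m : C) != 0 by rewrite expf_neq0.
have w1c : w1 = (((p%:R ^+ m)%:P * w1)`_0 / p%:R ^+ m)%:P.
  apply: (mulfI (_ : (p%:R ^+ m)%:P != 0)); first by rewrite polyC_eq0.
  by rewrite {1}wc -polyCM [_ * (_ / _)]mulrC divfK.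
rewrite w1c in w1E.
by case/eqP: a10; exact: (quotient_const jpos k0 Ea1 Eb1 jn jm w1E).
Qed.
End Final.
End Algebra3.

(** * Branches of algebraic functions and descent to powers *)

Section OneVariable.
Variable R : realType.
Local Notation C := R[i].
Implicit Types (z w s t x v : C) (f g : C -> C) (e r K : R) (P Q D V : {poly C}).

Definition cnear z (A : C -> Prop) :=
  exists2 d : R, 0 < d & forall w, cnorm (w - z) < d -> A w.

Lemma cnearI z A B : cnear z A -> cnear z B -> cnear z (fun w => A w /\ B w).
Proof.
move=> [d d0 hA] [d' d'0 hB]; exists (Num.min d d'); first by rewrite lt_min d0.
by move=> w; rewrite lt_min => /andP[? ?]; split; [apply: hA | apply: hB].
Qed.

Lemma cnearS z (A B : C -> Prop) : (forall w, A w -> B w) -> cnear z A -> cnear z B.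
Proof. by move=> AB [d d0 h]; exists d => // w /h /AB. Qed.

Lemma cnear_ball z e : 0 < e -> cnear z (fun w => cnorm (w - z) < e).
Proof. by move=> e0; exists e. Qed.

Lemma cnear_near z A : cnear z A -> cnear z (fun w => cnear w A).
Proof.
move=> [d d0 h]; exists (d / 2); first by rewrite divr_gt0.
move=> w wz; exists (d / 2); first by rewrite divr_gt0.
by move=> u uw; apply: h; have := cnormDl u w z; lra.
Qed.

Lemma cnear_at z A : cnear z A -> A z.
Proof. by move=> [d d0]; apply; rewrite subrr cnorm0. Qed.

Lemma cnear_cont f z A : ccont f z -> cnear (f z) A -> cnear z (fun w => A (f w)).
Proof.
move=> hf [d d0 h]; have [d' d'0 h'] := hf (d / 2) (divr_gt0 d0 (ltr0Sn _ 1)).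
by exists d' => // w /h' wz; apply: h; lra.
Qed.

Lemma cnear_cderiv f z l A : cderiv f z l -> cnear (f z) A -> cnear z (fun w => A (f w)).
Proof. by move=> /cderiv_cont; apply: cnear_cont. Qed.

Lemma cnear_value f z l e : cderiv f z l -> 0 < e -> cnear z (fun w => cnorm (f w - f z) < e).
Proof. by move=> hf e0; apply: (cnear_cderiv hf (cnear_ball (f z) e0)). Qed.

Definition cholo f := cnear 0 (fun z => exists l, cderiv f z l).

Lemma choloP (f : C1 R -> C1 R) : holomorphic_germ f <-> cholo f.
Proof.
split=> [/near_CP|] h; first by apply: cnearS h => w /differentiable1P.
by apply/near_CP; apply: cnearS h => w /differentiable1P.
Qed.

Lemma cderiv_near_eq f g z l : cnear z (fun w => f w = g w) -> cderiv f z l -> cderiv g z l.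
Proof. by move=> [d d0 h]; apply: cderiv_ext d0 h. Qed.

(** With a contour of radius [d/2], the ratio [2 |w| / (d/2)] of [taylor] equals [|w| / (2 r)] for
    [r = d/8], so it stays below [1/2]. *)
Lemma cholo_taylor f : cholo f -> exists (c : nat -> C) r K,
  [/\ 0 < r, 0 <= K & forall N w, cnorm w <= r ->
    cnorm (f w - \sum_(n < N) c n * w ^+ n) <= K * (cnorm w / (2 * r)) ^+ N].
Proof.
move=> hf; have [l hl] := cnear_at hf.
have [d d0 hd] := cnearI hf (cnear_cderiv hl (cnear_ball (f 0) ltr01)).
pose v : C := (d / 2)%:C%C.
have nv : cnorm v = d / 2 by rewrite cnorm_real ger0_norm // divr_ge0 // ltW.
have v0 : v != 0 by rewrite -cnorm_gt0 nv divr_gt0.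
exists (fun n => tcoef v n f), (d / 8), (16 * (cnorm (f 0) + 1)); split.
- by rewrite divr_gt0.
- by rewrite mulr_ge0 // addr_ge0 ?cnorm_ge0.
move=> N w wd; rewrite (_ : cnorm w / _ = 2 * cnorm w / cnorm v); last first.
  by rewrite nv; field; rewrite gt_eqF.
have hz z : cnorm z <= cnorm v -> cnorm (z - 0) < d by rewrite subr0 nv => zv; lra.
apply: taylor => //.
- by move=> z /hz /hd[].
- by move=> z /hz /hd[_ h]; have := cnorm_le_D (f z) (f 0); lra.
- by rewrite nv; lra.
Qed.

Lemma taylor_zero f r K : 0 < r -> 0 <= K ->
  (forall N w, cnorm w <= r -> cnorm (f w) <= K * (cnorm w / (2 * r)) ^+ N) ->
  cnear 0 (fun w => f w = 0).
Proof.
move=> r0 K0 h; exists r => // w; rewrite subr0 => wr.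
apply/eqP; rewrite -cnorm_eq0 eq_le cnorm_ge0 andbT; apply/ler_addgt0Pl => e e0.
have [N hN] := expr_half_lt e0 K0.
rewrite addr0; apply: le_trans (h N w (ltW wr)) _; apply: le_trans (ltW hN).
have ge0 : 0 <= cnorm w / (2 * r) by rewrite divr_ge0 ?cnorm_ge0 // mulr_ge0 // ltW.
have le_half : cnorm w / (2 * r) <= 1 / 2 by rewrite ler_pdivrMr ?mulr_gt0 //; lra.
by apply: ler_wpM2l => //; apply: lerXn2r; rewrite ?nnegrE //; lra.
Qed.

(** At the first nonzero Taylor coefficient [c n], the term [c n * w ^+ n] dominates the remainder,
    which has order [n + 1]. *)
Lemma cholo_zero_or f : cholo f ->
  cnear 0 (fun w => f w = 0) \/ cnear 0 (fun w => w != 0 -> f w != 0).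
Proof.
move=> /cholo_taylor[c [r [K [r0 K0 h]]]].
have [call|] := pselect (forall n, c n = 0).
  left; apply: (taylor_zero r0 K0) => N w /(h N).
  by rewrite big1 ?subr0 // => i _; rewrite call mul0r.
move=> /existsNP[n0 /eqP hn0]; right.
have exn : exists n, c n != 0 by exists n0.
case: (ex_minnP exn) => n cn hmin; have cn0 : 0 < cnorm (c n) by rewrite cnorm_gt0.
pose K' := K / (2 * r) ^+ n.+1 + 1; have K'0 : 0 < K'.
  by rewrite ltr_wpDl // divr_ge0 // exprn_ge0 // mulr_ge0 // ltW.
exists (Num.min r (cnorm (c n) / K')); first by rewrite lt_min r0 divr_gt0.
move=> w; rewrite subr0 lt_min => /andP[wr wc] w0; apply/eqP => fw.
have := h n.+1 w (ltW wr); rewrite big_ord_recr big1 /= => [|i _]; last first.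
  apply/eqP; rewrite mulf_eq0; apply/orP; left; apply/negPn/negP => /hmin.
  by rewrite leqNgt ltn_ord.
rewrite fw !add0r cnormN cnormM cnormX exprMn exprVn => H.
have wn : 0 < cnorm w ^+ n by rewrite exprn_gt0 // cnorm_gt0.
have : cnorm (c n) * cnorm w ^+ n <= K' * cnorm w * cnorm w ^+ n.
  apply: le_trans H _; rewrite /K' exprS.
  have := cnorm_ge0 w; move: (cnorm w) wn => u wn u0; have := mulr_ge0 u0 (ltW wn).
  move: (u ^+ n) (_ ^- n.+1) => a b; lra.
rewrite ler_pM2r // => H2; move: wc; rewrite ltr_pdivlMr // mulrC; lra.
Qed.

Lemma cholo_flat f : cholo f ->
  (forall N, exists K r, 0 < r /\
    forall t, t != 0 -> cnorm t < r -> cnorm (f t) <= K * cnorm t ^+ N) ->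
  cnear 0 (fun w => f w = 0).
Proof.
move=> /cholo_taylor[c [r [K [r0 K0 h]]]] flat.
have c0 n : c n = 0.
  have [K1 [r1 [r10 h1]]] := flat n.+1.
  have : (\poly_(i < n.+1) c i)`_n = 0.
    apply: (@poly_small _ _ n.+1 (K1 + K / (2 * r) ^+ n.+1) (Num.min r r1)) => //.
      by rewrite lt_min r0.
    move=> t t0; rewrite lt_min horner_poly => /andP[/ltW /h ht /(h1 _ t0) ht1].
    have := ht n.+1; rewrite cnormB exprMn exprVn [_ * (2 * r) ^- _]mulrC mulrA => ht'.
    have := cnorm_le_D (\sum_(i < n.+1) c i * t ^+ i) (f t); rewrite mulrDl; lra.
  by rewrite coef_poly ltnSn.
apply: (taylor_zero r0 K0) => N w /(h N).
by rewrite big1 ?subr0 // => i _; rewrite c0 mul0r.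
Qed.

(** The logarithmic derivative at [t] is the sum of [1/(t - x)] over the roots [x]. If all of them,
    at most [N] in number, were farther than [rho], it would be bounded by [N / rho], half of its
    actual norm. *)
Lemma near_root P t (N : nat) : P^`().[t] != 0 -> (size P <= N.+1)%N ->
  exists2 x, P.[x] = 0 & cnorm (x - t) <= 2 * N%:R * (cnorm P.[t] / cnorm P^`().[t]).
Proof.
move=> dP sP; have [Pt|Pt] := eqVneq P.[t] 0.
  by exists t => //; rewrite subrr cnorm0 Pt cnorm0 mul0r mulr0.
have [s Ps] := closed_field_poly_normal P.
have P0 : P != 0 by apply: contraNneq Pt => ->; rewrite horner0.
have lc0 : lead_coef P != 0 by rewrite lead_coef_eq0.
have log_deriv (l : seq C) : (forall x, x \in l -> t != x) ->
    (\prod_(x <- l) ('X - x%:P))^`().[t] =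
    (\prod_(x <- l) ('X - x%:P)).[t] * \sum_(x <- l) (t - x)^-1.
  elim: l => [|x l IH] hl; first by rewrite !big_nil derivC horner0 mulr0.
  rewrite !big_cons derivM derivXsubC mul1r hornerD !hornerM hornerXsubC IH; last first.
    by move=> y yl; apply: hl; rewrite inE yl orbT.
  have : t - x != 0 by rewrite subr_eq0; apply: hl; rewrite inE eqxx.
  by move=> tx; field.
have ts x : x \in s -> t != x.
  move=> xs; apply: contraNneq Pt => ->; rewrite Ps hornerZ horner_prod.
  by rewrite (big_rem x xs) /= hornerXsubC subrr mul0r mulr0.
have ss : (size s <= N)%N by move: sP; rewrite Ps size_scale // size_prod_XsubC.
set rho := _ * _; have [[x xs hx]|no] := pselect (exists2 x, x \in s & cnorm (x - t) <= rho).
  exists x => //; rewrite Ps hornerZ horner_prod (big_rem x xs) /= hornerXsubC subrr.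
  by rewrite mul0r mulr0.
have dP0 : 0 < cnorm P^`().[t] by rewrite cnorm_gt0.
have Pt0 : 0 < cnorm P.[t] by rewrite cnorm_gt0.
have E : P^`().[t] = P.[t] * \sum_(x <- s) (t - x)^-1.
  by rewrite Ps derivZ !hornerZ log_deriv // mulrA.
have rho0 : 0 <= rho by rewrite !mulr_ge0 // ?invr_ge0 ltW.
have [N0|N0] := posnP N.
  move: ss; rewrite N0 leqn0 => /nilP s0; move: E; rewrite s0 big_nil mulr0 => E.
  by rewrite E eqxx in dP.
have rhoP : 0 < rho by rewrite !mulr_gt0 // ?invr_gt0 // ltr0n.
have : cnorm (\sum_(x <- s) (t - x)^-1) <= N%:R * rho^-1.
  apply: le_trans (cnorm_sum _ _ _) _.
  apply: (@le_trans _ _ (\sum_(x <- s) rho^-1)).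
    rewrite big_seq [leRHS]big_seq; apply: ler_sum => x xs; rewrite cnormV.
    have : rho < cnorm (t - x).
      by rewrite cnormB ltNge; apply/negP => hx; apply: no; exists x.
    by move=> hx; rewrite lef_pV2 ?posrE ?ltW // (lt_trans rhoP).
  rewrite (_ : \sum_(x <- s) _ = (size s)%:R * rho^-1); last first.
    by rewrite big_const_seq count_predT iter_addr_0 mulr_natl.
  by apply: ler_wpM2r; rewrite ?invr_ge0 // ler_nat.
move=> H; have := congr1 (@cnorm R) E; rewrite cnormM => E2.
have : cnorm P^`().[t] <= cnorm P.[t] * (N%:R * rho^-1).
  by rewrite E2; apply: ler_wpM2l H; exact: ltW.
rewrite /rho; have NR : (N%:R : R) != 0 by rewrite pnatr_eq0 -lt0n.
rewrite (_ : cnorm P.[t] * (_ * _) = cnorm P^`().[t] / 2); first by clear -dP0; lra.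
by field; rewrite NR !gt_eqF.
Qed.

(** Strict differentiability: the estimate is uniform in both points, which is what makes the branch
    of [pencil_branch] Lipschitz. *)
Lemma poly_strict P t e : 0 < e -> exists2 d, 0 < d & forall x y,
  cnorm (x - t) < d -> cnorm (y - t) < d ->
  cnorm (P.[x] - P.[y] - P^`().[t] * (x - y)) <= e * cnorm (x - y).
Proof.
elim/poly_ind: P e => [|P c IH] e e0.
  exists 1 => // x y _ _; rewrite !horner0 deriv0 horner0 subrr mul0r subrr cnorm0.
  by rewrite mulr_ge0 ?cnorm_ge0 // ltW.
have B0 : 0 < cnorm t + 1 by have := cnorm_ge0 t; lra.
pose e1 := e / 3 / (cnorm t + 1).
have e10 : 0 < e1 by rewrite !divr_gt0.
have [d1 d10 h1] := IH _ e10.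
pose B2 := cnorm P^`().[t] + 1; have B20 : 0 < B2 by have := cnorm_ge0 P^`().[t]; rewrite /B2; lra.
have d20 : 0 < e / 3 / B2 by rewrite !divr_gt0.
have e30 : 0 < e / 3 by rewrite divr_gt0.
have [d3 d30 h3] : cnear t (fun y => cnorm (P.[y] - P.[t]) <= e / 3).
  exact: (cderiv_cont (cderiv_horner P t) e30).
exists (Num.min (Num.min d1 1) (Num.min (e / 3 / B2) d3)).
  by rewrite !lt_min d10 ltr01 d20.
move=> x y; rewrite !lt_min => /andP[/andP[x1 x2] /andP[x3 x4]].
move=> /andP[/andP[y1 y2] /andP[y3 y4]].
rewrite !hornerMXaddC derivD derivM derivX derivC addr0 mulr1 hornerD hornerM hornerX.
set a := P.[x] in h1 *.
rewrite (_ : _ - _ = (a - P.[y] - P^`().[t] * (x - y)) * x +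
  P^`().[t] * (x - y) * (x - t) + (P.[y] - P.[t]) * (x - y)); last by ring.
apply: le_trans (cnormD3 _ _ _) _; rewrite !cnormM.
have nxy := cnorm_ge0 (x - y); have nx : cnorm x <= cnorm t + 1.
  by have := cnorm_le_D x t; lra.
have t1 : cnorm (a - P.[y] - P^`().[t] * (x - y)) * cnorm x <= e / 3 * cnorm (x - y).
  apply: le_trans (ler_pM (cnorm_ge0 _) (cnorm_ge0 _) (h1 x y x1 y1) nx) _.
  rewrite /e1 le_eqVlt; apply/orP; left; apply/eqP; field; rewrite gt_eqF //.
have t2 : cnorm P^`().[t] * cnorm (x - y) * cnorm (x - t) <= e / 3 * cnorm (x - y).
  rewrite mulrAC; apply: ler_wpM2r => //.
  apply: (@le_trans _ _ (B2 * (e / 3 / B2))).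
    by apply: ler_pM; rewrite ?cnorm_ge0 // /B2 ?ltW //; lra.
  by rewrite mulrC divfK // gt_eqF.
have t3 : cnorm (P.[y] - P.[t]) * cnorm (x - y) <= e / 3 * cnorm (x - y).
  by apply: ler_wpM2r => //; apply: h3.
lra.
Qed.

Lemma cderiv_slope f g z : ccont g z -> cnear z (fun w => f w - f z = (w - z) * g w) ->
  cderiv f z (g z).
Proof.
move=> hg hf e e0; have [d d0 h] := cnearI (hg e e0) hf; exists d => // w /h[h1 h2].
rewrite h2 [g z * _]mulrC -mulrBr cnormM mulrC.
by apply: ler_wpM2r => //; exact: cnorm_ge0.
Qed.

Lemma cderiv_div f g z l m : cderiv f z l -> cderiv g z m -> g z != 0 ->
  exists k, cderiv (fun w => f w / g w) z k.
Proof.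
move=> hf hg g0; have := cderiv_comp hg (cderiv_inv g0).
by move=> /(cderivM hf); eexists; eassumption.
Qed.

Lemma cnear_neq0 f z l : cderiv f z l -> f z != 0 -> cnear z (fun w => f w != 0).
Proof.
move=> hf f0; apply: (@cnear_cderiv f z l (fun u => u != 0) hf); exists (cnorm (f z)); first by rewrite cnorm_gt0.
by move=> w; apply: contraTneq => ->; rewrite sub0r cnormN ltxx.
Qed.

(** An implicit function theorem through roots of polynomials. [near_root] places a root of
    [Q - s D] at distance [O(s)] from [t0]; one is chosen for each [s], and strict differentiability
    at [t0] makes the choice Lipschitz, then holomorphic. *)
Lemma pencil_branch Q D t0 : Q.[t0] = 0 -> Q^`().[t0] != 0 -> exists T : C -> C,
  T 0 = t0 /\
  cnear 0 (fun s => Q.[T s] = s * D.[T s] /\ exists l, cderiv T s l).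
Proof.
move=> Q0 dQ; set q := cnorm Q^`().[t0].
have q0 : 0 < q by rewrite cnorm_gt0.
pose P s := Q - s%:P * D.
have PE s t : (P s).[t] = Q.[t] - s * D.[t] by rewrite !hornerE.
have dPE s t : (P s)^`().[t] = Q^`().[t] - s * D^`().[t].
  by rewrite derivB derivM derivC mul0r add0r !hornerE.
pose N := maxn (size Q) (size D).
have sP s : (size (P s) <= N.+1)%N.
  apply: leq_trans (size_polyD _ _) _; rewrite size_polyN geq_max.
  rewrite mul_polyC (leq_trans (leq_maxl _ _) (leqnSn _)) /=.
  by apply: leq_trans (size_scale_leq _ _) _; apply: leq_trans (leq_maxr _ _) (leqnSn _).
pose d' := cnorm D^`().[t0]; have d'0 : 0 <= d' := cnorm_ge0 _.
(* For [|s| < r1] the derivative of [Q - s D] at [t0] keeps norm at least [q / 2]. *)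
pose r1 := q / (2 * (d' + 1)); have r10 : 0 < r1 by rewrite divr_gt0 // mulr_gt0 //; lra.
pose K := 2 * N%:R * (cnorm D.[t0] / (q / 2)).
have K0 : 0 <= K by rewrite !mulr_ge0 ?cnorm_ge0 // invr_ge0 divr_ge0 // ltW.
have /choice[T hT] s : exists t, cnorm s < r1 -> Q.[t] = s * D.[t] /\ cnorm (t - t0) <= K * cnorm s.
  have [sr|sr] := ltP (cnorm s) r1; last by exists 0.
  have dP : q / 2 <= cnorm (P s)^`().[t0].
    have := cnorm_le_D Q^`().[t0] (s * D^`().[t0]); rewrite dPE cnormM -/q -/d'.
    have : cnorm s * d' <= r1 * (d' + 1).
      by apply: ler_pM; rewrite ?cnorm_ge0 // ?ltW //; lra.
    by rewrite (_ : r1 * (d' + 1) = q / 2) /r1; [lra | field; rewrite gt_eqF //; lra].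
  have dP0 : (P s)^`().[t0] != 0 by rewrite -cnorm_gt0; lra.
  have [x Px hx] := near_root dP0 (sP s); exists x => _; split.
    by apply/eqP; rewrite -subr_eq0 -PE Px.
  apply: le_trans hx _; rewrite PE Q0 sub0r cnormN cnormM /K.
  rewrite -[leRHS]mulrA; apply: ler_wpM2l; first by rewrite mulr_ge0.
  rewrite [leRHS]mulrC mulrA; apply: ler_wpM2l.
    by rewrite mulr_ge0 ?cnorm_ge0.
  by rewrite lef_pV2 ?posrE //; lra.
have TC s : cnorm s < r1 -> cnorm (T s - t0) <= K * cnorm s by move=> /hT[].
have T0 : T 0 = t0.
  apply/eqP; rewrite -subr_eq0 -cnorm_eq0 eq_le cnorm_ge0 andbT.
  by have := TC 0; rewrite cnorm0 mulr0; apply.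
exists T; split => //.
have [dQ0 dQ00 hQ] := poly_strict Q t0 (divr_gt0 q0 (ltr0Sn _ 3)).
have [dD0 dD00 hD] := poly_strict D t0 ltr01.
have [dM dM0 hM] : cnear t0 (fun t => cnorm (D.[t] - D.[t0]) < 1).
  exact: cnear_value (cderiv_horner D t0) ltr01.
have [dq dq0 hq] : cnear t0 (fun t => cnorm (Q^`().[t] - Q^`().[t0]) < q / 4).
  exact: cnear_value (cderiv_horner Q^`() t0) (divr_gt0 q0 (ltr0Sn _ 3)).
have [dd dd0 hd] : cnear t0 (fun t => cnorm (D^`().[t] - D^`().[t0]) < 1).
  exact: cnear_value (cderiv_horner D^`() t0) ltr01.
pose dl := Num.min (Num.min dQ0 dD0) (Num.min dM (Num.min dq dd)).
have dl0 : 0 < dl by rewrite !lt_min dQ00 dD00 dM0 dq0.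
(* Small enough for [T s] to stay in the ball where the strict estimates hold, and for the
   perturbation by [s D] to cost at most [q / 4]. *)
pose r2 := Num.min r1 (Num.min (dl / (K + 1)) (q / (4 * (d' + 1)))).
have r20 : 0 < r2.
  have K1 : 0 < K + 1 by lra.
  have d1 : 0 < 4 * (d' + 1) by lra.
  by rewrite !lt_min r10 !divr_gt0.
have r2P s : cnorm s < r2 ->
    [/\ cnorm s < r1, cnorm s < dl / (K + 1) & cnorm s < q / (4 * (d' + 1))].
  by rewrite 2!lt_min => /and3P.
have near_t s : cnorm s < r2 -> cnorm (T s - t0) < dl.
  move=> /r2P[s1 s2 _]; apply: le_lt_trans (TC s s1) _; move: s2; rewrite ltr_pdivlMr; last by lra.
  by have := cnorm_ge0 s; lra.
have small s : cnorm s < r2 -> cnorm s * (d' + 1) <= q / 4.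
  move=> /r2P[_ _]; rewrite ltr_pdivlMr; last by rewrite mulr_gt0 //; lra.
  lra.
have eqT s : cnorm s < r2 -> Q.[T s] = s * D.[T s].
  by move=> /r2P[/hT[]].
pose M := cnorm D.[t0] + 1; have M0 : 0 < M by have := cnorm_ge0 D.[t0]; rewrite /M; lra.
have lip s s1 : cnorm s < r2 -> cnorm s1 < r2 ->
    q / 2 * cnorm (T s - T s1) <= M * cnorm (s - s1).
  move=> sr s1r; have := near_t _ sr; have := near_t _ s1r; rewrite !lt_min.
  move=> /andP[/andP[a1 a2] /andP[a3 _]] /andP[/andP[b1 b2] /andP[b3 _]].
  have E : Q^`().[t0] * (T s - T s1) = (s - s1) * D.[T s] +
      s1 * (D.[T s] - D.[T s1] - D^`().[t0] * (T s - T s1)) + s1 * (D^`().[t0] * (T s - T s1)) -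
      (Q.[T s] - Q.[T s1] - Q^`().[t0] * (T s - T s1)).
    by rewrite !eqT //; ring.
  have := congr1 (@cnorm R) E; rewrite cnormM -/q => E2.
  have := cnormD4 ((s - s1) * D.[T s])
    (s1 * (D.[T s] - D.[T s1] - D^`().[t0] * (T s - T s1))) (s1 * (D^`().[t0] * (T s - T s1)))
    (- (Q.[T s] - Q.[T s1] - Q^`().[t0] * (T s - T s1))).
  rewrite -E2 cnormN !cnormM -/d'.
  have := hQ _ _ b1 a1; have := hD _ _ b2 a2.
  have nM : cnorm D.[T s] <= M.
    by have := hM _ b3; have := cnorm_le_D D.[T s] D.[t0]; rewrite /M; lra.
  have := small _ s1r; have := cnorm_ge0 (T s - T s1); have := cnorm_ge0 s1.
  have := ler_wpM2l (cnorm_ge0 (s - s1)) nM.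
  move: (cnorm (T s - T s1)) (cnorm s1) (cnorm (s - s1)) (cnorm D.[T s]) => X a b c.
  move: (cnorm (_ - _)) (cnorm (_ - _)) => U V h1 a0 X0 h2 h3 h4 h5.
  have := ler_wpM2l a0 h3; have := ler_wpM2r X0 h2; lra.
exists r2 => // s1; rewrite subr0 => s1r; split; first exact: eqT.
(* Dividing [Q - s1 D] by its root [T s1] makes the slope explicit:
   [(T s - T s1) V(T s) = (s - s1) D(T s)]. *)
have /factor_theorem[V PV] : root (P s1) (T s1) by rewrite /root PE eqT // subrr.
have dPV : (P s1)^`().[T s1] = V.[T s1].
  by rewrite PV derivM derivXsubC mulr1 hornerD hornerM hornerXsubC subrr mulr0 add0r.
have V0 : V.[T s1] != 0.
  rewrite -dPV dPE -cnorm_gt0.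
  have := near_t _ s1r; rewrite !lt_min => /andP[_ /andP[_ /andP[a1 a2]]].
  have := small _ s1r; have := hq _ a1; have := hd _ a2.
  have := cnorm_le_D D^`().[T s1] D^`().[t0]; rewrite -/d'.
  have := cnorm_le_D Q^`().[t0] Q^`().[T s1]; rewrite -/q (cnormB Q^`().[t0]).
  have := cnorm_le_D Q^`().[T s1] (s1 * D^`().[T s1]); rewrite cnormM.
  move=> h1 h2 h3 h4 h5 h6; have := cnorm_ge0 s1 => h7.
  have : cnorm s1 * cnorm D^`().[T s1] <= cnorm s1 * (d' + 1) by apply: ler_wpM2l => //; lra.
  lra.
have [k hk] := cderiv_div (cderiv_horner D (T s1)) (cderiv_horner V (T s1)) V0.
have Tc : ccont T s1.
  move=> e e0; exists (Num.min (r2 - cnorm s1) (e * (q / 2) / M)).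
    by rewrite lt_min subr_gt0 s1r !mulr_gt0 // ?invr_gt0 //; lra.
  move=> w; rewrite lt_min => /andP[w1 w2].
  have wr : cnorm w < r2 by have := cnorm_le_D w s1; lra.
  have := lip _ _ wr s1r; move: w2; rewrite ltr_pdivlMr // => w2 h.
  rewrite -(ler_pM2l (_ : 0 < q / 2)); lra.
exists (D.[T s1] / V.[T s1]).
apply: (@cderiv_slope T (fun s => D.[T s] / V.[T s])).
  move=> e e0; have [d d0 h] := cnear_cont Tc (cderiv_cont hk e0).
  by exists d.
have hV := cnear_cont Tc (cnear_neq0 (cderiv_horner V (T s1)) V0).
have near_s : cnear s1 (fun w => cnorm w < r2).
  exists (r2 - cnorm s1); first by rewrite subr_gt0.
  by move=> w ws; have := cnorm_le_D w s1; lra.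
apply: cnearS (cnearI hV near_s) => s [Vs sr].
have : (P s1).[T s] = (s - s1) * D.[T s] by rewrite PE eqT // mulrBl.
rewrite PV hornerM hornerXsubC mulrA => <-.
by rewrite [V.[_] * _]mulrC mulfK.
Qed.

Lemma nth_root_branch N x0 s0 : (0 < N)%N -> x0 != 0 -> s0 ^+ N = x0 ->
  exists sg : C -> C, sg x0 = s0 /\
    cnear x0 (fun x => sg x ^+ N = x /\ exists l, cderiv sg x l).
Proof.
move=> N0 x00 hs; have s00 : s0 != 0.
  by apply: contraNneq x00 => s0E; rewrite -hs s0E expr0n -leqn0 leqNgt N0.
have [||T [T0 [r r0 hT]]] := @pencil_branch ('X^N - x0%:P) 1 s0.
- by rewrite hornerD hornerN hornerXn hornerC hs subrr.
- by rewrite derivB derivXn derivC subr0 hornerMn hornerXn -mulr_natl mulf_neq0 ?expf_neq0 ?pnatr_eq0 -?lt0n.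
exists (fun x => T (x - x0)); split; first by rewrite subrr.
exists r => // x xr; have [h [l hl]] := hT (x - x0) ltac:(by rewrite subr0); split.
  move: h; rewrite hornerD hornerN hornerXn !hornerC mulr1 => /eqP.
  by rewrite subr_eq subrK => /eqP.
by exists l; apply: (@cderiv_shift _ T x (- x0)).
Qed.
End OneVariable.

(** * Descent of invariant functions through [t |-> t^d] *)

Section Descent.
Variable R : realType.
Local Notation C := R[i].
Implicit Types (z w s t x v : C) (f g : C -> C) (e r K : R) (P Q : {poly C}).

Lemma unity_roots N : (0 < N)%N -> exists l : seq C,
  [/\ 'X^N - 1 = \prod_(x <- l) ('X - x%:P), uniq l & size l = N].
Proof.
move=> N0; have mX : ('X^N - 1 : {poly C}) \is monic by apply: monicXnsubC.
have [l] := closed_field_poly_normal ('X^N - 1 : {poly C}).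
rewrite (monicP mX) scale1r => El; exists l; split => //.
  by rewrite -(@separable_prod_XsubC C l) -El separable_Xn_sub_1 // pnatr_eq0 -lt0n.
by apply: succn_inj; rewrite -(size_prod_XsubC l id) -El -polyC1 size_XnsubC.
Qed.

Lemma unity_rootsP N (l : seq C) : 'X^N - 1 = \prod_(x <- l) ('X - x%:P) ->
  forall x, (x \in l) = (x ^+ N == 1).
Proof.
move=> E x; rewrite -(root_prod_XsubC l x) -E /root.
by rewrite hornerD hornerN hornerXn -polyC1 hornerC subr_eq0.
Qed.

Lemma taylor_bound f : cholo f -> exists (c : nat -> C) r,
  0 < r /\ forall N, exists2 K, 0 <= K & forall w, cnorm w <= r ->
    cnorm (f w - \sum_(n < N) c n * w ^+ n) <= K * cnorm w ^+ N.
Proof.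
move=> /cholo_taylor[c [r [K [r0 K0 h]]]]; exists c, r; split => // N.
have h2 : 0 <= (2 * r) ^+ N by rewrite exprn_ge0 // mulr_ge0 // ltW.
exists (K / (2 * r) ^+ N); first by rewrite divr_ge0.
move=> w /(h N); rewrite exprMn exprVn; congr (_ <= _); ring.
Qed.

Lemma horner_sum_coef (c : nat -> C) N t :
  (\poly_(n < N) c n).[t] = \sum_(n < N) c n * t ^+ n.
Proof. by rewrite horner_poly. Qed.

Lemma root_small d t x r : (0 < d)%N -> 0 < r -> t ^+ d = x -> cnorm x < r ^+ d -> cnorm t < r.
Proof.
move=> d0 r0 <-; rewrite cnormX ltr_pXn2r // ?nnegrE ?cnorm_ge0 //; exact: ltW.
Qed.

(** [g] is [f] after the chosen [d]-th root; invariance makes the value independent of the choice,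
    so off 0 a holomorphic local branch may be substituted. At 0, only [c 0 + c d * t ^+ d] is left
    of the expansion up to order [d + 1], which gives the derivative [c d]. *)
Lemma descent d f : (0 < d)%N -> cholo f ->
  cnear 0 (fun t => forall x, x ^+ d = 1 -> f (x * t) = f t) ->
  exists2 g, cholo g & cnear 0 (fun t => f t = g (t ^+ d)).
Proof.
move=> d0 hf hinv; have [c [rc [rc0 hc]]] := taylor_bound hf.
have [r1 r10 h1] := cnearI hf hinv.
have same t u : cnorm t < r1 -> u ^+ d = t ^+ d -> f u = f t.
  move=> tr ud; have [t0|t0] := eqVneq t 0.
    by move: ud; rewrite t0 expr0n gtn_eqF // => /eqP; rewrite expf_eq0 d0 => /eqP ->.
  have [_] := h1 t ltac:(by rewrite subr0); move=> /(_ (u / t)).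
  by rewrite expr_div_n ud divff ?expf_neq0 // divfK //; apply.
pose g x := f (d.-root x).
have gE t : cnorm t < r1 -> f t = g (t ^+ d).
  by move=> tr; rewrite /g (same t) // rootCK.
exists g; last by exists r1 => // t; rewrite subr0; exact: gE.
(* [X^n - 1] has fewer roots than there are [d]-th roots of unity, so some [x] satisfies [x^d = 1]
   and [x^n != 1]; comparing the expansions at [t] and [x t] kills [c n]. *)
have c0 n : (0 < n)%N -> (n < d)%N -> c n = 0.
  move=> n0 nd; have [l [lE lu ls]] := unity_roots d0.
  have : exists2 x : C, x ^+ d = 1 & x ^+ n != 1.
    apply: contrapT => no; move: nd; rewrite ltnNge => /negP; apply.
    have := @max_poly_roots _ ('X^n - 1 : {poly C}) l.
    rewrite -polyC1 size_XnsubC // ls ltnS; apply => //.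
      by rewrite -size_poly_eq0 size_XnsubC.
    apply/allP => x xl; rewrite /root hornerD hornerN hornerXn hornerC subr_eq0.
    apply/negPn/negP => xn; apply: no; exists x => //.
    by move: xl; rewrite (unity_rootsP lE) => /eqP.
  move=> [x xd xn]; have [K K0 hK] := hc d.+1.
  have nx : cnorm x = 1.
    apply/eqP; rewrite -(@pexpr_eq1 _ _ d) ?cnorm_ge0 // -cnormX xd cnorm1 //.
  have : (\poly_(n < d.+1) (c n * (x ^+ n - 1)))`_n = 0.
    apply: (@poly_small _ _ d.+1 (K + K) (Num.min rc r1)); last exact: leqW.
      by rewrite lt_min rc0.
    move=> t t0; rewrite lt_min => /andP[/ltW t1 t2]; rewrite horner_sum_coef.
    have xt : cnorm (x * t) = cnorm t by rewrite cnormM nx mul1r.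
    have := hK (x * t); have := hK _ t1; rewrite xt => H1 /(_ t1) H2.
    have [_ hx] := h1 t ltac:(by rewrite subr0).
    have -> : \sum_(i < d.+1) c i * (x ^+ i - 1) * t ^+ i =
      (f t - \sum_(i < d.+1) c i * t ^+ i) - (f (x * t) - \sum_(i < d.+1) c i * (x * t) ^+ i).
      have sub_sub (a b y : C) : a - b - (a - y) = y - b by ring.
      rewrite (hx _ xd) sub_sub -sumrB.
      by apply: eq_bigr => i _; rewrite exprMn; ring.
    apply: le_trans (cnormD _ _) _; rewrite cnormN mulrDl; exact: lerD.
  rewrite coef_poly leqW // => /eqP; rewrite mulf_eq0 subr_eq0 (negPf xn) orbF.
  by move/eqP.
have [K K0 hK] := hc d.+1.
have expand t : \sum_(n < d.+1) c n * t ^+ n = c 0%N + c d * t ^+ d.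
  case: (d) d0 c0 => // m _ c0; rewrite big_ord_recr big_ord_recl expr0 mulr1 big1 => [|i _]; last first.
    by rewrite c0 ?mul0r //; exact: (ltn_ord i).
  by rewrite /= addr0.
have root0 : d.-root (0 : C) = 0 by apply: rootC0.
have g0 : g 0 = c 0%N.
  rewrite /g root0; apply/eqP; rewrite -subr_eq0 -cnorm_eq0 eq_le cnorm_ge0 andbT.
  have := hK 0; rewrite cnorm0 expand !expr0n /= gtn_eqF // !mulr0 addr0; apply; exact: ltW.
exists (r1 ^+ d); first exact: exprn_gt0.
move=> x; rewrite subr0 => xr; have [x0|x0] := eqVneq x 0; last first.
  have sr : cnorm (d.-root x) < r1 := root_small d0 r10 (rootCK d0 x) xr.
  have [sg [sgx hsg]] := nth_root_branch d0 x0 (rootCK d0 x).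
  have [hs [ls hls]] := cnear_at hsg.
  have [lf hlf] : exists l, cderiv f (sg x) l.
    by rewrite sgx; have [] := h1 (d.-root x) ltac:(by rewrite subr0).
  exists (lf * ls); apply: (cderiv_near_eq _ (cderiv_comp hls hlf)).
  have hb : cnear (sg x) (fun u => cnorm u < r1).
    rewrite sgx; exists (r1 - cnorm (d.-root x)); first by rewrite subr_gt0.
    by move=> u hu; have := cnorm_le_D u (d.-root x); lra.
  apply: cnearS (cnearI hsg (cnear_cderiv hls hb)) => u [[hu _] ur].
  by rewrite gE // hu.
exists (c d) => e e0; rewrite x0 g0.
pose e1 := Num.min rc (e / (K + 1)).
have e10 : 0 < e1 by rewrite lt_min rc0 divr_gt0 //; lra.
exists (e1 ^+ d); first exact: exprn_gt0.
move=> w; rewrite subr0 => we; have := root_small d0 e10 (rootCK d0 w) we.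
rewrite lt_min => /andP[u1]; rewrite ltr_pdivlMr; last by lra.
move=> u2; have := hK _ (ltW u1); rewrite expand rootCK // opprD addrA => h.
apply: le_trans h _; rewrite exprS mulrA -cnormX rootCK //.
apply: ler_wpM2r; first exact: cnorm_ge0.
have := cnorm_ge0 (d.-root w); lra.
Qed.

Lemma divide_power M f K r : 0 < r -> cholo f ->
  (forall t, t != 0 -> cnorm t < r -> cnorm (f t) <= K * cnorm t ^+ M) ->
  exists2 g, cholo g & cnear 0 (fun t => t != 0 -> f t = t ^+ M * g t).
Proof.
move=> r0 hf hb; have [c [rc [rc0 hc]]] := taylor_bound hf.
have cM n : (n < M)%N -> c n = 0.
  move=> nM; have [K1 K10 hK] := hc M.
  have : (\poly_(n < M) c n)`_n = 0.
    apply: (@poly_small _ _ M (K + K1) (Num.min rc r)) nM; first by rewrite lt_min rc0.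
    move=> t t0; rewrite lt_min horner_sum_coef => /andP[/ltW t1 t2].
    have := hK _ t1; rewrite cnormB => h.
    have := cnorm_le_D (\sum_(i < M) c i * t ^+ i) (f t); have := hb _ t0 t2.
    by rewrite mulrDl; lra.
  by rewrite coef_poly nM.
have [K1 K10 hK] := hc M.+2.
pose g t := if t == 0 then c M else f t / t ^+ M.
have gE t : t != 0 -> f t = t ^+ M * g t.
  by move=> t0; rewrite /g (negPf t0) mulrC divfK // expf_neq0.
exists g; last by exists r => // t _; exact: gE.
have [d d0 hd] := hf; exists d => // t /hd[l hl]; have [t0|t0] := eqVneq t 0; last first.
  have := cderiv_div hl (cderivX M (cderiv_id t)) (expf_neq0 M t0) => -[k hk].
  exists k; apply: cderiv_near_eq hk.
  apply: cnearS (cnear_neq0 (cderiv_id t) t0) => u u0.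
  by rewrite /g (negPf u0).
exists (c M.+1) => e e0; rewrite t0.
exists (Num.min rc (e / (K1 + 1))); first by rewrite lt_min rc0 divr_gt0 //; lra.
move=> w; rewrite subr0 lt_min => /andP[w1]; rewrite ltr_pdivlMr; last by lra.
move=> w2; have g0 : g 0 = c M by rewrite /g eqxx.
have [w0|w0] := eqVneq w 0; first by rewrite w0 mulr0 subr0 subrr cnorm0 mulr0.
rewrite g0; have := hK _ (ltW w1); rewrite 2!big_ord_recr big1 /= => [|i _]; last first.
  by rewrite cM ?mul0r.
rewrite add0r gE // (_ : _ - _ = w ^+ M * (g w - c M - c M.+1 * w)); last first.
  by rewrite exprS; ring.
rewrite cnormM cnormX -addn2 exprD [in leRHS]mulrCA ler_pM2l; last first.
  by rewrite exprn_gt0 // cnorm_gt0.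
move=> h; apply: le_trans h _; rewrite expr2 mulrA; apply: ler_wpM2r; first exact: cnorm_ge0.
have := cnorm_ge0 w; lra.
Qed.
End Descent.

(** * Separatrices *)

Section Separatrix.
Variable R : realType.
Local Notation C := R[i].
Implicit Types (z w : C2 R) (s t x v u : C) (f : C -> C) (e r K : R) (P Q : {poly C}).

Lemma cnear_all (l : seq C) (z : C) (A : C -> C -> Prop) : (forall x, x \in l -> cnear z (A x)) ->
  cnear z (fun u => forall x, x \in l -> A x u).
Proof.
elim: l => [|a l IH] h; first by exists 1.
have [||d d0 hd] := @cnearI R z (A a) (fun u => forall x, x \in l -> A x u).
- by apply: h; rewrite inE eqxx.
- by apply: IH => x xl; apply: h; rewrite inE xl orbT.
exists d => // w /hd[h1 h2] x; rewrite inE => /orP[/eqP -> //|]; exact: h2.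
Qed.

Lemma cnear_ord (n : nat) (z : C) (A : nat -> C -> Prop) : (forall i, cnear z (A i)) ->
  cnear z (fun u => forall i, (i < n)%N -> A i u).
Proof.
move=> h; elim: n => [|n IH]; first by exists 1.
apply: cnearS (cnearI IH (h n)) => w [h1 h2] i; rewrite ltnS leq_eqVlt => /orP[/eqP -> //|].
exact: h1.
Qed.

Lemma cnear_neq (z : C) (A : C -> Prop) : cnear z A -> exists2 w, w != z & A w.
Proof.
move=> [d d0 h]; exists (z + (d / 2)%:C%C).
  by rewrite -subr_eq0 addrC addKr -cnorm_gt0 cnorm_real gtr0_norm ?divr_gt0.
by apply: h; rewrite addrC addKr cnorm_real gtr0_norm ?divr_gt0 //; lra.
Qed.

Lemma near_fst z (A : C -> Prop) : cnear z.1 A -> \forall w \near z, A w.1.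
Proof. by move=> [d d0 h]; apply/near_C2P; exists d => // w w1 _; apply: h. Qed.

Lemma near_snd z (A : C -> Prop) : cnear z.2 A -> \forall w \near z, A w.2.
Proof. by move=> [d d0 h]; apply/near_C2P; exists d => // w _ w2; apply: h. Qed.

Lemma differentiable_fst_comp f z l : cderiv f z.1 l ->
  differentiable (fun w : C2 R => f w.1 : C1 R) z.
Proof.
move=> h; apply: (@differentiable_comp _ _ _ _ (fst : C2 R -> C1 R) (f : C1 R -> C1 R)).
  exact: differentiable_fst.
by apply/differentiable1P; exists l.
Qed.

Variables (X : C2 R -> C2 R) (N : nat) (eta eta1 : C -> C).
Hypotheses (N0 : (0 < N)%N) (eta0 : eta 0 = 0).
Hypothesis heta : cnear 0 (fun s => cderiv eta s (eta1 s)).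

(** The image of a Puiseux parametrisation, which need not be injective. *)
Definition curve : set (C2 R) := [set z | exists2 s, s ^+ N = z.1 & z.2 = eta s].

Let gam s := pt (s ^+ N) (eta s).

Lemma curve_gam s : curve (gam s). Proof. by exists s. Qed.

Lemma near_gam s (P : C2 R -> Prop) : (exists l, cderiv eta s l) ->
  (\forall z \near gam s, P z) -> cnear s (fun t => P (gam t)).
Proof.
move=> [l hl] /near_C2P[d d0 h].
apply: cnearS (cnearI (cnear_value (cderivX N (cderiv_id s)) d0) (cnear_value hl d0)).
by move=> t [h1 h2]; apply: h.
Qed.

Lemma near0_gam (P : C2 R -> Prop) : (\forall z \near (0 : C2 R), P z) ->
  cnear 0 (fun t => P (gam t)).
Proof.
move=> h; apply: near_gam; first by have := cnear_at heta; exists (eta1 0).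
by rewrite /gam eta0 expr0n gtn_eqF.
Qed.

Lemma near_param (A : C -> Prop) : cnear 0 A ->
  \forall z \near (0 : C2 R), forall s, s ^+ N = z.1 -> A s.
Proof.
move=> [d d0 h]; apply/near_C20P; exists (d ^+ N); first exact: exprn_gt0.
move=> w w1 _ s /root_small sw; apply: h; rewrite subr0; exact: (sw d).
Qed.

Lemma cnear_rot (l : seq C) (A : C -> Prop) : (forall x, x \in l -> cnorm x = 1) ->
  cnear 0 A -> cnear 0 (fun s => forall x, x \in l -> A (x * s)).
Proof.
move=> hl [d d0 h]; exists d => // s; rewrite subr0 => sd x /hl hx.
by apply: h; rewrite subr0 cnormM hx mul1r.
Qed.

Lemma norm_unity x : x ^+ N = 1 -> cnorm x = 1.
Proof.
by move=> xN; apply/eqP; rewrite -(@pexpr_eq1 _ _ N) ?cnorm_ge0 // -cnormX xN cnorm1.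
Qed.

Lemma coef_prod_deriv (l : seq C) (h : C -> C -> C) s :
  (forall x, x \in l -> exists k, cderiv (h x) s k) ->
  forall i, exists k, cderiv (fun t => (\prod_(x <- l) ('X - (h x t)%:P))`_i) s k.
Proof.
elim: l => [|a l IH] hl i.
  exists 0; have -> : (fun t => (\prod_(x <- [::]) ('X - (h x t)%:P))`_i) = (fun=> (1 : {poly C})`_i).
    by apply/funext => t; rewrite big_nil.
  exact: cderiv_cst.
have [k hk] := hl a ltac:(by rewrite inE eqxx).
have {}IH : forall i, exists k, cderiv (fun t => (\prod_(x <- l) ('X - (h x t)%:P))`_i) s k.
  by apply: IH => x xl; apply: hl; rewrite inE xl orbT.
have [k2 hk2] := IH i; have hM := cderivM hk hk2; case: i hk2 hM => [|i] hk2 hM.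
  have -> : (fun t => (\prod_(x <- a :: l) ('X - (h x t)%:P))`_0) =
    (fun t => - (h a t * (\prod_(x <- l) ('X - (h x t)%:P))`_0)).
    by apply/funext => t; rewrite big_cons mulrBl coefB coefXM coefCM sub0r.
  by have := cderivN hM; eexists; eassumption.
have -> : (fun t => (\prod_(x <- a :: l) ('X - (h x t)%:P))`_i.+1) =
  (fun t => (\prod_(x <- l) ('X - (h x t)%:P))`_i - h a t * (\prod_(x <- l) ('X - (h x t)%:P))`_i.+1).
  by apply/funext => t; rewrite big_cons mulrBl coefB coefXM coefCM.
have [k1 hk1] := IH i; by have := cderivB hk1 hM; eexists; eassumption.
Qed.

(** The product of [y - eta(x s)] over the [N]-th roots of unity [x] has coefficients invariant
    under these roots. By [descent] they are holomorphic in [s^N], and the product becomes an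
    equation in the two coordinates. *)
Lemma curve_equation : curve_germ curve.
Proof.
have [l [lE lu ls]] := unity_roots R N0; have lP := unity_rootsP lE.
have l1 x : x \in l -> cnorm x = 1 by rewrite lP => /eqP/norm_unity.
pose P s := \prod_(x <- l) ('X - (eta (x * s))%:P).
have holo i : cholo (fun s => (P s)`_i).
  have hr : cnear 0 (fun s => forall x, x \in l -> exists k, cderiv eta (x * s) k).
    apply: (@cnear_rot l (fun u => exists k, cderiv eta u k)) => //.
    by apply: cnearS heta => s hs; exists (eta1 s).
  apply: cnearS hr => s hs; apply: (@coef_prod_deriv l (fun x s => eta (x * s))) => x /hs[k hk].
  by exists (k * x); apply: cderiv_comp hk; have := cderivZ x (cderiv_id s); rewrite mulr1.
have inv i s x : x ^+ N = 1 -> (P (x * s))`_i = (P s)`_i.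
  move=> xN; have x0 : x != 0 by apply/eqP => x0; move: (norm_unity xN); rewrite x0 cnorm0 => /esym/eqP; rewrite oner_eq0.
  have pl : perm_eq [seq y * x | y <- l] l.
    apply: uniq_perm => //; first by rewrite map_inj_uniq //; exact: mulIf.
    move=> y; rewrite lP; apply/mapP/idP => [[u + ->]|/eqP yN].
      by rewrite lP exprMn xN mulr1.
    by exists (y / x); rewrite ?divfK // lP expr_div_n yN xN divr1.
  suff -> : P (x * s) = P s by [].
  rewrite /P -[RHS](perm_big _ pl) /= big_map.
  by apply: eq_bigr => y _; rewrite mulrA.
have /choice[phi hphi] i : exists g, cholo g /\ cnear 0 (fun t => (P t)`_i = g (t ^+ N)).
  have [|g hg1 hg2] := descent N0 (holo i); last by exists g.
  by exists 1 => // t _ x xN; exact: inv.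
pose g z : C1 R := \sum_(i < N.+1) phi i z.1 * z.2 ^+ i.
have gP : \forall z \near (0 : C2 R), g z = 0 <-> curve z.
  have := near_param (cnear_ord N.+1 (fun i => (hphi i).2)); apply: filterS => z hz.
  have sz : (N.-root z.1) ^+ N = z.1 := rootCK N0 z.1.
  set s := N.-root z.1 in sz; have {}hz := hz s sz.
  have -> : g z = \prod_(x <- l) (z.2 - eta (x * s)).
    have -> : g z = (P s).[z.2].
      rewrite (@horner_coef_wide _ N.+1) ?size_prod_XsubC ?ls //.
      by apply: eq_bigr => i _; rewrite hz // sz.
    by rewrite horner_prod; apply: eq_bigr => x _; rewrite hornerXsubC.
  split=> [/eqP|[s' s'N z2]].
    rewrite prodf_seq_eq0 => /hasP[x xl /=]; rewrite subr_eq0 => /eqP z2.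
    by exists (x * s) => //; rewrite exprMn sz; move: xl; rewrite lP => /eqP ->; rewrite mul1r.
  apply/eqP; rewrite prodf_seq_eq0; apply/hasP; have [s0|s0] := eqVneq s 0.
    exists 1; first by rewrite lP expr1n.
    rewrite /= subr_eq0 mul1r s0 z2; move: s'N; rewrite -sz s0 expr0n gtn_eqF // => /eqP.
    by rewrite expf_eq0 N0 => /eqP ->.
  exists (s' / s); first by rewrite lP expr_div_n s'N sz divff // -sz expf_neq0.
  by rewrite /= divfK // z2 subrr.
have g0 : g 0 = 0.
  by apply/(nbhs_singleton gP); exists 0; rewrite ?expr0n ?gtn_eqF.
exists g; split => //.
- have hh : cnear 0 (fun t => forall i, (i < N.+1)%N -> exists k, cderiv (phi i) t k).
    by apply: cnear_ord => i; have [] := hphi i.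
  have := near_fst (z := 0 : C2 R) hh; apply: filterS => z hz.
  apply: differentiable_bigsum => i _; apply: differentiable_mul.
    by have [k hk] := hz i (ltn_ord i); exact: differentiable_fst_comp hk.
  exact: differentiable_exp (differentiable_snd z).
(* Were the equation identically zero, the curve would fill a neighbourhood of 0; but it meets the
   axis [x = 0] only at the origin. *)
- move=> gz; have /near_C20P[d d0 h] : \forall z \near (0 : C2 R), curve z.
    by apply: filterS2 gP gz => z h1 h2; apply/h1.
  have [y y0 yd] := cnear_neq (cnear_ball (0 : C) d0).
  have [s /= /eqP] : curve (pt 0 y).
    by apply: h; rewrite /= ?cnorm0 //; move: yd; rewrite subr0.
  by rewrite expf_eq0 N0 => /eqP ->; rewrite eta0 => y00; rewrite y00 eqxx in y0.
- by apply: filterS gP => z h; apply/propext; rewrite -h.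
Qed.

(** Pulled back to the parameter, an analytic germ either contains the curve or avoids it off the
    origin, by isolation of zeros. Two germs of the second kind cannot cover the curve. *)
Lemma curve_irreducible : irreducible_germ curve.
Proof.
have zero_or A : analytic_germ A -> cnear 0 (fun s => A (gam s)) \/
    cnear 0 (fun s => s != 0 -> ~ A (gam s)).
  move=> [n [g [hg hA]]].
  have hol i : cholo (fun s => g i (gam s)).
    apply: cnearS (cnearI (near0_gam (hg i)) heta) => s [h1 h2].
    have := @cderiv_curve _ (g i) (fun u => u ^+ N) eta s _ _ h1 (cderivX N (cderiv_id s)) h2.
    by eexists; eassumption.
  have hA' := near0_gam hA.
  have [all0|] := pselect (forall i, cnear 0 (fun s => g i (gam s) = 0)).
    left; have h : cnear 0 (fun s => forall i, g i (gam s) = 0).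
      case: n g hg hA hol hA' all0 => [|n] g _ _ _ _ all0; first by exists 1 => // w _ [].
      apply: cnearS (cnear_ord n.+1 (fun i => all0 (inord i))) => s h i.
      by have := h i (ltn_ord i); rewrite inord_val.
    by apply: cnearS (cnearI h hA') => s [h1 ->].
  move=> /existsNP[i hi]; right; have [//|h] := cholo_zero_or (hol i).
  by apply: cnearS (cnearI h hA') => s [h1 ->] s0 /(_ i) /eqP; apply/negP/h1.
move=> A1 A2 h1 h2 hA.
have side A B : germ_eq curve (fun z => A z \/ B z) -> cnear 0 (fun s => A (gam s)) -> germ_eq curve A.
  move=> hAB /near_param hs; have {}hAB : \forall z \near (0 : C2 R), curve z = (A z \/ B z) := hAB.
  apply: filterS2 hAB hs => z E h.
  apply/propext; split=> [[s sN z2]|Az]; last by rewrite E; left.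
  by rewrite (_ : z = gam s); [exact: h|case: z {E h} sN z2 => a b /= <- ->].
have [c1|c1] := zero_or _ h1; first by left; apply: side hA c1.
have [c2|c2] := zero_or _ h2.
  right; apply: (side A2 A1 _ c2); rewrite /germ_eq in hA *; apply: filterS hA => z ->; apply/propext.
  by split=> -[h|h]; [right|left|right|left].
have [s s0 [[a1 a2] a3]] := cnear_neq (cnearI (cnearI c1 c2) (near0_gam hA)).
have [h|h] : (A1 `|` A2) (gam s) by rewrite -a3; exact: curve_gam.
  by case: (a1 s0 h).
by case: (a2 s0 h).
Qed.

(** At a point of parameter [s0 != 0] the equation is [y = eta(sg x)], where [sg] is a local branch
    of the [N]-th root. Branches twisted by a root of unity coincide with it if they pass through
    the point, and otherwise stay away by continuity. *)
Lemma curve_regular : regular_outside_0 curve.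
Proof.
have [l [lE lu ls]] := unity_roots R N0; have lP := unity_rootsP lE.
have l1 x : x \in l -> cnorm x = 1 by rewrite lP => /eqP/norm_unity.
have h_eta : cnear 0 (fun s => exists k, cderiv eta s k).
  by apply: cnearS heta => s hs; exists (eta1 s).
have hrot := cnear_rot l1 h_eta.
(* [eta (x * t) - eta t] either vanishes near 0 or has no small zero except 0; so an equality at one
   small [t != 0] extends to a neighbourhood. *)
have hsame : cnear 0 (fun t => forall x, x \in l -> t != 0 -> eta (x * t) = eta t ->
    cnear t (fun u => eta (x * u) = eta u)).
  apply: cnear_all => x xl.
  have hol : cholo (fun t => eta (x * t) - eta t).
    apply: cnearS (cnearI hrot h_eta) => t [/(_ x xl)[k hk] [k' hk']].
    exists (k * x - k'); apply: cderivB hk'; apply: cderiv_comp hk.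
    by have := cderivZ x (cderiv_id t); rewrite mulr1.
  have [h|h] := cholo_zero_or hol.
    apply: cnearS (cnear_near h) => t ht _ _; apply: cnearS ht => u /eqP.
    by rewrite subr_eq0 => /eqP.
  by apply: cnearS h => t ht t0 E; have := ht t0; rewrite E subrr eqxx.
suff : \forall z \near (0 : C2 R), z != 0 -> curve z -> exists h, local_equation curve z h.
  by rewrite /regular_outside_0 /dnbhs near_withinE.
have := near_param (cnearI hsame (cnear_near (cnearI hrot h_eta))); apply: filterS.
move=> z; change (C2 R) in z; move=> hz z0 [s0 s0N z2]; have {hz}[hs hk] := hz s0 s0N.
have s00 : s0 != 0.
  apply: contra_neq z0 => s00; move: s0N z2; rewrite s00 eta0 expr0n gtn_eqF //.
  by case: (z) => a b /= <- ->.
have z10 : z.1 != 0 by rewrite -s0N expf_neq0.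
have [sg [sgz hsg]] := nth_root_branch N0 z10 s0N.
have [_ [ls' hls]] := cnear_at hsg.
have hk' : cnear z.1 (fun x => forall y, y \in l -> exists k, cderiv eta (y * sg x) k).
  apply: (@cnear_cderiv _ sg _ _ (fun u => forall y, y \in l -> exists k, cderiv eta (y * u) k) hls).
    by rewrite sgz; apply: cnearS hk => t [].
have hk2 : cnear z.1 (fun x => exists k, cderiv eta (sg x) k).
  by apply: (@cnear_cderiv _ sg _ _ (fun u => exists k, cderiv eta u k) hls); rewrite sgz; apply: cnearS hk => t [].
exists (fun w => w.2 - eta (sg w.1)).
have hol : holomorphic_at z (fun w => w.2 - eta (sg w.1) : C1 R).
  apply: filterS (near_fst (cnearI hk2 hsg)) => w [[k hw] [_ [k' hw']]].
  apply: differentiable_sub; first exact: differentiable_snd.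
  exact: (@differentiable_fst_comp (fun x => eta (sg x)) w _ (cderiv_comp hw' hw)).
split=> //.
- have key : \forall w \near z, forall x, x \in l -> w.2 = eta (x * sg w.1) ->
      eta (x * sg w.1) = eta (sg w.1).
    have hx x : x \in l -> \forall w \near z, w.2 = eta (x * sg w.1) ->
        eta (x * sg w.1) = eta (sg w.1).
      move=> xl; have [E|E] := eqVneq (eta (x * s0)) (eta s0).
        have h : cnear z.1 (fun y => eta (x * sg y) = eta (sg y)).
          by apply: (@cnear_cderiv _ sg _ _ (fun u => eta (x * u) = eta u) hls); rewrite sgz; exact: hs.
        by apply: filterS (near_fst h) => w.
      pose e := cnorm (eta (x * s0) - eta s0) / 2.
      have e0 : 0 < e by rewrite divr_gt0 // cnorm_gt0 subr_eq0.
      have [k hxk] := (cnear_at hk).1 x xl.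
      have hcomp : cderiv (fun u => eta (x * sg u)) z.1 (k * (x * ls')).
        apply: (@cderiv_comp _ eta (fun u => x * sg u)); first exact: cderivZ.
        by rewrite sgz.
      apply: filterS2 (near_fst (cnear_value hcomp e0)) (near_snd (cnear_ball z.2 e0)) => w.
      rewrite sgz z2 => a b c; exfalso.
      rewrite -c in a; have E2 : cnorm (eta (x * s0) - eta s0) = 2 * e by rewrite /e; field.
      have := cnormDl (eta (x * s0)) w.2 (eta s0); rewrite E2 (cnormB _ w.2); lra.
    have : forall m : seq C, {subset m <= l} -> \forall w \near z, forall x, x \in m ->
        w.2 = eta (x * sg w.1) -> eta (x * sg w.1) = eta (sg w.1).
      elim=> [|a m IH] ml; first by apply/near_C2P; exists 1 => // w _ _ x; rewrite in_nil.
      apply: filterS2 (hx a _) (IH _) => [w h1 h2 x||x xm]; last by apply: ml; rewrite inE xm orbT.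
        by rewrite inE => /orP[/eqP ->|]; [exact: h1|exact: h2].
      by apply: ml; rewrite inE eqxx.
    exact.
  have h0 : cnear z.1 (fun x => x != 0) := cnear_neq0 (cderiv_id z.1) z10.
  apply: filterS2 key (near_fst (cnearI hsg h0)) => w kw [[sgw _] w0].
  split=> [[s sN w2]|/eqP]; last first.
    by rewrite subr_eq0 => /eqP w2; exists (sg w.1).
  have sg0 : sg w.1 != 0 by apply: contra_neq w0 => E; rewrite -sgw E expr0n gtn_eqF.
  have E : s / sg w.1 * sg w.1 = s by rewrite divfK.
  have := kw (s / sg w.1); rewrite E => h; apply/eqP; rewrite subr_eq0 w2; apply/eqP/h => //.
  by rewrite lP expr_div_n sN sgw divff.
- exists (pt 0 1); have dh : differentiable (fun w => w.2 - eta (sg w.1) : C1 R) z := nbhs_singleton hol.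
  rewrite deriveE //; have zE : z = pt z.1 z.2 by case: (z).
  have dh' := dh; rewrite zE in dh'.
  have := cderiv_partial_y dh' (cderiv_id z.2); rewrite mul1r -zE => h1.
  have h2 : cderiv (fun u => u - eta (sg z.1)) z.2 (1 - 0).
    by apply: cderivB; [exact: cderiv_id|exact: cderiv_cst].
  have := cderiv_uniq h1 h2; rewrite subr0 /dy => ->; apply/eqP; exact: oner_neq0.
Qed.

Hypothesis tangent : cnear 0 (fun s =>
  (X (gam s)).1 * eta1 s = (X (gam s)).2 * (N%:R * s ^+ N.-1)).

(** A local equation vanishes along the parametrisation, so its differential kills the velocity, and
    [tangent] makes [X] a multiple of the velocity off 0. *)
Lemma curve_invariant : vf_invariant X curve.
Proof.
suff : \forall z \near (0 : C2 R), z != 0 -> curve z ->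
    forall h, local_equation curve z h -> 'D_(X z) h z = 0.
  by rewrite /vf_invariant /dnbhs near_withinE.
have := near_param (cnearI tangent heta); apply: filterS.
move=> z hz z0 [s sN z2] h [hol hA _]; have [tan he] := hz s sN.
have zE : z = gam s by case: (z) sN z2 => a b /= <- ->.
have s0 : s != 0.
  apply: contra_neq z0 => s0; by rewrite zE s0 /gam eta0 expr0n gtn_eqF.
rewrite zE in hol hA *; have dh := nbhs_singleton hol.
rewrite deriveE //; pose m1 := N%:R * s ^+ N.-1.
have m10 : m1 != 0 by rewrite mulf_neq0 ?expf_neq0 // pnatr_eq0 -lt0n.
have h0 : cnear s (fun t => h (gam t) = 0).
  have : cnear s (fun t => curve (gam t) <-> h (gam t) = 0)
    by apply: (@near_gam s (fun w => curve w <-> h w = 0)) => //; exists (eta1 s).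
  by apply: cnearS => t [+ _]; apply; exact: curve_gam.
have hs : cderiv (fun t => t ^+ N) s m1 by have := cderivX N (cderiv_id s); rewrite mulr1.
have d0 : 'd h (gam s) (pt m1 (eta1 s)) = 0.
  apply: (cderiv_uniq (@cderiv_curve _ h (fun u => u ^+ N) eta s _ _ dh hs he)).
  by apply: cderiv_near_eq (cderiv_cst 0 s); apply: cnearS h0.
have -> : X (gam s) = ((X (gam s)).1 / m1) *: pt m1 (eta1 s).
  rewrite [LHS]surjective_pairing; congr (_, _); rewrite /= /GRing.scale /=.
    by rewrite divfK.
  by rewrite mulrAC tan mulfK.
by rewrite linearZ /= d0 scaler0.
Qed.

Theorem curve_separatrix : separatrix X curve.
Proof.
split; [exact: curve_equation|exact: curve_irreducible|exact: curve_regular|].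
exact: curve_invariant.
Qed.
End Separatrix.

(** * A node produces infinitely many separatrices *)

Section Dicritical.
Variable R : realType.
Local Notation C := R[i].
Implicit Types (z : C2 R) (w s t x v u c : C) (r K : R) (P Q A B Y Z h D e : {poly C}).

Lemma cholo_derivative (f : C -> C) : exists f' : C -> C, forall u,
  (exists l, cderiv f u l) -> cderiv f u (f' u).
Proof.
have /choice[f' hf'] (u : C) : exists l, (exists l', cderiv f u l') -> cderiv f u l.
  have [[l hl]|no] := pselect (exists l, cderiv f u l); first by exists l.
  by exists 0 => /no.
by exists f'.
Qed.

(* The invariant curves lie on the levels [G = c F], which tells them apart. *)
Lemma node_dicritical p q (k m : int) (j : nat) (X : C2 R -> C2 R) (F G : C2 R -> C) A B Y e t0 :
  let h := wedge p q A B in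
  (0 < p)%N -> (0 < q)%N -> (0 < j)%N -> X 0 = 0 ->
  (forall s t, s != 0 -> X (pt (s ^+ p) (s ^+ q * t)) =
     pt (s ^ (k + p%:Z) * A.[t]) (s ^ (k + q%:Z) * B.[t])) ->
  (forall s t, s != 0 -> G (pt (s ^+ p) (s ^+ q * t)) = s ^ m * h.[t]) ->
  (forall s t, s != 0 -> F (pt (s ^+ p) (s ^+ q * t)) = s ^ (m + j%:Z) * (Y * h - A * e).[t]) ->
  comm_eqs j k A Y h e -> h.[t0] = 0 -> e.[t0] != 0 -> A.[t0] != 0 ->
  ~ non_dicritical X.
Proof.
move=> h p0 q0 j0 X0 hX hG hF ce ht he hA; pose D := Y * h - A * e.
have wr := comm_eqs_wedge2 ce; rewrite /= -/D in wr.
have jC : (j%:R : C) != 0 by rewrite pnatr_eq0 -lt0n.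
have dh : h^`().[t0] = j%:R * A.[t0] := node_root ce ht he.
have D0 : D.[t0] != 0.
  rewrite /D hornerD hornerN !hornerM; move: ht; rewrite -/h => ->.
  by rewrite mulr0 sub0r oppr_eq0 mulf_neq0.
have [|T [T0 hT]] := @pencil_branch R h D t0 ht; first by rewrite dh mulf_neq0.
have [T' hT'] := cholo_derivative T.
have [_ [l0 hl0]] := cnear_at hT.
have hD : cnear 0 (fun w => D.[T w] != 0).
  apply: (@cnear_cderiv _ T _ _ (fun u => D.[u] != 0) hl0); rewrite T0.
  exact: cnear_neq0 (cderiv_horner D t0) D0.
(* Differentiating [h(T w) = w D(T w)] and inserting the equation of [D] at [T w] gives
   [j A T' = D], which is the invariance of the curves read in the chart. *)
have hA' : cnear 0 (fun w => j%:R * A.[T w] * T' w = D.[T w]).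
  have heq : cnear 0 (fun w => h.[T w] = w * D.[T w]) by apply: cnearS hT => w [].
  apply: cnearS (cnearI (cnearI hT hD) (cnear_near heq)) => w [[[E /hT' hw] Dw] hE].
  have d1 := cderiv_comp hw (cderiv_horner h (T w)).
  have d2 := cderivM (cderiv_id w) (cderiv_comp hw (cderiv_horner D (T w))).
  have d3 := cderiv_uniq (cderiv_near_eq hE d1) d2.
  have E2 : (j%:~R : {poly C}).[T w] = j%:R by rewrite horner_int.
  have := congr1 (fun P => P.[T w]) wr; rewrite /= hornerD !hornerM E E2 => E3.
  apply: (mulfI Dw); transitivity (D.[T w] * h^`().[T w] * T' w - w * D.[T w] * D^`().[T w] * T' w).
    rewrite -E3; ring.
  transitivity (D.[T w] * (h^`().[T w] * T' w) - w * D.[T w] * D^`().[T w] * T' w); first by ring.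
  by rewrite d3; ring.
(* In the chart the curve is [t = T(c s^j)]; all these curves pass through the point [t0] of the
   exceptional divisor. *)
pose eta (c s : C) := s ^+ q * T (c * s ^+ j).
pose eta' (c s : C) := q%:R * s ^+ q.-1 * 1 * T (c * s ^+ j) +
  s ^+ q * (T' (c * s ^+ j) * (c * (j%:R * s ^+ j.-1 * 1))).
have hpow c (P : C -> Prop) : cnear 0 P -> cnear 0 (fun s => P (c * s ^+ j)).
  move=> hP; apply: (@cnear_cderiv _ (fun s => c * s ^+ j) _ _ P (cderivZ c (cderivX j (cderiv_id 0)))).
  by rewrite expr0n gtn_eqF // mulr0.
have eta0 c : eta c 0 = 0 by rewrite /eta expr0n gtn_eqF // mul0r.
have heta c : cnear 0 (fun s => cderiv (eta c) s (eta' c s)).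
  apply: cnearS (hpow c _ hT) => s [_ /hT' hs].
  apply: cderivM; first exact: cderivX (cderiv_id s).
  exact: (@cderiv_comp _ T (fun s => c * s ^+ j) s _ _ (cderivZ c (cderivX j (cderiv_id s))) hs).
have tangent c : cnear 0 (fun s => (X (pt (s ^+ p) (eta c s))).1 * eta' c s =
    (X (pt (s ^+ p) (eta c s))).2 * (p%:R * s ^+ p.-1)).
  apply: cnearS (hpow c _ (cnearI hT hA')) => s [[Ew _] hw].
  have [s0|s0] := eqVneq s 0.
    rewrite s0 eta0 expr0n gtn_eqF //.
    have -> : X (pt 0 0) = 0 := X0; by rewrite !mul0r.
  rewrite /eta hX //= /eta'; move: Ew hw; set w := c * s ^+ j; set tau := T w => Ew hw.
  have qE : s ^+ q = s ^+ q.-1 * s by rewrite -exprSr prednK.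
  have pE : s ^+ p = s ^+ p.-1 * s by rewrite -exprSr prednK.
  have jE : s ^+ j = s ^+ j.-1 * s by rewrite -exprSr prednK.
  have hE : h.[tau] = p%:R * B.[tau] - q%:R * tau * A.[tau].
    by rewrite /h /wedge hornerD hornerN !hornerM !horner_nat hornerX.
  have E : A.[tau] * (q%:R * tau + j%:R * w * T' w) = p%:R * B.[tau].
    transitivity (q%:R * tau * A.[tau] + w * (j%:R * A.[tau] * T' w)); first by ring.
    by rewrite hw -Ew hE; ring.
  have {}E : A.[tau] * (q%:R * tau + j%:R * (c * (s ^+ j.-1 * s)) * T' w) = p%:R * B.[tau].
    by rewrite -jE; exact: E.
  have -> : s ^ (k + p%:Z) = s ^ k * (s ^+ p.-1 * s) by rewrite expfzDr // -exprnP pE.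
  have -> : s ^ (k + q%:Z) = s ^ k * (s ^+ q.-1 * s) by rewrite expfzDr // -exprnP qE.
  rewrite qE; clear hE Ew hw; clearbody tau; move: E; move: (s ^ k) (s ^+ p.-1) (s ^+ q.-1) (s ^+ j.-1) (T' w) A.[tau] B.[tau].
  move=> a b d f x y y2 E.
  transitivity (a * b * s * d * (y * (q%:R * tau + j%:R * (c * (f * s)) * x))); first by ring.
  by rewrite E; ring.
have sep c := curve_separatrix p0 (eta0 c) (heta c) (tangent c).
have FG c : cnear 0 (fun s => s != 0 -> F (pt (s ^+ p) (eta c s)) != 0 /\
    G (pt (s ^+ p) (eta c s)) = c * F (pt (s ^+ p) (eta c s))).
  apply: cnearS (hpow c _ (cnearI hT hD)) => s [[Ew _] Dw] s0; rewrite /eta hF // hG //.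
  split; first by rewrite mulf_neq0 // expfz_neq0.
  by rewrite Ew expfzDr // -exprnP -/D; ring.
have uniq_c c c' : germ_eq (curve p (eta c)) (curve p (eta c')) -> c = c'.
  move=> hg; have hg' : \forall z \near (0 : C2 R), curve p (eta c) z -> curve p (eta c') z.
    by rewrite /germ_eq in hg; apply: filterS hg => z ->.
  have h1 := near0_gam p0 (eta0 c) (heta c) hg'.
  have h2 := near0_gam p0 (eta0 c) (heta c) (near_param p0 (FG c')).
  have [s s0 [[a1 a2] a3]] := cnear_neq (cnearI (cnearI h1 h2) (FG c)).
  have [f0 fE] := a3 s0; have [s' s'p es] : curve p (eta c') (pt (s ^+ p) (eta c s)).
    by apply: a1; exists s.
  have s'0 : s' != 0.
    by apply: contra_neq s0 => s'0; apply/eqP; move: s'p; rewrite s'0 expr0n gtn_eqF //= => /esym/eqP; rewrite expf_eq0 p0.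
  have [_] := a2 s' s'p s'0; move: es s'p => /= <- -> E.
  by apply: (mulIf f0); rewrite -E -fE.
move=> [FF [finF hFF]].
(* The curves with natural [c] would map injectively to the finite set [FF]. *)
have /choice[b hb] (n : nat) : exists W : set (C2 R), FF W /\ germ_eq (curve p (eta n%:R)) W.
  by have [W] := hFF _ (sep n%:R); exists W.
apply: infinite_nat; rewrite (_ : [set: nat] = b @^-1` FF); last first.
  by apply/seteqP; split=> n // _; exact: (hb n).1.
apply: finite_preimage finF => n n' _ _ E.
have : (n%:R : C) = n'%:R.
  apply: uniq_c; have h1 := (hb n).2; have h2 := (hb n').2; rewrite E in h1.
  by rewrite /germ_eq in h1 h2 *; apply: filterS2 h1 h2 => z -> ->.
by move/eqP; rewrite eqr_nat => /eqP.
Qed.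
End Dicritical.

(** * Exchange of the two coordinates *)

Section Swap.
Variable R : realType.
Implicit Types (z w v : C2 R) (X : C2 R -> C2 R) (f h : C2 R -> C1 R) (A : set (C2 R)).

(** Carries the chart [y = 1] with weights [(p, q)] to the chart [x = 1] with weights [(q, p)], so
    that the chart arguments are made once. *)
Definition swap z : C2 R := pt z.2 z.1.

Lemma swapK : involutive swap. Proof. by case. Qed.

Lemma near_swap z (P : C2 R -> Prop) : (\forall w \near swap z, P w) ->
  \forall w \near z, P (swap w).
Proof. by move=> /near_C2P[d d0 h]; apply/near_C2P; exists d => // w w1 w2; apply: h. Qed.

Lemma near0_swap (P : C2 R -> Prop) : (\forall w \near (0 : C2 R), P w) ->
  \forall w \near (0 : C2 R), P (swap w).
Proof. exact: (@near_swap 0). Qed.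

Lemma diff_swap f z : differentiable f (swap z) -> differentiable (f \o swap) z /\
  forall v, 'd (f \o swap) z v = 'd f (swap z) (swap v).
Proof.
move=> hf; have ds : differentiable swap z.
  by apply/differentiable_components; split; [exact: differentiable_snd|exact: differentiable_fst].
split=> [|v]; first exact: (@differentiable_comp _ _ _ _ swap f z ds hf).
have E1 : 'd swap z v = swap v.
  have E := @diff_components _ swap z v ds; apply: (etrans E).
  exact: congr2 (diff_snd z v) (diff_fst z v).
have E := congr1 (fun F => F v) (@diff_comp _ _ _ _ swap f z ds hf).
by apply: (etrans E); rewrite /= E1.
Qed.

Lemma derive_swap f z v : differentiable f (swap z) ->
  'D_v (f \o swap) z = 'D_(swap v) f (swap z).
Proof.
move=> hf; have [ds E] := diff_swap hf.
exact: etrans (deriveE v ds) (etrans (E v) (esym (deriveE (swap v) hf))).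
Qed.

Lemma holomorphic_swap f z : holomorphic_at (swap z) f -> holomorphic_at z (f \o swap).
Proof. by move=> /near_swap; apply: filterS => w /diff_swap[]. Qed.

Lemma holomorphic_germ_swap f : holomorphic_germ f -> holomorphic_germ (f \o swap).
Proof. by move=> /near0_swap; apply: filterS => w /diff_swap[]. Qed.

Lemma analytic_swap A : analytic_germ A -> analytic_germ (A \o swap).
Proof.
move=> [n [g [hg hA]]]; exists n, (fun i => g i \o swap); split=> [i|].
  exact: holomorphic_germ_swap (hg i).
exact: near0_swap hA.
Qed.

Lemma local_equation_swap A z h : local_equation A (swap z) h ->
  local_equation (A \o swap) z (h \o swap).
Proof.
move=> [hh hA [v hv]]; split; first exact: holomorphic_swap.
  exact: near_swap hA.
exists (swap v) => D0; apply: hv; have := derive_swap (swap v) (nbhs_singleton hh).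
by rewrite D0 swapK => ->.
Qed.

Definition swap_vf X : C2 R -> C2 R := fun z => swap (X (swap z)).

Lemma separatrix_swap X A : separatrix X A -> separatrix (swap_vf X) (A \o swap).
Proof.
have AK B : (B \o swap) \o swap = B by apply/funext => z /=; rewrite swapK.
move=> [[g [hg gn g0 hA]] irr reg inv]; split.
- exists (g \o swap); split=> //; first exact: holomorphic_germ_swap hg.
    by move=> /near0_swap h; apply: gn; apply: filterS h => z /=; rewrite swapK.
  exact: near0_swap hA.
- move=> A1 A2 /analytic_swap h1 /analytic_swap h2 /near0_swap hA12.
  have h12 : germ_eq A ((A1 \o swap) `|` (A2 \o swap)).
    by apply: filterS hA12 => z /=; rewrite swapK.
  have [h|h] := irr _ _ h1 h2 h12.
    by left; have := near0_swap h; apply: filterS => z /=; rewrite swapK.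
  by right; have := near0_swap h; apply: filterS => z /=; rewrite swapK.
- have := reg; rewrite /regular_outside_0 /dnbhs !near_withinE => /near0_swap.
  apply: filterS => z h z0 Az; have [||h' hh] := h => //.
    by apply: contra_neq z0 => z0; rewrite -(swapK z) z0.
  by exists (h' \o swap); exact: local_equation_swap.
- have := inv; rewrite /vf_invariant /dnbhs !near_withinE => /near0_swap.
  apply: filterS => z h z0 Az h' hh.
  have hl : local_equation A (swap z) (h' \o swap).
    by have := @local_equation_swap (A \o swap) (swap z) h'; rewrite swapK AK; apply.
  have [hh' _ _] := hh; have dh : differentiable h' (swap (swap z)).
    by rewrite swapK; exact: nbhs_singleton hh'.
  have z0' : swap z != 0 by apply: contra_neq z0 => z0; rewrite -(swapK z) z0.
  have := h z0' Az _ hl; have := derive_swap (X (swap z)) dh; rewrite swapK => -> //.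
Qed.

Lemma non_dicritical_swap X : non_dicritical X -> non_dicritical (swap_vf X).
Proof.
have XK : swap_vf (swap_vf X) = X by apply/funext => z; rewrite /swap_vf !swapK.
have AK (B : set (C2 R)) : (B \o swap) \o swap = B by apply/funext => z /=; rewrite swapK.
move=> [F [finF hF]]; exists [set B \o swap | B in F]; split; first exact: finite_image.
move=> A /separatrix_swap; rewrite XK => /hF[B FB hB]; exists (B \o swap); first by exists B.
have := near0_swap hB; apply: filterS => z /=; rewrite swapK.
by [].
Qed.
End Swap.

(** * Homogeneous commuting fields and first integrals *)

Section Charts.
Variable R : realType.
Local Notation C := R[i].
Implicit Types (z : C2 R) (F G A B P Q : C2 R -> C1 R) (s t c : C) (j k m : int).

Lemma hom_pt p q m F s t : hom p q m F -> s != 0 ->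
  F (pt (s ^+ p) (s ^+ q * t)) = s ^ m * F (pt 1 t).
Proof. by move=> h s0; rewrite -h // /dil /= mulr1. Qed.

Lemma hom_pt2 p q m F s t : hom p q m F -> s != 0 ->
  F (pt (s ^+ p * t) (s ^+ q)) = s ^ m * F (pt t 1).
Proof. by move=> h s0; rewrite -h // /dil /= mulr1. Qed.

(** A dilation by a root of a nonzero coordinate moves any point off 0 onto [x = 1] or [y = 1]. *)
Lemma hom_ext p q m F G : (0 < p)%N -> (0 < q)%N -> hom p q m F -> hom p q m G ->
  (forall t, F (pt 1 t) = G (pt 1 t)) -> (forall t, F (pt t 1) = G (pt t 1)) ->
  forall z, z != 0 -> F z = G z.
Proof.
move=> p0 q0 hF hG h1 h2 [x y] z0; have [x0|x0] := eqVneq x 0.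
  have y0 : y != 0 by apply: contra_neq z0 => y0; rewrite x0 y0.
  pose s := q.-root y; have sy : s ^+ q = y := rootCK q0 y.
  have s0 : s != 0 by apply: contra_neq y0 => s0; rewrite -sy s0 expr0n gtn_eqF.
  have -> : (x, y) = pt (s ^+ p * (x / s ^+ p)) (s ^+ q).
    by rewrite mulrC divfK ?sy // expf_neq0.
  by rewrite (hom_pt2 _ hF) // (hom_pt2 _ hG) // h2.
pose s := p.-root x; have sx : s ^+ p = x := rootCK p0 x.
have s0 : s != 0 by apply: contra_neq x0 => s0; rewrite -sx s0 expr0n gtn_eqF.
have -> : (x, y) = pt (s ^+ p) (s ^+ q * (y / s ^+ q)).
  by rewrite mulrC divfK ?sx // expf_neq0.
by rewrite (hom_pt _ hF) // (hom_pt _ hG) // h1.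
Qed.

Lemma hom_compat p q m F (P1 P2 : {poly C}) : hom p q m F ->
  (forall t, F (pt 1 t) = P1.[t]) -> (forall t, F (pt t 1) = P2.[t]) -> compat p q m P1 P2.
Proof.
move=> hF h1 h2 s s0; rewrite -h1 -h2 -(hom_pt2 _ hF) //.
by rewrite divff // expf_neq0.
Qed.

Lemma hom_swap p q m F : hom p q m F -> hom q p m (F \o @swap R).
Proof. by move=> h t z t0; rewrite /= -h. Qed.

Lemma wpoly_swap p q m F : wpoly p q m F -> wpoly q p m (F \o @swap R).
Proof.
move=> [dF hF [P1 h1] [P2 h2]]; split; [|exact: hom_swap|by exists P2|by exists P1].
by move=> z; have [] := diff_swap (dF (swap z)).
Qed.

Lemma vder_swap A B F z : differentiable F (swap z) ->
  vder (B \o @swap R) (A \o @swap R) (F \o @swap R) z = vder A B F (swap z).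
Proof.
move=> /diff_swap[_ E].
have E1 : dx (F \o @swap R) z = dy F (swap z) := E (pt 1 0).
have E2 : dy (F \o @swap R) z = dx F (swap z) := E (pt 0 1).
apply: etrans (congr2 (fun a b => (B \o @swap R) z * a + (A \o @swap R) z * b) E1 E2) _.
exact: addrC.
Qed.

Lemma chart_comm_eqs p q j k A B P Q (A1 B1 P1 Q1 : {poly C}) :
  wpoly p q (k + p%:Z) A -> wpoly p q (k + q%:Z) B ->
  wpoly p q (j + p%:Z) P -> wpoly p q (j + q%:Z) Q ->
  (forall t, A (pt 1 t) = A1.[t]) -> (forall t, B (pt 1 t) = B1.[t]) ->
  (forall t, P (pt 1 t) = P1.[t]) -> (forall t, Q (pt 1 t) = Q1.[t]) ->
  (forall z, z != 0 -> vder A B P z = vder P Q A z /\ vder A B Q z = vder P Q B z) ->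
  comm_eqs j k A1 P1 (wedge p q A1 B1) (wedge p q P1 Q1).
Proof.
move=> [dA hA _ _] [dB hB _ _] [dP hP _ _] [dQ hQ _ _] A1E B1E P1E Q1E hc.
have wE (U V : {poly C}) t : (wedge p q U V).[t] = p%:R * V.[t] - q%:R * t * U.[t].
  by rewrite /wedge hornerD hornerN !hornerM !horner_nat hornerX.
have pt0 t : pt 1 t != 0 by apply/eqP => -[/eqP]; rewrite oner_eq0.
apply: comm_eqs_wedge; apply: poly_ext => t; rewrite !hornerD !hornerM !horner_int !wE.
  rewrite -(chart_vder dP hP P1E (A1E t) (B1E t)) (hc _ (pt0 t)).1.
  by rewrite (chart_vder dA hA A1E (P1E t) (Q1E t)).
rewrite -(chart_vder dQ hQ Q1E (A1E t) (B1E t)) (hc _ (pt0 t)).2.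
by rewrite (chart_vder dB hB B1E (P1E t) (Q1E t)).
Qed.

Lemma no_common_root_bezout (A1 B1 : {poly C}) : no_common_root A1 B1 ->
  exists u v, u * A1 + v * B1 = 1.
Proof.
move=> h; have /Bezout_eq1_coprimepP[[u v] /= E] : coprimep A1 B1; last by exists u, v.
rewrite /coprimep; apply/negPn/negP => /closed_rootP[x]; rewrite root_gcd => /andP[].
by rewrite /root => /eqP /h h' /eqP.
Qed.

Lemma parallel_quotient (A1 B1 Y1 Z1 : {poly C}) : no_common_root A1 B1 ->
  Y1 * B1 = Z1 * A1 -> exists g, Y1 = g * A1 /\ Z1 = g * B1.
Proof.
move=> /no_common_root_bezout[u [v E]] par; exists (u * Y1 + v * Z1); split.
  rewrite -[LHS]mulr1 -E; transitivity (u * Y1 * A1 + v * (Y1 * B1)); first by ring.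
  by rewrite par; ring.
rewrite -[LHS]mulr1 -E; transitivity (u * (Z1 * A1) + v * Z1 * B1); first by ring.
by rewrite -par; ring.
Qed.

(** This is the second commutation equation of the field [g X], divided by [h1]; the result says
    that [g], of degree [j - k], is a first integral. *)
Lemma quotient_first_integral j k (A1 h1 g : {poly C}) : h1 != 0 ->
  comm_eqs j k A1 (g * A1) h1 (g * h1) -> (j - k)%:~R * A1 * g + h1 * g^`() = 0.
Proof.
move=> h0 [_ E]; apply: (mulIf h0); rewrite mul0r.
transitivity (j%:~R * A1 * (g * h1) + h1 * (g * h1)^`() -
    (k%:~R * (g * A1) * h1 + g * h1 * h1^`())).
  by rewrite derivM; ring.
by rewrite E subrr.
Qed.
End Charts.

(** * Homogeneous commuting fields as multiples of [X] *)

Section Commuting.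
Variable R : realType.
Local Notation C := R[i].
Implicit Types (z v : C2 R) (F G P Q : C2 R -> C1 R) (s t c : C) (j m : int).
Variables (p q : nat) (k : int) (A B : C2 R -> C1 R) (A1 A2 B1 B2 : {poly C}).
Hypotheses (p0 : (0 < p)%N) (q0 : (0 < q)%N) (k0 : 0 < k).
Hypotheses (wA : wpoly p q (k + p%:Z) A) (wB : wpoly p q (k + q%:Z) B).
Hypotheses (A1E : forall t, A (pt 1 t) = A1.[t]) (A2E : forall t, A (pt t 1) = A2.[t]).
Hypotheses (B1E : forall t, B (pt 1 t) = B1.[t]) (B2E : forall t, B (pt t 1) = B2.[t]).
Hypothesis isolated : forall z, z != 0 -> A z = 0 -> B z <> 0.
Hypotheses (A0 : A 0 = 0) (B0 : B 0 = 0).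
Hypothesis nd : non_dicritical (fun z => pt (A z) (B z)).

Lemma field_charts : charts k p q A1 B1 A2 B2.
Proof.
have [_ hA _ _] := wA; have [_ hB _ _] := wB.
split; [exact: hom_compat hA A1E A2E|exact: hom_compat hB B1E B2E| |] => t.
  by rewrite -A1E -B1E; apply: isolated; apply/eqP => -[/eqP]; rewrite oner_eq0.
rewrite -A2E -B2E => Bt At; apply: isolated At Bt.
by apply/eqP => -[_ /eqP]; rewrite oner_eq0.
Qed.

(* Homogeneous first integrals of degree [m], read in the charts x = 1 and y = 1. *)
Definition chart_first_integral m (g1 g2 : {poly C}) :=
  [/\ compat p q m g1 g2, m%:~R * A1 * g1 + wedge p q A1 B1 * g1^`() = 0 &
      m%:~R * B2 * g2 + wedge q p B2 A2 * g2^`() = 0].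

(** The contrapositive of [node_dicritical], with [F = p (Y_j /\ X)] and [G = S /\ X]. The data are
    primed because it is applied to both charts, the second one after [swap]. *)
Lemma node_zero p' q' j (A' B' P Q : C2 R -> C1 R) (A1' B1' P1 Q1 : {poly C}) :
  (0 < p')%N -> (0 < q')%N ->
  wpoly p' q' (k + p'%:Z) A' -> wpoly p' q' (k + q'%:Z) B' ->
  wpoly p' q' (j + p'%:Z) P -> wpoly p' q' (j + q'%:Z) Q ->
  (forall t, A' (pt 1 t) = A1'.[t]) -> (forall t, B' (pt 1 t) = B1'.[t]) ->
  (forall t, P (pt 1 t) = P1.[t]) -> (forall t, Q (pt 1 t) = Q1.[t]) ->
  comm_eqs j k A1' P1 (wedge p' q' A1' B1') (wedge p' q' P1 Q1) ->
  no_common_root A1' B1' -> A' 0 = 0 -> B' 0 = 0 ->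
  non_dicritical (fun z => pt (A' z) (B' z)) ->
  0 < j -> forall t, (wedge p' q' A1' B1').[t] = 0 -> (wedge p' q' P1 Q1).[t] = 0.
Proof.
move=> p'0 q'0 [_ hA _ _] [_ hB _ _] [_ hP _ _] [_ hQ _ _] A1E' B1E' P1E Q1E ce nr A00 B00 nd' j0 t ht.
apply/eqP; apply: contraT => et; exfalso.
have At : A1'.[t] != 0 by apply/eqP; exact: wedge_root ht.
have wE (U V : {poly C}) x : (wedge p' q' U V).[x] = p'%:R * V.[x] - q'%:R * x * U.[x].
  by rewrite /wedge hornerD hornerN !hornerM !horner_nat hornerX.
have jn : j = (absz j)%:Z by rewrite gez0_abs // ltW.
rewrite jn in ce.
pose F z : C := p'%:R * (P z * B' z - Q z * A' z).
pose G z : C := p'%:R * z.1 * B' z - q'%:R * z.2 * A' z.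
apply: (@node_dicritical R p' q' k (k + p'%:Z + q'%:Z) (absz j) (fun z => pt (A' z) (B' z)) F G
  A1' B1' P1 (wedge p' q' P1 Q1) t) => //.
- by rewrite absz_gt0 gt_eqF.
- by rewrite A00 B00.
- by move=> s x s0; rewrite (hom_pt _ hA) // (hom_pt _ hB) // A1E' B1E'.
- move=> s x s0; rewrite /G (hom_pt _ hA) // (hom_pt _ hB) // A1E' B1E' wE !expfzDr //=.
  rewrite -!exprnP; ring.
move=> s x s0; rewrite /F (hom_pt _ hA) // (hom_pt _ hB) // (hom_pt _ hP) // (hom_pt _ hQ) //.
rewrite A1E' B1E' P1E Q1E hornerD hornerN !hornerM !wE -jn !expfzDr // -!exprnP; ring.
Qed.

(** Parallelism and the absence of common zeros make the quotient polynomial in each chart;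
    commutation turns it into a first integral. *)
Theorem commuting_multiple j P Q (P1 P2 Q1 Q2 : {poly C}) :
  wpoly p q (j + p%:Z) P -> wpoly p q (j + q%:Z) Q ->
  (forall t, P (pt 1 t) = P1.[t]) -> (forall t, P (pt t 1) = P2.[t]) ->
  (forall t, Q (pt 1 t) = Q1.[t]) -> (forall t, Q (pt t 1) = Q2.[t]) ->
  (forall z, z != 0 -> vder A B P z = vder P Q A z /\ vder A B Q z = vder P Q B z) ->
  exists g1 g2, [/\ chart_first_integral (j - k) g1 g2,
    P1 = g1 * A1, Q1 = g1 * B1, P2 = g2 * A2 & Q2 = g2 * B2].
Proof.
move=> wP wQ P1E P2E Q1E Q2E hc; have ch := field_charts; have ch' := charts_sym ch.
have [hA hB n1 n2] := ch; have [_ hP _ _] := wP; have [_ hQ _ _] := wQ.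
have cP := hom_compat hP P1E P2E; have cQ := hom_compat hQ Q1E Q2E.
have ce1 := chart_comm_eqs wA wB wP wQ A1E B1E P1E Q1E hc.
have wA' := wpoly_swap wA; have wB' := wpoly_swap wB.
have wP' := wpoly_swap wP; have wQ' := wpoly_swap wQ.
have hc' z : z != 0 ->
    vder (B \o @swap R) (A \o @swap R) (Q \o @swap R) z = vder (Q \o @swap R) (P \o @swap R) (B \o @swap R) z /\
    vder (B \o @swap R) (A \o @swap R) (P \o @swap R) z = vder (Q \o @swap R) (P \o @swap R) (A \o @swap R) z.
  move=> z0; have z0' : swap z != 0 by apply: contra_neq z0 => z0; rewrite -(swapK z) z0.
  have [dA _ _ _] := wA; have [dB _ _ _] := wB; have [dP _ _ _] := wP; have [dQ _ _ _] := wQ.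
  have [E1 E2] := hc _ z0'.
  split; [apply: etrans (etrans E2 _)|apply: etrans (etrans E1 _)]; try exact: vder_swap;
  by apply/esym/vder_swap.
have ce2 := chart_comm_eqs wB' wA' wQ' wP' B2E A2E Q2E P2E hc'.
have node1 : 0 < j -> forall t, (wedge p q A1 B1).[t] = 0 -> (wedge p q P1 Q1).[t] = 0.
  exact: (node_zero p0 q0 wA wB wP wQ A1E B1E P1E Q1E ce1 n1 A0 B0 nd).
have node2 : 0 < j -> forall t, (wedge q p B2 A2).[t] = 0 -> (wedge q p Q2 P2).[t] = 0.
  exact: (node_zero q0 p0 wB' wA' wQ' wP' B2E A2E Q2E P2E ce2 n2 B0 A0 (non_dicritical_swap nd)).
have par1 := commuting_parallel p0 q0 k0 ch cP cQ ce1 ce2 node1 node2.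
have par2 := commuting_parallel q0 p0 k0 ch' (compat_sym cQ) (compat_sym cP) ce2 ce1 node2 node1.
have [g1 [EP1 EQ1]] := parallel_quotient n1 par1.
have [g2 [EQ2 EP2]] := parallel_quotient n2 par2.
exists g1, g2; split => //.
have ew p' q' g (U V : {poly C}) : wedge p' q' (g * U) (g * V) = g * wedge p' q' U V.
  by rewrite /wedge; ring.
have h10 := charts_wedge_neq0 p0 q0 k0 ch.
split.
- apply: (compat_cancel p0 q0 (m' := k + p%:Z + q%:Z) (Q1 := wedge p q A1 B1) (Q2 := - wedge q p B2 A2)) => //.
    rewrite mulrN -!ew -EP1 -EQ1 -EP2 -EQ2 (_ : j - k + _ = j + p%:Z + q%:Z); last by ring.
    exact: compat_wedge.
  exact: compat_wedge.
- by apply: (quotient_first_integral h10); rewrite -ew -EP1 -EQ1.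
- apply: (quotient_first_integral (charts_wedge_neq0 q0 p0 k0 ch')).
  by rewrite -ew -EP2 -EQ2.
Qed.
End Commuting.

(** * The first integral of minimal degree *)

Section Generator.
Variable R : realType.
Local Notation C := R[i].
Implicit Types (f g u h P Q : {poly C}) (s t c : C) (m : int).

Lemma integral_mul (A h g u : {poly C}) m m' :
  m%:~R * A * g + h * g^`() = 0 -> m'%:~R * A * u + h * u^`() = 0 ->
  (m + m')%:~R * A * (g * u) + h * (g * u)^`() = 0.
Proof.
move=> Eg Eu; transitivity (u * (m%:~R * A * g + h * g^`()) + g * (m'%:~R * A * u + h * u^`())).
  by rewrite derivM intrD; ring.
by rewrite Eg Eu; ring.
Qed.

Lemma integral_exp (A h g : {poly C}) m n : m%:~R * A * g + h * g^`() = 0 ->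
  (m * n%:Z)%:~R * A * g ^+ n + h * (g ^+ n)^`() = 0.
Proof.
move=> Eg; elim: n => [|n IH]; first by rewrite mulr0 expr0 -polyC1 derivC; ring.
rewrite exprS (_ : m * n.+1%:Z = m + m * n%:Z); last by rewrite intS mulrDr mulr1.
exact: integral_mul.
Qed.

Lemma integral_div (A h g u : {poly C}) m m' : g != 0 ->
  m%:~R * A * g + h * g^`() = 0 -> (m' + m)%:~R * A * (u * g) + h * (u * g)^`() = 0 ->
  m'%:~R * A * u + h * u^`() = 0.
Proof.
move=> g0 Eg Eu; apply: (mulIf g0); rewrite mul0r.
transitivity ((m' + m)%:~R * A * (u * g) + h * (u * g)^`() - u * (m%:~R * A * g + h * g^`())).
  by rewrite derivM intrD; ring.
by rewrite Eu Eg; ring.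
Qed.

(** Two solutions of one linear equation of first order have zero Wronskian. *)
Lemma integral_proportional (A h g u : {poly C}) m : h != 0 -> g != 0 ->
  m%:~R * A * g + h * g^`() = 0 -> m%:~R * A * u + h * u^`() = 0 ->
  exists c, u = c%:P * g.
Proof.
move=> h0 g0 Eg Eu; apply: wronskian0 => //; apply: (mulfI h0); apply/eqP; rewrite -subr_eq0.
apply/eqP; transitivity (g * (m%:~R * A * u + h * u^`()) - u * (m%:~R * A * g + h * g^`())).
  by ring.
by rewrite Eu Eg; ring.
Qed.

Variables (p q : nat).
Hypotheses (p0 : (0 < p)%N) (q0 : (0 < q)%N).

(** The weight and the exponent of [y] determine a monomial, so the coefficients on [x = 1] define
    the polynomial; the other chart follows by compatibility. *)
Lemma hpart_of_charts (m : nat) g1 g2 : compat p q m%:Z g1 g2 ->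
  exists a, (forall t, hpart p q a m (pt 1 t) = g1.[t]) /\
            (forall t, hpart p q a m (pt t 1) = g2.[t]).
Proof.
move=> cg; pose a (i l : nat) := g1`_l; exists a.
have size_g1 : (size g1 <= m.+1)%N.
  apply/leq_sizeP => l ml; apply/eqP/negPn/negP => gl.
  by have [i hi _] := compat_coef p0 q0 cg gl; nia.
have chart1 t : hpart p q a m (pt 1 t) = g1.[t].
  rewrite (horner_coef_wide _ size_g1) /hpart (exchange_big_dep xpredT) //=.
  apply: eq_bigr => l _; have [gl|gl] := eqVneq g1`_l 0.
    by rewrite gl mul0r big1 // => i _; rewrite /monomial /a gl !mul0r.
  have [i [hi] _] := compat_coef p0 q0 cg gl.
  have im : (i < m.+1)%N by nia.
  rewrite (big_pred1 (Ordinal im)) /=; first by rewrite /monomial /a /= expr1n mulr1.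
  move=> i' /=; apply/eqP/eqP => [E|->//]; apply: val_inj => /=; apply/eqP.
  by rewrite -(eqn_pmul2l p0) -(eqn_add2r (q * l)) E hi.
split=> // t; have [P2 hP2] := hpart_chart2 p q a m; rewrite hP2; congr (_.[t]).
apply: poly_ext_neq0 => x x0; pose s := (p.-root x)^-1.
have sx : s ^- p = x by rewrite exprVn invrK rootCK.
have s0 : s != 0.
  by rewrite invr_neq0 //; apply: contra_neq x0 => E; rewrite -(rootCK p0 x) E expr0n gtn_eqF.
have := hom_compat (@hom_hpart R p q a m) chart1 hP2 s0; rewrite cg // sx.
by move/(mulfI (expfz_neq0 _ s0)) => ->.
Qed.

Variables (k : int) (A1 A2 B1 B2 : {poly C}).
Hypothesis k0 : 0 < k.
Hypothesis ch : charts k p q A1 B1 A2 B2.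
Local Notation integral := (chart_first_integral p q A1 A2 B1 B2).

(** [f^M] and [g^d] solve the same equation, hence are proportional, and the [d]-th power of
    [f ^+ (M %/ d)] divides [f^M]. *)
Lemma integral_root_dvd (A h f g : {poly C}) (d M : nat) : (0 < d)%N -> h != 0 -> f != 0 ->
  d%:Z%:~R * A * f + h * f^`() = 0 -> M%:Z%:~R * A * g + h * g^`() = 0 ->
  f ^+ (M %/ d) %| g.
Proof.
move=> d0 h0 f0 Ef Eg.
have Ef' := integral_exp M Ef; have Eg' := integral_exp d Eg; rewrite [d%:Z * _]mulrC in Ef'.
have [c E] := integral_proportional h0 (expf_neq0 M f0) Ef' Eg'.
rewrite -(dvdp_pexp2r _ _ d0) E -exprM {2}(divn_eq M d) exprD.
by rewrite [c%:P * _]mulrCA dvdp_mulr.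
Qed.

(** Dividing an integral of degree [m] by the largest power of [f] that fits leaves one of degree
    [m] modulo [d]. Minimality forces this degree to be 0, and an integral of degree 0 is
    constant. *)
Theorem first_integral_generator : (exists m g1 g2, [/\ 0 < m, integral m g1 g2 & g1 != 0]) ->
  exists (d : nat) f1 f2, [/\ (0 < d)%N, integral d%:Z f1 f2, f1 != 0 &
    forall m g1 g2, integral m g1 g2 -> g1 != 0 -> exists (n : nat) c,
      [/\ m = (n * d)%N%:Z, g1 = c%:P * f1 ^+ n & g2 = c%:P * f2 ^+ n]].
Proof.
move=> [m0 [g10 [g20 [m00 hI0 g10n0]]]].
pose S := [pred d : nat | (0 < d)%N && `[< exists g1 g2, integral d%:Z g1 g2 /\ g1 != 0 >]].
have exS : exists d, S d.
  exists (absz m0); rewrite /= absz_gt0 gt_eqF //=; apply/asboolP; exists g10, g20.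
  by rewrite gez0_abs // ltW.
case: (ex_minnP exS) => d /andP[d0 /asboolP[f1 [f2 [If f10]]]] dmin.
exists d, f1, f2; split=> // m g1 g2 Ig g1n0.
have h10 := charts_wedge_neq0 p0 q0 k0 ch.
have h20 := charts_wedge_neq0 q0 p0 k0 (charts_sym ch).
have [cf ef1 ef2] := If; have [cg eg1 eg2] := Ig.
have f20 : f2 != 0 by apply: contraNneq f10 => f20; apply/eqP; exact: (compat_eq0 p0 q0 cf f20).
have m_ge0 : 0 <= m.
  by rewrite leNgt; apply: contraNN g1n0 => mneg; apply/eqP; exact: (compat_neg p0 q0 mneg cg).
pose M := absz m; have mM : m = M%:Z by rewrite /M gez0_abs.
rewrite mM in cg eg1 eg2.
have /dvdpP[u1 E1] := integral_root_dvd d0 h10 f10 ef1 eg1.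
have /dvdpP[u2 E2] := integral_root_dvd d0 h20 f20 ef2 eg2.
pose n := (M %/ d)%N; pose r := (M %% d)%N; rewrite -/n in E1 E2.
have ME : M%:Z = r%:Z + d%:Z * n%:Z by rewrite /n /r {1}(divn_eq M d) PoszD PoszM; ring.
rewrite ME E1 in eg1; rewrite ME E2 in eg2.
have iu1 := integral_div (expf_neq0 n f10) (integral_exp n ef1) eg1.
have iu2 := integral_div (expf_neq0 n f20) (integral_exp n ef2) eg2.
have cu : compat p q r%:Z u1 u2.
  apply: (compat_cancel p0 q0 _ (compatX n cf)); last by rewrite expf_neq0.
  by rewrite -E1 -E2 -ME.
have u10 : u1 != 0 by apply: contraNneq g1n0 => u10; rewrite E1 u10 mul0r.
have r0 : r = 0%N.
  apply/eqP/negPn/negP; rewrite -lt0n => rpos; have := @dmin r; rewrite /= rpos /=.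
  have -> : `[< exists g1 g2, integral r%:Z g1 g2 /\ g1 != 0 >] by apply/asboolP; exists u1, u2.
  by move=> /(_ isT); rewrite leqNgt ltn_pmod.
rewrite r0 in cu; have u1c := compat_zero p0 q0 cu.
have u2c := compat_zero q0 p0 (compat_sym cu).
have uu : u1`_0 = u2`_0.
  by have := cu 1 (oner_neq0 _); rewrite u1c u2c !hornerC mul1r !coefC.
exists n, u1`_0; split; [|by rewrite -u1c|by rewrite uu -u2c].
by rewrite mM ME r0 add0r mulrC PoszM.
Qed.

End Generator.

(** * The centralizer *)

Section Asymptotics.
Variable R : realType.
Local Notation C := R[i].
Implicit Types (s t x u : C) (V : C -> C) (c : nat -> C) (r K : R) (N M d w : nat).

(** Order [N] is reached only once sufficiently many terms are taken: the form in which weighted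
    expansions restrict to dilation orbits. *)
Definition asymptotic V c := forall N, exists M0, forall M, (M0 <= M)%N -> exists K r,
  [/\ 0 <= K, 0 < r & forall t, t != 0 -> cnorm t < r ->
    cnorm (V t - \sum_(i < M) c i * t ^+ i) <= K * cnorm t ^+ N].

Lemma asymptotic_zero V c : asymptotic V c -> cnear 0 (fun t => t != 0 -> V t = 0) ->
  forall n, c n = 0.
Proof.
move=> as_ [d d0 hd] n; have [M0 hM] := as_ n.+1.
have [K [r [K0 r0 h]]] := hM (maxn M0 n.+1) (leq_maxl _ _).
have : (\poly_(i < maxn M0 n.+1) c i)`_n = 0.
  apply: (@poly_small _ _ n.+1 K (Num.min d r)) => //; first by rewrite lt_min d0.
  move=> t t0; rewrite lt_min horner_poly => /andP[td tr].
  by have := h t t0 tr; rewrite hd ?subr0 // sub0r cnormN.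
by rewrite coef_poly leq_max ltnSn orbT.
Qed.

Lemma asymptotic_leading V c w : asymptotic V c -> (forall n, c n != 0 -> (w <= n)%N) ->
  exists K r, 0 < r /\
    forall t, t != 0 -> cnorm t < r -> cnorm (V t) <= K * cnorm t ^+ w.
Proof.
move=> as_ cw; have [M0 hM] := as_ w; have [K [r [K0 r0 h]]] := hM M0 (leqnn _).
exists (K + \sum_(i < M0) cnorm (c i)), (Num.min r 1); split; first by rewrite lt_min r0 ltr01.
move=> t t0; rewrite lt_min => /andP[tr t1].
apply: le_trans (cnorm_le_D _ (\sum_(i < M0) c i * t ^+ i)) _.
rewrite mulrDl; apply: lerD; first exact: h.
apply: le_trans (cnorm_sum _ _ _) _; rewrite mulr_suml; apply: ler_sum => i _.
rewrite cnormM cnormX; have [ci|ci] := eqVneq (c i) 0; first by rewrite ci cnorm0 !mul0r.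
apply: ler_wpM2l; first exact: cnorm_ge0.
by apply: ler_wiXn2l; rewrite ?cnorm_ge0 ?cw // ltW.
Qed.

(** Exponents of the form [w + d l] give [V(x t) = x^w V(t)] to every order for each [d]-th root of
    unity [x], hence exactly. After division by [t^w] the function is invariant and [descent]
    applies. *)
Lemma asymptotic_descent V c d w : (0 < d)%N -> cholo V -> asymptotic V c ->
  (forall n, c n != 0 -> exists l, n = (w + d * l)%N) ->
  exists2 phi, cholo phi & cnear 0 (fun t => t != 0 -> V t = t ^+ w * phi (t ^+ d)).
Proof.
move=> d0 hV as_ cd.
have [|K [r [r0 hK]]] := @asymptotic_leading V c w as_.
  by move=> n /cd[l ->]; exact: leq_addr.
have [g hg hVg] := divide_power r0 hV hK.
have [l [lE lu ls]] := unity_roots R d0; have lP := unity_rootsP lE.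
have l1 x : x \in l -> cnorm x = 1 by rewrite lP => /eqP; exact: norm_unity.
have rot : cnear 0 (fun t => forall x, x \in l -> V (x * t) - x ^+ w * V t = 0).
  apply: cnear_all => x xl; have nx := l1 x xl.
  have xd : x ^+ d = 1 by apply/eqP; rewrite -lP.
  apply: cholo_flat.
    have hr := cnear_rot l1 hV; apply: cnearS (cnearI hr hV) => t [/(_ x xl)[k hk] [k' hk']].
    exists (k * x - x ^+ w * k'); apply: cderivB; last exact: cderivZ.
    by apply: (cderiv_comp _ hk); have := cderivZ x (cderiv_id t); rewrite mulr1.
  move=> N; have [M0 hM] := as_ N; have [K1 [r1 [K10 r10 h1]]] := hM M0 (leqnn _).
  exists (K1 + K1), r1; split=> // t t0 tr.
  have x0 : x != 0 by rewrite -cnorm_gt0 nx.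
  have := h1 (x * t) (mulf_neq0 x0 t0); rewrite cnormM nx mul1r => /(_ tr) a1.
  have a2 := h1 t t0 tr.
  have -> : V (x * t) - x ^+ w * V t = (V (x * t) - \sum_(i < M0) c i * (x * t) ^+ i) -
      x ^+ w * (V t - \sum_(i < M0) c i * t ^+ i).
    rewrite (_ : \sum_(i < M0) c i * (x * t) ^+ i = x ^+ w * \sum_(i < M0) c i * t ^+ i).
      by ring.
    rewrite mulr_sumr; apply: eq_bigr => i _; have [ci|ci] := eqVneq (c i) 0.
      by rewrite ci !mul0r mulr0.
    have [m ->] := cd _ ci; rewrite exprMn exprD exprM xd expr1n mulr1; ring.
  apply: le_trans (cnormD _ _) _; rewrite cnormN cnormM cnormX nx expr1n mul1r mulrDl.
  exact: lerD.
have inv : cnear 0 (fun t => forall x, x ^+ d = 1 -> g (x * t) = g t).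
  have rotg := @cnear_rot R l (fun t => t != 0 -> V t = t ^+ w * g t) l1 hVg.
  apply: cnearS (cnearI (cnearI rot rotg) hVg) => t [[h1 h2] h3] x xd.
  have [->|t0] := eqVneq t 0; first by rewrite mulr0.
  have xl : x \in l by rewrite lP xd.
  have x0 : x != 0 by rewrite -cnorm_gt0 l1.
  have /eqP := h1 x xl; rewrite subr_eq0 (h2 x xl) ?mulf_neq0 // h3 // exprMn -mulrA.
  by move=> /eqP/(mulfI (expf_neq0 _ x0))/(mulfI (expf_neq0 _ t0)).
have [phi hphi hgphi] := descent d0 hg inv.
exists phi => //; apply: cnearS (cnearI hVg hgphi) => t [h1 h2] t0.
by rewrite h1 // h2.
Qed.
End Asymptotics.

(** * Multiples of [X] by first integrals *)

Section Derivations.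
Variable R : realType.
Local Notation C := R[i].
Implicit Types (z v : C2 R) (f g A B P Q G : C2 R -> C1 R) (X Y : C2 R -> C2 R) (t : C).

Lemma dxE f z : differentiable f z -> cderiv (fun u => f (pt u z.2)) z.1 (dx f z).
Proof.
case: z => x y df; have := cderiv_partial_x (df : differentiable f (pt x y)) (cderiv_id x).
by move: (dx f (pt x y)) => a; rewrite mul1r.
Qed.

Lemma dyE f z : differentiable f z -> cderiv (fun u => f (pt z.1 u)) z.2 (dy f z).
Proof.
case: z => x y df; have := cderiv_partial_y (df : differentiable f (pt x y)) (cderiv_id y).
by move: (dy f (pt x y)) => a; rewrite mul1r.
Qed.

Lemma dxM f g z : differentiable f z -> differentiable g z ->
  dx (fun w => f w * g w : C1 R) z = dx f z * g z + f z * dx g z.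
Proof.
move=> df dg; case: z df dg => x y df dg.
exact: cderiv_uniq (dxE (differentiable_mul df dg)) (cderivM (dxE df) (dxE dg)).
Qed.

Lemma dyM f g z : differentiable f z -> differentiable g z ->
  dy (fun w => f w * g w : C1 R) z = dy f z * g z + f z * dy g z.
Proof.
move=> df dg; case: z df dg => x y df dg.
exact: cderiv_uniq (dyE (differentiable_mul df dg)) (cderivM (dyE df) (dyE dg)).
Qed.

Lemma vderM A B f g z : differentiable f z -> differentiable g z ->
  vder A B (fun w => f w * g w : C1 R) z = vder A B f z * g z + f z * vder A B g z.
Proof.
move=> df dg.
apply: etrans (congr2 (fun a b => A z * a + B z * b) (dxM df dg) (dyM df dg)) _.
rewrite /vder; move: (dx f z) (dx g z) (dy f z) (dy g z) => a b c d; ring.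
Qed.

Lemma vder_comp A B (phi : C -> C) f z l : cderiv phi (f z) l -> differentiable f z ->
  differentiable (fun w => phi (f w) : C1 R) z /\
  vder A B (fun w => phi (f w) : C1 R) z = l * vder A B f z.
Proof.
move=> hphi df; have dc : differentiable (fun w => phi (f w) : C1 R) z.
  apply: (@differentiable_comp _ _ _ _ f (phi : C1 R -> C1 R)) => //.
  by apply/differentiable1P; exists l.
split=> //; case: z hphi df dc => x y hphi df dc.
have Ex := cderiv_uniq (dxE dc) (cderiv_comp (dxE df) hphi).
have Ey := cderiv_uniq (dyE dc) (cderiv_comp (dyE df) hphi).
apply: etrans (congr2 (fun a b => A (x, y) * a + B (x, y) * b) Ex Ey) _.
by rewrite /vder; move: (dx f (x, y)) (dy f (x, y)) => a b; ring.
Qed.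

Lemma near_near (T : topologicalType) (a : T) (S : T -> Prop) : (\forall z \near a, S z) ->
  \forall z \near a, \forall w \near z, S w.
Proof. exact: nbhs_interior. Qed.

Definition represents X A B := \forall z \near (0 : C2 R), X z = pt (A z) (B z).

Lemma vder_near A B X f z : X z = pt (A z) (B z) -> differentiable f z ->
  'D_(X z) f z = vder A B f z.
Proof.
move=> XE df; apply: etrans (deriveE _ df) _; apply: etrans (diff_split _ df) _.
by rewrite XE.
Qed.

Lemma near_bracket X Y A B P Q : holomorphic_germ X -> holomorphic_germ Y ->
  represents X A B -> represents Y P Q -> \forall z \near (0 : C2 R),
  lie_bracket X Y z = (vder A B P z - vder P Q A z, vder A B Q z - vder P Q B z).
Proof.
move=> hX hY /near_near XE /near_near YE.
apply: filterS2 (filterI hX hY) (filterI XE YE) => z [dX dY] [XEz YEz].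
have [Xz Yz] := (nbhs_singleton XEz, nbhs_singleton YEz).
have [dX1 dX2] := (differentiable_components X z).1 dX.
have [dY1 dY2] := (differentiable_components Y z).1 dY.
have same (U : C2 R -> C1 R) V : differentiable U z -> (\forall w \near z, U w = V w) ->
    dx U z = dx V z /\ dy U z = dy V z.
  move=> dU UV; have [_ E] := near_eq_diff UV dU.
  by split; [exact: esym (congr1 (fun F => F (pt 1 0)) E)|exact: esym (congr1 (fun F => F (pt 0 1)) E)].
have eX1 : \forall w \near z, (X w).1 = A w by apply: filterS XEz => w ->.
have eX2 : \forall w \near z, (X w).2 = B w by apply: filterS XEz => w ->.
have eY1 : \forall w \near z, (Y w).1 = P w by apply: filterS YEz => w ->.
have eY2 : \forall w \near z, (Y w).2 = Q w by apply: filterS YEz => w ->.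
have [a1 a2] := same _ _ dX1 eX1; have [b1 b2] := same _ _ dX2 eX2.
have [c1 c2] := same _ _ dY1 eY1; have [d1 d2] := same _ _ dY2 eY2.
have vE (U V U' V' F F' : C2 R -> C1 R) : U z = U' z -> V z = V' z -> dx F z = dx F' z ->
    dy F z = dy F' z -> vder U V F z = vder U' V' F' z.
  by rewrite /vder => -> -> -> ->.
apply: etrans (lie_bracketE dX dY) _.
have X1 : (X z).1 = A z by rewrite Xz. have X2 : (X z).2 = B z by rewrite Xz.
have Y1 : (Y z).1 = P z by rewrite Yz. have Y2 : (Y z).2 = Q z by rewrite Yz.
exact: (congr2 pair (congr2 (fun a b : C1 R => a - b) (vE _ _ _ _ _ _ X1 X2 c1 c2) (vE _ _ _ _ _ _ Y1 Y2 a1 a2))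
  (congr2 (fun a b : C1 R => a - b) (vE _ _ _ _ _ _ X1 X2 d1 d2) (vE _ _ _ _ _ _ Y1 Y2 b1 b2))).
Qed.

Lemma multiple_commutes X Y A B G : holomorphic_germ X -> represents X A B ->
  (forall z, differentiable A z) -> (forall z, differentiable B z) -> holomorphic_germ G ->
  (\forall z \near (0 : C2 R), vder A B G z = 0) -> germ_eq Y (fun z => G z *: X z) ->
  centralizer X Y.
Proof.
move=> hX XE dA dB hG G0 YE.
have YE' : represents Y (fun z => G z * A z : C1 R) (fun z => G z * B z : C1 R).
  by rewrite /represents in XE *; rewrite /germ_eq in YE; apply: filterS2 XE YE => z XEz ->; rewrite XEz.
have hY : holomorphic_germ Y.
  apply: filterS2 hG (near_near YE') => z dG YEz.
  pose Z w : C2 R := pt (G w * A w) (G w * B w).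
  have dZ : differentiable Z z.
    apply/differentiable_components; split; [exact: differentiable_mul dG (dA z)|exact: differentiable_mul dG (dB z)].
  have ZY : \forall w \near z, Z w = Y w by apply: filterS YEz => w ->.
  by have [] := near_eq_diff ZY dZ.
split=> //; rewrite /germ_eq.
apply: filterS2 (near_bracket hX hY XE YE') (filterI hG G0) => z -> [dG Gz].
have E (U : C2 R -> C1 R) : (forall z, differentiable U z) ->
    vder A B (fun w => G w * U w : C1 R) z -
    vder (fun w => G w * A w : C1 R) (fun w => G w * B w : C1 R) U z = 0.
  move=> dU; have := vderM A B dG (dU z); rewrite Gz => ->; rewrite /vder.
  by move: (dx U z) (dy U z) => a b; ring.
exact: (congr2 pair (E A dA) (E B dB)).
Qed.

Lemma vf_apply_near X A B g : represents X A B -> holomorphic_germ g ->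
  \forall z \near (0 : C2 R), vf_apply X g z = vder A B g z.
Proof. by move=> XE hg; apply: filterS2 XE hg => z; exact: vder_near. Qed.

End Derivations.

(** * Expansion of a commuting field in powers of [f] *)

Section Structure.
Variable R : realType.
Local Notation C := R[i].
Implicit Types (z : C2 R) (f U D G : C2 R -> C1 R) (g : {poly C}) (Y : C2 R -> C2 R) (s t c : C) (e : nat -> C).
Variables (p q : nat).
Hypotheses (p0 : (0 < p)%N) (q0 : (0 < q)%N).

Lemma sum_shift (F : nat -> C) (s M : nat) : (forall n, (n < s)%N -> F n = 0) ->
  \sum_(n < M + s) F n = \sum_(i < M) F (i + s)%N.
Proof.
move=> F0; rewrite addnC big_split_ord /= big1 ?add0r => [|i _]; last by rewrite F0.
by apply: eq_bigr => i _; rewrite addnC.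
Qed.

Lemma n2_dil_lt z0 d0 : 0 < d0 -> z0 != 0 -> exists2 r, 0 < r &
  forall t, cnorm t < r -> n2 (dil p q t z0) <= cnorm t * n2 z0 /\ n2 (dil p q t z0) < d0.
Proof.
move=> d00 z00; have n0 : 0 < n2 z0 by rewrite n2_gt0.
exists (Num.min 1 (d0 / n2 z0)); first by rewrite lt_min ltr01 divr_gt0.
move=> t; rewrite lt_min => /andP[/ltW t1]; rewrite ltr_pdivlMr // => t2.
have := @n2_dil R p q p0 q0 t z0 t1; split=> //; lra.
Qed.

Lemma cholo_dil U z0 : holomorphic_germ U -> z0 != 0 -> cholo (fun t => U (dil p q t z0)).
Proof.
move=> /near0_n2P[d0 d00 hU] z00; have [r r0 hr] := n2_dil_lt d00 z00.
exists r => // t; rewrite subr0 => /hr[_ /hU dU].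
have h1 := cderivM (cderivX p (cderiv_id t)) (cderiv_cst z0.1 t).
have h2 := cderivM (cderivX q (cderiv_id t)) (cderiv_cst z0.2 t).
have := @cderiv_curve R U (fun t => t ^+ p * z0.1) (fun t => t ^+ q * z0.2) t _ _ dU h1 h2.
by eexists; eassumption.
Qed.

(** On the orbit of [z0] one has [f = t^d] and [D = t^w D(z0)], so the term of index [n] becomes
    [e n * D z0 * t^(n - s)]; [s] is the gap between the index and the exponent. *)
Lemma curve_asymptotic U D f e (l : nat -> nat) (d w s : nat) z0 :
  (0 < d)%N -> hom p q w%:Z D -> hom p q d%:Z f -> f z0 = 1 -> z0 != 0 ->
  (forall n, e n != 0 -> n = (w + s + d * l n)%N) ->
  (forall N, exists M0, forall M, (M0 <= M)%N ->
     bigO N (fun z => U z - \sum_(n < M) e n * f z ^+ l n * D z)) ->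
  asymptotic (fun t => U (dil p q t z0)) (fun i => e (i + s)%N * D z0).
Proof.
move=> d0 hD hf fz0 z00 he hU N; have [M0 hM] := hU N; exists M0 => M MM.
have [|K1 K10 [d1 d10 h]] := hM (M + s)%N; first exact: leq_trans MM (leq_addr _ _).
have [r r0 hr] := n2_dil_lt d10 z00.
exists (K1 * n2 z0 ^+ N), r; split=> //; first by rewrite mulr_ge0 // exprn_ge0 // n2_ge0.
move=> t t0 tr; have [n1 n2'] := hr t tr.
have := h (dil p q t z0); rewrite n2_gt0 dil_neq0 // => /(_ isT n2').
have E n : e n * f (dil p q t z0) ^+ l n * D (dil p q t z0) =
    if (s <= n)%N then e n * D z0 * t ^+ (n - s) else 0.
  have [en|en] := eqVneq (e n) 0; first by rewrite en !mul0r; case: ifP.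
  have nE := he n en; have -> : (s <= n)%N by rewrite nE; lia.
  rewrite hf // hD // fz0 mulr1 -!exprnP -exprM (_ : n - s = d * l n + w)%N; last by rewrite {1}nE; lia.
  by rewrite exprD; ring.
have -> : \sum_(n < M + s) e n * f (dil p q t z0) ^+ l n * D (dil p q t z0) =
    \sum_(i < M) e (i + s)%N * D z0 * t ^+ i.
  transitivity (\sum_(n < M + s) (if (s <= n)%N then e n * D z0 * t ^+ (n - s) else 0)).
    by apply: eq_bigr => i _; exact: E.
  rewrite (@sum_shift (fun n => if (s <= n)%N then e n * D z0 * t ^+ (n - s) else 0)).
    by apply: eq_bigr => i _; rewrite leq_addl addnK.
  by move=> n ns; rewrite leqNgt ns.
move=> H; apply: le_trans H _; rewrite -mulrA; apply: ler_wpM2l => //.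
rewrite -exprMn mulrC; apply: lerXn2r; rewrite ?nnegrE ?n2_ge0 //.
by rewrite mulr_ge0 ?cnorm_ge0 ?n2_ge0.
Qed.

Variables (K : nat) (A B : C2 R -> C1 R) (X : C2 R -> C2 R) (A1 A2 B1 B2 : {poly C}).
Hypotheses (K0 : (0 < K)%N) (wA : wpoly p q (K%:Z + p%:Z) A) (wB : wpoly p q (K%:Z + q%:Z) B).
Hypotheses (A1E : forall t, A (pt 1 t) = A1.[t]) (A2E : forall t, A (pt t 1) = A2.[t]).
Hypotheses (B1E : forall t, B (pt 1 t) = B1.[t]) (B2E : forall t, B (pt t 1) = B2.[t]).
Hypothesis isolated : forall z, z != 0 -> A z = 0 -> B z <> 0.
Hypotheses (A0 : A 0 = 0) (B0 : B 0 = 0).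
Hypothesis nd : non_dicritical (fun z => pt (A z) (B z)).
Hypotheses (hX : holomorphic_germ X) (XE : represents X A B).
Local Notation integral := (chart_first_integral p q A1 A2 B1 B2).

Lemma represents_components Y : represents Y (fun z => (Y z).1) (fun z => (Y z).2).
Proof. by apply: filterE => z; case: (Y z). Qed.

Lemma holomorphic_components Y : holomorphic_germ Y ->
  holomorphic_germ (fun z => (Y z).1 : C1 R) /\ holomorphic_germ (fun z => (Y z).2 : C1 R).
Proof.
by move=> hY; split; apply: filterS hY => z /differentiable_components[].
Qed.

(** The component of index [n] has degree [n - p - q], and it is [c f^l X] of degree [K + d l], or 0
    with the default exponent. The value [d = 0] is allowed, for use with a constant [f]. *)
Lemma centralizer_coefs d f (f1 f2 : {poly C}) Y : hom p q d%:Z f ->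
  (forall t, f (pt 1 t) = f1.[t]) -> (forall t, f (pt t 1) = f2.[t]) ->
  (forall m g1 g2, integral m g1 g2 -> g1 != 0 -> exists (n : nat) c,
      [/\ m = (n * d)%N%:Z, g1 = c%:P * f1 ^+ n & g2 = c%:P * f2 ^+ n]) ->
  centralizer X Y -> exists e (l : nat -> nat),
    (forall n, e n != 0 -> n = (K + p + q + d * l n)%N) /\
    forall N, exists M0, forall M, (M0 <= M)%N ->
      bigO N (fun z => (Y z).1 - \sum_(n < M) e n * f z ^+ l n * A z) /\
      bigO N (fun z => (Y z).2 - \sum_(n < M) e n * f z ^+ l n * B z).
Proof.
move=> hf f1E f2E gen [hY br]; have [hY1 hY2] := holomorphic_components hY.
have comm : \forall z \near (0 : C2 R),
    vder A B (fun z => (Y z).1 : C1 R) z = vder (fun z => (Y z).1 : C1 R) (fun z => (Y z).2 : C1 R) A z /\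
    vder A B (fun z => (Y z).2 : C1 R) z = vder (fun z => (Y z).1 : C1 R) (fun z => (Y z).2 : C1 R) B z.
  have br' : \forall z \near (0 : C2 R), lie_bracket X Y z = 0 := br.
  apply: filterS2 (near_bracket hX hY XE (represents_components Y)) br' => z E1 E2.
  have E : _ = 0 := etrans (esym E1) E2.
  exact: conj (subr0_eq (congr1 fst E)) (subr0_eq (congr1 snd E)).
have [dA hA _ _] := wA; have [dB hB _ _] := wB.
have [P [Q [wP wQ hc hbig]]] := bracket_components p0 q0 dA dB hA hB hY1 hY2 comm.
have /choice[el hel] n : exists cl : C * nat, (cl.1 != 0 -> n = (K + p + q + d * cl.2)%N) /\
    forall z, z != 0 -> P n z = cl.1 * f z ^+ cl.2 * A z /\ Q n z = cl.1 * f z ^+ cl.2 * B z.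
  pose j : int := n%:Z - p%:Z - q%:Z.
  have wPn : wpoly p q (j + p%:Z) (P n).
    by rewrite (_ : j + p%:Z = n%:Z - q%:Z) /j; [exact: wP|ring].
  have wQn : wpoly p q (j + q%:Z) (Q n).
    by rewrite (_ : j + q%:Z = n%:Z - p%:Z) /j; [exact: wQ|ring].
  have [_ hPn [P1 P1E] [P2 P2E]] := wPn; have [_ hQn [Q1 Q1E] [Q2 Q2E]] := wQn.
  have k0 : 0 < K%:Z by [].
  have [g1 [g2 [Ig EP1 EQ1 EP2 EQ2]]] := commuting_multiple p0 q0 k0 wA wB A1E A2E B1E B2E
    isolated A0 B0 nd wPn wQn P1E P2E Q1E Q2E (hc n).
  have [g10|g10] := eqVneq g1 0.
    have [cg _ _] := Ig; have g20 := compat_eq0 q0 p0 (compat_sym cg) g10.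
    exists (0, 0%N); split=> [|z z0]; first by rewrite eqxx.
    have hom0 (m : int) : hom p q m (fun=> 0 : C1 R) by move=> t w t0; rewrite mulr0.
    rewrite /= !mul0r; split.
      apply: (hom_ext p0 q0 hPn (hom0 _)) => // t; [rewrite P1E EP1 g10|rewrite P2E EP2 g20];
      by rewrite mul0r horner0.
    apply: (hom_ext p0 q0 hQn (hom0 _)) => // t; [rewrite Q1E EQ1 g10|rewrite Q2E EQ2 g20];
    by rewrite mul0r horner0.
  have [l [c [ml E1 E2]]] := gen _ _ _ Ig g10.
  have hfl : hom p q ((l * d)%N%:Z) (fun z => c * f z ^+ l : C1 R).
    by move=> t z t0; rewrite hf // exprMn -!exprnP -exprM mulnC; ring.
  exists (c, l); split=> [_|z z0] /=; first by move: ml; rewrite /j mulnC; lia.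
  have hPA : hom p q (j + p%:Z) (fun z => c * f z ^+ l * A z : C1 R).
    by rewrite (_ : j + p%:Z = (l * d)%N%:Z + (K%:Z + p%:Z)); [exact: hom_mul|rewrite -ml; ring].
  have hQB : hom p q (j + q%:Z) (fun z => c * f z ^+ l * B z : C1 R).
    by rewrite (_ : j + q%:Z = (l * d)%N%:Z + (K%:Z + q%:Z)); [exact: hom_mul|rewrite -ml; ring].
  split.
    apply: (hom_ext p0 q0 hPn hPA) => // t.
      by rewrite P1E EP1 E1 f1E A1E !hornerM hornerC horner_exp.
    by rewrite P2E EP2 E2 f2E A2E !hornerM hornerC horner_exp.
  apply: (hom_ext p0 q0 hQn hQB) => // t.
    by rewrite Q1E EQ1 E1 f1E B1E !hornerM hornerC horner_exp.
  by rewrite Q2E EQ2 E2 f2E B2E !hornerM hornerC horner_exp.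
exists (fun n => (el n).1), (fun n => (el n).2); split=> [n|N]; first exact: (hel n).1.
have [M0 hM] := hbig N; exists M0 => M /hM[b1 b2]; split.
  apply: eq_bigO_neq0 b1 => z z0; congr (_ - _); apply: eq_bigr => n _.
  exact: ((hel n).2 z z0).1.
apply: eq_bigO_neq0 b2 => z z0; congr (_ - _); apply: eq_bigr => n _.
exact: ((hel n).2 z z0).2.
Qed.

(** Without an integral of positive degree, the constants are the only homogeneous integrals, and
    [centralizer_coefs] with [d = 0] and [f = 1] leaves the single index [K + p + q]: every
    commuting field is a scalar multiple of [X]. *)
Lemma nonconstant_integral : centralizer X <> scalar_multiples X ->
  exists m g1 g2, [/\ 0 < m, integral m g1 g2 & g1 != 0].
Proof.
move=> hC; apply: contrapT => no; apply: hC; apply/seteqP; split=> Y; last first.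
  move=> [c YE]; have [dA _ _ _] := wA; have [dB _ _ _] := wB.
  apply: (multiple_commutes hX XE dA dB (G := fun=> c) _ _ YE).
    by apply: holomorphic_germ_all => z; exact: differentiable_const.
  apply: filterE => z; rewrite /vder.
  by apply: etrans (congr2 (fun a b => A z * a + B z * b) (dx_cst c z) (dy_cst c z)) _; rewrite !mulr0 addr0.
move=> CY; have hom1 : hom p q 0%:Z (fun=> 1 : C1 R) by move=> t z t0; rewrite mul1r.
have gen m g1 g2 : integral m g1 g2 -> g1 != 0 -> exists (n : nat) c,
    [/\ m = (n * 0)%N%:Z, g1 = c%:P * 1 ^+ n & g2 = c%:P * 1 ^+ n].
  move=> Ig g10; have [cg _ _] := Ig.
  have [mneg|mpos|m0] := ltgtP m 0.
  - by rewrite (compat_neg p0 q0 mneg cg) eqxx in g10.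
  - by case: no; exists m, g1, g2.
  rewrite m0 in cg; have u1c := compat_zero p0 q0 cg.
  have u2c := compat_zero q0 p0 (compat_sym cg).
  have uu : g1`_0 = g2`_0.
    by have := cg 1 (oner_neq0 _); rewrite u1c u2c !hornerC mul1r !coefC.
  exists 0%N, g1`_0; rewrite muln0 !expr0 !mulr1; split=> //; by rewrite uu.
have one1 t : (1 : C1 R) = (1 : {poly C}).[t] by rewrite hornerC.
have [e [l [he hb]]] := @centralizer_coefs 0 (fun=> 1) 1 1 Y hom1 one1 one1 gen CY.
pose n0 := (K + p + q)%N.
have sumE (U : C2 R -> C1 R) z M : (n0 < M)%N -> \sum_(n < M) e n * 1 ^+ l n * U z = e n0 * U z.
  move=> nM; rewrite (bigD1 (Ordinal nM)) //= expr1n mulr1 big1 ?addr0 // => i ni.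
  have [ei|ei] := eqVneq (e i) 0; first by rewrite ei !mul0r.
  by move: ni; rewrite -val_eqE /= {1}(he _ ei) mul0n addn0 eqxx.
have [hY _] := CY; have [hY1 hY2] := holomorphic_components hY.
have [dA _ _ _] := wA; have [dB _ _ _] := wB.
have flat (U V : C2 R -> C1 R) : holomorphic_germ V -> (forall z, differentiable U z) ->
    (forall N, exists M0, forall M, (M0 <= M)%N -> bigO N (fun z => V z - \sum_(n < M) e n * 1 ^+ l n * U z)) ->
    germ_eq (fun z => V z - e n0 * U z : C1 R) (fun=> 0).
  move=> hV dU hVU; apply: holomorphic_germ_zero.
    apply: holomorphic_germB => //; apply: holomorphic_germ_all => z.
    exact: differentiable_mul (differentiable_const _ z) (dU z).
  move=> N; have [M0 hM] := hVU N; have := hM (maxn M0 n0.+1) (leq_maxl _ _).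
  by apply: eq_bigO_neq0 => z z0; rewrite sumE // leq_maxr.
have z1 : germ_eq (fun z => (Y z).1 - e n0 * A z : C1 R) (fun=> 0).
  by apply: flat => // N; have [M0 hM] := hb N; exists M0 => M /hM[].
have z2 : germ_eq (fun z => (Y z).2 - e n0 * B z : C1 R) (fun=> 0).
  by apply: flat => // N; have [M0 hM] := hb N; exists M0 => M /hM[].
exists (e n0); rewrite /germ_eq in z1 z2 *; have XE' := XE; rewrite /represents in XE'.
apply: filterS3 z1 z2 XE' => z E1 E2 ->; move/eqP: E1; rewrite subr_eq0 => /eqP E1.
move/eqP: E2; rewrite subr_eq0 => /eqP E2.
by rewrite [LHS]surjective_pairing E1 E2.
Qed.
End Structure.

(** * Convergence, and the two equalities of the conclusion *)

Section Centralizer.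
Variable R : realType.
Local Notation C := R[i].
Implicit Types (z : C2 R) (f U D G : C2 R -> C1 R) (g : {poly C}) (Y : C2 R -> C2 R) (s t c : C) (e : nat -> C).
Variables (p q K : nat).
Hypotheses (p0 : (0 < p)%N) (q0 : (0 < q)%N) (K0 : (0 < K)%N).
Variables (A B : C2 R -> C1 R) (X : C2 R -> C2 R) (A1 A2 B1 B2 : {poly C}).
Hypotheses (wA : wpoly p q (K%:Z + p%:Z) A) (wB : wpoly p q (K%:Z + q%:Z) B).
Hypotheses (A1E : forall t, A (pt 1 t) = A1.[t]) (A2E : forall t, A (pt t 1) = A2.[t]).
Hypotheses (B1E : forall t, B (pt 1 t) = B1.[t]) (B2E : forall t, B (pt t 1) = B2.[t]).
Hypothesis isolated : forall z, z != 0 -> A z = 0 -> B z <> 0.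
Hypotheses (A0 : A 0 = 0) (B0 : B 0 = 0).
Hypothesis nd : non_dicritical (fun z => pt (A z) (B z)).
Hypotheses (hX : holomorphic_germ X) (XE : represents X A B).
Local Notation integral := (chart_first_integral p q A1 A2 B1 B2).

Lemma vderB (P Q f h : C2 R -> C1 R) z : differentiable f z -> differentiable h z ->
  vder P Q (fun w => f w - h w : C1 R) z = vder P Q f z - vder P Q h z.
Proof.
move=> df dh; apply: etrans (congr2 (fun a b => P z * a + Q z * b) (dxB df dh) (dyB df dh)) _.
rewrite /vder; move: (dx f z) (dx h z) (dy f z) (dy h z) => a b c d; ring.
Qed.

Lemma centralizer_sub Y (Z : C2 R -> C2 R) : centralizer X Y -> centralizer X Z ->
  centralizer X (fun z => pt ((Y z).1 - (Z z).1) ((Y z).2 - (Z z).2)).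
Proof.
move=> [hY bY] [hZ bZ]; set W := fun z => _.
have [hY1 hY2] := holomorphic_components hY; have [hZ1 hZ2] := holomorphic_components hZ.
have hW1 := holomorphic_germB hY1 hZ1; have hW2 := holomorphic_germB hY2 hZ2.
have hW : holomorphic_germ W.
  by apply: filterS2 hW1 hW2 => z d1 d2; apply/differentiable_components.
split; first exact: hW.
rewrite /germ_eq in bY bZ *.
have WE : represents W (fun z => (Y z).1 - (Z z).1) (fun z => (Y z).2 - (Z z).2).
  exact: filterE.
have nY := near_bracket hX hY XE (represents_components Y).
have nZ := near_bracket hX hZ XE (represents_components Z).
have nW := near_bracket hX hW XE WE.
apply: filterS3 nW (filterI (filterI nY bY) (filterI nZ bZ))
  (filterI (filterI hY1 hY2) (filterI hZ1 hZ2)).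
move=> z EW [[EY Y0] [EZ Z0]] [[dY1 dY2] [dZ1 dZ2]]; apply: etrans EW _.
have EY0 : _ = 0 := etrans (esym EY) Y0; have EZ0 : _ = 0 := etrans (esym EZ) Z0.
have y1 := congr1 fst EY0; have y2 := congr1 snd EY0.
have z1 := congr1 fst EZ0; have z2 := congr1 snd EZ0.
have sub_vder (P Q P' Q' F : C2 R -> C1 R) : vder (fun z => P z - P' z : C1 R) (fun z => Q z - Q' z : C1 R) F z =
    vder P Q F z - vder P' Q' F z.
  by rewrite /vder; move: (dx F z) (dy F z) => a b; ring.
have sub4 (a b c d : C) : a - b = 0 -> c - d = 0 -> a - c - (b - d) = 0.
  by move=> /subr0_eq -> /subr0_eq ->; rewrite subrr.
have E1 := etrans (congr2 (fun a b : C1 R => a - b) (vderB A B dY1 dZ1)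
  (sub_vder (fun z => (Y z).1) (fun z => (Y z).2) (fun z => (Z z).1) (fun z => (Z z).2) A)) (sub4 _ _ _ _ y1 z1).
have E2 := etrans (congr2 (fun a b : C1 R => a - b) (vderB A B dY2 dZ2)
  (sub_vder (fun z => (Y z).1) (fun z => (Y z).2) (fun z => (Z z).1) (fun z => (Z z).2) B)) (sub4 _ _ _ _ y2 z2).
exact: (congr2 pair E1 E2).
Qed.

Lemma near_comp f (S : C -> Prop) : differentiable f 0 -> f 0 = 0 -> cnear 0 S ->
  \forall z \near (0 : C2 R), S (f z).
Proof.
move=> df f0 hS; have := differentiable_continuous df; apply; rewrite f0.
exact/near_CP.
Qed.

Section Integral.
Variables (d : nat) (f : C2 R -> C1 R) (f1 f2 : {poly C}).
Hypotheses (d0 : (0 < d)%N) (df : forall z, differentiable f z) (hf : hom p q d%:Z f).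
Hypotheses (f1E : forall t, f (pt 1 t) = f1.[t]) (f2E : forall t, f (pt t 1) = f2.[t]).
Hypothesis If : integral d%:Z f1 f2.

Lemma hom_zero : f 0 = 0.
Proof.
have two0 : (2 : C) != 0 by rewrite pnatr_eq0.
have := hf 0 two0; rewrite (_ : dil p q 2 0 = 0); last by rewrite /dil !mulr0.
move=> E; have : (2 ^+ d - 1) * f 0 = 0 by rewrite mulrBl mul1r {2}E subrr.
move/eqP; rewrite mulf_eq0 subr_eq0 -natrX pnatr_eq1 => /orP[/eqP E2|/eqP//].
by move: (ltn_expl d (isT : 1 < 2)%N); rewrite E2 ltnS leqNgt d0.
Qed.

Lemma vder_integral z : vder A B f z = 0.
Proof.
have [z0|z0] := eqVneq z 0.
  by rewrite z0 /vder A0 B0; move: (dx f 0) (dy f 0) => a b; rewrite !mul0r addr0.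
have [_ e1 e2] := If; have [dA hA _ _] := wA; have [dB hB _ _] := wB.
have pC : (p%:R : C) != 0 by rewrite pnatr_eq0 -lt0n.
have qC : (q%:R : C) != 0 by rewrite pnatr_eq0 -lt0n.
have wE p' q' (U V : {poly C}) t : (wedge p' q' U V).[t] = p'%:R * V.[t] - q'%:R * t * U.[t].
  by rewrite /wedge hornerD hornerN !hornerM !horner_nat hornerX.
have hom0 (m : int) : hom p q m (fun=> 0 : C1 R) by move=> t w t0; rewrite mulr0.
apply: (hom_ext p0 q0 (hom_vder hA hB df hf) (hom0 _)) => // t.
  apply: (mulfI pC); rewrite mulr0 (chart_vder df hf f1E (A1E t) (B1E t)) -wE.
  by have := congr1 (fun P => P.[t]) e1; rewrite /= hornerD !hornerM horner_int horner0.
have hf' := hom_swap hf.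
have df' z' : differentiable (f \o @swap R) z' by have [] := diff_swap (df (swap z')).
have f2E' u : (f \o @swap R) (pt 1 u) = f2.[u] := f2E u.
have B2E' : (B \o @swap R) (pt 1 t) = B2.[t] := B2E t.
have A2E' : (A \o @swap R) (pt 1 t) = A2.[t] := A2E t.
apply: etrans (esym (@vder_swap R A B f (pt 1 t) (df _))) _.
apply: (mulfI qC); rewrite mulr0 (chart_vder df' hf' f2E' B2E' A2E') -wE.
by have := congr1 (fun P => P.[t]) e2; rewrite /= hornerD !hornerM horner_int horner0.
Qed.

Lemma composition_integral (phi : C1 R -> C1 R) : holomorphic_germ phi ->
  holomorphic_germ (phi \o f) /\ \forall z \near (0 : C2 R), vder A B (phi \o f) z = 0.
Proof.
move=> /choloP hphi; have := near_comp (df 0) hom_zero hphi => hz.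
split; apply: filterS hz => z [l hl]; have [h1 h2] := vder_comp A B hl (df z).
  exact: h1.
by apply: etrans h2 _; rewrite vder_integral mulr0.
Qed.

Lemma composition_commutes (phi : C1 R -> C1 R) Y : holomorphic_germ phi ->
  germ_eq Y (fun z => phi (f z) *: X z) -> centralizer X Y.
Proof.
move=> hphi YE; have [dA _ _ _] := wA; have [dB _ _ _] := wB.
have [hG G0] := composition_integral hphi.
exact: (multiple_commutes hX XE dA dB hG G0 YE).
Qed.

Hypothesis gen : forall m g1 g2, integral m g1 g2 -> g1 != 0 -> exists (n : nat) c,
  [/\ m = (n * d)%N%:Z, g1 = c%:P * f1 ^+ n & g2 = c%:P * f2 ^+ n].
Variable z0 : C2 R.
Hypotheses (fz0 : f z0 = 1) (z00 : z0 != 0).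

(** Since [f = t^d] on the orbit of [z0], [asymptotic_descent] produces a convergent function of
    [f]; the factor [t^w] is absorbed by [D]. *)
Lemma component_composition U D e (l : nat -> nat) (w s : nat) :
  hom p q w%:Z D -> D z0 != 0 -> holomorphic_germ U ->
  (forall n, e n != 0 -> n = (w + s + d * l n)%N) ->
  (forall N, exists M0, forall M, (M0 <= M)%N ->
     bigO N (fun z => U z - \sum_(n < M) e n * f z ^+ l n * D z)) ->
  exists2 phi, cholo phi & cnear 0 (fun t => t != 0 ->
    U (dil p q t z0) = phi (f (dil p q t z0)) * D (dil p q t z0)).
Proof.
move=> hD Dz hU he hb; have as_ := curve_asymptotic p0 q0 d0 hD hf fz0 z00 he hb.
have [|phi hphi hU'] := asymptotic_descent (w := w) d0 (cholo_dil p0 q0 hU z00) as_.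
  move=> n; rewrite mulf_eq0 negb_or => /andP[en _]; exists (l (n + s)%N).
  by have := he _ en; move=> E; apply: (@addIn s); rewrite {1}E; ring.
exists (fun t => (D z0)^-1 * phi t).
  by apply: cnearS hphi => t [k hk]; exists ((D z0)^-1 * k); exact: cderivZ.
apply: cnearS hU' => t ht t0; rewrite ht // hf // hD // fz0 mulr1 -!exprnP.
by field.
Qed.

Lemma component_zero U D e (l : nat -> nat) (w s : nat) :
  hom p q w%:Z D -> D z0 != 0 ->
  (forall n, e n != 0 -> n = (w + s + d * l n)%N) ->
  (forall N, exists M0, forall M, (M0 <= M)%N ->
     bigO N (fun z => U z - \sum_(n < M) e n * f z ^+ l n * D z)) ->
  cnear 0 (fun t => t != 0 -> U (dil p q t z0) = 0) -> forall n, e n = 0.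
Proof.
move=> hD Dz he hb hU0; have as_ := curve_asymptotic p0 q0 d0 hD hf fz0 z00 he hb.
have e0 := asymptotic_zero as_ hU0.
move=> n; apply/eqP/negPn/negP => en; have nE := he n en.
have := e0 (n - s)%N; rewrite subnK; last by rewrite nE; lia.
by move/eqP; rewrite mulf_eq0 (negPf en) (negPf Dz).
Qed.

(** [phi] is read on the orbit of [z0] from a component of [X] nonzero at [z0]. The same component
    of [Y - phi(f) X] vanishes on the orbit, which kills every coefficient in the expansion of this
    commuting field; both its components are then flat. *)
Lemma centralizer_composition Y : centralizer X Y ->
  exists2 phi : C1 R -> C1 R, holomorphic_germ phi & germ_eq Y (fun z => phi (f z) *: X z).
Proof.
move=> CY; have [_ hA _ _] := wA; have [_ hB _ _] := wB.
have coefs := centralizer_coefs p0 q0 K0 wA wB A1E A2E B1E B2E isolated A0 B0 nd hX XE hf f1E f2E gen.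
have [e [l [he hb]]] := coefs Y CY.
have hb1 N : exists M0, forall M, (M0 <= M)%N ->
    bigO N (fun z => (Y z).1 - \sum_(n < M) e n * f z ^+ l n * A z).
  by have [M0 hM] := hb N; exists M0 => M /hM[].
have hb2 N : exists M0, forall M, (M0 <= M)%N ->
    bigO N (fun z => (Y z).2 - \sum_(n < M) e n * f z ^+ l n * B z).
  by have [M0 hM] := hb N; exists M0 => M /hM[].
have swapn m : (K + p + q + m = K + q + p + m)%N by rewrite (addnAC K p q).
have he' n : e n != 0 -> n = (K + q + p + d * l n)%N by move=> /he; rewrite swapn.
have [hY1 hY2] := holomorphic_components CY.1.
have [phi hphi hYphi] : exists2 phi : C -> C, cholo phi &
    (A z0 != 0 /\ cnear 0 (fun t => t != 0 -> (Y (dil p q t z0)).1 = phi (f (dil p q t z0)) * A (dil p q t z0))) \/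
    (B z0 != 0 /\ cnear 0 (fun t => t != 0 -> (Y (dil p q t z0)).2 = phi (f (dil p q t z0)) * B (dil p q t z0))).
  have [Az|Az] := eqVneq (A z0) 0.
    have Bz : B z0 != 0 by apply/eqP; exact: isolated Az.
    have [phi hphi h] := component_composition hB Bz hY2 he' hb2.
    by exists phi => //; right.
  have [phi hphi h] := component_composition hA Az hY1 he hb1.
  by exists phi => //; left.
have hphi' : holomorphic_germ (phi : C1 R -> C1 R) by apply/choloP.
exists phi => //.
pose Z z : C2 R := pt (phi (f z) * A z) (phi (f z) * B z).
have XE' : \forall z \near (0 : C2 R), X z = pt (A z) (B z) := XE.
have ZE : \forall z \near (0 : C2 R), Z z = phi (f z) *: X z by apply: filterS XE' => z ->.
have CZ : centralizer X Z := composition_commutes hphi' ZE.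
have CW := centralizer_sub CY CZ.
have [e' [l' [he1 hbW]]] := coefs _ CW.
have he2 n : e' n != 0 -> n = (K + q + p + d * l' n)%N by move=> /he1; rewrite swapn.
have hbW1 N : exists M0, forall M, (M0 <= M)%N ->
    bigO N (fun z => (Y z).1 - (Z z).1 - \sum_(n < M) e' n * f z ^+ l' n * A z).
  by have [M0 hM] := hbW N; exists M0 => M /hM[].
have hbW2 N : exists M0, forall M, (M0 <= M)%N ->
    bigO N (fun z => (Y z).2 - (Z z).2 - \sum_(n < M) e' n * f z ^+ l' n * B z).
  by have [M0 hM] := hbW N; exists M0 => M /hM[].
have e'0 : forall n, e' n = 0.
  case: hYphi => -[Dz h].
    apply: (component_zero hA Dz he1 hbW1); apply: cnearS h => t ht t0.
    by rewrite ht // subrr.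
  apply: (component_zero hB Dz he2 hbW2); apply: cnearS h => t ht t0.
  by rewrite ht // subrr.
have zero (U D : C2 R -> C1 R) : holomorphic_germ U -> (forall N, exists M0, forall M, (M0 <= M)%N ->
    bigO N (fun z => U z - \sum_(n < M) e' n * f z ^+ l' n * D z)) -> germ_eq U (fun=> 0).
  move=> hU hb'; apply: holomorphic_germ_zero => // N; have [M0 hM] := hb' N.
  apply: eq_bigO_neq0 (hM M0 (leqnn _)) => z _; rewrite big1 ?subr0 // => n _.
  by rewrite e'0 !mul0r.
have [hZ1 hZ2] := holomorphic_components CZ.1.
have w1 : \forall z \near (0 : C2 R), (Y z).1 - (Z z).1 = 0 := zero _ _ (holomorphic_germB hY1 hZ1) hbW1.
have w2 : \forall z \near (0 : C2 R), (Y z).2 - (Z z).2 = 0 := zero _ _ (holomorphic_germB hY2 hZ2) hbW2.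
rewrite /germ_eq; apply: filterS3 w1 w2 ZE => z /subr0_eq E1 /subr0_eq E2 <-.
by rewrite [LHS]surjective_pairing E1 E2.
Qed.

Lemma centralizerE : centralizer X = composition_multiples f X.
Proof.
apply/seteqP; split=> Y.
  by move=> /centralizer_composition[phi hphi YE]; exists (phi \o f) => //; exists phi => //; exact: filterE.
move=> [g [phi hphi gE] YE]; apply: (composition_commutes hphi).
by rewrite /germ_eq in gE YE *; apply: filterS2 gE YE => z E ->; rewrite E.
Qed.

(** For a first integral [g], the field [g X] commutes with [X] and equals [phi(f) X]. So
    [g = phi(f)] near 0 wherever [X] is nonzero, that is off 0, and flatness settles the origin. *)
Lemma first_integralsE : first_integrals X = compositions f.
Proof.
have [dA _ _ _] := wA; have [dB _ _ _] := wB.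
have XE' : \forall z \near (0 : C2 R), X z = pt (A z) (B z) := XE.
apply/seteqP; split=> g.
  move=> [hg gX]; have g0 : \forall z \near (0 : C2 R), vder A B g z = 0.
    by rewrite /germ_eq in gX; apply: filterS2 (vf_apply_near XE hg) gX => z <- ->.
  have CY : centralizer X (fun z => g z *: X z).
    by apply: (multiple_commutes hX XE dA dB hg g0); exact: filterE.
  have [phi hphi YE] := centralizer_composition CY.
  exists phi => //; have [hG _] := composition_integral hphi.
  have := holomorphic_germ_zero (holomorphic_germB hg hG); rewrite /germ_eq in YE * => h.
  suff : \forall z \near (0 : C2 R), g z - (phi \o f) z = 0 by apply: filterS => z /subr0_eq.
  apply: h => N; exists 0 => //; have hXY : \forall z \near (0 : C2 R),
      X z = pt (A z) (B z) /\ g z *: X z = phi (f z) *: X z by exact: filterI XE' YE.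
  have [r r0 hr] := (near0_n2P (fun z =>
    X z = pt (A z) (B z) /\ g z *: X z = phi (f z) *: X z)).1 hXY.
  exists r => // z zn /hr[XEz E]; rewrite mul0r.
  have zn0 : z != 0 by rewrite -n2_gt0.
  have [Az|Az] := eqVneq (A z) 0.
    have Bz : B z != 0 by apply/eqP; exact: isolated Az.
    have := congr1 snd E; rewrite XEz /= => /(mulIf Bz) ->.
    by rewrite subrr cnorm0.
  have := congr1 fst E; rewrite XEz /= => /(mulIf Az) ->.
  by rewrite subrr cnorm0.
move=> [phi hphi gE]; have [hG G0] := composition_integral hphi.
have hg : holomorphic_germ g.
  rewrite /germ_eq in gE; apply: filterS2 hG (near_near gE) => z dG E.
  have E' : \forall w \near z, (phi \o f) w = g w by apply: filterS E => w ->.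
  by have [] := near_eq_diff E' dG.
split; first exact: hg.
rewrite /germ_eq in gE *.
apply: filterS3 (vf_apply_near XE hg) (near_near gE) (filterI hG G0) => z -> E [dG vG].
have E' : \forall w \near z, (phi \o f) w = g w by apply: filterS E => w ->.
have [_ D] := near_eq_diff E' dG.
have D1 : dx g z = dx (phi \o f) z := congr1 (fun F => F (pt 1 0)) D.
have D2 : dy g z = dy (phi \o f) z := congr1 (fun F => F (pt 0 1)) D.
exact: etrans (congr2 (fun a b => A z * a + B z * b) D1 D2) vG.
Qed.
End Integral.
End Centralizer.

(** * Reduction to a weighted homogeneous polynomial field *)

Section Reduction.
Variable R : realType.
Local Notation C := R[i].
Implicit Types (z : C2 R) (f A B : C2 R -> C1 R) (X Y : C2 R -> C2 R) (t : C).
Variables (p q : nat).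
Hypotheses (p0 : (0 < p)%N) (q0 : (0 < q)%N).

Local Notation radial := (weighted_radial p q : C2 R -> C2 R).

Lemma differentiable_scale (c : C) (f : C2 R -> C1 R) z : differentiable f z ->
  differentiable (fun w => c * f w : C1 R) z.
Proof. by move=> df; exact: differentiable_mul (differentiable_const (c : C1 R) z) df. Qed.

Lemma radial_represents : represents radial (fun z => p%:R * z.1) (fun z => q%:R * z.2).
Proof. exact: filterE. Qed.

Lemma radial_holomorphic : holomorphic_germ radial.
Proof.
apply: filterE => z; apply/differentiable_components; split.
  exact: differentiable_scale (differentiable_fst z).
exact: differentiable_scale (differentiable_snd z).
Qed.

Lemma vder_fst A B (c : C) z : vder A B (fun w => c * w.1 : C1 R) z = c * A z.
Proof.
have df : differentiable (fun w : C2 R => c * w.1 : C1 R) z := differentiable_scale c (differentiable_fst z).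
have Ex := cderiv_uniq (dxE df) (cderivZ c (cderiv_id z.1)).
have Ey := cderiv_uniq (dyE df) (cderiv_cst (c * z.1) z.2).
by apply: etrans (congr2 (fun a b => A z * a + B z * b) Ex Ey) _; rewrite mulr1 mulr0 addr0 mulrC.
Qed.

Lemma vder_snd A B (c : C) z : vder A B (fun w => c * w.2 : C1 R) z = c * B z.
Proof.
have df : differentiable (fun w : C2 R => c * w.2 : C1 R) z := differentiable_scale c (differentiable_snd z).
have Ex := cderiv_uniq (dxE df) (cderiv_cst (c * z.2) z.1).
have Ey := cderiv_uniq (dyE df) (cderivZ c (cderiv_id z.2)).
by apply: etrans (congr2 (fun a b => A z * a + B z * b) Ex Ey) _; rewrite mulr1 mulr0 add0r mulrC.
Qed.

(** The components of [[S, X]] are [S(X_1) - p X_1] and [S(X_2) - q X_2], so [X_1] and [X_2] are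
    eigenfunctions of [S] for [K + p] and [K + q], and [qh_component] applies. *)
Lemma quasi_homogeneous_represents X (K : nat) : holomorphic_germ X ->
  quasi_homogeneous_vf radial K%:Z X ->
  exists a b, represents X (hpart p q a (K + p)) (hpart p q b (K + q)).
Proof.
move=> hX; rewrite /quasi_homogeneous_vf /germ_eq => hSX.
have [h1 h2] := holomorphic_components hX.
have nb := near_bracket radial_holomorphic hX radial_represents (represents_components X).
have weight (u w : C) (n : nat) : u - n%:R * w = K%:~R * w -> u = (K + n)%:R * w.
  by move=> /(canRL (subrK _)) ->; rewrite -mulrDl natrD pmulrn.
have e1 : \forall z \near (0 : C2 R), p%:R * z.1 * dx (fun z => (X z).1 : C1 R) z +
    q%:R * z.2 * dy (fun z => (X z).1 : C1 R) z = (K + p)%:R * (X z).1.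
  apply: filterS2 nb hSX => z E1 E2; have E := congr1 fst (etrans (esym E1) E2).
  have E' := etrans (congr1 (fun u : C => vder (fun z => p%:R * z.1) (fun z => q%:R * z.2)
    (fun z => (X z).1) z - u) (esym (vder_fst (fun z => (X z).1) (fun z => (X z).2) p%:R z))) E.
  exact: (weight _ _ _ E').
have e2 : \forall z \near (0 : C2 R), p%:R * z.1 * dx (fun z => (X z).2 : C1 R) z +
    q%:R * z.2 * dy (fun z => (X z).2 : C1 R) z = (K + q)%:R * (X z).2.
  apply: filterS2 nb hSX => z E1 E2; have E := congr1 snd (etrans (esym E1) E2).
  have E' := etrans (congr1 (fun u : C => vder (fun z => p%:R * z.1) (fun z => q%:R * z.2)
    (fun z => (X z).2) z - u) (esym (vder_snd (fun z => (X z).1) (fun z => (X z).2) q%:R z))) E.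
  exact: (weight _ _ _ E').
have [a aE] := qh_component p0 q0 h1 e1; have [b bE] := qh_component p0 q0 h2 e2.
exists a, b; rewrite /germ_eq in aE bE; apply: filterS2 aE bE => z <- <-.
exact: surjective_pairing.
Qed.

Lemma non_dicritical_germ X Y : germ_eq X Y -> non_dicritical X -> non_dicritical Y.
Proof.
rewrite /germ_eq => XY [F [finF hF]]; exists F; split; first exact: finF.
move=> S [h1 h2 h3 h4]; apply: hF; split; [exact: h1|exact: h2|exact: h3|].
have h4' : \forall z \near (0 : C2 R), z != 0 -> S z ->
    forall h, local_equation S z h -> 'D_(Y z) h z = 0.
  by have := h4; rewrite /vf_invariant /dnbhs near_withinE.
suff : \forall z \near (0 : C2 R), z != 0 -> S z ->
    forall h, local_equation S z h -> 'D_(X z) h z = 0.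
  by rewrite /vf_invariant /dnbhs near_withinE.
by apply: filterS2 XY h4' => z ->.
Qed.

(** A zero off 0 would spread along its dilation orbit to points arbitrarily close to 0. *)
Lemma isolated_homogeneous X A B (m n : int) : hom p q m A -> hom p q n B ->
  represents X A B -> isolated_singularity X ->
  [/\ A 0 = 0, B 0 = 0 & forall z, z != 0 -> A z = 0 -> B z <> 0].
Proof.
move=> hA hB XE [X0 Xn].
have X00 : pt (A 0) (B 0) = 0 := etrans (esym (nbhs_singleton XE)) X0.
split; [exact: (congr1 (fun w : C2 R => w.1) X00)|exact: (congr1 (fun w : C2 R => w.2) X00)|].
move=> z z0 Az Bz.
have Xn' : \forall z \near (0 : C2 R), z != 0 -> X z <> 0.
  by move: Xn; rewrite /dnbhs near_withinE.
have hXX : \forall z \near (0 : C2 R), X z = pt (A z) (B z) /\ (z != 0 -> X z <> 0).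
  by exact: filterI XE Xn'.
have [r r0 hr] := (near0_n2P (fun z => X z = pt (A z) (B z) /\ (z != 0 -> X z <> 0))).1 hXX.
have [r1 r10 h1] := n2_dil_lt p0 q0 r0 z0.
have [t t0 tr] := cnear_neq (cnear_ball (0 : C) r10).
rewrite subr0 in tr; have [_ /hr[E]] := h1 t tr.
move=> /(_ (dil_neq0 p q t0 z0)); apply; rewrite E hA // hB // Az Bz !mulr0.
by [].
Qed.
End Reduction.

Theorem theorem5 (R : realType) (p q : nat) (k : int) (X : C2 R -> C2 R)
    (hp : (1 <= p)%N) (hq : (1 <= q)%N) (hpq : coprime p q)
    (hX : holomorphic_germ X)
    (hk : 0 < k) (hSX : quasi_homogeneous_vf (weighted_radial p q) k X)
    (hiso : isolated_singularity X) (hnd : non_dicritical X)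
    (hC : centralizer X <> scalar_multiples X) :
  exists f : C2 R -> C1 R,
    [/\ holomorphic_germ f,
        ~ germ_eq f (fun=> 0),
        quasi_homogeneous_fun (weighted_radial p q) f,
        first_integrals X = compositions f &
        centralizer X = composition_multiples f X].
Proof.
case: k hk hSX => // K K0 hSX; have {}K0 : (0 < K)%N by [].
have [a [b XE]] := quasi_homogeneous_represents hp hq hX hSX.
set A := hpart p q a (K + p) in XE; set B := hpart p q b (K + q) in XE.
have wA : wpoly p q (K%:Z + p%:Z) A by exact: wpoly_hpart.
have wB : wpoly p q (K%:Z + q%:Z) B by exact: wpoly_hpart.
have [_ hA [A1 A1E] [A2 A2E]] := wA; have [_ hB [B1 B1E] [B2 B2E]] := wB.
have [A0 B0 isolated] := isolated_homogeneous hp hq hA hB XE hiso.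
have nd : non_dicritical (fun z => pt (A z) (B z)) := non_dicritical_germ XE hnd.
have k0 : 0 < K%:Z by [].
have ch := field_charts wA wB A1E A2E B1E B2E isolated.
have [d [f1 [f2 [d0 If f10 gen]]]] := first_integral_generator hp hq k0 ch
  (nonconstant_integral hp hq K0 wA wB A1E A2E B1E B2E isolated A0 B0 nd hX XE hC).
have [cf _ _] := If; have [af [f1E f2E]] := hpart_of_charts hp hq cf.
set f := hpart p q af d in f1E f2E.
have [df hf _ _] : wpoly p q d%:Z f by exact: wpoly_hpart.
have [t1 ft1] : exists t, f1.[t] != 0.
  apply: contrapT => no; case/eqP: f10; apply: poly_ext => t; rewrite horner0.
  by apply/eqP/negPn/negP => ft; apply: no; exists t.
(* Starting from a point of [x = 1] where [f] is nonzero, a dilation by a [d]-th root of the inverse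
   value brings [f] to 1. *)
have [z0 fz0 z00] : exists2 z0, f z0 = 1 & z0 != 0.
  pose s := d.-root (f1.[t1])^-1; have sd : s ^+ d = (f1.[t1])^-1 := rootCK d0 _.
  have s0 : s != 0.
    by apply: contra_neq (invr_neq0 ft1) => s0; rewrite -sd s0 expr0n gtn_eqF.
  exists (dil p q s (pt 1 t1)); first by rewrite hf // -exprnP sd f1E mulVf.
  by apply: dil_neq0 => //; apply/eqP => -[/eqP]; rewrite oner_eq0.
have f00 := hom_zero d0 hf.
have fn0 : ~ germ_eq f (fun=> 0).
  rewrite /germ_eq => f0; have [r r0 hr] := (near0_n2P (fun z => f z = 0)).1 f0.
  have [r1 r10 h1] := n2_dil_lt hp hq r0 z00.
  have [t t0 tr] := cnear_neq (cnear_ball (0 : R[i]) r10).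
  rewrite subr0 in tr; have [_ /hr] := h1 t tr; rewrite hf // fz0 mulr1 => /eqP.
  by rewrite expf_eq0 (negPf t0) andbF.
have hfg : holomorphic_germ f := holomorphic_germ_all df.
exists f; split => //.
- split=> //.
    move=> [c fc]; apply: fn0; have c0 : c = 0 by rewrite -f00; exact: esym (nbhs_singleton fc).
    by rewrite -c0.
  exists d%:Z; have := vf_apply_near (radial_represents R p q) hfg; rewrite /germ_eq.
  apply: filterS => z ->; exact: euler df hf.
- exact: (first_integralsE hp hq K0 wA wB A1E A2E B1E B2E isolated A0 B0 nd hX XE d0 df hf f1E f2E If gen fz0 z00).
- exact: (centralizerE hp hq K0 wA wB A1E A2E B1E B2E isolated A0 B0 nd hX XE d0 df hf f1E f2E If gen fz0 z00).
Qed.
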